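(* Let $M$ be a model of ZFC satisfying CH, and let $G_{\omega_2}$ be generic over $M$ for the finite support iteration of length $\omega_2$ of Hechler forcing $\mathbb{H}$. Then in $M[G_{\omega_2}]$ every $\gamma$-set is countable, but every set of reals of cardinality $\omega_1$ has strong measure zero.
   Context: Hechler forcing $\mathbb{H}$ consists of pairs $(n,f)$ with $n\in\omega$, $f\in\omega^\omega$, ordered by $(m,g)\le(n,f)$ iff $m\ge n$, $g\upharpoonright n=f\upharpoonright n$ and $g(i)\ge f(i)$ for all $i$. An open cover $\mathcal{U}$ of a topological space $X$ is an $\omega$-cover if $X\notin\mathcal{U}$ and every finite $F\subseteq X$ is contained in some $U\in\mathcal{U}$. An open cover $\mathcal{U}$ is a $\gamma$-cover if it is infinite and each $x\in X$ lies in all but finitely many members of $\mathcal{U}$. A $\gamma$-set is a separable metric space in which every open $\omega$-cover contains a $\gamma$-subcover. A set of reals $X$ has strong measure zero if for every sequence $(\epsilon_n:n<\omega)$ of positive reals there are intervals $I_n$ of length less than $\epsilon_n$ with $X\subseteq\bigcup_n I_n$. *)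

(* Defs.v *)
Set Implicit Arguments.
Unset Strict Implicit.

(* Formulas of the language {∈} with parameters from [V], in higher-order
   abstract syntax.  Equality is not primitive, see [eqv]. *)
Inductive form (V : Type) : Type :=
| Mem (x y : V)
| Bot
| Imp (a b : form V)
| And (a b : form V)
| Or (a b : form V)
| All (a : V -> form V)
| Ex (a : V -> form V).
Arguments Bot {V}.

Declare Scope form_scope.
Delimit Scope form_scope with form.
Bind Scope form_scope with form.
Open Scope form_scope.

Notation "x ∈ y" := (Mem x y) (at level 70, no associativity) : form_scope.
Notation "¬ a" := (Imp a Bot) (at level 75, right associativity) : form_scope.
Notation "a ∧ b" := (And a b) (at level 80, right associativity) : form_scope.
Notation "a ∨ b" := (Or a b) (at level 85, right associativity) : form_scope.
Notation "a ⇒ b" := (Imp a b) (at level 90, right associativity) : form_scope.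
Notation "a ⇔ b" := (And (Imp a b) (Imp b a))
  (at level 95, no associativity) : form_scope.
Notation "∀ x .. y , a" := (All (fun x => .. (All (fun y => a)) ..))
  (at level 200, x binder, y binder, right associativity) : form_scope.
Notation "∃ x .. y , a" := (Ex (fun x => .. (Ex (fun y => a)) ..))
  (at level 200, x binder, y binder, right associativity) : form_scope.
Notation "∀[ x ∈ u ] a" := (All (fun x => Imp (Mem x u) a))
  (at level 200, x name, u at level 60, right associativity) : form_scope.
Notation "∃[ x ∈ u ] a" := (Ex (fun x => And (Mem x u) a))
  (at level 200, x name, u at level 60, right associativity) : form_scope.

Fixpoint truth (M : Type) (mem : M -> M -> Prop) (phi : form M) : Prop :=
  match phi with
  | Mem x y => mem x y
  | Bot => False
  | Imp a b => truth mem a -> truth mem b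
  | And a b => truth mem a /\ truth mem b
  | Or a b => truth mem a \/ truth mem b
  | All a => forall x, truth mem (a x)
  | Ex a => exists x, truth mem (a x)
  end.

Notation "mem ⊨ a" := (truth mem a) (at level 97, no associativity).

(** * Basic set-theoretic notions *)

Definition eqv {V} (x y : V) : form V := ∀ z, z ∈ x ⇔ z ∈ y.
Notation "x ≐ y" := (eqv x y) (at level 70, no associativity) : form_scope.

Definition sub {V} (x y : V) : form V := ∀[z ∈ x] z ∈ y.
Definition empty {V} (x : V) : form V := ∀ z, ¬ z ∈ x.
Definition upair {V} (z x y : V) : form V := ∀ w, w ∈ z ⇔ w ≐ x ∨ w ≐ y.
Definition opair {V} (z x y : V) : form V :=
  ∀ w, w ∈ z ⇔ upair w x x ∨ upair w x y.
Definition power {V} (c a : V) : form V := ∀ x, x ∈ c ⇔ sub x a.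
Definition succ {V} (y x : V) : form V := ∀ z, z ∈ y ⇔ z ∈ x ∨ z ≐ x.

(* ⟨x, y⟩ ∈ f *)
Definition maps {V} (f x y : V) : form V := ∃ z, opair z x y ∧ z ∈ f.
(* ⟨⟨x, y⟩, z⟩ ∈ f *)
Definition maps2 {V} (f x y z : V) : form V := ∃ u, opair u x y ∧ maps f u z.

Definition fun_on {V} (f a : V) : form V :=
  (∀[z ∈ f] ∃[x ∈ a] ∃ y, opair z x y)
  ∧ ∀[x ∈ a] ∃ y, maps f x y ∧ ∀ y', maps f x y' ⇒ y' ≐ y.
Definition func {V} (f a b : V) : form V :=
  fun_on f a ∧ ∀ x y, maps f x y ⇒ y ∈ b.
Definition inj {V} (f a b : V) : form V :=
  func f a b ∧ ∀ x x' y, maps f x y ∧ maps f x' y ⇒ x ≐ x'.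
Definition embeds {V} (a b : V) : form V := ∃ f, inj f a b.
Definition equipotent {V} (a b : V) : form V :=
  ∃ f, inj f a b ∧ ∀[y ∈ b] ∃[x ∈ a] maps f x y.

Definition transitive {V} (x : V) : form V := ∀[y ∈ x] sub y x.
Definition ord {V} (x : V) : form V := transitive x ∧ ∀[y ∈ x] transitive y.
Definition ole {V} (x y : V) : form V := x ∈ y ∨ x ≐ y.
Definition natural {V} (n : V) : form V :=
  ord n ∧ ∀ m, ole m n ⇒ empty m ∨ ∃ k, succ m k.
Definition omega {V} (w : V) : form V := ∀ n, n ∈ w ⇔ natural n.
Definition finite {V} (x : V) : form V := ∃ n, natural n ∧ embeds x n.
Definition countable {V} (x : V) : form V := ∃ w, omega w ∧ embeds x w.
Definition omega1 {V} (a : V) : form V :=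
  ord a ∧ ¬ countable a ∧ ∀[b ∈ a] countable b.
Definition omega2 {V} (a : V) : form V :=
  ord a ∧ ∃ o, omega1 o ∧ ¬ embeds a o ∧ ∀[b ∈ a] embeds b o.

Definition CH {V} : form V :=
  ∃ w c o, omega w ∧ power c w ∧ omega1 o ∧ equipotent c o.

(** * Models of ZFC *)

(* De Bruijn formulas, used for the schemas only: [form M] itself also
   contains infinitary formulas (through [All] and [Ex]). *)
Inductive code : Type :=
| CMem (i j : nat)
| CBot
| CImp (a b : code)
| CAll (a : code).

Definition scons {V} (x : V) (e : nat -> V) (n : nat) : V :=
  match n with O => x | S k => e k end.

Fixpoint decode {V} (c : code) (e : nat -> V) : form V :=
  match c with
  | CMem i j => e i ∈ e j
  | CBot => Bot
  | CImp a b => decode a e ⇒ decode b e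
  | CAll a => ∀ x, decode a (scons x e)
  end.

Record ZFC (M : Type) (mem : M -> M -> Prop) : Prop := {
  extensionality : mem ⊨ ∀ x y, x ≐ y ⇒ ∀ z, x ∈ z ⇒ y ∈ z;
  foundation : mem ⊨ ∀ x, ¬ empty x ⇒ ∃[y ∈ x] ∀[z ∈ y] ¬ z ∈ x;
  pairing : mem ⊨ ∀ x y, ∃ z, upair z x y;
  union : mem ⊨ ∀ a, ∃ u, ∀ x, x ∈ u ⇔ ∃[y ∈ a] x ∈ y;
  powerset : mem ⊨ ∀ a, ∃ c, power c a;
  infinity : mem ⊨ ∃ w, (∃[x ∈ w] empty x) ∧ ∀[x ∈ w] ∃[y ∈ w] succ y x;
  separation : forall (c : code) (e : nat -> M),
    mem ⊨ ∀ a, ∃ b, ∀ x, x ∈ b ⇔ x ∈ a ∧ decode c (scons x e);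
  replacement : forall (c : code) (e : nat -> M),
    mem ⊨ ∀ a,
      (∀[x ∈ a] ∀ y y', decode c (scons x (scons y e))
                        ∧ decode c (scons x (scons y' e)) ⇒ y ≐ y') ⇒
      ∃ b, ∀ y, y ∈ b ⇔ ∃[x ∈ a] decode c (scons x (scons y e));
  choice : mem ⊨ ∀ a,
      (∀[x ∈ a] ¬ empty x)
      ∧ (∀[x ∈ a] ∀[y ∈ a] (∃[z ∈ x] z ∈ y) ⇒ x ≐ y) ⇒
      ∃ c, ∀[x ∈ a] ∃ z, (z ∈ x ∧ z ∈ c)
                         ∧ ∀ z', z' ∈ x ∧ z' ∈ c ⇒ z' ≐ z
}.

(** * Forcing over a model *)

Section Forcing.
Context {M : Type} (mem : M -> M -> Prop).

(* [P L : M] are the set of conditions and the order, a set of pairs, of a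
   forcing notion of the model. *)
Definition below (P L q p : M) : Prop :=
  mem q P /\ (mem ⊨ maps L q p).

(* The names are all the sets of the model; ⟨ρ, r⟩ ∈ σ with r ∈ P means that ρ
   is put into σ by r, and other elements of σ are ignored.  The set W of
   triples ⟨p, ⟨σ, τ⟩⟩ represents the relation p ⊩ σ = τ, and the next clause
   says p ⊩ σ ⊆ τ in terms of the relation for names of lower rank. *)
Definition sub_clause (P L W p s t : M) : Prop :=
  forall rho r q, (mem ⊨ maps s rho r) -> mem r P ->
    below P L q p -> below P L q r ->
    exists rho' r' q', (mem ⊨ maps t rho' r') /\ mem r' P /\
      below P L q' q /\ below P L q' r' /\
      (mem ⊨ ∃ u, opair u rho rho' ∧ maps W q' u).

(* The recursion is carried out inside the model, on a transitive set T of
   names, since the model is not assumed to be well-founded. *)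
Definition forces_eq (P L p s t : M) : Prop :=
  exists T W : M, (mem ⊨ transitive T) /\ mem s T /\ mem t T /\
    (forall p' s' t', mem p' P -> mem s' T -> mem t' T ->
      ((mem ⊨ ∃ u, opair u s' t' ∧ maps W p' u) <->
       sub_clause P L W p' s' t' /\ sub_clause P L W p' t' s')) /\
    (mem ⊨ ∃ u, opair u s t ∧ maps W p u).

Definition forces_mem (P L p s t : M) : Prop :=
  forall q, below P L q p -> exists q' rho r,
    below P L q' q /\ (mem ⊨ maps t rho r) /\ mem r P /\ below P L q' r /\
    forces_eq P L q' s rho.

Fixpoint forces (P L p : M) (phi : form M) : Prop :=
  match phi with
  | Mem s t => forces_mem P L p s t
  | Bot => False
  | Imp a b => forall q, below P L q p -> forces P L q a -> forces P L q b
  | And a b => forces P L p a /\ forces P L p b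
  | Or a b => forall q, below P L q p -> exists q', below P L q' q /\
      (forces P L q' a \/ forces P L q' b)
  | All a => forall s, forces P L p (a s)
  | Ex a => forall q, below P L q p -> exists q', below P L q' q /\
      exists s, forces P L q' (a s)
  end.

Definition dense (P L A : M) : Prop :=
  (mem ⊨ sub A P) /\
  forall p, mem p P -> exists q, mem q A /\ below P L q p.

Record generic (P L : M) (G : M -> Prop) : Prop := {
  generic_sub : forall p, G p -> mem p P;
  generic_nonempty : exists p, G p;
  generic_up : forall p q, G q -> mem p P -> below P L q p -> G p;
  generic_dir : forall p q, G p -> G q ->
    exists r, G r /\ below P L r p /\ below P L r q;
  generic_dense : forall A, dense P L A -> exists p, G p /\ mem p A
}.

(* The membership relation of the extension M[G], on the names: the values of
   σ and τ satisfy σ^G ∈ τ^G iff some p ∈ G forces σ ∈ τ.  As equality is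
   coextensionality, passing to the quotient by σ^G = τ^G is not needed.  When
   the model is transitive, this is the usual {σ^G : σ ∈ M} up to isomorphism. *)
Definition ext (P L : M) (G : M -> Prop) (s t : M) : Prop :=
  exists p, G p /\ forces_mem P L p s t.

(** * Finite support iteration of Hechler forcing *)

Definition hechler {V} (x : V) : form V :=
  ∃ w n f, omega w ∧ n ∈ w ∧ func f w w ∧ opair x n f.

Definition hechler_le {V} (x y : V) : form V :=
  ∃ w m g n f, omega w ∧ opair x m g ∧ opair y n f
    ∧ ole n m
    ∧ (∀[i ∈ n] ∀ k, maps g i k ⇔ maps f i k)
    ∧ (∀[i ∈ w] ∀ j k, maps f i j ∧ maps g i k ⇒ ole j k).

(* p' is the restriction of p to z *)
Definition restrict {V} (p' p z : V) : form V :=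
  ∀ u, u ∈ p' ⇔ u ∈ p ∧ ∃[x ∈ z] ∃ y, opair u x y.

(* Sequences ⟨P_ξ, ≤_ξ : ξ ≤ δ⟩ and ⟨Q_ξ : ξ < δ⟩ in the model, with Q_ξ a
   P_ξ-name for the set of Hechler conditions.  The conditions of P_ξ are finite
   partial functions on ξ whose domain is the support: at coordinates outside
   the domain the condition is trivial. *)
Record fs_hechler (d P L Q : M) : Prop := {
  fs_P : mem ⊨ ∃ d', succ d' d ∧ fun_on P d';
  fs_L : mem ⊨ ∃ d', succ d' d ∧ fun_on L d';
  fs_Q : mem ⊨ fun_on Q d;
  fs_cond : forall x Px, (mem ⊨ maps P x Px) -> forall p,
    mem p Px <->
    (mem ⊨ finite p ∧ ∃ a, sub a x ∧ fun_on p a) /\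
    (forall z q, (mem ⊨ maps p z q) ->
      forall Pz Lz Qz p', (mem ⊨ maps P z Pz) -> (mem ⊨ maps L z Lz) ->
        (mem ⊨ maps Q z Qz) -> (mem ⊨ restrict p' p z) ->
        mem p' Pz /\ (mem ⊨ ∃ r, maps Qz q r) /\ forces Pz Lz p' (q ∈ Qz));
  fs_le : forall x Px Lx, (mem ⊨ maps P x Px) -> (mem ⊨ maps L x Lx) ->
    forall u, mem u Lx <->
    exists p q, (mem ⊨ opair u p q) /\ mem p Px /\ mem q Px /\
      forall z q1, (mem ⊨ maps q z q1) ->
        exists p1, (mem ⊨ maps p z p1) /\
        forall Pz Lz p', (mem ⊨ maps P z Pz) -> (mem ⊨ maps L z Lz) ->
          (mem ⊨ restrict p' p z) -> forces Pz Lz p' (hechler_le p1 q1);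
  fs_name : forall x Px Lx Qx, (mem ⊨ maps P x Px) -> (mem ⊨ maps L x Lx) ->
    (mem ⊨ maps Q x Qx) ->
    forall p, mem p Px -> forces Px Lx p (∀ y, y ∈ Qx ⇔ hechler y)
}.

End Forcing.

(** * The real line *)

(* [lt] is the set of pairs ⟨x, y⟩ with x < y. *)
Record line (V : Type) : Type := Line {
  car : V; add : V; mul : V; zero : V; lt : V
}.

Definition op2 {V} (f a b : V) : form V :=
  ∀[x ∈ a] ∀[y ∈ a] ∃[z ∈ b] maps2 f x y z ∧ ∀ z', maps2 f x y z' ⇒ z' ≐ z.

Definition comm_assoc {V} (f a : V) : form V :=
  op2 f a a
  ∧ (∀[x ∈ a] ∀[y ∈ a] ∀ z, maps2 f x y z ⇒ maps2 f y x z)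
  ∧ (∀[x ∈ a] ∀[y ∈ a] ∀[z ∈ a] ∀ u v t,
       maps2 f x y u ∧ maps2 f u z t ∧ maps2 f y z v ⇒ maps2 f x v t).

Definition ordered_field {V} (R : line V) : form V :=
  comm_assoc (add R) (car R)
  ∧ zero R ∈ car R
  ∧ (∀[x ∈ car R] maps2 (add R) x (zero R) x)
  ∧ (∀[x ∈ car R] ∃[y ∈ car R] maps2 (add R) x y (zero R))
  ∧ comm_assoc (mul R) (car R)
  ∧ (∃[e ∈ car R] (¬ e ≐ zero R)
       ∧ (∀[x ∈ car R] maps2 (mul R) x e x)
       ∧ (∀[x ∈ car R] (¬ x ≐ zero R) ⇒ ∃[y ∈ car R] maps2 (mul R) x y e))
  ∧ (∀[x ∈ car R] ∀[y ∈ car R] ∀[z ∈ car R] ∀ s p q t,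
       maps2 (add R) y z s ∧ maps2 (mul R) x y p ∧ maps2 (mul R) x z q
       ∧ maps2 (mul R) x s t ⇒ maps2 (add R) p q t)
  ∧ (∀[x ∈ car R] ¬ maps (lt R) x x)
  ∧ (∀[x ∈ car R] ∀[y ∈ car R] ∀[z ∈ car R]
       maps (lt R) x y ∧ maps (lt R) y z ⇒ maps (lt R) x z)
  ∧ (∀[x ∈ car R] ∀[y ∈ car R]
       maps (lt R) x y ∨ x ≐ y ∨ maps (lt R) y x)
  ∧ (∀[x ∈ car R] ∀[y ∈ car R] ∀[z ∈ car R] ∀ u v,
       maps (lt R) x y ∧ maps2 (add R) x z u ∧ maps2 (add R) y z v
       ⇒ maps (lt R) u v)
  ∧ (∀[x ∈ car R] ∀[y ∈ car R] ∀ z,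
       maps (lt R) (zero R) x ∧ maps (lt R) (zero R) y ∧ maps2 (mul R) x y z
       ⇒ maps (lt R) (zero R) z).

Definition upper_bound {V} (R : line V) (b a : V) : form V :=
  b ∈ car R ∧ ∀[x ∈ a] ¬ maps (lt R) b x.

Definition real_line {V} (R : line V) : form V :=
  ordered_field R
  ∧ ∀ a, sub a (car R) ∧ (¬ empty a) ∧ (∃ b, upper_bound R b a) ⇒
      ∃ b, upper_bound R b a
           ∧ ∀ b', upper_bound R b' a ⇒ ¬ maps (lt R) b' b.

Definition positive {V} (R : line V) (e : V) : form V :=
  e ∈ car R ∧ maps (lt R) (zero R) e.

Definition strong_measure_zero {V} (R : line V) (X : V) : form V :=
  sub X (car R)
  ∧ ∀ w eps, omega w ∧ func eps w (car R)
      ∧ (∀ n e, maps eps n e ⇒ positive R e) ⇒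
    ∃ a b, func a w (car R) ∧ func b w (car R)
      ∧ (∀ n x y e s, maps a n x ∧ maps b n y ∧ maps eps n e
           ∧ maps2 (add R) x e s ⇒ maps (lt R) x y ∧ maps (lt R) y s)
      ∧ (∀[t ∈ X] ∃ n x y, maps a n x ∧ maps b n y
           ∧ maps (lt R) x t ∧ maps (lt R) t y).

(** * γ-sets *)

Definition metric {V} (R : line V) (X d : V) : form V :=
  op2 d X (car R)
  ∧ (∀[x ∈ X] ∀[y ∈ X] maps2 d x y (zero R) ⇔ x ≐ y)
  ∧ (∀[x ∈ X] ∀[y ∈ X] ∀ r, maps2 d x y r ⇒ maps2 d y x r)
  ∧ (∀[x ∈ X] ∀[y ∈ X] ∀[z ∈ X] ∀ p q r s,
       maps2 d x y p ∧ maps2 d y z q ∧ maps2 d x z r ∧ maps2 (add R) p q s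
       ⇒ ¬ maps (lt R) s r).

(* d(x, y) < e *)
Definition near {V} (R : line V) (d x y e : V) : form V :=
  ∃ r, maps2 d x y r ∧ maps (lt R) r e.

Definition separable {V} (R : line V) (X d : V) : form V :=
  ∃ D, sub D X ∧ countable D
    ∧ ∀[x ∈ X] ∀ e, positive R e ⇒ ∃[y ∈ D] near R d x y e.

Definition open_set {V} (R : line V) (X d U : V) : form V :=
  sub U X
  ∧ ∀[x ∈ U] ∃ e, positive R e ∧ ∀[y ∈ X] near R d x y e ⇒ y ∈ U.

Definition open_cover {V} (R : line V) (X d C : V) : form V :=
  (∀[U ∈ C] open_set R X d U) ∧ ∀[x ∈ X] ∃[U ∈ C] x ∈ U.

Definition omega_cover {V} (R : line V) (X d C : V) : form V :=
  open_cover R X d C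
  ∧ (¬ X ∈ C)
  ∧ ∀ F, sub F X ∧ finite F ⇒ ∃[U ∈ C] sub F U.

Definition gamma_cover {V} (R : line V) (X d C : V) : form V :=
  open_cover R X d C
  ∧ (¬ finite C)
  ∧ ∀[x ∈ X] ∃ F, finite F ∧ ∀[U ∈ C] U ∈ F ∨ x ∈ U.

Definition gamma_set {V} (R : line V) (X d : V) : form V :=
  metric R X d
  ∧ separable R X d
  ∧ ∀ C, omega_cover R X d C ⇒ ∃ C', sub C' C ∧ gamma_cover R X d C'.

(* The real line is taken to be an arbitrary complete ordered field; it is
   unique up to isomorphism. *)
Definition gamma_sets_countable {V} : form V :=
  ∀ c a m o l, let R := Line c a m o l in
    real_line R ⇒ ∀ X d, gamma_set R X d ⇒ countable X.

Definition omega1_sets_smz {V} : form V :=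
  ∀ c a m o l, let R := Line c a m o l in
    real_line R ⇒
    ∀ X, sub X (car R) ∧ (∃ k, omega1 k ∧ equipotent X k) ⇒
      strong_measure_zero R X.

(* Main.v *)
(* By the truth lemma it is enough that the conditions force the conclusion, and this is a first-order property of the ground
   model.  It may therefore be proved in a countable elementary submodel of the quotient by coextensionality, where every
   condition belongs to a generic filter; let N be the resulting extension.

   Conditions all of whose stems are decided are dense, and two of them with the same stems on their common support are
   compatible.  Hence the iteration is ccc, and every subset of omega1 x omega in N belongs to an intermediate stage.

   Strong measure zero.  Let (a(n,k), b(n,k)), k < omega, list the rational intervals of length less than eps(n), each infinitely
   often.  For every real x, the set of k with x in the k-th interval is infinite for each n, and the Hechler real h added after
   the intervals and the omega1 reals belongs to such a set for some n: x is in the h(n)-th interval for some n.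

   Gamma-sets.  Let x be an injective omega1-sequence of points of X.  Fix for every j two open sets W(j,0), W(j,1) covering X
   such that any two points are separated by some j.  For u a subset of n x k let W(n,k,u) be the set of the x such that, for
   some i < n and all j < k, x is in W(j,[(i,j) in u]).  With a Hechler real f, the sets W(n,f(n),u) minus one of the points
   x_i, i <= n, form an omega-cover.  A gamma-subcover gives an infinite set A of pairs (n,u) such that uncountably many points
   belong to W(n,f(n),u) for almost all (n,u) in A.  At the stage where f is added this is impossible, because an uncountable
   family contains n+1 points which no W(n,k,u) covers for large k.  By induction it remains impossible for the sets A of all
   later stages: at limits by reflection to a smaller stage, at successors by a fusion of the stems of Hechler conditions. *)

Require Import Defs.
From Stdlib Require Import Classical ClassicalEpsilon FunctionalExtensionality PropExtensionality ProofIrrelevance List Arith Lia Cantor.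
Import ListNotations.

(** The ground model may be ill-founded, so no induction or recursion comes from outside: each is
    run on a predicate definable in the model, which is why definability is tracked everywhere.
    Inductions about the extension mention the generic filter; a density argument provides minimal
    counterexamples for predicates definable from it. The extensions are only shown to satisfy
    Zermelo's axioms; the consequence of choice needed there, that omega1 embeds into every
    uncountable set, comes from a well-order of names. Over a countable model, forcing by p is the
    same as truth for all generic filters through p, so most arguments take place inside extensions.

    The obstacle with gamma-sets is that the subcover may appear long after f. The induction
    therefore treats arbitrary infinite sets of tasks (n,(f(n),w)), with w a subset of n x f(n), at
    each later stage; that only finitely many tasks share an n is what its successor step exploits.
    Deleting some x_i keeps X itself out of the cover, and n+1 candidates are available so that a
    finite F with at most n points misses one of them. *)

Ltac spl := repeat (split; [solve [auto]|]); auto.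
Tactic Notation "contra" ident(H) := apply NNPP; intros H.

(** * Coded formulas and definability over all models *)

(** All connectives of [form] are kept, so that decoding gives back the very same formula and not
    just an equivalent one; [forces] is a recursion on the shape of the formula. *)
Inductive xc := xMem (i j : nat) | xBot | xImp (a b : xc) | xAnd (a b : xc)
 | xOr (a b : xc) | xAll (a : xc) | xEx (a : xc).

Fixpoint xd {V} (c : xc) (e : nat -> V) : form V :=
 match c with
 | xMem i j => Mem (e i) (e j)
 | xBot => Bot
 | xImp a b => Imp (xd a e) (xd b e)
 | xAnd a b => And (xd a e) (xd b e)
 | xOr a b => Or (xd a e) (xd b e)
 | xAll a => All (fun x => xd a (scons x e))
 | xEx a => Ex (fun x => xd a (scons x e))
 end.

Definition etl {V} (e : nat -> V) : nat -> V := fun n => e (S n).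

Lemma scons_eta V (e : nat -> V) : scons (e 0) (etl e) = e.
Proof. extensionality n; destruct n; reflexivity. Qed.

(* [phi] comes from one first-order formula, uniformly in the model; this is what passes to elementary submodels. *)
Definition Cod (phi : forall V, (nat -> V) -> form V) :=
 exists c, forall V e, xd c e = phi V e.

Lemma cod_mem i j : Cod (fun V e => Mem (e i) (e j)).
Proof. exists (xMem i j); reflexivity. Qed.
Lemma cod_bot : Cod (fun V e => Bot).
Proof. exists xBot; reflexivity. Qed.
Lemma cod_imp a b : Cod a -> Cod b -> Cod (fun V e => Imp (a V e) (b V e)).
Proof. intros [c C] [d D]; exists (xImp c d); intros; simpl; rewrite C, D; reflexivity. Qed.
Lemma cod_and a b : Cod a -> Cod b -> Cod (fun V e => And (a V e) (b V e)).
Proof. intros [c C] [d D]; exists (xAnd c d); intros; simpl; rewrite C, D; reflexivity. Qed.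
Lemma cod_or a b : Cod a -> Cod b -> Cod (fun V e => Or (a V e) (b V e)).
Proof. intros [c C] [d D]; exists (xOr c d); intros; simpl; rewrite C, D; reflexivity. Qed.
Lemma cod_all (b : forall V, (nat -> V) -> V -> form V) :
 Cod (fun V e => b V (etl e) (e 0)) -> Cod (fun V e => All (fun x => b V e x)).
Proof.
 intros [c C]; exists (xAll c); intros; simpl; f_equal; extensionality x.
 rewrite C; reflexivity.
Qed.
Lemma cod_ex (b : forall V, (nat -> V) -> V -> form V) :
 Cod (fun V e => b V (etl e) (e 0)) -> Cod (fun V e => Ex (fun x => b V e x)).
Proof.
 intros [c C]; exists (xEx c); intros; simpl; f_equal; extensionality x.
 rewrite C; reflexivity.
Qed.

Fixpoint dx (c : code) (r : nat -> nat) : xc :=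
 match c with
 | CMem i j => xMem (r i) (r j)
 | CBot => xBot
 | CImp a b => xImp (dx a r) (dx b r)
 | CAll a => xAll (dx a (fun n => match n with 0 => 0 | S k => S (r k) end))
 end.

Lemma xd_dx c : forall r V (e : nat -> V), xd (dx c r) e = decode c (fun n => e (r n)).
Proof.
 induction c; intros; simpl; try (rewrite IHc1, IHc2); try reflexivity.
 f_equal; extensionality x; rewrite IHc; f_equal; extensionality n; destruct n; reflexivity.
Qed.

Lemma cod_decode c (r : nat -> nat) : Cod (fun V e => decode c (fun n => e (r n))).
Proof. exists (dx c r); intros; apply xd_dx. Qed.

Create HintDb cod.
Ltac cod1 :=
 lazymatch goal with
 | |- Cod (fun V e => Mem _ _) => exact (cod_mem _ _)
 | |- Cod (fun V e => Bot) => exact cod_bot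
 | |- Cod (fun V e => Imp _ _) => apply cod_imp
 | |- Cod (fun V e => And _ _) => apply cod_and
 | |- Cod (fun V e => Or _ _) => apply cod_or
 | |- Cod (fun V e => All (fun x => @?b V e x)) => apply (cod_all b); cbv beta delta [etl]
 | |- Cod (fun V e => Ex (fun x => @?b V e x)) => apply (cod_ex b); cbv beta delta [etl]
 | |- Cod (fun V e => decode _ _) => fail
 | |- Cod ?phi => first [solve [auto with cod nocore] |
   let f := constr:(fun (V : Type) (e : nat -> V) => ltac:(let t := eval cbv beta in (phi V e) in let t := eval red in t in exact t)) in
   change (Cod f); cbv beta]
 end.
Ltac cod := cbv beta delta [etl]; repeat cod1.

Lemma cod_eqv i j : Cod (fun V e => eqv (e i) (e j)).
Proof. cod. Qed.
Hint Resolve cod_eqv : cod.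
Lemma cod_opair i j k : Cod (fun V e => opair (e i) (e j) (e k)).
Proof. cod. Qed.
Hint Resolve cod_opair : cod.
Lemma cod_maps i j k : Cod (fun V e => maps (e i) (e j) (e k)).
Proof. cod. Qed.
Hint Resolve cod_maps : cod.
Lemma cod_maps2 i j k l : Cod (fun V e => maps2 (e i) (e j) (e k) (e l)).
Proof. cod. Qed.
Hint Resolve cod_maps2 : cod.
Lemma cod_conclusion : Cod (fun V e => gamma_sets_countable ∧ omega1_sets_smz).
Proof. cod. Qed.

Set Implicit Arguments.
Unset Strict Implicit.

(** The notions of forcing are propositions about a model and not terms of type [form]. This is
    their counterpart of [Cod], which lets them be moved along an elementary map. *)
Definition PCod (A : forall V, (V -> V -> Prop) -> (nat -> V) -> Prop) :=
 exists c, forall V mem (e : nat -> V), truth mem (xd c e) <-> A V mem e.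

Lemma pcod_truth (phi : forall V, (nat -> V) -> form V) :
 Cod phi -> PCod (fun V mem e => truth mem (phi V e)).
Proof. intros [c C]; exists c; intros; rewrite C; tauto. Qed.
Lemma pcod_mem i j : PCod (fun V mem e => mem (e i) (e j)).
Proof. exists (xMem i j); reflexivity. Qed.
Lemma pcod_false : PCod (fun V mem e => False).
Proof. exists xBot; reflexivity. Qed.
Lemma pcod_imp A B : PCod A -> PCod B -> PCod (fun V mem e => A V mem e -> B V mem e).
Proof. intros [c C] [d D]; exists (xImp c d); intros; simpl; rewrite C, D; tauto. Qed.
Lemma pcod_and A B : PCod A -> PCod B -> PCod (fun V mem e => A V mem e /\ B V mem e).
Proof. intros [c C] [d D]; exists (xAnd c d); intros; simpl; rewrite C, D; tauto. Qed.
Lemma pcod_or A B : PCod A -> PCod B -> PCod (fun V mem e => A V mem e \/ B V mem e).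
Proof. intros [c C] [d D]; exists (xOr c d); intros; simpl; rewrite C, D; tauto. Qed.
Lemma pcod_iff A B : PCod A -> PCod B -> PCod (fun V mem e => A V mem e <-> B V mem e).
Proof. intros; apply pcod_and; apply pcod_imp; auto. Qed.
Lemma pcod_all (B : forall V, (V -> V -> Prop) -> (nat -> V) -> V -> Prop) :
 PCod (fun V mem e => B V mem (etl e) (e 0)) -> PCod (fun V mem e => forall x, B V mem e x).
Proof.
 intros [c C]; exists (xAll c); intros; simpl.
 split; intros H x; specialize (H x); apply C in H || apply C; exact H.
Qed.
Lemma pcod_ex (B : forall V, (V -> V -> Prop) -> (nat -> V) -> V -> Prop) :
 PCod (fun V mem e => B V mem (etl e) (e 0)) -> PCod (fun V mem e => exists x, B V mem e x).
Proof.
 intros [c C]; exists (xEx c); intros; simpl.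
 split; intros [x H]; exists x; apply C in H || apply C; exact H.
Qed.

Create HintDb pcod.
Ltac pforces := solve [auto with pcod nocore].
Ltac pcod1 :=
 lazymatch goal with
 | |- PCod (fun V mem e => truth mem (@?phi V e)) => apply (@pcod_truth phi); cod
 | |- PCod (fun V mem e => forces mem _ _ _ _) => pforces
 | |- PCod (fun V mem e => mem _ _) => exact (pcod_mem _ _)
 | |- PCod (fun V mem e => False) => exact pcod_false
 | |- PCod (fun V mem e => (@?A V mem e) /\ (@?B V mem e)) => apply (@pcod_and A B)
 | |- PCod (fun V mem e => (@?A V mem e) <-> (@?B V mem e)) => apply (@pcod_iff A B)
 | |- PCod (fun V mem e => (@?A V mem e) \/ (@?B V mem e)) => apply (@pcod_or A B)
 | |- PCod (fun V mem e => exists x, @?b V mem e x) => apply (@pcod_ex b); cbv beta delta [etl]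
 | |- PCod (fun V mem e => (@?A V mem e) -> (@?B V mem e)) => apply (@pcod_imp A B)
 | |- PCod (fun V mem e => forall x, @?b V mem e x) => apply (@pcod_all b); cbv beta delta [etl]
 | |- _ => solve [auto with pcod nocore]
 end.
Ltac pcod := cbv beta delta [etl]; repeat pcod1.

Lemma pcod_below i j k l : PCod (fun V mem e => below mem (e i) (e j) (e k) (e l)).
Proof. unfold below; pcod. Qed.
Hint Resolve pcod_below : pcod.
Lemma pcod_sub_clause i j k l m n : PCod (fun V mem e => sub_clause mem (e i) (e j) (e k) (e l) (e m) (e n)).
Proof. unfold sub_clause; pcod. Qed.
Hint Resolve pcod_sub_clause : pcod.
Lemma pcod_forces_eq i j k l m : PCod (fun V mem e => forces_eq mem (e i) (e j) (e k) (e l) (e m)).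
Proof. unfold forces_eq; pcod. Qed.
Hint Resolve pcod_forces_eq : pcod.
Lemma pcod_forces_mem i j k l m : PCod (fun V mem e => forces_mem mem (e i) (e j) (e k) (e l) (e m)).
Proof. unfold forces_mem; pcod. Qed.
Hint Resolve pcod_forces_mem : pcod.

(** Definability of forcing, by recursion on the code: the clause of [forces] for each connective is
    a first-order condition on the clauses for its parts. *)
Lemma pcod_forces_xd c : forall i j k (r : nat -> nat),
 PCod (fun V mem e => forces mem (e i) (e j) (e k) (xd c (fun n => e (r n)))).
Proof.
 induction c; intros; simpl; pcod.
 - destruct (IHc (S i) (S j) (S k) (fun n => match n with 0 => 0 | S m => S (r m) end)) as [d D].
  exists d; intros; rewrite D.
  replace (fun n => e (match n with 0 => 0 | S m => S (r m) end))
   with (scons (e 0) (fun n => e (S (r n)))) by (extensionality n; destruct n; reflexivity).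
  tauto.
 - destruct (IHc (S (S (S i))) (S (S (S j))) 1 (fun n => match n with 0 => 0 | S m => S (S (S (r m))) end)) as [d' D].
  exists d'; intros; rewrite D.
  replace (fun n => e (match n with 0 => 0 | S m => S (S (S (r m))) end))
   with (scons (e 0) (fun n => e (S (S (S (r n)))))) by (extensionality n; destruct n; reflexivity).
  tauto.
Qed.

Lemma pcod_forces i j k (phi : forall V, (nat -> V) -> form V) : Cod phi ->
 PCod (fun V mem e => forces mem (e i) (e j) (e k) (phi V e)).
Proof.
 intros [c C]. destruct (pcod_forces_xd c i j k (fun n => n)) as [d D].
 exists d; intros; rewrite D, <- C; tauto.
Qed.

Ltac pforces ::= lazymatch goal with
 | |- PCod (fun V mem e => forces mem _ _ _ (@?phi V e)) => apply (@pcod_forces _ _ _ phi); cod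
 end.

Lemma pcod_ext A B : (forall V mem e, A V mem e <-> B V mem e) -> PCod A -> PCod B.
Proof. intros E [c C]; exists c; intros; rewrite C; apply E. Qed.

Lemma pcod_fs : PCod (fun V mem e => fs_hechler mem (e 0) (e 1) (e 2) (e 3)).
Proof.
 apply pcod_ext with (A := fun V mem e =>
 (mem ⊨ ∃ d', succ d' (e 0) ∧ fun_on (e 1) d') /\
 (mem ⊨ ∃ d', succ d' (e 0) ∧ fun_on (e 2) d') /\
 (mem ⊨ fun_on (e 3) (e 0)) /\
 (forall x Px, (mem ⊨ maps (e 1) x Px) -> forall p,
  mem p Px <->
  (mem ⊨ finite p ∧ ∃ a, sub a x ∧ fun_on p a) /\
  (forall z q, (mem ⊨ maps p z q) ->
   forall Pz Lz Qz p', (mem ⊨ maps (e 1) z Pz) -> (mem ⊨ maps (e 2) z Lz) ->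
    (mem ⊨ maps (e 3) z Qz) -> (mem ⊨ restrict p' p z) ->
    mem p' Pz /\ (mem ⊨ ∃ r, maps Qz q r) /\ forces mem Pz Lz p' (q ∈ Qz))) /\
 (forall x Px Lx, (mem ⊨ maps (e 1) x Px) -> (mem ⊨ maps (e 2) x Lx) ->
  forall u, mem u Lx <->
  exists p q, (mem ⊨ opair u p q) /\ mem p Px /\ mem q Px /\
   forall z q1, (mem ⊨ maps q z q1) ->
    exists p1, (mem ⊨ maps p z p1) /\
    forall Pz Lz p', (mem ⊨ maps (e 1) z Pz) -> (mem ⊨ maps (e 2) z Lz) ->
     (mem ⊨ restrict p' p z) -> forces mem Pz Lz p' (hechler_le p1 q1)) /\
 (forall x Px Lx Qx, (mem ⊨ maps (e 1) x Px) -> (mem ⊨ maps (e 2) x Lx) ->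
  (mem ⊨ maps (e 3) x Qx) ->
  forall p, mem p Px -> forces mem Px Lx p (∀ y, y ∈ Qx ⇔ hechler y))).
 - intros V mem e; split.
  + intros (H1 & H2 & H3 & H4 & H5 & H6); split; assumption.
  + intros [H1 H2 H3 H4 H5 H6]. exact (conj H1 (conj H2 (conj H3 (conj H4 (conj H5 H6))))).
 - pcod.
Qed.

Lemma pcod_dense : PCod (fun V mem e => dense mem (e 0) (e 1) (e 2)).
Proof. unfold dense; pcod. Qed.

(** * Elementary maps between models *)

Definition Elem {V' V} (mem' : V' -> V' -> Prop) (mem : V -> V -> Prop) (h : V' -> V) :=
 forall c e, truth mem' (xd c e) <-> truth mem (xd c (fun n => h (e n))).

Lemma elem_cod V' V mem' mem (h : V' -> V) phi : Elem mem' mem h -> Cod phi ->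
 forall e, truth mem' (phi V' e) <-> truth mem (phi V (fun n => h (e n))).
Proof. intros H [c C] e; rewrite <- !C; apply H. Qed.

Lemma elem_pcod V' V mem' mem (h : V' -> V) A : Elem mem' mem h -> PCod A ->
 forall e, A V' mem' e <-> A V mem (fun n => h (e n)).
Proof. intros H [c C] e; rewrite <- !C; apply H. Qed.

Lemma elem_ZFC V' V mem' mem (h : V' -> V) : inhabited V' -> Elem mem' mem h -> ZFC mem -> ZFC mem'.
Proof.
 intros [x0] H Z.
 assert (K : forall phi : forall V, form V, Cod (fun V e => phi V) -> truth mem (phi V) -> truth mem' (phi V')).
 { intros phi C T. apply (elem_cod H C (fun _ => x0)). exact T. }
 split.
 - apply (K (fun V => ∀ x y, x ≐ y ⇒ ∀ z, x ∈ z ⇒ y ∈ z)); [cod|apply Z].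
 - apply (K (fun V => ∀ x, ¬ empty x ⇒ ∃[y ∈ x] ∀[z ∈ y] ¬ z ∈ x)); [cod|apply Z].
 - apply (K (fun V => ∀ x y, ∃ z, upair z x y)); [cod|apply Z].
 - apply (K (fun V => ∀ a, ∃ u, ∀ x, x ∈ u ⇔ ∃[y ∈ a] x ∈ y)); [cod|apply Z].
 - apply (K (fun V => ∀ a, ∃ c, power c a)); [cod|apply Z].
 - apply (K (fun V => ∃ w, (∃[x ∈ w] empty x) ∧ ∀[x ∈ w] ∃[y ∈ w] succ y x)); [cod|apply Z].
 - intros c e.
  refine (proj2 (elem_cod H (phi := fun V e => ∀ a, ∃ b, ∀ x, x ∈ b ⇔ x ∈ a ∧ decode c (scons x e)) _ e) (@separation _ _ Z c _)).
  cod.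
  (* The parameters of the schema lie behind the bound variables a, b and x, hence the shift by
     three. *)
  all: match goal with |- Cod ?f => replace f with (fun V (e : nat -> V) => decode c (fun n => e (match n with 0 => 0 | S k => S (S (S k)) end))) by
   (extensionality V0; extensionality e0; f_equal; extensionality n; destruct n; reflexivity) end; apply cod_decode.
 - intros c e.
  refine (proj2 (elem_cod H (phi := fun V e => ∀ a,
   (∀[x ∈ a] ∀ y y', decode c (scons x (scons y e))
            ∧ decode c (scons x (scons y' e)) ⇒ y ≐ y') ⇒
   ∃ b, ∀ y, y ∈ b ⇔ ∃[x ∈ a] decode c (scons x (scons y e))) _ e) (@replacement _ _ Z c _)).
  cod.
  1:{ match goal with |- Cod ?f => replace f with (fun V (e : nat -> V) => decode c (fun n => e (match n with 0 => 2 | 1 => 1 | S (S k) => S (S (S (S k))) end))) by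
   (extensionality V0; extensionality e0; f_equal; extensionality n; destruct n as [|[|n]]; reflexivity) end; apply cod_decode. }
  1:{ match goal with |- Cod ?f => replace f with (fun V (e : nat -> V) => decode c (fun n => e (match n with 0 => 2 | 1 => 0 | S (S k) => S (S (S (S k))) end))) by
   (extensionality V0; extensionality e0; f_equal; extensionality n; destruct n as [|[|n]]; reflexivity) end; apply cod_decode. }
  1-2: match goal with |- Cod ?f => replace f with (fun V (e : nat -> V) => decode c (fun n => e (match n with 0 => 0 | 1 => 1 | S (S k) => S (S (S (S k))) end))) by
   (extensionality V0; extensionality e0; f_equal; extensionality n; destruct n as [|[|n]]; reflexivity) end; apply cod_decode.
 - apply (K (fun V => ∀ a,
   (∀[x ∈ a] ¬ empty x)
   ∧ (∀[x ∈ a] ∀[y ∈ a] (∃[z ∈ x] z ∈ y) ⇒ x ≐ y) ⇒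
   ∃ c, ∀[x ∈ a] ∃ z, (z ∈ x ∧ z ∈ c)
             ∧ ∀ z', z' ∈ x ∧ z' ∈ c ⇒ z' ≐ z)); [cod|apply Z].
Qed.

Definition leibniz V (mem : V -> V -> Prop) := forall x y, (forall z, mem z x <-> mem z y) -> x = y.

(** Coextensional sets have the same elements by definition and belong to the same sets by the axiom
    of extensionality; this is the atomic case, and the rest follows by induction. *)
Lemma truth_congr V (mem : V -> V -> Prop) : ZFC mem -> forall c (e e' : nat -> V),
 (forall n, mem ⊨ e n ≐ e' n) -> truth mem (xd c e) <-> truth mem (xd c e').
Proof.
 intros Z; induction c; intros e e' H; simpl.
 - pose proof (extensionality Z (H i)) as K.
  assert (K' : mem ⊨ e' i ≐ e i) by (intros z; destruct (H i z); split; assumption).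
  apply (extensionality Z) in K'. destruct (H j (e i)) as [A B]; destruct (H j (e' i)) as [A' B'].
  simpl in *; split; intros; auto.
 - tauto.
 - rewrite (IHc1 e e'), (IHc2 e e') by assumption; tauto.
 - rewrite (IHc1 e e'), (IHc2 e e') by assumption; tauto.
 - rewrite (IHc1 e e'), (IHc2 e e') by assumption; tauto.
 - assert (E : forall x, truth mem (xd c (scons x e)) <-> truth mem (xd c (scons x e'))).
  { intros x; apply IHc; intros [|n]; simpl; [tauto|apply H]. }
  split; intros K x; apply E, K.
 - assert (E : forall x, truth mem (xd c (scons x e)) <-> truth mem (xd c (scons x e'))).
  { intros x; apply IHc; intros [|n]; simpl; [tauto|apply H]. }
  split; intros [x K]; exists x; apply E, K.
Qed.

(** * Leibniz quotients and countable elementary submodels *)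

Section Quotient.
Variables (M : Type) (mem : M -> M -> Prop) (Z : ZFC mem).
Definition rep (x : M) : M := epsilon (inhabits x) (fun y => mem ⊨ x ≐ y).
Lemma rep_eq x : mem ⊨ x ≐ rep x.
Proof. unfold rep; apply epsilon_spec with (P := fun y => mem ⊨ x ≐ y); exists x; simpl; tauto. Qed.
Lemma rep_congr x y : mem ⊨ x ≐ y -> rep x = rep y.
Proof.
 (* The default passed to [epsilon] depends on the element, but it is a proof of [inhabited M], so
    proof irrelevance identifies the two. *)
 intros H; unfold rep. rewrite (proof_irrelevance _ (inhabits x) (inhabits y)). f_equal.
 extensionality z; apply propositional_extensionality; simpl in *.
 split; intros K w; specialize (K w); specialize (H w); tauto.
Qed.
Lemma rep_rep x : rep (rep x) = rep x.
Proof. symmetry; apply rep_congr, rep_eq. Qed.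

(** The quotient is realized on chosen representatives, so that [s] is an inclusion. It is
    elementary because any witness may be replaced by its representative, by [truth_congr]. *)
Lemma quotient : exists (M1 : Type) (mem1 : M1 -> M1 -> Prop) (s : M1 -> M) (pi : M -> M1),
 (forall x, pi (s x) = x) /\ (forall x, mem ⊨ s (pi x) ≐ x) /\ leibniz mem1 /\ Elem mem1 mem s.
Proof.
 pose (M1 := {x : M | rep x = x}).
 pose (mem1 := fun x y : M1 => mem (proj1_sig x) (proj1_sig y)).
 pose (pi := fun x => exist (fun x => rep x = x) (rep x) (rep_rep x) : M1).
 assert (E : Elem mem1 mem (fun x : M1 => proj1_sig x)).
 { intros c; induction c; intros e; simpl; try (rewrite IHc1, IHc2); try tauto.
  - split; intros K x.
   + specialize (K (pi x)); apply IHc in K. revert K; apply truth_congr; auto.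
    intros [|n]; simpl; try tauto. intros z; destruct (rep_eq x z); split; assumption.
   + apply IHc. specialize (K (proj1_sig x)). revert K; apply truth_congr; auto.
    intros [|n]; simpl; tauto.
  - split; intros [x K].
   + exists (proj1_sig x); apply IHc in K. revert K; apply truth_congr; auto.
    intros [|n]; simpl; tauto.
   + exists (pi x). apply IHc. revert K; apply truth_congr; auto.
    intros [|n]; simpl; try tauto. intros z; destruct (rep_eq x z); split; assumption. }
 assert (inj1 : forall x y : M1, proj1_sig x = proj1_sig y -> x = y).
 { intros [x a] [y b]; simpl; intros ->; f_equal; apply proof_irrelevance. }
 exists M1, mem1, (fun x => proj1_sig x), pi. split; [|split; [|split]]; auto.
 - intros x; apply inj1; simpl; apply (proj2_sig x).
 - intros x z; simpl; destruct (rep_eq x z); split; assumption.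
 - intros x y H; apply inj1. rewrite <- (proj2_sig x), <- (proj2_sig y); apply rep_congr.
  pose proof (elem_cod E (cod_eqv 0 1) (scons x (fun _ => y))) as K; simpl in K.
  exact (proj1 K H).
Qed.
End Quotient.

Section LS.
Variables (V : Type) (mem : V -> V -> Prop) (Z : leibniz mem) (ps : nat -> V).

Definition lenv (l : list V) : nat -> V := fun n => nth n l (ps 0).
Definition sk (c : xc) (l : list V) : V :=
 epsilon (inhabits (ps 0)) (fun x => truth mem (xd c (scons x (lenv l)))).

(** Closed Skolem terms. A term evaluates to a list, so that one constructor serves for Skolem
    functions of all arities; the hull consists of the values of terms that give a one-element
    list. *)
Inductive tm := tN | tL (n : nat) | tC (a b : tm) | tS (c : xc) (a : tm).
Fixpoint ev (t : tm) : list V :=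
 match t with
 | tN => [] | tL n => [ps n] | tC a b => ev a ++ ev b | tS c a => [sk c (ev a)]
 end.

Fixpoint encx (c : xc) : nat :=
 match c with
 | xMem i j => to_nat (0, to_nat (i, j)) | xBot => to_nat (1, 0)
 | xImp a b => to_nat (2, to_nat (encx a, encx b)) | xAnd a b => to_nat (3, to_nat (encx a, encx b))
 | xOr a b => to_nat (4, to_nat (encx a, encx b)) | xAll a => to_nat (5, encx a) | xEx a => to_nat (6, encx a)
 end.
Fixpoint enct (t : tm) : nat :=
 match t with
 | tN => to_nat (0, 0) | tL n => to_nat (1, n) | tC a b => to_nat (2, to_nat (enct a, enct b))
 | tS c a => to_nat (3, to_nat (encx c, enct a))
 end.

Ltac pair_inj := repeat match goal with
 | H : to_nat _ = to_nat _ |- _ => apply to_nat_inj in H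
 | H : (_, _) = (_, _) |- _ => apply pair_equal_spec in H; destruct H end.

Lemma encx_inj c : forall d, encx c = encx d -> c = d.
Proof.
 induction c; intros d H; destruct d; cbn [encx] in H; pair_inj; try congruence; f_equal; auto.
Qed.
Lemma enct_inj c : forall d, enct c = enct d -> c = d.
Proof.
 induction c; intros d H; destruct d; cbn [enct] in H; pair_inj; try congruence; f_equal; auto using encx_inj.
Qed.

Definition V0 := {x : V | exists t, ev t = [x]}.
Definition mem0 (x y : V0) := mem (proj1_sig x) (proj1_sig y).

Fixpoint bnd_fm (c : xc) : nat :=
 match c with
 | xMem i j => S (max i j) | xBot => 0
 | xImp a b | xAnd a b | xOr a b => max (bnd_fm a) (bnd_fm b)
 | xAll a | xEx a => bnd_fm a
 end.

Lemma bd_spec W c : forall e e' : nat -> W, (forall n, n < bnd_fm c -> e n = e' n) -> xd c e = xd c e'.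
Proof.
 induction c; intros e e' H; simpl in *.
 - rewrite !H by lia; reflexivity.
 - reflexivity.
 - erewrite IHc1, IHc2; [reflexivity| |]; intros; apply H; lia.
 - erewrite IHc1, IHc2; [reflexivity| |]; intros; apply H; lia.
 - erewrite IHc1, IHc2; [reflexivity| |]; intros; apply H; lia.
 - f_equal; extensionality x; apply IHc; intros [|n] ?; simpl; auto; apply H; lia.
 - f_equal; extensionality x; apply IHc; intros [|n] ?; simpl; auto; apply H; lia.
Qed.

Lemma list_tm (e : nat -> V0) k : exists t, forall n, n < k -> nth n (ev t) (ps 0) = proj1_sig (e n).
Proof.
 assert (H : exists t, length (ev t) = k /\ forall n, n < k -> nth n (ev t) (ps 0) = proj1_sig (e n)).
 { induction k as [|k [t [L H]]].
  - exists tN; simpl; split; auto; intros; lia.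
  - destruct (proj2_sig (e k)) as [u E]. exists (tC t u); simpl; rewrite E, length_app; simpl; split; [lia|].
   intros n Hn. destruct (Nat.eq_dec n k) as [->|].
   + rewrite app_nth2 by lia. rewrite L, Nat.sub_diag; reflexivity.
   + rewrite app_nth1 by lia. apply H; lia. }
 destruct H as [t [_ H]]; exists t; exact H.
Qed.

(** The Tarski-Vaught condition: a formula uses finitely many variables, so its parameters form a
    list named by a single term, and the Skolem function of the formula names a witness. *)
Lemma skolem c (e : nat -> V0) : (exists x, truth mem (xd c (scons x (fun n => proj1_sig (e n))))) ->
 exists x : V0, truth mem (xd c (scons (proj1_sig x) (fun n => proj1_sig (e n)))).
Proof.
 intros [x H]. destruct (list_tm e (bnd_fm c)) as [t T].
 assert (E : forall y, xd c (scons y (fun n => proj1_sig (e n))) = xd c (scons y (lenv (ev t)))).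
 { intros y; apply bd_spec; intros [|n] Hn; simpl; auto. unfold lenv; rewrite T by lia; reflexivity. }
 assert (K : ev (tS c t) = [sk c (ev t)]) by reflexivity.
 exists (exist (fun x => exists t, ev t = [x]) _ (ex_intro _ _ K)); simpl.
 rewrite E. unfold sk. apply epsilon_spec with (P := fun y => truth mem (xd c (scons y (lenv (ev t))))).
 exists x; rewrite <- E; exact H.
Qed.

Lemma elem0 : Elem mem0 mem (fun x : V0 => proj1_sig x).
Proof.
 assert (S : forall (e : nat -> V0) x, (fun n => proj1_sig (scons x e n)) = scons (proj1_sig x) (fun n => proj1_sig (e n))).
 { intros e x; extensionality n; destruct n; reflexivity. }
 intros c; induction c; intros e; simpl; try (rewrite IHc1, IHc2); try tauto.
 - split; intros K x.
  (* The Tarski-Vaught condition speaks of witnesses, so the universal case is treated through the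
     negation. *)
  + apply NNPP; intros N.
   destruct (skolem (c := xImp c xBot) (e := e)) as [y Y]; [exists x; exact N|].
   apply Y. rewrite <- S. apply IHc, K.
  + apply IHc; rewrite S; apply K.
 - split.
  + intros [x K]; exists (proj1_sig x); rewrite <- S; apply IHc, K.
  + intros K; apply skolem in K; destruct K as [x K]; exists x; apply IHc; rewrite S; exact K.
Qed.

Lemma downward_LS : exists (V0 : Type) (mem0 : V0 -> V0 -> Prop) (h : V0 -> V),
 Elem mem0 mem h /\ leibniz mem0 /\ (exists f : nat -> V0, forall x, exists n, f n = x) /\
 (forall n, exists x, h x = ps n).
Proof.
 exists V0, mem0, (fun x => proj1_sig x).
 assert (inj1 : forall x y : V0, proj1_sig x = proj1_sig y -> x = y).
 { intros [x a] [y b]; simpl; intros ->; f_equal; apply proof_irrelevance. }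
 assert (k0 : ev (tL 0) = [ps 0]) by reflexivity.
 split; [exact elem0|split; [|split]].
 - intros x y H; apply inj1, Z.
  pose proof (elem_cod elem0 (cod_eqv 0 1) (scons x (fun _ => y))) as K; simpl in K.
  assert (K' := proj1 K H). intros z; destruct (K' z); split; assumption.
 - pose (x0 := exist (fun x => exists t, ev t = [x]) _ (ex_intro _ _ k0) : V0).
  exists (fun n => epsilon (inhabits x0) (fun x => exists t, ev t = [proj1_sig x] /\ enct t = n)).
  intros x; destruct (proj2_sig x) as [t T]. exists (enct t).
  assert (K : exists x : V0, exists t', ev t' = [proj1_sig x] /\ enct t' = enct t) by (exists x, t; auto).
  apply (epsilon_spec (inhabits x0)) in K. destruct K as [t' [A B]].
  apply enct_inj in B; subst t'. apply inj1. rewrite T in A. injection A; auto.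
 - intros n. assert (K : ev (tL n) = [ps n]) by reflexivity.
  exists (exist (fun x => exists t, ev t = [x]) _ (ex_intro _ _ K)); reflexivity.
Qed.
End LS.

(** * Definability in a model of set theory *)

Inductive fm := fmem (i j : nat) | fU (i : nat) | fE (i j : nat) | fbot | fimp (a b : fm)
 | fand (a b : fm) | for_ (a b : fm) | fall (a : fm) | fex (a : fm).

Section Sat.
Variables (V : Type) (mem : V -> V -> Prop) (U : V -> Prop) (E : V -> V -> Prop).
Fixpoint sat (c : fm) (e : nat -> V) : Prop :=
 match c with
 | fmem i j => mem (e i) (e j) | fU i => U (e i) | fE i j => E (e i) (e j) | fbot => False
 | fimp a b => sat a e -> sat b e | fand a b => sat a e /\ sat b e | for_ a b => sat a e \/ sat b e
 | fall a => forall x, sat a (scons x e) | fex a => exists x, sat a (scons x e)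
 end.
End Sat.

Definition upr (r : nat -> nat) n := match n with 0 => 0 | S k => S (r k) end.
Fixpoint ren (c : fm) (r : nat -> nat) : fm :=
 match c with
 | fmem i j => fmem (r i) (r j) | fU i => fU (r i) | fE i j => fE (r i) (r j) | fbot => fbot
 | fimp a b => fimp (ren a r) (ren b r) | fand a b => fand (ren a r) (ren b r)
 | for_ a b => for_ (ren a r) (ren b r)
 | fall a => fall (ren a (upr r)) | fex a => fex (ren a (upr r))
 end.

Lemma sat_ren V mem U E c : forall r (e : nat -> V), sat mem U E (ren c r) e <-> sat mem U E c (fun n => e (r n)).
Proof.
 assert (K : forall r (e : nat -> V) x, (fun n => scons x e (upr r n)) = scons x (fun n => e (r n))).
 { intros; extensionality n; destruct n; reflexivity. }
 induction c; intros; simpl; try rewrite IHc1, IHc2; try tauto.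
 - split; intros H x; specialize (H x); rewrite IHc, K in *; exact H.
 - split; intros [x H]; exists x; rewrite IHc, K in *; exact H.
Qed.

Definition join {V} (e f : nat -> V) n := if Nat.even n then e (Nat.div2 n) else f (Nat.div2 n).
Lemma join_e V (e f : nat -> V) n : join e f (2 * n) = e n.
Proof. unfold join. rewrite Nat.even_even, Nat.div2_double; reflexivity. Qed.
Lemma join_f V (e f : nat -> V) n : join e f (S (2 * n)) = f n.
Proof. unfold join. replace (Nat.even (S (2*n))) with false by (rewrite Nat.even_succ, Nat.odd_mul; reflexivity).
 rewrite Nat.div2_succ_double; reflexivity. Qed.

Lemma nat_eo n : exists m, n = 2 * m \/ n = S (2 * m).
Proof. induction n as [|n [m [H|H]]]; [exists 0|exists m|exists (S m)]; lia. Qed.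

Section Dfn.
Variables (I V : Type) (mem : V -> V -> Prop) (U : I -> V -> Prop) (E : I -> V -> V -> Prop).

(* [I] indexes a family of predicates [U i] and relations [E i], added to the language: generic filters and forced membership.
  [join e f] gives the even variables to the arguments and the odd ones to the parameters. *)
Definition dfn (A : I -> (nat -> V) -> Prop) :=
 exists c (f : nat -> V), forall i e, A i e <-> sat mem (U i) (E i) c (join e f).
Definition dft (t : I -> (nat -> V) -> V) := dfn (fun i e => t i (etl e) = e 0).

(** Two definable predicates come with separate parameter sequences f and g, and are combined over
    [join f g]. The renamings [r1] and [r2] let the first formula find f there and the second g;
    [rq] makes room for a variable that has just been quantified. *)
Definition r1 n := if Nat.even n then n else 2 * n - 1.
Definition r2 n := if Nat.even n then n else 2 * n + 1.
Definition rq n := match n with 0 => 0 | _ => if Nat.even n then n - 1 else n + 1 end.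

Lemma even_d m : Nat.even (2 * m) = true.
Proof. apply Nat.even_even. Qed.
Lemma even_s m : Nat.even (S (2 * m)) = false.
Proof. rewrite Nat.even_succ, Nat.odd_mul; reflexivity. Qed.

Lemma join_r1 (e f g : nat -> V) : (fun n => join e (join f g) (r1 n)) = join e f.
Proof.
 extensionality n; destruct (nat_eo n) as [m [->| ->]]; unfold r1.
 - rewrite even_d, !join_e; reflexivity.
 - rewrite even_s. replace (2 * S (2 * m) - 1) with (S (2 * (2 * m))) by lia.
  rewrite !join_f, join_e; reflexivity.
Qed.
Lemma join_r2 (e f g : nat -> V) : (fun n => join e (join f g) (r2 n)) = join e g.
Proof.
 extensionality n; destruct (nat_eo n) as [m [->| ->]]; unfold r2.
 - rewrite even_d, !join_e; reflexivity.
 - rewrite even_s. replace (2 * S (2 * m) + 1) with (S (2 * (S (2 * m)))) by lia.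
  rewrite !join_f; reflexivity.
Qed.
Lemma join_rq x (e f : nat -> V) : (fun n => scons x (join e f) (rq n)) = join (scons x e) f.
Proof.
 extensionality n; destruct (nat_eo n) as [m [->| ->]]; unfold rq.
 - destruct m as [|m].
  + simpl; reflexivity.
  + rewrite join_e, even_d. replace (2 * S m) with (S (S (2 * m))) at 1 by lia.
   replace (2 * S m - 1) with (S (2 * m)) by lia.
   change (join e f (2 * m) = e m). apply join_e.
 - rewrite join_f, even_s. replace (S (2 * m) + 1) with (S (S (2 * m))) by lia.
  change (join e f (S (2 * m)) = f m). apply join_f.
Qed.

Lemma d_imp A B : dfn A -> dfn B -> dfn (fun i e => A i e -> B i e).
Proof.
 intros [c [f C]] [d [g D]]; exists (fimp (ren c r1) (ren d r2)), (join f g); intros; simpl.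
 rewrite !sat_ren, join_r1, join_r2, C, D; tauto.
Qed.
Lemma d_and A B : dfn A -> dfn B -> dfn (fun i e => A i e /\ B i e).
Proof.
 intros [c [f C]] [d [g D]]; exists (fand (ren c r1) (ren d r2)), (join f g); intros; simpl.
 rewrite !sat_ren, join_r1, join_r2, C, D; tauto.
Qed.
Lemma d_or A B : dfn A -> dfn B -> dfn (fun i e => A i e \/ B i e).
Proof.
 intros [c [f C]] [d [g D]]; exists (for_ (ren c r1) (ren d r2)), (join f g); intros; simpl.
 rewrite !sat_ren, join_r1, join_r2, C, D; tauto.
Qed.
Lemma d_iff A B : dfn A -> dfn B -> dfn (fun i e => A i e <-> B i e).
Proof. intros; apply d_and; apply d_imp; auto. Qed.
Lemma d_all (B : I -> (nat -> V) -> V -> Prop) : dfn (fun i e => B i (etl e) (e 0)) ->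
 dfn (fun i e => forall x, B i e x).
Proof.
 intros [c [f C]]; exists (fall (ren c rq)), f; intros; simpl.
 assert (K : forall x, B i e x <-> sat mem (U i) (E i) (ren c rq) (scons x (join e f))).
 { intros x; rewrite sat_ren, join_rq, <- C; reflexivity. }
 split; intros H x; apply K, H.
Qed.
Lemma d_ex (B : I -> (nat -> V) -> V -> Prop) : dfn (fun i e => B i (etl e) (e 0)) ->
 dfn (fun i e => exists x, B i e x).
Proof.
 intros [c [f C]]; exists (fex (ren c rq)), f; intros; simpl.
 assert (K : forall x, B i e x <-> sat mem (U i) (E i) (ren c rq) (scons x (join e f))).
 { intros x; rewrite sat_ren, join_rq, <- C; reflexivity. }
 split; intros [x H]; exists x; apply K, H.
Qed.
Lemma d_ext A B : (forall i e, A i e <-> B i e) -> dfn A -> dfn B.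
Proof. intros H [c [f C]]; exists c, f; intros; rewrite <- H; apply C. Qed.
End Dfn.

Definition dfn0 V (mem : V -> V -> Prop) (A : V -> Prop) :=
 dfn mem (fun (_ : unit) _ => False) (fun _ _ _ => False) (fun _ e => A (e 0)).

(** The axioms common to the ground model and to its generic extensions, where neither replacement
    nor choice is established. Separation is stated for semantic predicates that are definable with
    parameters, so that no code has to be written when it is used. *)
Record SetM := {
 scar :> Type;
 smem : scar -> scar -> Prop;
 s_ext : leibniz smem;
 s_pair : forall x y, exists z, forall w, smem w z <-> w = x \/ w = y;
 s_union : forall a, exists u, forall x, smem x u <-> exists y, smem y a /\ smem x y;
 s_power : forall a, exists c, forall x, smem x c <-> forall z, smem z x -> smem z a;
 s_inf : exists w, (exists x, smem x w /\ forall z, ~ smem z x) /\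
  forall x, smem x w -> exists y, smem y w /\ forall z, smem z y <-> smem z x \/ z = x;
 s_found : forall x y, smem y x -> exists m, smem m x /\ forall z, smem z m -> ~ smem z x;
 s_sep : forall A, dfn0 smem A -> forall a, exists b, forall x, smem x b <-> smem x a /\ A x
}.
Notation "x ∊ y" := (smem x y) (at level 70, no associativity).
Notation tr := (truth (@smem _)).
Notation dfns := (dfn (@smem _)).
Notation dfts := (dft (@smem _)).
Notation dfnp := (dfn (@smem _) (fun (_ : unit) _ => False) (fun _ _ _ => False)).
Notation dftp := (dft (@smem _) (fun (_ : unit) _ => False) (fun _ _ _ => False)).

Section Rules.
Variables (S : SetM) (I : Type) (U : I -> S -> Prop) (E : I -> S -> S -> Prop).
Notation dfn := (dfn (@smem S) U E).
Notation dft := (dft (@smem S) U E).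

Lemma s_inh : inhabited S.
Proof. destruct (s_inf S) as [w _]; exact (inhabits w). Qed.

Lemma d_vmem m n : dfn (fun i e => e m ∊ e n).
Proof.
 destruct s_inh as [x]. exists (fmem (2 * m) (2 * n)), (fun _ => x); intros; cbn [sat].
 rewrite !join_e; tauto.
Qed.
Lemma d_vU n : dfn (fun i e => U i (e n)).
Proof.
 destruct s_inh as [x]. exists (fU (2 * n)), (fun _ => x); intros; cbn [sat].
 rewrite !join_e; tauto.
Qed.
Lemma d_vE m n : dfn (fun i e => E i (e m) (e n)).
Proof.
 destruct s_inh as [x]. exists (fE (2 * m) (2 * n)), (fun _ => x); intros; cbn [sat].
 rewrite !join_e; tauto.
Qed.
Lemma d_veq m n : dfn (fun i e => e m = e n).
Proof.
 apply d_ext with (A := fun i e => forall x, x ∊ e m <-> x ∊ e n).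
 - intros; split; [apply s_ext|intros ->; tauto].
 - apply (@d_all _ _ _ _ _ (fun i e x => x ∊ e m <-> x ∊ e n)), d_iff; apply (d_vmem 0).
Qed.
Lemma d_false : dfn (fun i e => False).
Proof. destruct s_inh as [x]; exists fbot, (fun _ => x); intros; simpl; tauto. Qed.
Lemma d_not A : dfn A -> dfn (fun i e => ~ A i e).
Proof. intros; apply d_imp; auto; apply d_false. Qed.
Lemma d_prop (P : Prop) : dfn (fun i e => P).
Proof.
 destruct (classic P); [apply d_ext with (A := fun i e => False -> False)|apply d_ext with (A := fun i e => False)];
  try tauto; try (apply d_imp); apply d_false.
Qed.

Lemma d_ren A (r : nat -> nat) : dfn A -> dfn (fun i e => A i (fun n => e (r n))).
Proof.
 intros [c [f C]]. exists (ren c (fun n => if Nat.even n then 2 * r (Nat.div2 n) else n)), f.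
 intros; rewrite sat_ren, C.
 replace (fun n => join e f (if Nat.even n then 2 * r (Nat.div2 n) else n)) with (join (fun n => e (r n)) f); [tauto|].
 extensionality n; destruct (nat_eo n) as [m [->| ->]].
 - rewrite even_d, !join_e. rewrite Nat.div2_double; reflexivity.
 - rewrite even_s, !join_f; reflexivity.
Qed.

Lemma ft_var n : dft (fun i e => e n).
Proof. apply (d_veq (Datatypes.S n) 0). Qed.
Lemma ft_const x : dft (fun i e => x).
Proof.
 apply d_ext with (A := fun i e => forall z, z ∊ x <-> z ∊ e 0).
 - intros; split; [apply s_ext|intros ->; tauto].
 - apply (@d_all _ _ _ _ _ (fun i e z => z ∊ x <-> z ∊ e 0)), d_iff; [|apply (d_vmem 0)].
  exists (fmem 0 1), (fun _ => x); intros; simpl; tauto.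
Qed.
Lemma ft_ren t (r : nat -> nat) : dft t -> dft (fun i e => t i (fun n => e (r n))).
Proof.
 intros H. apply (@d_ren (fun i e => t i (etl e) = e 0) (upr r)) in H. exact H.
Qed.

Lemma d_sub1 (P : I -> S -> Prop) t : dfn (fun i e => P i (e 0)) -> dft t -> dfn (fun i e => P i (t i e)).
Proof.
 intros H K. apply d_ext with (A := fun i e => exists x, t i e = x /\ P i x).
 - intros; split; [intros [x [-> h]]; auto|intros h; eauto].
 - apply (@d_ex _ _ _ _ _ (fun i e x => t i e = x /\ P i x)), d_and; auto.
Qed.
Lemma d_sub2 (P : I -> S -> S -> Prop) t u :
 dfn (fun i e => P i (e 0) (e 1)) -> dft t -> dft u -> dfn (fun i e => P i (t i e) (u i e)).
Proof.
 intros H K L. apply d_ext with (A := fun i e => exists x, t i e = x /\ exists y, u i e = y /\ P i x y).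
 - intros; split; [intros [x [-> [y [-> h]]]]; auto|intros h; eauto].
 - apply (@d_ex _ _ _ _ _ (fun i e x => t i e = x /\ exists y, u i e = y /\ P i x y)), d_and; auto.
  apply (@d_ex _ _ _ _ _ (fun i e y => u i (etl e) = y /\ P i (e 0) y)), d_and; auto.
  + apply (@d_ren (fun i e => u i (etl e) = e 0) (fun n => match n with 0 => 0 | Datatypes.S k => Datatypes.S (Datatypes.S k) end)) in L. exact L.
  + apply (@d_ren (fun i e => P i (e 0) (e 1)) (fun n => match n with 0 => 1 | _ => 0 end)) in H. exact H.
Qed.
Lemma d_mem t u : dft t -> dft u -> dfn (fun i e => t i e ∊ u i e).
Proof. apply (@d_sub2 (fun i x y => x ∊ y)), (d_vmem 0). Qed.
Lemma d_eq t u : dft t -> dft u -> dfn (fun i e => t i e = u i e).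
Proof. apply (@d_sub2 (fun i x y => x = y)), (d_veq 0). Qed.
Lemma d_U t : dft t -> dfn (fun i e => U i (t i e)).
Proof. apply d_sub1, d_vU. Qed.
Lemma d_E t u : dft t -> dft u -> dfn (fun i e => E i (t i e) (u i e)).
Proof. apply d_sub2, (d_vE 0). Qed.
Lemma d_subst_sat c : forall ts : nat -> I -> (nat -> S) -> S, (forall n, dft (ts n)) ->
 dfn (fun i e => sat (@smem S) (U i) (E i) c (fun n => ts n i e)).
Proof.
 assert (K : forall (ts : nat -> I -> (nat -> S) -> S) i e x, scons x (fun n => ts n i e) = fun n => (match n with 0 => fun i e => e 0 | Datatypes.S n => fun i e => ts n i (etl e) end) i (scons x e)).
 { intros; extensionality n; destruct n; reflexivity. }
 assert (K' : forall ts : nat -> I -> (nat -> S) -> S, (forall n, dft (ts n)) -> forall n, dft (match n with 0 => fun i e => e 0 | Datatypes.S n => fun i e => ts n i (etl e) end)).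
 { intros ts H [|n]; [apply ft_var|apply (@ft_ren (ts n) (fun k => Datatypes.S k)); auto]. }
 induction c; intros ts H; simpl.
 - apply d_mem; auto.
 - apply d_U; auto.
 - apply d_E; auto.
 - apply d_false.
 - apply d_imp; auto.
 - apply d_and; auto.
 - apply d_or; auto.
 - apply d_all. eapply d_ext; [|apply (IHc _ (K' ts H))]. intros i e; simpl. rewrite K, scons_eta. tauto.
 - apply d_ex. eapply d_ext; [|apply (IHc _ (K' ts H))]. intros i e; simpl. rewrite K, scons_eta. tauto.
Qed.
Lemma d_subst A (ts : nat -> I -> (nat -> S) -> S) : dfn A -> (forall n, dft (ts n)) -> dfn (fun i e => A i (fun n => ts n i e)).
Proof.
 intros [c [f C]] H.
 assert (K : forall i e, join (fun n => ts n i e) f = fun n => (if Nat.even n then ts (Nat.div2 n) else fun _ _ => f (Nat.div2 n)) i e).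
 { intros; extensionality n; unfold join; destruct (Nat.even n); auto. }
 apply d_ext with (A := fun i e => sat (@smem S) (U i) (E i) c (fun n => (if Nat.even n then ts (Nat.div2 n) else fun _ _ => f (Nat.div2 n)) i e)).
 { intros i e; rewrite <- K. symmetry; apply C. }
 apply d_subst_sat. intros n; destruct (Nat.even n); auto. apply ft_const.
Qed.
End Rules.

Fixpoint nofU (c : fm) : fm :=
 match c with
 | fU _ | fE _ _ => fbot
 | fimp a b => fimp (nofU a) (nofU b) | fand a b => fand (nofU a) (nofU b)
 | for_ a b => for_ (nofU a) (nofU b) | fall a => fall (nofU a) | fex a => fex (nofU a)
 | fmem i j => fmem i j | fbot => fbot
 end.
Lemma sat_nofU V (mem : V -> V -> Prop) U E c : forall e,
 sat mem (fun _ => False) (fun _ _ => False) c e <-> sat mem U E (nofU c) e.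
Proof.
 induction c; intros; simpl; try rewrite IHc1, IHc2; try tauto.
 - split; intros K x; apply IHc, K.
 - split; intros [x K]; exists x; eapply IHc, K.
Qed.
Lemma pure_lift V (mem : V -> V -> Prop) I (U : I -> V -> Prop) E (A : (nat -> V) -> Prop) :
 dfn mem (fun (_ : unit) _ => False) (fun _ _ _ => False) (fun _ e => A e) -> dfn mem U E (fun i e => A e).
Proof. intros [c [f C]]; exists (nofU c), f; intros i e; rewrite <- sat_nofU; apply (C tt). Qed.

Create HintDb dfn.
Ltac dfn1 := cbv beta delta [etl];
 lazymatch goal with
 | |- dfn _ _ _ (fun i e => False) => apply d_false
 | |- dfn _ _ _ (fun i e => (@?A i e) /\ (@?B i e)) => apply (@d_and _ _ _ _ _ A B)
 | |- dfn _ _ _ (fun i e => (@?A i e) \/ (@?B i e)) => apply (@d_or _ _ _ _ _ A B)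
 | |- dfn _ _ _ (fun i e => (@?A i e) <-> (@?B i e)) => apply (@d_iff _ _ _ _ _ A B)
 | |- dfn _ _ _ (fun i e => ~ (@?A i e)) => apply (@d_not _ _ _ _ A)
 | |- dfn _ _ _ (fun i e => exists x : _, @?B i e x) => apply (@d_ex _ _ _ _ _ B)
 | |- dfn _ _ _ (fun i e => @?t i e = @?u i e) => apply (@d_eq _ _ _ _ t u)
 | |- dfn _ _ _ (fun i e => smem (@?t i e) (@?u i e)) => apply (@d_mem _ _ _ _ t u)
 | |- dfn _ _ _ (fun i e => (@?A i e) -> (@?B i e)) => apply (@d_imp _ _ _ _ _ A B)
 | |- dfn _ _ _ (fun i e => forall x : _, @?B i e x) => apply (@d_all _ _ _ _ _ B)
 | |- dft _ _ _ (fun i e => e ?n) => apply (ft_var _ _ n)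
 | |- dft _ _ _ (fun i e => ?t i (fun n => e (@?r n))) => apply (@ft_ren _ _ _ _ t r); assumption
 end.
Ltac dfn3 := match goal with
 | |- dft _ _ _ (fun i e => ?x) => apply (ft_const _ _ x)
 | |- dfn _ _ _ (fun i e => ?P) => apply (d_prop _ _ P)
 end.
Ltac dfn2 := first [dfn3 | dfn1 | solve [assumption] | apply d_U | apply d_E].
Global Hint Extern 0 (dfn _ _ _ _) => dfn2 : dfn.
Global Hint Extern 0 (dft _ _ _ _) => dfn2 : dfn.
Definition d0 (S : SetM) (F : S -> S) := dftp (fun _ e => F (e 0)).
Ltac dfn_unfold := lazymatch goal with |- dfn ?m ?U ?E ?A =>
 let A' := constr:(fun i0__ e0__ => ltac:(let t := eval cbv beta in (A i0__ e0__) in let t := eval red in t in exact t)) in change (dfn m U E A'); cbv beta end.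
Global Hint Extern 10 (dfn _ _ _ _) => dfn_unfold : dfn.
Ltac d_by H f := first [refine (@d_subst _ _ _ _ _ f H _) | refine (@d_subst _ _ _ _ _ f (pure_lift _ _ H) _)]; intros [|[|[|]]].
Global Hint Extern 2 (dfn _ _ _ (fun i e => ?R (@?t i e) (@?u i e))) =>
 match goal with H : dfn _ _ _ (fun i e => R (e 0) (e 1)) |- _ => d_by H (fun n => match n with 0 => t | _ => u end) end : dfn.
Global Hint Extern 2 (dfn _ _ _ (fun i e => ?R i (@?t i e) (@?u i e))) =>
 match goal with H : dfn _ _ _ (fun i e => R i (e 0) (e 1)) |- _ => d_by H (fun n => match n with 0 => t | _ => u end) end : dfn.
Global Hint Extern 2 (dfn _ _ _ (fun i e => ?R (@?t i e) (@?u i e) (@?v i e))) =>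
 match goal with H : dfn _ _ _ (fun i e => R (e 0) (e 1) (e 2)) |- _ => d_by H (fun n => match n with 0 => t | 1 => u | _ => v end) end : dfn.
Ltac dfn := unfold dfn0, d0; cbv beta delta [etl]; auto 300 with dfn nocore.

Lemma ft_spec (S : SetM) I (U : I -> S -> Prop) E t (Q : I -> (nat -> S) -> S -> Prop) :
 (forall i e y, t i e = y <-> Q i e y) -> dfns U E (fun i e => Q i (etl e) (e 0)) ->
 dfts U E t.
Proof. intros H; apply d_ext; intros; symmetry; apply H. Qed.

Lemma ft_set (S : SetM) I (U : I -> S -> Prop) E t (Q : I -> (nat -> S) -> S -> Prop) :
 (forall i e x, x ∊ t i e <-> Q i e x) -> dfns U E (fun i e => Q i (etl e) (e 0)) -> dfts U E t.
Proof.
 intros H D. apply ft_spec with (Q := fun i e y => forall x, x ∊ y <-> Q i e x).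
 - intros i e y. split; [intros <- x; apply H|]. intros K. apply (s_ext (s := S)). intros x. rewrite H, K. tauto.
 - apply (@d_all _ _ _ _ _ (fun i e x => x ∊ e 0 <-> Q i (etl e) x)), d_iff; [dfn|].
  exact (d_ren (fun n => match n with 0 => 0 | Datatypes.S k => Datatypes.S (Datatypes.S k) end) D).
Qed.

(** * Sets, ordinals and cardinals in a model *)

Section Basics.
Variable S : SetM.
Implicit Types x y z a b u v w f g n m : S.

Definition the (P : S -> Prop) : S := epsilon (s_inh S) P.
Lemma the_spec (P : S -> Prop) : (exists x, P x) -> P (the P).
Proof. apply epsilon_spec. Qed.

Lemma sext x y : (forall z, z ∊ x <-> z ∊ y) -> x = y.
Proof. apply s_ext. Qed.

Definition Sub x y := forall z, z ∊ x -> z ∊ y.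
Lemma Sub_antisym x y : Sub x y -> Sub y x -> x = y.
Proof. intros; apply sext; split; auto. Qed.

Definition up x y := the (fun z => forall w, w ∊ z <-> w = x \/ w = y).
Lemma in_up x y w : w ∊ up x y <-> w = x \/ w = y.
Proof. revert w; apply (the_spec (s_pair x y)). Qed.
Definition Un a := the (fun u => forall x, x ∊ u <-> exists y, y ∊ a /\ x ∊ y).
Lemma in_Un a x : x ∊ Un a <-> exists y, y ∊ a /\ x ∊ y.
Proof. revert x; apply (the_spec (s_union a)). Qed.
Definition Pw a := the (fun u => forall x, x ∊ u <-> Sub x a).
Lemma in_Pw a x : x ∊ Pw a <-> Sub x a.
Proof. revert x; apply (the_spec (s_power a)). Qed.
Definition sep a (P : S -> Prop) := the (fun b => forall x, x ∊ b <-> x ∊ a /\ P x).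
Lemma in_sep a (P : S -> Prop) x : dfn0 (@smem S) P -> x ∊ sep a P <-> x ∊ a /\ P x.
Proof. intros H; revert x; apply (the_spec (s_sep H a)). Qed.
Definition em := the (fun x => forall z, ~ z ∊ x).
Lemma in_em z : ~ z ∊ em.
Proof.
 revert z. apply (the_spec (P := fun x => forall z, ~ z ∊ x)).
 destruct (s_inf S) as [w [[x [_ H]] _]]; eauto.
Qed.
Definition sg x := up x x.
Lemma in_sg x z : z ∊ sg x <-> z = x.
Proof. unfold sg; rewrite in_up; tauto. Qed.
Definition cup x y := Un (up x y).
Lemma in_cup x y z : z ∊ cup x y <-> z ∊ x \/ z ∊ y.
Proof.
 unfold cup; rewrite in_Un; split.
 - intros [u [H K]]; apply in_up in H; destruct H; subst; auto.
 - intros [H|H]; [exists x|exists y]; rewrite in_up; auto.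
Qed.
Definition adj x y := cup x (sg y).
Lemma in_adj x y z : z ∊ adj x y <-> z ∊ x \/ z = y.
Proof. unfold adj; rewrite in_cup, in_sg; tauto. Qed.
Definition sc x := adj x x.
Lemma in_sc x z : z ∊ sc x <-> z ∊ x \/ z = x.
Proof. apply in_adj. Qed.

Definition op x y := up (sg x) (up x y).
Lemma sg_inj x y : sg x = sg y -> x = y.
Proof. intros H; apply in_sg; rewrite <- H; apply in_sg; auto. Qed.
Lemma op_inj x y x' y' : op x y = op x' y' <-> x = x' /\ y = y'.
Proof.
 split; [|intros [-> ->]; auto]. intros H.
 assert (A : forall z, z ∊ op x y <-> z ∊ op x' y') by (rewrite H; tauto).
 unfold op in A. setoid_rewrite in_up in A.
 assert (X : x = x').
 { destruct (proj1 (A (sg x)) (or_introl eq_refl)) as [B|B]; [apply sg_inj; auto|].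
  assert (K : x' ∊ sg x) by (rewrite B, in_up; auto). apply in_sg in K; auto. }
 subst x'; split; auto.
 assert (P : forall u v, up x u = up x v -> u = v \/ (u = x /\ v = x) \/ v = u).
 { intros u v B. assert (C : u ∊ up x v) by (rewrite <- B, in_up; auto).
  assert (D : v ∊ up x u) by (rewrite B, in_up; auto). rewrite in_up in C, D.
  destruct C; destruct D; subst; auto. }
 destruct (proj1 (A (up x y)) (or_intror eq_refl)) as [B|B].
 - assert (K : y ∊ sg x) by (rewrite <- B, in_up; auto). apply in_sg in K; subst y.
  destruct (proj2 (A (up x y')) (or_intror eq_refl)) as [C|C].
  + assert (K : y' ∊ sg x) by (rewrite <- C, in_up; auto). apply in_sg in K; auto.
  + assert (K : y' ∊ up x x) by (rewrite <- C, in_up; auto). apply in_sg in K; auto.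
 - destruct (P _ _ B) as [|[[]|]]; congruence.
Qed.
Lemma op_inj2 x y x' y' : op x y = op x' y' -> y = y'.
Proof. intros H; apply op_inj in H; tauto. Qed.

End Basics.
Arguments em {S}.
Ltac opi := repeat match goal with H : op _ _ = op _ _ |- _ => apply op_inj in H as [? ?] end; subst.

Section BasicD.
Variables (S : SetM) (I : Type) (U : I -> S -> Prop) (E : I -> S -> S -> Prop).
Notation dfn := (dfn (@smem S) U E).
Notation dft := (dft (@smem S) U E).
Lemma ft_up t u : dft t -> dft u -> dft (fun i e => up (t i e) (u i e)).
Proof.
 intros; eapply ft_set; [intros; apply in_up|dfn].
Qed.
Lemma ft_Un t : dft t -> dft (fun i e => Un (t i e)).
Proof.
 intros; eapply ft_set; [intros; apply in_Un|dfn].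
Qed.
Lemma ft_Pw t : dft t -> dft (fun i e => Pw (t i e)).
Proof.
 intros; eapply ft_set; [intros; apply in_Pw|dfn].
Qed.
End BasicD.
Global Hint Resolve ft_up ft_Un ft_Pw : dfn.

Lemma ft_sep (S : SetM) I (U : I -> S -> Prop) E t (P : I -> (nat -> S) -> S -> Prop) : dfts U E t ->
 dfns U E (fun i e => P i (etl e) (e 0)) -> (forall i e, dfn0 (@smem S) (P i e)) -> dfts U E (fun i e => sep (t i e) (P i e)).
Proof. intros. eapply ft_set; [intros; apply in_sep; auto|dfn]. Qed.
Global Hint Extern 0 (dft _ _ _ (fun i e => sep (@?t i e) (@?P i e))) => apply (@ft_sep _ _ _ _ t P) : dfn.
Global Hint Extern 0 (dft _ _ _ (fun i e => sep (@?t i e) (fun x => @?P i e x))) => apply (@ft_sep _ _ _ _ t P) : dfn.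
Ltac dft_unfold := lazymatch goal with |- dft ?m ?U ?E ?t =>
 let t' := constr:(fun i0__ e0__ => ltac:(let r := eval cbv beta in (t i0__ e0__) in let r := eval red in r in
  lazymatch r with the _ => fail | epsilon _ _ => fail | _ => exact r end)) in change (dft m U E t'); cbv beta end.
Global Hint Extern 10 (dft _ _ _ _) => dft_unfold : dfn.
Global Hint Extern 0 (dfn0 _ _) => unfold dfn0 : dfn.
Ltac sepd := rewrite in_sep by (dfn).
Tactic Notation "sepd" "in" hyp(H) := rewrite in_sep in H by (dfn).

Section Fun.
Variable S : SetM.
Implicit Types x y z a b c u v w f g n m : S.

Definition prod a b := sep (Pw (Pw (cup a b))) (fun u => exists x y, x ∊ a /\ y ∊ b /\ u = op x y).
Lemma in_prod a b u : u ∊ prod a b <-> exists x y, x ∊ a /\ y ∊ b /\ u = op x y.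
Proof.
 unfold prod; sepd; split; [tauto|]. intros H; split; auto.
 destruct H as [x [y [X [Y ->]]]]. apply in_Pw; intros v V; apply in_up in V.
 apply in_Pw; intros w W. apply in_cup. destruct V; subst v.
 - apply in_sg in W; subst; auto.
 - apply in_up in W; destruct W; subst; auto.
Qed.
Lemma op_prod a b x y : op x y ∊ prod a b <-> x ∊ a /\ y ∊ b.
Proof.
 rewrite in_prod; split; [|intros []; eauto]. intros [x' [y' [X [Y H]]]].
 apply op_inj in H; destruct H; subst; auto.
Qed.

Definition rel a b (R : S -> S -> Prop) := sep (prod a b) (fun u => exists x y, u = op x y /\ R x y).
Lemma op_rel a b (R : S -> S -> Prop) x y : dfnp (fun _ e => R (e 0) (e 1)) ->
 op x y ∊ rel a b R <-> x ∊ a /\ y ∊ b /\ R x y.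
Proof.
 intros D. unfold rel. sepd. rewrite op_prod. split; [intros [H [x' [y' [E K]]]]; opi; tauto|].
 intros [X [Y K]]. split; eauto.
Qed.

Definition isfun f a b := Sub f (prod a b) /\ (forall x, x ∊ a -> exists y, op x y ∊ f) /\
 (forall x y y', op x y ∊ f -> op x y' ∊ f -> y = y').
(* The union makes [app f x] definable without a case distinction: it is [em] when [x] has no value. *)
Definition app f x := Un (sep (Un (Un f)) (fun y => op x y ∊ f)).
Lemma in_app f x z : z ∊ app f x <-> exists y, op x y ∊ f /\ z ∊ y.
Proof.
 unfold app; rewrite in_Un. split; intros [y [Y Z]]; exists y; [sepd in Y; tauto|].
 sepd; repeat split; auto. apply in_Un; exists (up x y); rewrite in_up, in_Un; split; auto.
 exists (op x y); split; auto. apply in_up; auto.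
Qed.
Lemma app_eq f a b x y : isfun f a b -> op x y ∊ f -> app f x = y.
Proof.
 intros [_ [_ H]] X. apply sext; intros z; rewrite in_app; split; [|eauto].
 intros [y' [Y Z]]. rewrite (H x y y'); auto.
Qed.
Lemma app_in f a b x : isfun f a b -> x ∊ a -> op x (app f x) ∊ f.
Proof. intros F X. destruct (proj1 (proj2 F) x X) as [y Y]. rewrite (app_eq F Y); auto. Qed.
Lemma fun_dom f a b x y : isfun f a b -> op x y ∊ f -> x ∊ a.
Proof. intros [H _] X; apply H, op_prod in X; tauto. Qed.
Lemma fun_cod f a b x y : isfun f a b -> op x y ∊ f -> y ∊ b.
Proof. intros [H _] X; apply H, op_prod in X; tauto. Qed.
Lemma app_cod f a b x : isfun f a b -> x ∊ a -> app f x ∊ b.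
Proof. intros H X; eapply fun_cod; eauto using app_in. Qed.
Lemma app_iff f a b x y : isfun f a b -> x ∊ a -> (op x y ∊ f <-> y = app f x).
Proof. intros H X; split; [intros; symmetry; eapply app_eq; eauto|intros ->; eapply app_in; eauto]. Qed.
Lemma fun_ext f g a b c : isfun f a b -> isfun g a c -> (forall x, x ∊ a -> app f x = app g x) -> f = g.
Proof.
 intros F G H; apply sext; intros u; split; intros X.
 - destruct (proj1 (in_prod _ _ _) (proj1 F _ X)) as [x [y [A [B ->]]]].
  rewrite (app_iff _ G A), <- H by auto. symmetry; eapply app_eq; eauto.
 - destruct (proj1 (in_prod _ _ _) (proj1 G _ X)) as [x [y [A [B ->]]]].
  rewrite (app_iff _ F A), H by auto. symmetry; eapply app_eq; eauto.
Qed.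

Definition lam a b (F : S -> S) := sep (prod a b) (fun u => exists x, u = op x (F x)).
Lemma d0_use F I (U : I -> S -> Prop) E t : d0 F -> dfts U E t -> dfts U E (fun i e => F (t i e)).
Proof.
 intros D T. apply ft_spec with (Q := fun i e y => exists x, t i e = x /\ F x = y).
 { intros; split; [eauto|intros [x [<- ?]]; auto]. }
 apply (@d_ex _ _ _ _ _ (fun i e x => t i (etl e) = x /\ F x = e 0)), d_and.
 - apply d_eq; [|apply ft_var]. apply (@ft_ren _ _ _ _ t (fun k : nat => Datatypes.S (Datatypes.S k))); auto.
 - apply (@d_ren S I U E (fun i e => F (e 1) = e 0) (fun k : nat => match k with 0 => 1 | 1 => 0 | k => k end)).
  exact (pure_lift U E D).
Qed.
End Fun.
Global Hint Extern 2 (dft _ _ _ (fun i e => ?F _)) => match goal with H : d0 F |- _ => apply (d0_use H) end : dfn.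
Section Fun2.
Variable S : SetM.
Implicit Types x y z a b c u v w f g n m : S.
Lemma lam_fun a b (F : S -> S) : d0 F -> (forall x, x ∊ a -> F x ∊ b) -> isfun (lam a b F) a b.
Proof.
 intros D H. split; [|split]; unfold lam.
 - intros u Hu. sepd in Hu. tauto.
 - intros x X; exists (F x). sepd. rewrite op_prod; eauto.
 - intros x y y'. do 2 sepd. intros [_ [x1 A]] [_ [x2 B]].
  apply op_inj in A; apply op_inj in B; destruct A, B; congruence.
Qed.
Lemma app_lam a b (F : S -> S) x : d0 F -> (forall x, x ∊ a -> F x ∊ b) -> x ∊ a -> app (lam a b F) x = F x.
Proof.
 intros D H X. eapply app_eq; [apply lam_fun; auto|]. unfold lam; sepd; rewrite op_prod; eauto.
Qed.
End Fun2.
Tactic Notation "defset" ident(B) ident(H) constr(t) := set (B := t);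
 lazymatch t with
 | rel ?a ?b ?R => assert (H : forall x y, op x y ∊ B <-> x ∊ a /\ y ∊ b /\ R x y) by (intros; apply op_rel; dfn)
 | sep ?a ?P => assert (H : forall x, x ∊ B <-> x ∊ a /\ P x) by (intros; apply in_sep; dfn)
 end; cbv beta in H.

Section Ordinals.
Variable S : SetM.
Implicit Types x y z a b c u v w f g n m k : S.

(** The form in which well-foundedness is used: a counterexample in a set yields a minimal one. It
    is kept as a property of P because it has two sources, foundation for predicates definable in
    the model and [gen_IndOk] for those definable from a generic filter. *)
Definition Min (P : S -> Prop) := forall a x, x ∊ a -> ~ P x ->
 exists m, m ∊ a /\ ~ P m /\ forall z, z ∊ m -> z ∊ a -> P z.
Lemma Min_d P : dfn0 (@smem S) P -> Min P.
Proof.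
 intros D a x X N. destruct (@s_found S (sep a (fun z => ~ P z)) x) as [m [M K]].
 { rewrite in_sep; auto. apply d_not; auto. }
 assert (D' : dfn0 (@smem S) (fun z => ~ P z)) by (apply d_not; auto).
 rewrite in_sep in M by auto. exists m; split; [tauto|split; [tauto|]].
 intros z Z A. contra B; apply (K z Z); rewrite in_sep; auto.
Qed.

Lemma nin x : ~ x ∊ x.
Proof.
 intros H. destruct (@s_found S (sg x) x) as [m [M K]]; [apply in_sg; auto|].
 apply in_sg in M; subst m. apply (K x H), in_sg; auto.
Qed.
Lemma nin2 x y : x ∊ y -> ~ y ∊ x.
Proof.
 intros H H'. destruct (@s_found S (up x y) x) as [m [M K]]; [apply in_up; auto|].
 apply in_up in M; destruct M; subst m; [apply (K y)|apply (K x)]; auto; apply in_up; auto.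
Qed.

Definition trans x := forall y, y ∊ x -> Sub y x.
Definition Ord x := trans x /\ forall y, y ∊ x -> trans y.
Lemma Ord_in x y : Ord x -> y ∊ x -> Ord y.
Proof. intros [A B] H; split; auto. intros z Z; apply B, (A y H), Z. Qed.
Lemma Ord_tr x y z : Ord z -> x ∊ y -> y ∊ z -> x ∊ z.
Proof. intros [A _] H K; apply (A y K), H. Qed.

(** A double minimal counterexample: x is least among those not comparable with everything up to b,
    then y is least not comparable with x. Minimality makes each of them a subset of the other. *)
Lemma Ord_tri a b : Ord a -> Ord b -> a ∊ b \/ a = b \/ b ∊ a.
Proof.
 intros OA OB. contra N.
 set (cmp := fun x y => x ∊ y \/ x = y \/ y ∊ x).
 destruct (@Min_d (fun x => forall y, y ∊ sc b -> cmp x y)) with (a := sc a) (x := a) as [x [X [NX MX]]].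
 { dfn. }
 { apply in_sc; auto. }
 { intros H; apply N, H, in_sc; auto. }
 apply not_all_ex_not in NX as [y NX]; apply imply_to_and in NX as [Y NX].
 destruct (@Min_d (cmp x)) with (a := sc b) (x := y) as [y' [Y' [NY MY]]]; auto.
 { dfn. }
 assert (OX : Ord x) by (apply in_sc in X; destruct X; subst; auto; apply (Ord_in OA); auto).
 assert (OY : Ord y') by (apply in_sc in Y'; destruct Y'; subst; auto; apply (Ord_in OB); auto).
 apply NY; right; left; apply sext; intros z; split; intros Z.
 - destruct (MX z Z) with (y := y') as [|[|]]; auto.
  + apply in_sc; left; apply in_sc in X; destruct X; subst; auto; eapply Ord_tr; eauto.
  + subst; exfalso; apply NY; red; auto.
  + exfalso; apply NY; right; right; eapply Ord_tr; eauto.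
 - destruct (MY z Z) as [|[|]]; auto.
  + apply in_sc; left; apply in_sc in Y'; destruct Y'; subst; auto; eapply Ord_tr; eauto.
  + exfalso; apply NY; left; eapply Ord_tr; eauto.
  + subst; exfalso; apply NY; red; auto.
Qed.
Lemma Ord_le x y : Ord x -> Ord y -> (Sub x y <-> x ∊ y \/ x = y).
Proof.
 intros X Y; split.
 - intros H. destruct (Ord_tri X Y) as [|[|K]]; auto. destruct (nin (H _ K)).
 - intros [H| ->]; [apply (proj1 Y); auto|intros z; auto].
Qed.
Lemma Ord_nle x y : Ord x -> Ord y -> ~ Sub x y -> y ∊ x.
Proof. intros X Y H. rewrite Ord_le in H by auto. destruct (Ord_tri X Y) as [|[|]]; tauto. Qed.
Lemma Ord_total x y : Ord x -> Ord y -> Sub x y \/ Sub y x.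
Proof. intros X Y. rewrite !Ord_le by auto. destruct (Ord_tri X Y) as [|[|]]; auto. Qed.
Lemma Ord_le_lt x y z : Ord x -> Ord z -> Sub x y -> y ∊ z -> x ∊ z.
Proof.
 intros X Z H K. apply (Ord_le X (Ord_in Z K)) in H. destruct H; subst; auto. eapply Ord_tr; eauto.
Qed.
Lemma Ord_sc x : Ord x -> Ord (sc x).
Proof.
 intros [A B]; split; intros y Y; apply in_sc in Y.
 - intros z Z; apply in_sc; left; destruct Y as [Y| ->]; [exact (A y Y z Z)|exact Z].
 - destruct Y as [Y| ->]; auto.
Qed.
Lemma sc_in x : x ∊ sc x.
Proof. apply in_sc; auto. Qed.
Lemma Ord_em : Ord (@em S).
Proof. split; intros y Y; destruct (in_em Y). Qed.
Lemma Ord_sc_le x y : Ord x -> Ord y -> (x ∊ y <-> Sub (sc x) y).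
Proof.
 intros X Y; split.
 - intros H z Z; apply in_sc in Z; destruct Z; subst; auto; eapply Ord_tr; eauto.
 - intros H; apply H, sc_in.
Qed.
Lemma Ord_Un a : (forall x, x ∊ a -> Ord x) -> Ord (Un a).
Proof.
 intros H; split; intros y [x [X Y]]%in_Un.
 - intros z Z; apply in_Un; exists x; split; auto. exact (proj1 (H x X) y Y z Z).
 - exact (proj2 (H x X) y Y).
Qed.
Lemma sc_inj x y : sc x = sc y -> x = y.
Proof.
 intros H. assert (A : x ∊ sc y) by (rewrite <- H; apply sc_in). assert (B : y ∊ sc x) by (rewrite H; apply sc_in).
 apply in_sc in A; apply in_sc in B. destruct A; auto. destruct B; auto. destruct (nin2 H0 H1).
Qed.

Definition isnat n := Ord n /\ forall m, m ∊ n \/ m = n -> m = em \/ exists k, m = sc k.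
Lemma isnat_in n m : isnat n -> m ∊ n -> isnat m.
Proof.
 intros [A B] H; split; [eapply Ord_in; eauto|]. intros k [K| ->]; apply B; auto.
 left; eapply Ord_tr; eauto.
Qed.
Lemma isnat_0 : isnat em.
Proof. split; [apply Ord_em|]. intros m [H| ->]; auto. destruct (in_em H). Qed.
Lemma isnat_S n : isnat n -> isnat (sc n).
Proof.
 intros [A B]; split; [apply Ord_sc; auto|]. intros m [H| ->]; eauto. apply in_sc in H; auto.
Qed.
Definition ind_set := the (fun w : S => (exists x, x ∊ w /\ forall z, ~ z ∊ x) /\
  forall x, x ∊ w -> exists y, y ∊ w /\ forall z, z ∊ y <-> z ∊ x \/ z = x).
Definition om := sep ind_set isnat.
(** The inductive set provided by infinity may be too large, so it is cut down by [isnat].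
    Conversely, a least natural number outside it would be neither empty nor a successor. *)
Lemma in_om n : n ∊ om <-> isnat n.
Proof.
 unfold om; sepd; split; [tauto|]. intros H; split; auto.
 destruct (the_spec (s_inf S)) as [A B]. fold ind_set in A, B. contra N.
 destruct (@Min_d (fun x => isnat x -> x ∊ ind_set)) with (a := sc n) (x := n) as [m [M [NM K]]].
 { dfn. } { apply sc_in. } { auto. }
 apply imply_to_and in NM as [IM NM]. destruct (proj2 IM m) as [->|[k ->]]; auto.
 - destruct A as [x [X Y]]. replace em with x in NM; auto. apply sext; intros z; split; intros Z; [destruct (Y z Z)|destruct (in_em Z)].
 - assert (KK : k ∊ ind_set).
  { apply K; [apply sc_in| |apply (isnat_in IM), sc_in].
   apply in_sc; left. apply in_sc in M as [M|<-]; [|apply sc_in].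
   apply (Ord_tr (y := sc k)); auto using sc_in. apply H. }
  destruct (B k KK) as [y [Y Y']]. apply NM. replace (sc k) with y; auto.
  apply sext; intros z; rewrite Y', in_sc; tauto.
Qed.
Lemma om_0 : em ∊ om.
Proof. apply in_om, isnat_0. Qed.
Lemma om_S n : n ∊ om -> sc n ∊ om.
Proof. rewrite !in_om; apply isnat_S. Qed.
Lemma om_tr n m : n ∊ om -> m ∊ n -> m ∊ om.
Proof. rewrite !in_om; apply isnat_in. Qed.
Lemma om_ord n : n ∊ om -> Ord n.
Proof. rewrite in_om; intros [H _]; auto. Qed.
Lemma Ord_om : Ord om.
Proof. split; [intros n H m; apply om_tr; auto|intros n H; exact (proj1 (om_ord H))]. Qed.
Lemma om_case n : n ∊ om -> n = em \/ exists k, k ∊ om /\ n = sc k.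
Proof.
 intros H; destruct (proj2 (proj1 (in_om n) H) n) as [->|[k ->]]; auto.
 right; exists k; split; auto. apply (om_tr H), sc_in.
Qed.
Lemma om_ind P : Min P -> P em -> (forall n, n ∊ om -> P n -> P (sc n)) -> forall n, n ∊ om -> P n.
Proof.
 intros M H0 HS n N. contra K. destruct (M om n N K) as [m [A [B C]]].
 destruct (om_case A) as [->|[k [D ->]]]; auto. apply B, HS; auto. apply C; auto using sc_in.
Qed.
Lemma ord_ind P a : Ord a -> Min P -> (forall x, x ∊ a -> (forall y, y ∊ x -> P y) -> P x) -> forall x, x ∊ a -> P x.
Proof.
 intros A M H x X. contra K. destruct (M a x X K) as [m [B [C D]]].
 apply C, H; auto. intros y Y; apply D; auto. eapply Ord_tr; eauto.
Qed.
Lemma om_lt_S n m : n ∊ om -> m ∊ om -> (n ∊ sc m <-> Sub n m).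
Proof. intros N M; rewrite in_sc, Ord_le by (apply om_ord; auto); tauto. Qed.
Lemma om_0_le n : Sub em n.
Proof. intros z Z; destruct (in_em Z). Qed.
Lemma Sub_refl x : Sub x x.
Proof. intros z; auto. Qed.
Lemma Sub_trans x y z : Sub x y -> Sub y z -> Sub x z.
Proof. intros A B w W; auto. Qed.
Lemma om_max n m : n ∊ om -> m ∊ om -> exists k, k ∊ om /\ Sub n k /\ Sub m k.
Proof.
 intros N M. destruct (Ord_total (om_ord N) (om_ord M)); [exists m|exists n]; auto using Sub_refl.
Qed.
End Ordinals.
Arguments om {S}.

(** * Transfinite recursion along an ordinal *)

Section OrdRec.
Variable S : SetM.
Implicit Types x y z a b c u v w f g n m k : S.
Definition rst f B := sep f (fun u : S => exists x y, u = op x y /\ x ∊ B).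
Lemma in_rst f B u : u ∊ rst f B <-> u ∊ f /\ exists x y, u = op x y /\ x ∊ B.
Proof. unfold rst; sepd; tauto. Qed.
Lemma op_rst f B x y : op x y ∊ rst f B <-> op x y ∊ f /\ x ∊ B.
Proof.
 rewrite in_rst; split; intros [H K]; split; auto; [|eauto].
 destruct K as [x' [y' [K L]]]; opi; auto.
Qed.
Lemma rst_fun f a b B : isfun f a b -> Sub B a -> isfun (rst f B) B b.
Proof.
 intros F H; split; [|split].
 - intros u [X [x [y [-> Y]]]]%in_rst.
  apply op_prod; split; auto. eapply fun_cod; eauto.
 - intros x X. exists (app f x). apply op_rst; split; auto. eapply app_in; eauto.
 - intros x y y' A B'. apply op_rst in A; apply op_rst in B'. apply (proj2 (proj2 F) x); tauto.
Qed.
Lemma app_rst f a b B x : isfun f a b -> Sub B a -> x ∊ B -> app (rst f B) x = app f x.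
Proof.
 intros F H X. eapply app_eq; [eapply rst_fun; eauto|]. apply op_rst; split; auto. eapply app_in; eauto.
Qed.

Variables (k Y : S) (L : S -> S -> S -> Prop).
Hypothesis Ok : Ord k.
Hypothesis DL : dfnp (fun _ e => L (e 0) (e 1) (e 2)).
Hypothesis LU : forall a f y y', L a f y -> L a f y' -> y = y'.
Hypothesis LE : forall a f, a ∊ k -> isfun f a Y -> exists y, y ∊ Y /\ L a f y.

Definition appr a f := isfun f a Y /\ forall b, b ∊ a -> L b (rst f b) (app f b).
Lemma appr_agree a a' f f' : Ord a -> Ord a' -> appr a f -> appr a' f' -> forall b, b ∊ a -> b ∊ a' -> app f b = app f' b.
Proof.
 intros O O' [F H] [F' H']. apply (@ord_ind S (fun b => b ∊ a' -> app f b = app f' b)); [auto|apply Min_d; dfn|].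
 intros b B IH B'. apply (LU (H b B)). replace (rst f b) with (rst f' b); [auto|].
 assert (Sb := proj1 O b B). assert (Sb' := proj1 O' b B').
 apply (fun_ext (rst_fun F' Sb') (rst_fun F Sb)). intros c C. rewrite (app_rst F' Sb' C), (app_rst F Sb C). symmetry; auto.
Qed.
(** The values are confined to a set Y, so that F is cut out of a product by separation alone; the
    recursion can thus be run in the extensions too. *)
Lemma ord_rec : exists F, isfun F k Y /\ forall a, a ∊ k -> L a (rst F a) (app F a).
Proof.
 apply (@ord_ind S (fun a => exists f, appr a f) (sc k)); [apply Ord_sc, Ok|apply Min_d; dfn| |apply sc_in].
 intros a A IH. assert (Oa : Ord a) by (apply (Ord_in (Ord_sc Ok) A)).
 assert (AK : forall b, b ∊ a -> b ∊ k) by (intros b B; apply in_sc in A as [A| ->]; [apply (Ord_tr Ok B A)|auto]).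
 set (R := fun b y => exists f, appr b f /\ L b f y). set (F := sep (prod a Y) (fun u => exists b y, u = op b y /\ R b y)).
 assert (HF : forall b y, op b y ∊ F <-> (b ∊ a /\ y ∊ Y) /\ R b y).
 { intros b y. unfold F. sepd. rewrite op_prod. split; intros [B C]; split; eauto. destruct C as [b' [y' [E C]]]. opi; auto. }
 assert (AE : forall b f f', b ∊ a -> appr b f -> appr b f' -> f = f').
 { intros b f f' B H H'. assert (Ob := Ord_in Oa B). apply (fun_ext (proj1 H) (proj1 H')). intros c C. apply (appr_agree Ob Ob H H'); auto. }
 assert (IF : isfun F a Y).
 { split; [intros u U; unfold F in U; sepd in U; tauto|split].
  - intros b B. destruct (IH b B) as [f H]. destruct (LE (AK b B) (proj1 H)) as [y [Hy K]]. exists y. apply HF. unfold R; eauto.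
  - intros b y y' [[B _] [f [H K]]]%HF [_ [f' [H' K']]]%HF. rewrite (AE b f' f B H' H) in K'. apply (LU K K'). }
 exists F. split; auto. intros b B. destruct (IH b B) as [f H]. assert (Sb := proj1 Oa b B).
 assert (K := app_in IF B). apply HF in K as [_ [f' [H' K]]]. replace (rst F b) with f'; auto.
 apply (fun_ext (proj1 H') (rst_fun IF Sb)). intros c C. rewrite (app_rst IF Sb C). symmetry. apply (app_eq IF), HF.
 split; [split; [auto|apply (app_cod (proj1 H') C)]|]. exists (rst f' c). split; [|apply H'; auto].
 assert (Sc := proj1 (Ord_in Oa B) c C). split; [apply (rst_fun (proj1 H') Sc)|]. intros e Ee. rewrite (app_rst (proj1 H') Sc Ee).
 replace (rst (rst f' c) e) with (rst f' e); [apply (proj2 H'); auto|]. apply sext; intros u. rewrite !in_rst. split; [|tauto].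
 intros [U [x [y [-> X]]]]. repeat split; eauto. do 2 eexists; split; eauto. exact (proj1 (Ord_in (Ord_in Oa B) C) e Ee x X).
Qed.
End OrdRec.

Section Pi.
Variable S : SetM.
Implicit Types x y z a b c v w f g h m k : S.
Definition pr1 v := Un (sep (Un v) (fun a => exists b, v = op a b)).
Definition pr2 v := Un (sep (Un v) (fun b => exists a, v = op a b)).
Lemma in_pr1 v z : z ∊ pr1 v <-> exists a b, v = op a b /\ z ∊ a.
Proof.
 unfold pr1; rewrite in_Un; split.
 - intros [a [A Z]]; sepd in A. destruct A as [_ [b B]]; eauto.
 - intros [a [b [-> Z]]]; exists a; split; auto; sepd. split; eauto.
  apply in_Un; exists (up a b); unfold op; rewrite !in_up; auto.
Qed.
Lemma in_pr2 v z : z ∊ pr2 v <-> exists a b, v = op a b /\ z ∊ b.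
Proof.
 unfold pr2; rewrite in_Un; split.
 - intros [a [A Z]]; sepd in A. destruct A as [_ [b B]]; eauto.
 - intros [a [b [-> Z]]]; exists b; split; auto; sepd. split; eauto.
  apply in_Un; exists (up a b); unfold op; rewrite !in_up; auto.
Qed.
Lemma pr1_op x y : pr1 (op x y) = x.
Proof.
 apply sext; intros z; rewrite in_pr1; split; [|eauto]. intros [a [b [E Z]]]; opi; auto.
Qed.
Lemma pr2_op x y : pr2 (op x y) = y.
Proof.
 apply sext; intros z; rewrite in_pr2; split; [|eauto]. intros [a [b [E Z]]]; opi; auto.
Qed.
End Pi.

(** * Injections and countable sets *)

Section Card.
Variable S : SetM.
Implicit Types x y z a b c v w f g h n m k : S.

Definition Inj f a b := isfun f a b /\ forall x x' y, op x y ∊ f -> op x' y ∊ f -> x = x'.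
Definition emb a b := exists f, Inj f a b.
Definition ctb a := emb a om.
Definition fin a := exists n, n ∊ om /\ emb a n.
Definition ran f := sep (Un (Un f)) (fun y => exists x, op x y ∊ f).
Lemma in_ran f y : y ∊ ran f <-> exists x, op x y ∊ f.
Proof.
 unfold ran; sepd; split; [tauto|]. intros [x X]; split; eauto.
 apply in_Un; exists (up x y); split; [apply in_Un; exists (op x y); split; auto|]; apply in_up; auto.
Qed.
Lemma Inj_app f a b x x' : Inj f a b -> x ∊ a -> x' ∊ a -> app f x = app f x' -> x = x'.
Proof.
 intros [F H] X X' E. apply (H x x' (app f x)); [eapply app_in; eauto|rewrite E; eapply app_in; eauto].
Qed.
Lemma emb_lam a b (F : S -> S) : d0 F -> (forall x, x ∊ a -> F x ∊ b) ->
 (forall x x', x ∊ a -> x' ∊ a -> F x = F x' -> x = x') -> emb a b.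
Proof.
 intros D H K. exists (lam a b F); split; [apply lam_fun; auto|].
 intros x x' y X X'. pose proof (lam_fun D H) as L.
 assert (A : x ∊ a) by (eapply fun_dom; eauto). assert (A' : x' ∊ a) by (eapply fun_dom; eauto).
 rewrite (app_iff y L A) in X. rewrite (app_iff y L A') in X'. rewrite app_lam in X, X' by auto.
 apply K; congruence.
Qed.
Lemma emb_sub a b : Sub a b -> emb a b.
Proof. intros H; apply emb_lam with (F := fun x => x); auto. dfn. Qed.
Lemma emb_trans a b c : emb a b -> emb b c -> emb a c.
Proof.
 intros [f F] [g G]. apply emb_lam with (F := fun x => app g (app f x)).
 - dfn.
 - intros x X. eapply app_cod; [apply G|]. eapply app_cod; [apply F|auto].
 - intros x x' X X' E. apply (Inj_app F X X'). apply (Inj_app G); auto; eapply app_cod; try apply F; auto.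
Qed.
Lemma emb_Inj f a b : Inj f a b -> emb a b.
Proof. exists f; auto. Qed.

Lemma d_least P : dfn0 (@smem S) P -> (exists n, n ∊ om /\ P n) -> exists n, n ∊ om /\ P n /\ forall m, m ∊ n -> ~ P m.
Proof.
 intros D [n [N H]]. assert (D' : dfn0 (@smem S) (fun n => ~ P n)) by (apply d_not; auto).
 destruct (Min_d D' (a := om) (x := n)) as [m [M1 [M2 M3]]]; auto.
 exists m; split; auto; split; [apply NNPP; auto|]. intros z Z. apply M3; auto. eapply om_tr; eauto.
Qed.
Lemma d_least_ord P a : Ord a -> dfn0 (@smem S) P -> (exists n, n ∊ a /\ P n) -> exists n, n ∊ a /\ P n /\ forall m, m ∊ n -> ~ P m.
Proof.
 intros O D [n [N H]]. assert (D' : dfn0 (@smem S) (fun n => ~ P n)) by (apply d_not; auto).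
 destruct (Min_d D' (a := a) (x := n)) as [m [M1 [M2 M3]]]; auto.
 exists m; split; auto; split; [apply NNPP; auto|]. intros z Z. apply M3; auto. eapply Ord_tr; eauto.
Qed.

(** A point of b is sent to the least index of a preimage. The target being an ordinal, this
    selection costs no choice. *)
Lemma emb_img_ord a b o (F : S -> S) : Ord o -> d0 F -> emb a o -> (forall y, y ∊ b -> exists x, x ∊ a /\ F x = y) -> emb b o.
Proof.
 intros O D [f I] H.
 exists (sep (prod b o) (fun u => exists y n, u = op y n /\ (exists x, x ∊ a /\ F x = y /\ n = app f x) /\
  forall x, x ∊ a -> F x = y -> ~ app f x ∊ n)).
 assert (OF : forall x, x ∊ a -> app f x ∊ o) by (intros; eapply app_cod; eauto; apply I).
 split; [split; [|split]|].
 - intros u X; sepd in X; tauto.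
 - intros y Y. destruct (@d_least_ord (fun n => exists x, x ∊ a /\ F x = y /\ n = app f x) o O) as [n [N [K L]]].
  + dfn.
  + destruct (H y Y) as [x [X E]]. exists (app f x); split; eauto.
  + exists n. sepd. rewrite op_prod. split; auto. exists y, n; spl.
   intros x X E B. apply (L _ B); eauto.
 - intros y n n'. do 2 sepd. intros [_ [y1 [n1 [E1 [[x [X [FX ->]]] L]]]]] [_ [y2 [n2 [E2 [[x' [X' [FX' ->]]] L']]]]].
  opi.
  destruct (@Ord_tri S (app f x) (app f x')) as [T|[T|T]]; auto; try (apply (Ord_in O); auto; fail).
  + destruct (L' x X ltac:(congruence) T).
  + destruct (L x' X' ltac:(congruence) T).
 - intros y y' n. do 2 sepd. intros [_ [y1 [n1 [E1 [[x [X [FX ->]]] L]]]]] [_ [y2 [n2 [E2 [[x' [X' [FX' EE]]] L']]]]].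
  apply op_inj in E1; apply op_inj in E2. destruct E1 as [-> ->], E2 as [-> E2].
  rewrite <- FX, <- FX'. f_equal. apply (Inj_app I X X'); congruence.
Qed.
Lemma ctb_img a b (F : S -> S) : d0 F -> ctb a -> (forall y, y ∊ b -> exists x, x ∊ a /\ F x = y) -> ctb b.
Proof. intros D A H. exact (emb_img_ord (@Ord_om S) D A H). Qed.
Lemma ctb_sub a b : Sub a b -> ctb b -> ctb a.
Proof. intros H K; exact (emb_trans (emb_sub H) K). Qed.
End Card.

Section Rec.
Variable S : SetM.
Implicit Types x y z a b c v w f g h n m k : S.

Lemma om_rec (F : S -> S) Y y0 : d0 F -> (forall y, y ∊ Y -> F y ∊ Y) -> y0 ∊ Y ->
 exists h, isfun h om Y /\ app h em = y0 /\ forall n, n ∊ om -> app h (sc n) = F (app h n).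
Proof.
 intros D H H0. assert (NE : forall n : S, em <> sc n) by (intros n E; apply (@in_em S n); rewrite E; apply sc_in).
 destruct (@ord_rec S om Y (fun a f y => (a = em /\ y = y0) \/ exists n, a = sc n /\ y = F (app f n))) as [h [Hh K]]; [apply Ord_om|dfn| | |].
 - intros a f y y' [[-> ->]|[n [-> ->]]] [[E ->]|[n' [E ->]]]; auto; [destruct (NE _ E)|destruct (NE _ (eq_sym E))|apply sc_inj in E; congruence].
 - intros a f A Hf. destruct (om_case A) as [->|[n [N ->]]]; [exists y0; auto|]. exists (F (app f n)). split; [|eauto].
  apply H, (app_cod Hf), sc_in.
 - exists h. split; auto. split.
  + destruct (K em (@om_0 S)) as [[_ E]|[n [E _]]]; [auto|destruct (NE _ E)].
  + intros n N. destruct (K _ (om_S N)) as [[E _]|[m [E ->]]]; [destruct (NE _ (eq_sym E))|]. apply sc_inj in E. subst m.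
   rewrite (app_rst Hh (proj1 (@Ord_om S) _ (om_S N)) (sc_in n)). auto.
Qed.

Lemma emb_prod a b c d : emb a c -> emb b d -> emb (prod a b) (prod c d).
Proof.
 intros [f F] [g G]. apply emb_lam with (F := fun u => op (app f (pr1 u)) (app g (pr2 u))); [dfn| |].
 - intros u [x [y [X [Y ->]]]]%in_prod. rewrite pr1_op, pr2_op. apply op_prod. split; [apply (app_cod (proj1 F) X)|apply (app_cod (proj1 G) Y)].
 - intros u u' [x [y [X [Y ->]]]]%in_prod [x' [y' [X' [Y' ->]]]]%in_prod. rewrite !pr1_op, !pr2_op. intros [E E']%op_inj.
  f_equal; [apply (Inj_app F X X' E)|apply (Inj_app G Y Y' E')].
Qed.
(** The functional relation L replaces a choice function: it singles out the next value from the set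
    of earlier ones, and injectivity holds because the next value avoids them. *)
Lemma ord_inj k X (L : S -> S -> Prop) : Ord k -> dfnp (fun _ e => L (e 0) (e 1)) ->
 (forall b x x', L b x -> L b x' -> x = x') ->
 (forall a f, a ∊ k -> isfun f a X -> exists x, x ∊ X /\ ~ x ∊ ran f /\ L (ran f) x) ->
 exists F, Inj F k X /\ forall a, a ∊ k -> ~ app F a ∊ ran (rst F a) /\ L (ran (rst F a)) (app F a).
Proof.
 intros O D U H. destruct (@ord_rec S k X (fun a f x => ~ x ∊ ran f /\ L (ran f) x)) as [F [F1 F2]]; [auto|dfn| | |].
 - intros a f x x' [_ K] [_ K']. eauto.
 - auto.
 - exists F. split; auto. split; auto.
  assert (N : forall a b, a ∊ b -> b ∊ k -> app F a <> app F b).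
  { intros a b A B E. apply (F2 b B). apply in_ran. exists a. apply op_rst. split; auto. rewrite <- E. apply (app_in F1), (Ord_tr O A B). }
  intros x x' y Hx Hx'. assert (KX := fun_dom F1 Hx). assert (KX' := fun_dom F1 Hx').
  rewrite <- (app_eq F1 Hx) in Hx'. apply (app_eq F1) in Hx'.
  destruct (Ord_tri (Ord_in O KX) (Ord_in O KX')) as [T|[T|T]]; auto; destruct (N _ _ T); auto.
Qed.
(* Enumerate the pairs along [k], by increasing maximum and then lexicographically: if some pair were never reached,
  all the pairs enumerated would lie below it. *)
Lemma emb_square k : Ord k -> (forall x, x ∊ k -> sc x ∊ k) -> (forall m, m ∊ k -> ~ emb k (prod m m)) -> emb (prod k k) k.
Proof.
 intros O Hs N. contra NE.
 assert (C : forall a b, a ∊ k -> b ∊ k -> cup a b ∊ k).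
 { intros a b A B. destruct (Ord_total (Ord_in O A) (Ord_in O B)) as [H|H].
  - replace (cup a b) with b; auto. apply sext; intros z; rewrite in_cup; split; auto. intros [|]; auto.
  - replace (cup a b) with a; auto. apply sext; intros z; rewrite in_cup; split; auto. intros [|]; auto. }
 assert (NS : forall x y, x ∊ k -> y ∊ k -> ~ y ∊ x -> Sub x y).
 { intros x y X Y H. contra K. apply H, Ord_nle; eauto using Ord_in. }
 set (Q := fun B a b => (a ∊ k /\ b ∊ k) /\ ~ op a b ∊ B).
 set (L := fun B p => exists a b, p = op a b /\ Q B a b /\ forall a' b', Q B a' b' ->
  Sub (cup a b) (cup a' b') /\ (cup a' b' = cup a b -> Sub a a' /\ (a' = a -> Sub b b'))).
 assert (EX : forall a f, Sub a k -> isfun f a (prod k k) -> exists p, p ∊ prod k k /\ ~ p ∊ ran f).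
 { intros a f A F. contra H. apply NE. apply (@emb_img_ord S a _ k (fun x => app f x)); [auto|dfn|apply emb_sub, A|].
  intros y Y. assert (K : y ∊ ran f) by (contra K; eauto). apply in_ran in K as [x K]. exists x. split; [apply (fun_dom F K)|apply (app_eq F K)]. }
 destruct (@ord_inj k (prod k k) L) as [F [I K]]; [auto|dfn| | |].
 - intros B p p' [a [b [-> [H M]]]] [a' [b' [-> [H' M']]]]. destruct (M a' b' H') as [M1 M2], (M' a b H) as [M3 M4].
  assert (E := Sub_antisym M1 M3). destruct (M2 (eq_sym E)) as [M5 M6], (M4 E) as [M7 M8].
  assert (E' := Sub_antisym M5 M7). f_equal; auto. apply Sub_antisym; auto.
 - intros a f A F. destruct (EX a f (proj1 O a A) F) as [p [P1 P2]]. apply in_prod in P1 as [a0 [b0 [A0 [B0 ->]]]].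
  set (B := ran f) in *. assert (Q0 : Q B a0 b0) by (split; auto).
  destruct (@d_least_ord S (fun m => exists a b, Q B a b /\ cup a b = m) k O) as [m [Hm [[a1 [b1 [Q1 E1]]] M1]]]; [dfn|exists (cup a0 b0); split; [apply C; auto|eauto]|].
  destruct (@d_least_ord S (fun a => exists b, Q B a b /\ cup a b = m) k O) as [a2 [Ha [[b2 [Q2 E2]] M2]]]; [dfn|exists a1; split; [apply Q1|eauto]|].
  destruct (@d_least_ord S (fun b => Q B a2 b /\ cup a2 b = m) k O) as [b3 [Hb [[Q3 E3] M3]]]; [dfn|exists b2; split; [apply Q2|auto]|].
  exists (op a2 b3). split; [apply op_prod; auto|]. split; [apply Q3|]. exists a2, b3. spl. intros a' b' Q'. rewrite E3. destruct Q' as [[A' B'] Q'].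
  split; [apply NS; auto; intros H; apply (M1 _ H); unfold Q; eauto 8|]. intros E. split.
  + apply NS; auto. intros H. apply (M2 _ H). unfold Q. eauto 8.
  + intros ->. apply NS; auto. intros H. apply (M3 _ H). unfold Q; auto.
 - destruct (EX k F (@Sub_refl S k) (proj1 I)) as [p [P1 P2]]. apply in_prod in P1 as [a [b [A [B ->]]]].
  apply (N (sc (cup a b))); auto. apply emb_lam with (F := fun x => app F x); [dfn| |intros x x' X X'; apply (Inj_app I); auto].
  intros x X. destruct (K x X) as [_ [a1 [b1 [-> [[[A1 B1] _] M]]]]]. destruct (M a b) as [M1 _].
  { split; auto. intros H. apply P2. apply in_ran in H as [y H]. apply op_rst in H as [H _]. apply in_ran. eauto. }
  assert (OC := Ord_in O (C a b A B)). apply op_prod; split; apply in_sc, Ord_le; eauto using Ord_in; intros z Z; apply M1, in_cup; auto.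
Qed.
End Rec.

(** With this property, induction over finite sets and natural numbers may be applied to predicates
    mentioning the additional U and E, in practice the generic filter and the membership of the
    extension. *)
Definition IndOk (S : SetM) I (U : I -> S -> Prop) (E : I -> S -> S -> Prop) :=
 forall A : I -> S -> Prop, dfns U E (fun i e => A i (e 0)) -> forall i, Min (A i).

Lemma IndOk_pure (S : SetM) : @IndOk S unit (fun _ _ => False) (fun _ _ _ => False).
Proof. intros A H i. apply Min_d. unfold dfn0. destruct i.
 apply d_ext with (A := fun i e => A i (e 0)); auto. intros []; tauto.
Qed.

(** * Finite sets *)

Section Fin.
Variable S : SetM.
Implicit Types x y z a b c v w f g h m k : S.

(** A case distinction written as a set operation, so that its definability is automatic. *)
Definition ifeq z y a b := cup (sep a (fun _ => z = y)) (sep b (fun _ => z <> y)).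
Lemma ifeq_l z a b : ifeq z z a b = a.
Proof.
 apply sext; intros w; unfold ifeq; rewrite in_cup. do 2 (rewrite in_sep by dfn). tauto.
Qed.
Lemma ifeq_r z y a b : z <> y -> ifeq z y a b = b.
Proof.
 intros; apply sext; intros w; unfold ifeq; rewrite in_cup. do 2 (rewrite in_sep by dfn). tauto.
Qed.

Lemma emb_em (n : S) : emb n em -> n = em.
Proof.
 intros [f [F _]]. apply sext; intros z; split; intros Z; [|destruct (in_em Z)].
 destruct (in_em (app_cod F Z)).
Qed.
Lemma fin_em : fin (@em S).
Proof. exists em; split; [apply om_0|]. apply emb_sub, Sub_refl. Qed.
Lemma fin_sub a b : Sub a b -> fin b -> fin a.
Proof. intros H [n [N K]]; exists n; split; auto. exact (emb_trans (emb_sub H) K). Qed.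
Lemma fin_nat (n : S) : n ∊ om -> fin n.
Proof. intros; exists n; split; auto. apply emb_sub, Sub_refl. Qed.
Lemma fin_adj x y : fin x -> fin (adj x y).
Proof.
 intros [n [N [f F]]]. exists (sc n); split; [apply om_S; auto|].
 apply emb_lam with (F := fun z => ifeq z y n (app f z)).
 - dfn.
 - intros z Z. destruct (classic (z = y)) as [->|E]; [rewrite ifeq_l; apply sc_in|rewrite ifeq_r by auto].
  apply in_adj in Z. apply in_sc; left. apply (app_cod (proj1 F)). tauto.
 - intros z z' Z Z' E. apply in_adj in Z; apply in_adj in Z'.
  destruct (classic (z = y)) as [->|E1]; destruct (classic (z' = y)) as [->|E2]; auto.
  + rewrite ifeq_l, ifeq_r in E by auto. exfalso. apply (@nin S n). rewrite E at 1. apply (app_cod (proj1 F)). tauto.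
  + rewrite ifeq_l, ifeq_r in E by auto. exfalso. apply (@nin S n). rewrite <- E at 1. apply (app_cod (proj1 F)). tauto.
  + rewrite !ifeq_r in E by auto. apply (Inj_app F); auto; tauto.
Qed.
Lemma fin_img a b (F : S -> S) : d0 F -> fin a -> (forall y, y ∊ b -> exists x, x ∊ a /\ F x = y) -> fin b.
Proof. intros D [n [N K]] H; exists n; split; auto. exact (emb_img_ord (om_ord N) D K H). Qed.

Lemma fin_ind_gen I (U : I -> S -> Prop) E (HI : IndOk U E) (A : I -> S -> Prop) :
 dfns U E (fun i e => A i (e 0)) -> forall i, A i em ->
 (forall x y, fin x -> A i x -> ~ y ∊ x -> A i (adj x y)) -> forall x, fin x -> A i x.
Proof.
 intros D i H0 HS x [n [N K]]. revert x K.
 refine (@om_ind S (fun n => forall x, emb x n -> A i x) _ _ _ n N).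
 - apply (HI (fun i n => forall x, emb x n -> A i x)). dfn.
 - intros x K; apply emb_em in K; subst; auto.
 - clear n N. intros n N IH x [f F].
  destruct (classic (exists y, op y n ∊ f)) as [[y Y]|NY].
  + assert (YX : y ∊ x) by (apply (fun_dom (proj1 F) Y)).
   defset x' HX (sep x (fun z => z <> y)).
   assert (EX : emb x' n).
   { apply emb_lam with (F := fun z => app f z).
    - dfn.
    - intros z Z; apply HX in Z. assert (K : app f z ∊ sc n) by (apply (app_cod (proj1 F)); tauto).
     apply in_sc in K as [K|K]; auto. exfalso. apply (proj2 Z). apply (proj2 F z y n); auto.
     rewrite <- K. apply (app_in (proj1 F)); tauto.
    - intros z z' Z Z'; apply HX in Z; apply HX in Z'. apply (Inj_app F); tauto. }
   replace x with (adj x' y).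
   * apply HS; [exists n; auto|apply IH; auto|]. intros K; apply HX in K; tauto.
   * apply sext; intros z; rewrite in_adj, HX. split; [intros [[]| ->]; auto|]. intros; destruct (classic (z = y)); auto.
  + apply IH. apply emb_lam with (F := fun z => app f z).
   * dfn.
   * intros z Z. assert (K : app f z ∊ sc n) by (apply (app_cod (proj1 F)); tauto).
    apply in_sc in K as [K|K]; auto. exfalso; apply NY; exists z. rewrite <- K. apply (app_in (proj1 F)); auto.
   * intros z z' Z Z'; apply (Inj_app F); auto.
Qed.
Lemma fin_ind (A : S -> Prop) : dfn0 (@smem S) A -> A em ->
 (forall x y, fin x -> A x -> ~ y ∊ x -> A (adj x y)) -> forall x, fin x -> A x.
Proof. intros D. exact (@fin_ind_gen _ _ _ (@IndOk_pure S) (fun _ => A) D tt). Qed.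

Lemma fin_cup a b : fin a -> fin b -> fin (cup a b).
Proof.
 intros A B. revert b B. apply fin_ind.
 - dfn.
 - replace (cup a em) with a; auto. apply sext; intros z; rewrite in_cup. split; auto. intros [|K]; auto. destruct (in_em K).
 - intros x y X H _. replace (cup a (adj x y)) with (adj (cup a x) y) by (apply sext; intros; rewrite !in_adj, !in_cup, in_adj; tauto).
  apply fin_adj; auto.
Qed.
Lemma fin_prod a b : fin a -> fin b -> fin (prod a b).
Proof.
 intros A B. revert b B. apply fin_ind.
 - dfn.
 - replace (prod a em) with (@em S); [apply fin_em|]. apply sext; intros z; split; intros K; [destruct (in_em K)|].
  apply in_prod in K as [x [y [_ [Y _]]]]. destruct (in_em Y).
 - intros x y X H _. replace (prod a (adj x y)) with (cup (prod a x) (prod a (sg y))).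
  + apply fin_cup; auto. apply fin_img with (a := a) (F := fun z => op z y); auto.
   * dfn.
   * intros u [z [w [Z [W ->]]]]%in_prod. apply in_sg in W; subst; eauto.
  + apply sext; intros u; rewrite in_cup, !in_prod. split.
   * intros [[z [w [Z [W ->]]]]|[z [w [Z [W ->]]]]]; exists z, w; rewrite in_adj; [auto|]. apply in_sg in W; auto.
   * intros [z [w [Z [W ->]]]]. apply in_adj in W as [W|W]; [left|right]; exists z, w; rewrite ?in_sg; auto.
Qed.
Lemma fin_Pw a : fin a -> fin (Pw a).
Proof.
 revert a; apply fin_ind.
 - dfn.
 - apply fin_sub with (b := adj em em); [|apply fin_adj, fin_em].
  intros z Z; apply in_adj; right. apply in_Pw in Z. apply Sub_antisym; auto. apply om_0_le.
 - intros x y X H N.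
  set (B := sep (Pw (adj x y)) (fun z => y ∊ z)).
  assert (FB : fin B).
  { apply fin_img with (a := Pw x) (F := fun z => adj z y); auto.
   - dfn.
   - intros z Z; unfold B in Z; sepd in Z. destruct Z as [Z1 Z2].
    exists (sep z (fun w => w <> y)). split.
    + apply in_Pw; intros w W. sepd in W. destruct W as [W W']. apply in_Pw in Z1. specialize (Z1 w W). apply in_adj in Z1. tauto.
    + apply sext; intros w; rewrite in_adj. sepd. split; [intros [[]| ->]; auto|]. intros; destruct (classic (w = y)); auto. }
  apply fin_sub with (b := cup (Pw x) B); [|apply fin_cup; auto].
  intros z Z. apply in_cup. destruct (classic (y ∊ z)); [right; unfold B; sepd; auto|left].
  apply in_Pw in Z. apply in_Pw; intros w W. specialize (Z w W). apply in_adj in Z. destruct Z; subst; tauto.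
Qed.

Lemma php (n : S) : n ∊ om -> ~ emb (sc n) n.
Proof.
 revert n; apply om_ind.
 - apply Min_d; dfn.
 - intros H; apply emb_em in H. apply (@in_em S em). rewrite <- H at 2. apply sc_in.
 - intros n N IH [f F]. apply IH.
  assert (LN : sc n ∊ sc (sc n)) by apply sc_in.
  assert (SN : forall z, z ∊ sc n -> z ∊ sc (sc n)) by (intros; apply in_sc; auto).
  (* Where the value n was taken, the value of the last element is substituted; this removes both
     the last argument and the last value. *)
  apply emb_lam with (F := fun z => ifeq (app f z) n (app f (sc n)) (app f z)).
  + dfn.
  + intros z Z. destruct (classic (app f z = n)) as [E|E].
   * rewrite E, ifeq_l. assert (K := app_cod (proj1 F) LN). apply in_sc in K as [K|K]; auto.
    exfalso. apply (@nin S (sc n)). rewrite <- (Inj_app F (SN z Z) LN) at 1; auto. congruence.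
   * rewrite ifeq_r by auto. assert (K := app_cod (proj1 F) (SN z Z)). apply in_sc in K; tauto.
  + intros z z' Z Z' E.
   assert (ZN : z <> sc n) by (intros ->; destruct (nin Z)). assert (ZN' : z' <> sc n) by (intros ->; destruct (nin Z')).
   destruct (classic (app f z = n)) as [E1|E1]; destruct (classic (app f z' = n)) as [E2|E2].
   * apply (Inj_app F); auto. congruence.
   * rewrite E1, ifeq_l, ifeq_r in E by auto. destruct ZN'. symmetry. apply (Inj_app F); auto.
   * rewrite E2, ifeq_l, ifeq_r in E by auto. destruct ZN. apply (Inj_app F); auto.
   * rewrite !ifeq_r in E by auto. apply (Inj_app F); auto.
Qed.
Lemma om_nfin : ~ fin (@om S).
Proof.
 intros [n [N H]]. apply (php N). refine (emb_trans (emb_sub _) H).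
 exact (proj1 (@Ord_om S) _ (om_S N)).
Qed.

Lemma ctb_prod : ctb (prod (@om S) om).
Proof. apply emb_square; [apply Ord_om|apply om_S|]. intros m M H. apply om_nfin. destruct (fin_prod (fin_nat M) (fin_nat M)) as [n [Hn K]]. exists n. split; [auto|exact (emb_trans H K)]. Qed.
Lemma ctb_prod2 a b : ctb a -> ctb b -> ctb (prod a b).
Proof. intros A B; exact (emb_trans (emb_prod A B) ctb_prod). Qed.

(** The maximum of finitely many bounds, for a relation monotone in the bound. It is applied
    whenever finitely many values, points or tasks must be handled at once. *)
Lemma fin_bound I (U : I -> S -> Prop) E (HI : IndOk U E) (R : I -> S -> S -> Prop) i x :
 dfns U E (fun i e => R i (e 0) (e 1)) ->
 (forall y n m, R i y n -> n ∊ om -> m ∊ om -> Sub n m -> R i y m) -> fin x ->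
 (forall y, y ∊ x -> exists n, n ∊ om /\ R i y n) -> exists N, N ∊ om /\ forall y, y ∊ x -> R i y N.
Proof.
 intros D M X. revert x X.
 apply (@fin_ind_gen _ _ _ HI (fun i x => (forall y, y ∊ x -> exists n, n ∊ om /\ R i y n) -> exists N, N ∊ om /\ forall y, y ∊ x -> R i y N)).
 - repeat dfn2. exact (d_ren (fun k : nat => match k with 0 => 1 | 1 => 0 | k => k end) D).
 - intros _; exists em; split; [apply om_0|]. intros y Y; destruct (in_em Y).
 - intros z y Z IH _ H. destruct IH as [N [HN K]]; [intros; apply H, in_adj; auto|].
  destruct (H y) as [n [Hn Rn]]; [apply in_adj; auto|]. destruct (om_max HN Hn) as [k [Hk [A B]]].
  exists k; split; auto. intros w [W| ->]%in_adj; [apply (M w N); auto|apply (M y n); auto].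
Qed.
End Fin.

(** * The formulas of the statement, read in a model *)

Section Truth.
Variable S : SetM.
Notation T := (truth (@smem S)).
Implicit Types x y z a b c v w f g h m k : S.
Lemma t_eqv x y : T (eqv x y) <-> x = y.
Proof. split; [intros H; apply sext; intros z; exact (H z)|intros ->; simpl; tauto]. Qed.
Lemma t_sub x y : T (sub x y) <-> Sub x y.
Proof. split; intros H; exact H. Qed.
Lemma t_empty x : T (empty x) <-> x = em.
Proof.
 split; [|intros ->; intros z Z; exact (in_em Z)]. intros H; apply sext; intros z; split; intros Z; [destruct (H z Z)|destruct (in_em Z)].
Qed.
Lemma t_upair z x y : T (upair z x y) <-> z = up x y.
Proof.
 split; intros H.
 - apply sext; intros w; rewrite in_up. destruct (H w) as [A B]. rewrite <- !t_eqv; split; auto.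
 - subst; intros w; change ((w ∊ up x y -> T (eqv w x) \/ T (eqv w y)) /\ (T (eqv w x) \/ T (eqv w y) -> w ∊ up x y)).
  rewrite in_up, !t_eqv; tauto.
Qed.
Lemma t_opair z x y : T (opair z x y) <-> z = op x y.
Proof.
 assert (K : T (opair z x y) <-> forall w, w ∊ z <-> T (upair w x x) \/ T (upair w x y)) by reflexivity.
 rewrite K. split; intros H.
 - apply sext; intros w; rewrite H, !t_upair. unfold op; rewrite in_up. reflexivity.
 - subst; intros w; rewrite !t_upair. unfold op; rewrite in_up. reflexivity.
Qed.
Lemma t_succ y x : T (succ y x) <-> y = sc x.
Proof.
 assert (K : T (succ y x) <-> forall w, w ∊ y <-> w ∊ x \/ T (eqv w x)) by reflexivity.
 rewrite K. split; intros H.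
 - apply sext; intros w; rewrite H, in_sc, t_eqv; tauto.
 - subst; intros w; rewrite in_sc, t_eqv; tauto.
Qed.
Lemma t_maps f x y : T (maps f x y) <-> op x y ∊ f.
Proof.
 assert (K : T (maps f x y) <-> exists z, T (opair z x y) /\ z ∊ f) by reflexivity.
 rewrite K; split; [intros [z [H Z]]; apply t_opair in H; subst; auto|]. intros; exists (op x y); rewrite t_opair; auto.
Qed.
Lemma t_maps2 f x y z : T (maps2 f x y z) <-> op (op x y) z ∊ f.
Proof.
 assert (K : T (maps2 f x y z) <-> exists u, T (opair u x y) /\ T (maps f u z)) by reflexivity.
 rewrite K; split; [intros [u [H Z]]; apply t_opair in H; apply t_maps in Z; subst; auto|].
 intros; exists (op x y); rewrite t_opair, t_maps; auto.
Qed.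
Definition fon f a := (forall z, z ∊ f -> exists x y, x ∊ a /\ z = op x y) /\
 (forall x, x ∊ a -> exists y, op x y ∊ f) /\ forall x y y', op x y ∊ f -> op x y' ∊ f -> y = y'.
Lemma t_fun_on f a : T (fun_on f a) <-> fon f a.
Proof.
 assert (K : T (fun_on f a) <-> (forall z, z ∊ f -> exists x, x ∊ a /\ exists y, T (opair z x y)) /\
  forall x, x ∊ a -> exists y, T (maps f x y) /\ forall y', T (maps f x y') -> T (eqv y' y)) by reflexivity.
 rewrite K; clear K. split.
 - intros [H K]. assert (H' : forall z, z ∊ f -> exists x y, x ∊ a /\ z = op x y).
  { intros z Z; destruct (H z Z) as [x [X [y Y]]]; apply t_opair in Y; eauto. }
  split; [|split]; auto.
  + intros x X; destruct (K x X) as [y [Y _]]; apply t_maps in Y; eauto.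
  + intros x y y' Y Y'. assert (X : x ∊ a).
   { destruct (H' _ Y) as [x' [z [X E]]]. opi; auto. }
   destruct (K x X) as [w [_ W]]. rewrite <- t_maps in Y, Y'. apply W in Y; apply W in Y'.
   apply t_eqv in Y; apply t_eqv in Y'; congruence.
 - intros [H1 [H2 H3]]; split.
  + intros z Z; destruct (H1 z Z) as [x [y [X ->]]]; exists x; split; auto; exists y; apply t_opair; auto.
  + intros x X; destruct (H2 x X) as [y Y]; exists y. rewrite t_maps; split; auto.
   intros y' Y'; apply t_maps in Y'; apply t_eqv; eauto.
Qed.
Lemma fon_isfun f a b : isfun f a b <-> fon f a /\ forall x y, op x y ∊ f -> y ∊ b.
Proof.
 split.
 - intros F; split; [split; [|apply F]|].
  + intros z Z. apply F, in_prod in Z as [x [y [X [Y ->]]]]; eauto.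
  + intros x y; apply (fun_cod F).
 - intros [[H1 [H2 H3]] H4]; split; auto. intros z Z. destruct (H1 z Z) as [x [y [X ->]]]. apply op_prod; eauto.
Qed.
Lemma t_func f a b : T (func f a b) <-> isfun f a b.
Proof.
 assert (K : T (func f a b) <-> T (fun_on f a) /\ forall x y, T (maps f x y) -> y ∊ b) by reflexivity.
 rewrite K, t_fun_on, fon_isfun. split; intros [A B]; split; auto; intros x y; rewrite ?t_maps; [rewrite <- t_maps|]; apply B.
Qed.
Lemma t_inj f a b : T (inj f a b) <-> Inj f a b.
Proof.
 assert (K : T (inj f a b) <-> T (func f a b) /\ forall x x' y, T (maps f x y) /\ T (maps f x' y) -> T (eqv x x')) by reflexivity.
 rewrite K, t_func; unfold Inj. split; intros [A B]; split; auto.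
 - intros x x' y X X'. apply t_eqv, (B x x' y). rewrite !t_maps; auto.
 - intros x x' y [X X']. apply t_maps in X; apply t_maps in X'. apply t_eqv; eauto.
Qed.
Lemma t_embeds a b : T (embeds a b) <-> emb a b.
Proof. split; intros [f F]; exists f; apply t_inj; exact F. Qed.
Lemma t_ord x : T (ord x) <-> Ord x.
Proof. split; intros H; exact H. Qed.
Lemma t_ole x y : T (ole x y) <-> x ∊ y \/ x = y.
Proof. assert (K : T (ole x y) <-> x ∊ y \/ T (eqv x y)) by reflexivity. rewrite K, t_eqv; tauto. Qed.
Lemma t_natural n : T (natural n) <-> n ∊ om.
Proof.
 rewrite in_om. assert (K : T (natural n) <-> T (ord n) /\ forall m, T (ole m n) -> T (empty m) \/ exists k, T (succ m k)) by reflexivity.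
 rewrite K, t_ord; unfold isnat. split; intros [A B]; split; auto.
 - intros m M. apply t_ole in M. destruct (B m M) as [C|[k C]]; [left; apply t_empty|right; exists k; apply t_succ]; auto.
 - intros m M. apply t_ole in M. destruct (B m M) as [C|[k C]]; [left; apply t_empty|right; exists k; apply t_succ]; auto.
Qed.
Lemma t_omega w : T (omega w) <-> w = om.
Proof.
 assert (K : T (omega w) <-> forall n, n ∊ w <-> T (natural n)) by reflexivity.
 rewrite K; split; [intros H; apply sext; intros z; rewrite H; apply t_natural|intros ->; intros; symmetry; apply t_natural].
Qed.
Lemma t_finite x : T (finite x) <-> fin x.
Proof.
 assert (K : T (finite x) <-> exists n, T (natural n) /\ T (embeds x n)) by reflexivity.
 rewrite K; split; intros [n N]; exists n; [rewrite t_natural, t_embeds in N|rewrite t_natural, t_embeds]; auto.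
Qed.
Lemma t_countable x : T (countable x) <-> ctb x.
Proof.
 assert (K : T (countable x) <-> exists w, T (omega w) /\ T (embeds x w)) by reflexivity.
 rewrite K; split; [intros [w W]; rewrite t_omega, t_embeds in W; destruct W; subst; auto|].
 intros H; exists om; rewrite t_omega, t_embeds; auto.
Qed.
Definition isom1 a := Ord a /\ ~ ctb a /\ forall b, b ∊ a -> ctb b.
Lemma t_omega1 a : T (omega1 a) <-> isom1 a.
Proof.
 assert (K : T (omega1 a) <-> T (ord a) /\ ~ T (countable a) /\ forall b, b ∊ a -> T (countable b)) by reflexivity.
 rewrite K, t_ord, t_countable; unfold isom1. setoid_rewrite t_countable. tauto.
Qed.
Lemma t_omega2 a : T (omega2 a) <-> Ord a /\ exists o, isom1 o /\ ~ emb a o /\ forall b, b ∊ a -> emb b o.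
Proof.
 assert (K : T (omega2 a) <-> T (ord a) /\ exists o, T (omega1 o) /\ ~ T (embeds a o) /\ forall b, b ∊ a -> T (embeds b o)) by reflexivity.
 rewrite K, t_ord. setoid_rewrite t_embeds. setoid_rewrite t_omega1. tauto.
Qed.
Lemma t_hechler x : T (hechler x) <-> exists n f, n ∊ om /\ isfun f om om /\ x = op n f.
Proof.
 assert (K : T (hechler x) <-> exists w n f, T (omega w) /\ n ∊ w /\ T (func f w w) /\ T (opair x n f)) by reflexivity.
 rewrite K; clear K; split.
 - intros [w [n [f H]]]; rewrite t_omega, t_func, t_opair in H. exists n, f. destruct H as [-> H]; auto.
 - intros [n [f H]]; exists om, n, f. rewrite t_omega, t_func, t_opair; tauto.
Qed.
Lemma t_hechler_le x y : T (hechler_le x y) <-> exists m g n f, x = op m g /\ y = op n f /\ (n ∊ m \/ n = m) /\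
 (forall i, i ∊ n -> forall k, op i k ∊ g <-> op i k ∊ f) /\
 (forall i, i ∊ om -> forall j k, op i j ∊ f -> op i k ∊ g -> j ∊ k \/ j = k).
Proof.
 assert (K : T (hechler_le x y) <-> exists w m g n f, T (omega w) /\ T (opair x m g) /\ T (opair y n f) /\ T (ole n m) /\
  (forall i, i ∊ n -> forall k, T (maps g i k) <-> T (maps f i k)) /\
  (forall i, i ∊ w -> forall j k, T (maps f i j) /\ T (maps g i k) -> T (ole j k))) by reflexivity.
 rewrite K; clear K; split.
 - intros [w [m [g [n [f H]]]]]; rewrite t_omega, !t_opair, t_ole in H. exists m, g, n, f. destruct H as [-> [H1 [H2 [H3 [H4 H5]]]]].
  split; [auto|split; [auto|split; [auto|split]]].
  + intros i Hi k. rewrite <- !t_maps. apply H4; auto.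
  + intros i Hi j k X Y. rewrite <- t_maps in X, Y. apply t_ole. eapply H5; eauto.
 - intros [m [g [n [f [H1 [H2 [H3 [H4 H5]]]]]]]]; exists om, m, g, n, f. rewrite t_omega, !t_opair, t_ole.
  split; [auto|split; [auto|split; [auto|split; [auto|split]]]].
  + intros i Hi k. rewrite !t_maps. apply H4; auto.
  + intros i Hi j k [X Y]. rewrite t_maps in X, Y. apply t_ole; eauto.
Qed.
Lemma t_restrict p' p z : T (restrict p' p z) <-> p' = rst p z.
Proof.
 assert (K : T (restrict p' p z) <-> forall u, u ∊ p' <-> u ∊ p /\ exists x, x ∊ z /\ exists y, T (opair u x y)) by reflexivity.
 rewrite K; clear K; split.
 - intros H; apply sext; intros u; rewrite H, in_rst. split; intros [A B]; split; auto.
  + destruct B as [x [X [y Y]]]; apply t_opair in Y; eauto.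
  + destruct B as [x [y [Y X]]]. exists x; split; auto; exists y; apply t_opair; auto.
 - intros -> u; rewrite in_rst. split; intros [A B]; split; auto.
  + destruct B as [x [y [Y X]]]. exists x; split; auto; exists y; apply t_opair; auto.
  + destruct B as [x [X [y Y]]]; apply t_opair in Y; eauto.
Qed.
End Truth.

(** * Replacement, choice and recursion on membership *)

Record ZF := {
 zs :> SetM;
 z_repl : forall R : zs -> zs -> Prop,
  dfnp (fun _ e => R (e 0) (e 1)) ->
  forall a, (forall x, x ∊ a -> forall y y', R x y -> R x y' -> y = y') ->
  exists b, forall y, y ∊ b <-> exists x, x ∊ a /\ R x y;
 z_choice : forall a : zs, (forall x, x ∊ a -> x <> em) ->
  (forall x y, x ∊ a -> y ∊ a -> (exists z, z ∊ x /\ z ∊ y) -> x = y) ->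
  exists c, forall x, x ∊ a -> exists z, (z ∊ x /\ z ∊ c) /\ forall z', z' ∊ x -> z' ∊ c -> z' = z
}.

Section ZFT.
Variable S : ZF.
Implicit Types x y z a b c v w f g h m k : S.

Definition img (F : S -> S) a := the (fun b => forall y, y ∊ b <-> exists x, x ∊ a /\ F x = y).
Lemma in_img F a y : d0 F -> y ∊ img F a <-> exists x, x ∊ a /\ F x = y.
Proof.
 intros D. revert y. apply (the_spec (P := fun b => forall y, y ∊ b <-> exists x, x ∊ a /\ F x = y)).
 apply (z_repl (R := fun x y => F x = y)).
 - exact (d_ren (fun k : nat => match k with 0 => 1 | 1 => 0 | k => k end) D).
 - intros; congruence.
Qed.

Lemma mem_ind0 (P : S -> Prop) : Min P -> (forall x, (forall y, y ∊ x -> P y) -> P x) -> forall t x, trans t -> Sub x t -> P x.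
Proof.
 intros M H t x T X. apply H. intros y Y. contra N. destruct (M t y (X _ Y) N) as [m [A [B C]]].
 apply B, H. intros z Z. apply C; auto. apply (T m A z Z).
Qed.

Section MemRec.
Variable Phi : S -> S -> S.
Hypothesis HG : dfnp (fun _ e => Phi (e 1) (e 2) = e 0).

Lemma ft_Phi I (U : I -> S -> Prop) E t (u : I -> (nat -> S) -> S) : dfts U E t -> dfts U E u ->
 dfts U E (fun i e => Phi (t i e) (u i e)).
Proof.
 intros; apply ft_spec with (Q := fun i e y => exists a, a = t i e /\ exists b, b = u i e /\ Phi a b = y).
 { intros; split; [eauto|intros [a [-> [b [-> K]]]]; auto]. }
 repeat dfn2. exact (d_ren (fun k : nat => match k with 1 => 2 | 2 => 1 | k => k end) (pure_lift U E HG)).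
Qed.
Hint Resolve ft_Phi : dfn.

(** Partial solutions of the recursion on transitive sets. They are sets of the model, so the
    recursively defined function is definable even if the model is ill-founded. *)
Definition attempt t f := trans t /\ forall y w, y ∊ t -> (op y w ∊ f <-> w = Phi y (rst f y)).
Definition mrec x v := exists t f, attempt t f /\ Sub x t /\ v = Phi x (rst f x).
Lemma attempt_mrec t f y w : attempt t f -> y ∊ t -> (op y w ∊ f <-> mrec y w /\ w = Phi y (rst f y)).
Proof. intros A Y. rewrite (proj2 A y w Y). split; [|tauto]. intros E. split; auto. exists t, f. split; auto. split; auto. apply A, Y. Qed.
Lemma mrec_fun x v w : mrec x v -> mrec x w -> v = w.
Proof.
 intros V. assert (V' := V). destruct V' as [t [_ [[T _] [X _]]]]. revert v w V.
 refine (@mem_ind0 (fun x => forall v w, mrec x v -> mrec x w -> v = w) _ _ t x T X); [apply Min_d; dfn|]. clear x t T X.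
 assert (K : forall x, (forall y, y ∊ x -> forall v w, mrec y v -> mrec y w -> v = w) -> forall t f t' f', attempt t f -> attempt t' f' -> Sub x t -> Sub x t' -> Sub (rst f x) (rst f' x)).
 { intros x IH t f t' f' A A' X X' u [U [y [w [-> Y]]]]%in_rst. apply op_rst. split; auto.
  apply (attempt_mrec w A (X y Y)) in U. apply (proj2 A' y w (X' y Y)). apply (IH y Y); [apply U|].
  exists t', f'. split; auto. split; auto. apply (proj1 A'), X', Y. }
 intros x IH v w [t [f [A [X ->]]]] [t' [f' [A' [X' ->]]]]. f_equal. apply Sub_antisym; eapply K; eauto.
Qed.
Lemma mrec_ex t x : trans t -> Sub x t -> exists v, mrec x v.
Proof.
 intros T0 X0. refine (@mem_ind0 (fun x => Sub x t -> exists v, mrec x v) _ _ t x T0 X0 X0); [apply Min_d; dfn|]. clear x X0.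
 intros x IH XT. defset d HD (sep t (fun y => exists v, mrec y v)).
 destruct (@z_repl S (fun y v => exists w, v = op y w /\ mrec y w)) with (a := d) as [f F]; [dfn| |].
 { intros y Y v v' [w [-> W]] [w' [-> W']]. rewrite (mrec_fun W W'); auto. }
 assert (FI : forall y w, op y w ∊ f <-> y ∊ d /\ mrec y w).
 { intros y w; rewrite F; split; [intros [y' [Y' [w' [E W']]]]; opi; auto|intros [A B]; eauto]. }
 assert (KD : forall t' f' y, attempt t' f' -> Sub y t' -> forall z w, z ∊ y -> (op z w ∊ f' <-> mrec z w)).
 { intros t' f' y A Y z w Z. rewrite (attempt_mrec w A (Y z Z)). split; [tauto|]. intros M. split; auto. apply (mrec_fun M), (attempt_mrec _ A (Y z Z)), (proj2 A); auto. }
 exists (Phi x (rst f x)), d, f. split; [|split; auto; intros y Y; apply HD; split; auto; apply (IH y Y); intros z Z; apply (T0 y (XT y Y) z Z)]. split.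
 - intros y Y z Z. apply HD in Y as [Y [v [t' [f' [A [Y' _]]]]]]. apply HD. split; [apply (T0 y Y z Z)|]. exists (Phi z (rst f' z)). exists t', f'. split; auto. split; auto. apply A, Y', Z.
 - intros y w Y. assert (Yd := Y). apply HD in Y as [Y [v V]]. assert (E : v = Phi y (rst f y)).
  { assert (V' := V). destruct V' as [t' [f' [A [Y' ->]]]]. f_equal. apply sext; intros u. rewrite !in_rst.
   split; intros [U [z [w' [-> Z]]]]; (split; [|eauto]); [apply FI|apply (KD t' f' y); auto; apply FI in U; tauto].
   apply (KD t' f' y) in U; auto. split; auto. apply HD. split; eauto. apply (T0 y Y z Z). }
  rewrite FI, <- E. split; [intros [_ W]; apply (mrec_fun W V)|intros ->; auto].
Qed.
Definition mrecf x := the (mrec x).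
Lemma mrecf_iff t x v : trans t -> Sub x t -> (mrecf x = v <-> mrec x v).
Proof.
 intros T X. assert (K := the_spec (mrec_ex T X) : mrec x (mrecf x)). split; [intros <-; auto|apply (mrec_fun K)].
Qed.
Lemma mrecf_eq0 t x : trans t -> Sub x t -> exists f, mrecf x = Phi x f /\ forall u, u ∊ f <-> exists y, y ∊ x /\ u = op y (mrecf y).
Proof.
 intros T X. destruct (proj1 (mrecf_iff (mrecf x) T X) eq_refl) as [t' [f [A [X' E]]]]. exists (rst f x). split; auto. intros u. rewrite in_rst. split.
 - intros [U [y [w [-> Y]]]]. exists y. split; auto. f_equal. symmetry. apply (mrecf_iff w (proj1 A) (proj1 A y (X' y Y))). apply (attempt_mrec w A (X' y Y)), U.
 - intros [y [Y ->]]. split; [|eauto]. apply (proj2 A y); auto. apply (mrecf_iff _ (proj1 A) (proj1 A y (X' y Y))). exists t', f. split; auto. split; auto. exact (proj1 A y (X' y Y)).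
Qed.
End MemRec.

(** The transitive closure is itself built by recursion along omega. This is why the recursion
    theorem was first proved relative to a given transitive set: omega is one. *)
Lemma tc_ex x : exists t, trans t /\ Sub x t.
Proof.
 set (Phi := fun n f : S => cup x (Un (Un (ran f)))).
 assert (D : dfnp (fun _ e => Phi (e 1) (e 2) = e 0)) by (dfn).
 assert (To : trans (@om S)) by exact (proj1 (@Ord_om S)).
 assert (E : forall n u, n ∊ om -> (u ∊ mrecf Phi n <-> u ∊ x \/ exists m y, m ∊ n /\ y ∊ mrecf Phi m /\ u ∊ y)).
 { intros n u N. destruct (mrecf_eq0 D To (To n N)) as [f [-> F]]. unfold Phi. rewrite in_cup, in_Un. setoid_rewrite in_Un. setoid_rewrite in_ran. split.
  - intros [U|[y [[v [[m V] Y]] U]]]; auto. apply F in V as [m' [M V]]. opi. eauto 6.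
  - intros [U|[m [y [M [Y U]]]]]; auto. right. exists y. split; auto. exists (mrecf Phi m). split; auto. exists m. apply F. eauto. }
 assert (I : forall n v, n ∊ om -> (mrecf Phi n = v <-> mrec Phi n v)) by (intros n v N; apply (mrecf_iff D v To (To n N))).
 assert (DF := ft_Phi D). destruct (@z_repl S (mrec Phi)) with (a := (@om S)) as [b B]; [dfn|intros n N y y' H H'; apply (mrec_fun D H H')|].
 exists (Un b). split.
 - intros y Y z Z. apply in_Un in Y as [v [V Y]]. apply B in V as [n [N V]]. apply I in V; auto. subst v. apply in_Un. exists (mrecf Phi (sc n)).
  split; [apply B; exists (sc n); split; [|apply I]; auto using om_S|]. apply E; [apply om_S; auto|]. right. exists n, y. auto using sc_in.
 - intros u U. apply in_Un. exists (mrecf Phi em). split; [apply B; exists em; split; [|apply I]; auto using om_0|]. apply E; auto using om_0.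
Qed.
Lemma mem_ind (P : S -> Prop) : Min P -> (forall x, (forall y, y ∊ x -> P y) -> P x) -> forall x, P x.
Proof. intros M H x. destruct (tc_ex x) as [t [T X]]. exact (mem_ind0 M H T X). Qed.

Section MemRecTotal.
Variable Phi : S -> S -> S.
Hypothesis HG : dfnp (fun _ e => Phi (e 1) (e 2) = e 0).
Lemma d0_mrecf : d0 (mrecf Phi).
Proof.
 assert (D := ft_Phi HG). apply d_ext with (A := fun i e => mrec Phi (e 1) (e 0)); [|dfn].
 intros _ e. destruct (tc_ex (e 1)) as [t [T X]]. symmetry. apply (mrecf_iff HG _ T X).
Qed.
Lemma mrecf_eq x : mrecf Phi x = Phi x (img (fun y => op y (mrecf Phi y)) x).
Proof.
 assert (D := d0_mrecf). destruct (tc_ex x) as [t [T X]]. destruct (mrecf_eq0 HG T X) as [f [-> F]]. f_equal. apply sext; intros u.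
 rewrite F, in_img by dfn. split; intros [y [Y E]]; eauto.
Qed.
End MemRecTotal.

Lemma nonem b : b <> em -> exists x, x ∊ b.
Proof. intros N; contra K; apply N; apply sext; intros z; split; intros Z; [destruct K; eauto|destruct (in_em Z)]. Qed.
Lemma choice_fun X : exists c : S -> S, d0 c /\ forall b, Sub b X -> b <> em -> c b ∊ b.
Proof.
 (* The axiom of choice is stated for disjoint families, so b is replaced by {b} x b. *)
 defset A HA (sep (Pw (prod (Pw X) X)) (fun u => exists b, b ∊ Pw X /\ b <> em /\ u = prod (sg b) b)).
 destruct (@z_choice S A) as [C HC].
 - intros u H E. apply HA in H as [_ [b [B [N ->]]]]. destruct (nonem N) as [x X'].
  apply (@in_em S (op b x)). rewrite <- E. apply op_prod; rewrite in_sg; auto.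
 - intros u u' H H' [z [Z Z']]. apply HA in H as [_ [b [B [N ->]]]]. apply HA in H' as [_ [b' [B' [N' ->]]]].
  apply in_prod in Z as [p [q [P [Q ->]]]]. apply op_prod in Z' as [Z' _]. apply in_sg in P, Z'. congruence.
 - exists (fun b => Un (sep b (fun x => op b x ∊ C))). split; [dfn|].
  intros b B N. destruct (HC (prod (sg b) b)) as [z [[Z1 Z2] Z3]].
  { apply HA; split; [|exists b; split; [apply in_Pw|]; auto].
   apply in_Pw; intros v [p [q [P [Q ->]]]]%in_prod. apply in_sg in P; subst.
   apply op_prod; split; auto. apply in_Pw; auto. }
  apply in_prod in Z1 as [p [q [P [Q ->]]]]. apply in_sg in P; subst p.
  assert (E : forall x, x ∊ b -> op b x ∊ C -> x = q).
  { intros x X' H. apply (op_inj2 (Z3 (op b x) (proj2 (op_prod _ _ _ _) (conj (proj2 (in_sg _ _) eq_refl) X')) H)). }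
  match goal with |- ?u ∊ b => replace u with q; auto end.
  apply sext; intros w; rewrite in_Un; split.
  + intros W; exists q; split; auto. sepd; auto.
  + intros [y [Y W]]. sepd in Y. rewrite <- (E y); tauto.
Qed.
(** A Skolem function for a definable relation which is definable in its turn, so that it may occur
    in later separations and replacements. *)
Lemma choose (R : S -> S -> Prop) Y : dfnp (fun _ e => R (e 0) (e 1)) ->
 exists F : S -> S, d0 F /\ forall x y, y ∊ Y -> R x y -> F x ∊ Y /\ R x (F x).
Proof.
 intros D. destruct (choice_fun Y) as [c [Dc Hc]].
 assert (HW : forall x y, y ∊ sep Y (R x) <-> y ∊ Y /\ R x y) by (intros; apply in_sep; dfn).
 exists (fun x => c (sep Y (R x))). split; [dfn|]. intros x y Hy Z. apply HW, Hc; [intros w W; apply HW in W; tauto|].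
 intros E. apply (@in_em S y). rewrite <- E. apply HW; auto.
Qed.
Lemma choose_emb X b : (forall x, x ∊ X -> emb x b) -> exists F : S -> S, d0 F /\ forall x, x ∊ X -> Inj (F x) x b.
Proof.
 intros H. destruct (@choose (fun x f => Inj f x b) (Pw (prod (Un X) b))) as [F [D K]]; [dfn|]. exists F. split; auto.
 intros x Hx. destruct (H x Hx) as [f I]. apply (K x f); auto. apply in_Pw. intros u V.
 apply (proj1 (proj1 I)) in V. apply in_prod in V as [p [q [P [Q ->]]]]. apply op_prod; split; auto. apply in_Un; eauto.
Qed.
End ZFT.

Section WO.
Variable S : ZF.
Implicit Types x y z a b c v w f g h m k : S.

(* The index function [mrecf] enumerates [a] along the ordinals: by replacement it cannot be injective on all of them. *)
Lemma well_order a : exists al (F : S -> S), Ord al /\ d0 F /\ forall y, y ∊ a -> exists z, z ∊ al /\ F z = y.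
Proof.
 destruct (choice_fun a) as [c [Dc Hc]]. set (Phi := fun _ f : S => c (sep a (fun y => ~ y ∊ ran f))).
 assert (DP : dfnp (fun _ e => Phi (e 1) (e 2) = e 0)) by (dfn).
 set (F := mrecf Phi). assert (DF : d0 F) by (apply d0_mrecf, DP).
 assert (HF : forall x, (forall y, y ∊ a -> exists z, z ∊ x /\ F z = y) \/ (F x ∊ a /\ forall z, z ∊ x -> F z <> F x)).
 { intros x. unfold F at 2 4. rewrite mrecf_eq by exact DP. fold F. set (f := img _ x).
  assert (R : forall y, y ∊ ran f <-> exists z, z ∊ x /\ F z = y).
  { intros y. rewrite in_ran. unfold f. setoid_rewrite in_img; [|dfn]. split; [intros [z [z' [Z E]]]; opi; eauto|intros [z [Z <-]]; eauto]. }
  assert (K : forall y, y ∊ sep a (fun y => ~ y ∊ ran f) <-> y ∊ a /\ ~ y ∊ ran f) by (intros; sepd; tauto).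
  destruct (classic (sep a (fun y => ~ y ∊ ran f) = em)) as [E|E].
  - left. intros y Y. apply R, NNPP. intros N. apply (@in_em S y). rewrite <- E. apply K; auto.
  - right. destruct (proj1 (K _) (Hc _ (fun y Y => proj1 (proj1 (K y) Y)) E)) as [K1 K2]. split; [exact K1|]. intros z Z Q. apply K2, R. eauto. }
 assert (Ex : exists al, Ord al /\ forall y, y ∊ a -> exists z, z ∊ al /\ F z = y).
 { apply NNPP. intros N. assert (HF' : forall x, Ord x -> F x ∊ a /\ forall z, z ∊ x -> F z <> F x) by (intros x X; destruct (HF x); auto; destruct N; eauto).
  destruct (@z_repl S (fun y x => Ord x /\ F x = y)) with (a := a) as [b B]; [dfn| |].
  - intros y Y x x' [X E] [X' E']. subst y. destruct (Ord_tri X X') as [Q|[Q|Q]]; auto; exfalso; [apply (proj2 (HF' x' X') x)|apply (proj2 (HF' x X) x')]; auto.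
  - assert (Bo : forall x, x ∊ b <-> Ord x) by (intros x; rewrite B; split; [intros [y [_ [X _]]]; auto|intros X; exists (F x); split; [apply HF'|]; auto]).
   apply (@nin S b), Bo. split; [intros y Y z Z; apply Bo; apply Bo in Y; apply (Ord_in Y Z)|intros y Y; apply Bo in Y; exact (proj1 Y)]. }
 destruct Ex as [al [O HA]]. eauto.
Qed.
End WO.

(** * Countable unions, and regularity of omega1 and omega2 *)

Section Om1.
Variable S : ZF.
Implicit Types x y z a b c v w f g h m k o : S.

(** A point goes to the index of a set containing it and to its place in that set, under injections
    chosen simultaneously. *)
Lemma emb_cover (F : S -> S) a b k m : d0 F -> emb a k -> (forall x, x ∊ a -> emb (F x) m) -> (forall z, z ∊ b -> exists x, x ∊ a /\ z ∊ F x) ->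
 emb b (prod k m).
Proof.
 intros D [f A] H K. destruct (@choose_emb S (img F a) m) as [C [DC HC]]; [intros y Y; rewrite in_img in Y by auto; destruct Y as [x [X <-]]; auto|].
 assert (HC' : forall x, x ∊ a -> Inj (C (F x)) (F x) m) by (intros x X; apply HC; rewrite in_img by auto; eauto).
 destruct (@choose S (fun z x => z ∊ F x) a) as [G [DG KG']]; [dfn|].
 assert (KG : forall z, z ∊ b -> G z ∊ a /\ z ∊ F (G z)) by (intros z Z; destruct (K z Z) as [x [X Y]]; eauto).
 apply emb_lam with (F := fun z => op (app f (G z)) (app (C (F (G z))) z)); [dfn| |].
 - intros y Y. destruct (KG y Y) as [G1 G2]. apply op_prod. split; [apply (app_cod (proj1 A) G1)|apply (app_cod (proj1 (HC' _ G1)) G2)].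
 - intros y y' Y Y' [E E']%op_inj. destruct (KG y Y) as [G1 G2], (KG y' Y') as [G3 G4]. apply (Inj_app A G1 G3) in E. rewrite <- E in *. apply (Inj_app (HC' _ G1) G2 G4 E').
Qed.
Lemma ctb_cover (F : S -> S) a b : d0 F -> ctb a -> (forall x, x ∊ a -> ctb (F x)) -> (forall z, z ∊ b -> exists x, x ∊ a /\ z ∊ F x) -> ctb b.
Proof. intros D A H K. exact (emb_trans (emb_cover D A H K) (@ctb_prod S)). Qed.
Lemma ctb_Un_ch a : ctb a -> (forall x, x ∊ a -> ctb x) -> ctb (Un a).
Proof. intros A H. apply (ctb_cover (F := fun x => x) (a := a)); [dfn|auto|auto|]. intros z; apply in_Un. Qed.
Lemma fin_ctb a : fin a -> ctb a.
Proof.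
 intros [n [N H]]. refine (emb_trans H (emb_sub _)). exact (proj1 (@Ord_om S) _ N).
Qed.
Lemma ctb_om : ctb (@om S).
Proof. apply emb_sub, Sub_refl. Qed.
Lemma ctb_cup a b : ctb a -> ctb b -> ctb (cup a b).
Proof.
 intros A B. apply ctb_Un_ch.
 - apply fin_ctb. apply fin_sub with (b := adj (adj em a) b); [|apply fin_adj, fin_adj, fin_em].
  intros z Z; rewrite !in_adj; apply in_up in Z; tauto.
 - intros x X; apply in_up in X; destruct X; subst; auto.
Qed.
Lemma fin_sg a : fin (sg a).
Proof.
 apply fin_sub with (b := adj em a); [|apply fin_adj, fin_em]. intros z Z; apply in_sg in Z; apply in_adj; auto.
Qed.
Lemma ctb_adj a b : ctb a -> ctb (adj a b).
Proof. intros A; apply ctb_cup; auto. apply fin_ctb, fin_sg. Qed.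

Section Omega1.
Variable o : S.
Hypothesis Ho : isom1 o.
Lemma om1_ord x : x ∊ o -> Ord x.
Proof. apply Ord_in, Ho. Qed.
(** The supremum of a countable set of countable ordinals is a countable union of countable sets, so
    its successor is still below o. *)
Lemma om1_ctb_bdd B : Sub B o -> ctb B -> exists g, g ∊ o /\ forall x, x ∊ B -> x ∊ g.
Proof.
 intros SB C. assert (OU : Ord (Un B)) by (apply Ord_Un; intros x X; apply om1_ord; auto).
 assert (CU : ctb (sc (Un B))).
 { apply ctb_adj, ctb_Un_ch; auto. intros x X; apply Ho; auto. }
 assert (K : sc (Un B) ∊ o).
 { destruct (Ord_tri (Ord_sc OU) (proj1 Ho)) as [H|[H|H]]; auto.
  - destruct Ho as [_ [N _]]. rewrite <- H in N. tauto.
  - destruct Ho as [_ [N _]]. destruct N. apply (ctb_sub (b := sc (Un B))); auto.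
   exact (proj1 (Ord_sc OU) _ H). }
 exists (sc (Un B)); split; auto. intros x X. apply (Ord_le_lt (y := Un B)).
 - apply om1_ord; auto.
 - apply Ord_sc; auto.
 - intros z Z; apply in_Un; eauto.
 - apply sc_in.
Qed.
Lemma om1_S x : x ∊ o -> sc x ∊ o.
Proof.
 intros X. assert (C : ctb (sc x)) by (apply ctb_adj, Ho; auto).
 assert (OX := om1_ord X). destruct (Ord_tri (Ord_sc OX) (proj1 Ho)) as [H|[H|H]]; auto.
 - destruct Ho as [_ [N _]]. rewrite <- H in N. tauto.
 - apply in_sc in H as [H|H]; [destruct (nin2 H X)|subst; destruct (nin X)].
Qed.
Lemma om1_om : Sub (@om S) o.
Proof.
 intros n N. destruct (Ord_tri (om_ord N) (proj1 Ho)) as [H|[H|H]]; auto; exfalso.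
 - apply (proj1 (proj2 Ho)). rewrite <- H. apply fin_ctb, fin_nat; auto.
 - apply (proj1 (proj2 Ho)). apply fin_ctb, fin_nat. apply (om_tr N H).
Qed.

Lemma om1_sq : emb (prod o o) o.
Proof.
 apply emb_square; [apply Ho|apply om1_S|]. intros m M H. apply Ho.
 assert (C : ctb m) by (apply Ho, M). exact (emb_trans H (ctb_prod2 C C)).
Qed.
Lemma om1_om_emb : emb (prod o om) o.
Proof. exact (emb_trans (emb_prod (emb_sub (@Sub_refl S o)) (emb_sub om1_om)) om1_sq). Qed.

Variable d : S.
Hypothesis Hd : Ord d /\ ~ emb d o /\ forall b, b ∊ d -> emb b o.
(** If the values were unbounded, each g in d would be determined by an index w with g at most F w
    together with the place of g under a chosen injection of F w into omega1, and d would embed into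
    omega1. *)
Lemma om2_bdd W (F : S -> S) : d0 F -> emb W o -> (forall w, w ∊ W -> F w ∊ d) -> exists g, g ∊ d /\ forall w, w ∊ W -> F w ∊ g.
Proof.
 intros DF EW HF. contra N. apply (proj1 (proj2 Hd)).
 assert (K0 : forall g, g ∊ d -> exists x, x ∊ W /\ Sub g (F x)).
 { intros g G. contra K; apply N. exists g; split; auto. intros x X.
  apply Ord_nle; [apply (Ord_in (proj1 Hd) G)|apply (Ord_in (proj1 Hd)), (HF x X)|]. intros H; apply K; eauto. }
 assert (H1 : emb (prod W (prod o om)) o) by exact (emb_trans (emb_prod EW om1_om_emb) om1_sq).
 refine (emb_trans _ H1).
 destruct (choose_emb (proj2 (proj2 Hd))) as [c [D CW]]. destruct (@choose S (fun g x => Sub g (F x)) W) as [co [Do CX']]; [dfn|].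
 assert (CX : forall g, g ∊ d -> co g ∊ W /\ Sub g (F (co g))) by (intros g G; destruct (K0 g G) as [x [X Y]]; eauto).
 set (x0 := fun g : S => F (co g)).
 assert (Hx0 : forall g, g ∊ d -> x0 g ∊ d) by (intros g G; apply HF, CX; auto).
 assert (LE : forall g, g ∊ d -> g = x0 g \/ g ∊ x0 g).
 { intros g G. assert (K := proj2 (CX g G)). apply Ord_le in K; [tauto|apply (Ord_in (proj1 Hd) G)|apply (Ord_in (proj1 Hd) (Hx0 g G))]. }
 (* The last component is a flag: 0 if g is the chosen value itself, 1 if g lies below it. *)
 apply emb_lam with (F := fun g => op (co g) (ifeq g (x0 g) (op em em) (op (app (c (x0 g)) g) (sc em)))).
 - dfn.
 - intros g G. apply op_prod; split; [apply CX; auto|]. destruct (classic (g = x0 g)) as [E|E].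
  + rewrite <- E, ifeq_l. apply op_prod; split; [apply om1_om|]; apply om_0.
  + rewrite ifeq_r by auto. destruct (LE g G) as [|L]; [tauto|]. apply op_prod; split; [|apply om_S, om_0].
   apply (app_cod (proj1 (CW _ (Hx0 g G)))); auto.
 - intros g g' G G' [E1 E2]%op_inj.
  assert (E3 : x0 g = x0 g') by (unfold x0; rewrite E1; auto).
  assert (NE : sc (@em S) <> em) by (intros K; apply (@in_em S em); rewrite <- K at 2; apply sc_in).
  destruct (classic (g = x0 g)) as [Q|Q]; destruct (classic (g' = x0 g')) as [Q'|Q'].
  + congruence.
  + rewrite <- Q, ifeq_l, ifeq_r in E2 by auto. apply op_inj2 in E2. destruct (NE (eq_sym E2)).
  + rewrite <- Q', ifeq_l, ifeq_r in E2 by auto. apply op_inj2 in E2. destruct (NE E2).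
  + rewrite !ifeq_r in E2 by auto. opi. rewrite <- E3 in *.
   destruct (LE g G) as [|L]; [tauto|]. destruct (LE g' G') as [|L']; [congruence|].
   rewrite <- E3 in L'. apply (Inj_app (CW _ (Hx0 g G))); auto.
Qed.
End Omega1.
End Om1.

Section Subst.
Variables (S : SetM) (I : Type) (U : I -> S -> Prop) (E : I -> S -> S -> Prop).
Notation dfn := (dfn (@smem S) U E).
Notation dft := (dft (@smem S) U E).
Fixpoint xfm (c : xc) : fm :=
 match c with
 | xMem i j => fmem i j | xBot => fbot | xImp a b => fimp (xfm a) (xfm b) | xAnd a b => fand (xfm a) (xfm b)
 | xOr a b => for_ (xfm a) (xfm b) | xAll a => fall (xfm a) | xEx a => fex (xfm a)
 end.
Lemma sat_xfm c i : forall e, sat (@smem S) (U i) (E i) (xfm c) e <-> tr (xd c e).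
Proof.
 induction c; intros; simpl; try rewrite IHc1, IHc2; try tauto.
 - split; intros K x; apply IHc, K.
 - split; intros [x K]; exists x; eapply IHc, K.
Qed.
Lemma d_pcod A (ts : nat -> I -> (nat -> S) -> S) : PCod A -> (forall n, dft (ts n)) -> dfn (fun i e => A S (@smem S) (fun n => ts n i e)).
Proof.
 intros [c C] H. apply d_ext with (A := fun i e => sat (@smem S) (U i) (E i) (xfm c) (fun n => ts n i e)).
 { intros i e. rewrite sat_xfm, C; tauto. }
 apply d_subst_sat; auto.
Qed.
End Subst.

(** * Forcing and generic extensions *)

Section Poset.
Variable S : ZF.
Variables P L : S.
Implicit Types x y z a b p q r s : S.
Definition le q p := q ∊ P /\ op q p ∊ L.
Lemma t_below q p : below (@smem S) P L q p <-> le q p.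
Proof. unfold below, le. rewrite t_maps. tauto. Qed.
Record poset : Prop := {
 le_refl : forall p, p ∊ P -> le p p;
 le_tr : forall p q r, le r q -> le q p -> le r p;
 le_in : forall p q, le q p -> p ∊ P
}.
Hypothesis HP : poset.

Lemma le_in1 q p : le q p -> q ∊ P.
Proof. intros H; apply H. Qed.

Notation fmm := (forces_mem (@smem S) P L).
(** Forcing for the ground model expanded by the generic filter, [fU], and by membership in the
    extension, [fE]. The variables range over names, and [fmem] is membership in the ground model,
    which every condition decides. *)
Fixpoint fo (c : fm) (p : S) (e : nat -> S) : Prop :=
 match c with
 | fmem i j => e i ∊ e j
 | fU i => e i ∊ P /\ forall q, le q p -> exists r, le r q /\ le r (e i)
 | fE i j => fmm p (e i) (e j)
 | fbot => False
 | fimp a b => forall q, le q p -> fo a q e -> fo b q e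
 | fand a b => fo a p e /\ fo b p e
 | for_ a b => forall q, le q p -> exists r, le r q /\ (fo a r e \/ fo b r e)
 | fall a => forall x, fo a p (scons x e)
 | fex a => forall q, le q p -> exists r, le r q /\ exists x, fo a r (scons x e)
 end.

Lemma fo_mono c : forall p q e, le q p -> fo c p e -> fo c q e.
Proof.
 pose proof (le_tr HP) as T.
 induction c; intros p q e H K; simpl in *; auto.
 - destruct K; split; eauto.
 - intros r R. rewrite t_below in R. apply K. rewrite t_below; eauto.
 - eauto.
 - destruct K; split; eauto.
 - eauto.
 - eauto.
 - eauto.
Qed.
(** A statement forced densely below p is forced by p: the clauses for the filter, for membership,
    for disjunctions and for existence are themselves density clauses, and the others inherit the
    property. *)
Lemma fo_reg c : forall p e, p ∊ P -> (forall q, le q p -> exists r, le r q /\ fo c r e) -> fo c p e.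
Proof.
 pose proof (le_tr HP) as T. pose proof (le_refl HP) as R.
 induction c; intros p e H K; simpl in *; auto.
 - destruct (K p (R p H)) as [r [_ X]]; auto.
 - split; [destruct (K p (R p H)) as [r [_ X]]; tauto|].
  intros q Q. destruct (K q Q) as [r [X [_ Y]]]. destruct (Y r) as [r' [A B]]; [apply R, X|]. eauto.
 - intros q Q. rewrite t_below in Q. destruct (K q Q) as [r [X Y]]. destruct (Y r) as [q' [rho [r' Z]]]; [rewrite t_below; apply R, X|].
  exists q', rho, r'. rewrite t_below in *. intuition; eauto.
 - destruct (K p (R p H)) as [r [_ X]]; auto.
 - intros q Q A. apply IHc2; [apply Q|]. intros r X. destruct (K r) as [r' [Y Z]]; [eauto|]. exists r'; split; auto.
  apply Z; [apply R, Y|]. apply (fo_mono (p := q)); eauto.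
 - split; [apply IHc1|apply IHc2]; auto; intros q Q; destruct (K q Q) as [r [X Y]]; exists r; tauto.
 - intros q Q. destruct (K q Q) as [r [X Y]]. destruct (Y r) as [r' [A B]]; [apply R, X|]. eauto.
 - intros x. apply IHc; auto. intros q Q; destruct (K q Q) as [r [X Y]]; eauto.
 - intros q Q. destruct (K q Q) as [r [X Y]]. destruct (Y r) as [r' [A B]]; [apply R, X|]. eauto.
Qed.
Lemma fo_neg c p e : p ∊ P -> ~ fo c p e -> exists q, le q p /\ forall r, le r q -> ~ fo c r e.
Proof.
 intros H N. contra K. apply N, fo_reg; auto. intros q Q. contra X. apply K; exists q; split; auto.
 intros r R Y; apply X; eauto.
Qed.

Lemma d_fo I (U : I -> S -> Prop) E c : forall ts (t : I -> (nat -> S) -> S), dfts U E t -> (forall n, dfts U E (ts n)) ->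
 dfns U E (fun i e => fo c (t i e) (fun n => ts n i e)).
Proof.
 assert (K : forall (ts : nat -> I -> (nat -> S) -> S) i e x, scons x (fun n => ts n i e) = fun n => (match n with 0 => fun i e => e 0 | Datatypes.S n => fun i e => ts n i (etl e) end) i (scons x e)).
 { intros; extensionality n; destruct n; reflexivity. }
 assert (K' : forall ts : nat -> I -> (nat -> S) -> S, (forall n, dfts U E (ts n)) -> forall n, dfts U E (match n with 0 => fun i e => e 0 | Datatypes.S n => fun i e => ts n i (etl e) end)).
 { intros ts H [|n]; [apply ft_var|apply (@ft_ren _ _ _ _ (ts n) (fun k => Datatypes.S k)); auto]. }
 assert (SH : forall t, dfts U E t -> dfts U E (fun i e => t i (etl e))) by (intros; apply (@ft_ren _ _ _ _ t (fun k => Datatypes.S k)); auto).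
 induction c; intros ts t T H; simpl.
 - apply d_mem; auto.
 - pose proof (H i) as Hi. dfn.
 - apply (@d_pcod S I U E (fun V mem e => forces_mem mem (e 0) (e 1) (e 2) (e 3) (e 4))
   (fun n => match n with 0 => fun _ _ => P | 1 => fun _ _ => L | 2 => t | 3 => ts i | _ => ts j end)).
  + pcod.
  + intros [|[|[|[|n]]]]; auto; apply ft_const.
 - apply d_false.
 - apply d_all, d_imp; [dfn|]. apply d_imp; [apply (IHc1 (fun n i e => ts n i (etl e)))|apply (IHc2 (fun n i e => ts n i (etl e)))]; auto; apply ft_var.
 - apply d_and; auto.
 - apply d_all, d_imp; [dfn|]. apply d_ex, d_and; [dfn|]. apply d_or; [apply (IHc1 (fun n i e => ts n i (etl (etl e))))|apply (IHc2 (fun n i e => ts n i (etl (etl e))))]; auto; try apply ft_var; intros; apply (SH (fun i e => ts n i (etl e))); auto.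
 - apply d_all. eapply d_ext; [|apply (IHc _ (fun i e => t i (etl e)) (SH t T) (K' ts H))]. intros i e; cbv beta; match goal with |- fo _ _ ?a <-> fo _ _ ?b => replace a with b; [tauto|extensionality n; destruct n; reflexivity] end.
 - apply d_all, d_imp; [dfn|]. apply d_ex, d_and; [dfn|]. apply d_ex.
  eapply d_ext; [|apply (IHc _ (fun i e => e 1) (ft_var _ _ 1) (K' (fun n i e => ts n i (etl (etl e))) (fun n => SH _ (SH _ (H n)))))].
  intros i e; cbv beta; match goal with |- fo _ _ ?a <-> fo _ _ ?b => replace a with b; [tauto|extensionality n; destruct n; reflexivity] end.
Qed.

Notation gen := (generic (@smem S) P L).
Notation gext := (ext (@smem S) P L).

Lemma gen_sub g p : gen g -> g p -> p ∊ P.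
Proof. intros H; apply (generic_sub H). Qed.
Lemma gen_up g p q : gen g -> g q -> le q p -> g p.
Proof. intros H Q K. apply (generic_up H Q); [apply (le_in HP K)|apply t_below; auto]. Qed.
Lemma gen_dir g p q : gen g -> g p -> g q -> exists r, g r /\ le r p /\ le r q.
Proof. intros H A B. destruct (generic_dir H A B) as [r R]; exists r. rewrite !t_below in R; auto. Qed.
Lemma gen_dense g (D : S -> Prop) : gen g -> dfn0 (@smem S) D -> (forall p, p ∊ P -> exists q, D q /\ le q p) -> exists p, g p /\ D p.
Proof.
 intros H DD K. destruct (@generic_dense _ _ _ _ _ H (sep P D)) as [p [A B]].
 - split; [intros x X; change (x ∊ sep P D) in X; change (x ∊ P); rewrite in_sep in X by auto; tauto|]. intros p A. destruct (K p A) as [q [B C]]. exists q.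
  rewrite in_sep, t_below by auto. repeat split; auto; apply C.
 - exists p; split; auto. rewrite in_sep in B; tauto.
Qed.
Lemma gen_below g (D : S -> Prop) p : gen g -> g p -> dfn0 (@smem S) D -> (forall q, le q p -> exists r, D r /\ le r q) -> exists q, g q /\ D q /\ le q p.
Proof.
 (* The conditions incompatible with p are added to make the set dense below every condition; none
    of them can be in the filter. *)
 intros H A DD K. destruct (@gen_dense g (fun q => (D q /\ le q p) \/ ~ exists r, le r q /\ le r p)) as [q [Q R]]; auto.
 - unfold dfn0 in *; dfn.
 - intros q Q. destruct (classic (exists r, le r q /\ le r p)) as [[r [R1 R2]]|N].
  + destruct (K r R2) as [r' [A1 A2]]. exists r'. split; [left; split; auto|]; apply (le_tr HP A2); auto.
  + exists q; split; auto. apply (le_refl HP Q).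
 - destruct R as [[R1 R2]|N]; eauto. destruct (gen_dir H A Q) as [r R]. destruct N; exists r; tauto.
Qed.
Lemma gen_dec g (D : S -> Prop) : gen g -> dfn0 (@smem S) D -> exists p, g p /\ (D p \/ forall q, le q p -> ~ D q).
Proof.
 intros H DD. apply (@gen_dense g (fun p => D p \/ forall q, le q p -> ~ D q)); auto.
 - unfold dfn0 in *; dfn.
 - intros p A. destruct (classic (exists q, le q p /\ D q)) as [[q [B C]]|N]; [eauto 8|].
  exists p; split; [|apply (le_refl HP A)]. right; intros q Q K; eauto.
Qed.

Lemma dfo0 c e : dfn0 (@smem S) (fun p => fo c p e).
Proof. apply (@d_fo _ _ _ c (fun n _ _ => e n) (fun _ e => e 0)); [apply ft_var|intros; apply ft_const]. Qed.
Lemma dfo1 c e : dfn0 (@smem S) (fun p => exists x, fo c p (scons x e)).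
Proof.
 unfold dfn0. apply d_ex.
 eapply d_ext; [|apply (@d_fo _ _ _ c (fun n => match n with 0 => fun _ e => e 0 | Datatypes.S n => fun _ _ => e n end) (fun _ e => e 1))].
 - intros i e'. unfold etl. match goal with |- fo c _ ?a <-> fo c _ ?b => replace a with b; [tauto|extensionality n; destruct n; reflexivity] end.
 - apply ft_var.
 - intros [|n]; [apply ft_var|apply ft_const].
Qed.

(** The truth lemma for the expanded language. The dense sets that the filter has to meet are sets
    of the model because [fo] is definable. *)
Theorem fo_truth g : gen g -> forall c e, sat (@smem S) g (gext g) c e <-> exists p, g p /\ fo c p e.
Proof.
 intros H. destruct (generic_nonempty H) as [p0 G0]. induction c; intros e; simpl.
 - split; [eauto|intros [p [_ A]]; auto].
 - split.
  + intros A. exists (e i); split; auto. split; [apply (gen_sub H A)|]. intros q Q; exists q; split; auto. apply (le_refl HP), Q.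
  + intros [p [A [B C]]]. destruct (@gen_below g (fun q => le q (e i)) p H A) as [q [Q1 [Q2 Q3]]].
   * dfn.
   * intros q Q; destruct (C q Q) as [r R]; exists r; tauto.
   * apply (gen_up H Q1 Q2).
 - unfold ext; tauto.
 - split; [tauto|intros [p [_ []]]].
 - rewrite IHc1, IHc2. split.
  + intros A. destruct (@gen_dec g (fun q => fo c1 q e /\ ~ exists r, le r q /\ fo c2 r e)) as [p [G1 D]]; auto.
   { unfold dfn0. apply d_and; [apply (dfo0 c1 e)|]. apply d_not, d_ex, d_and; [dfn|].
    exact (d_ren (fun k => 0) (dfo0 c2 e)). }
   destruct D as [[D1 D2]|D].
   * destruct A as [q [Q1 Q2]]; eauto. destruct (gen_dir H G1 Q1) as [r [R1 [R2 R3]]]. destruct D2; exists r; split; auto.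
    apply (fo_mono R3); auto.
   * exists p; split; auto. intros q Q F. apply fo_reg; [apply Q|]. intros r R.
    assert (N := D r (le_tr HP R Q)). apply not_and_or in N as [N|N]; [destruct N; apply (fo_mono R); auto|apply NNPP; auto].
  + intros [p [G1 A]] [q [G2 B]]. destruct (gen_dir H G1 G2) as [r [R1 [R2 R3]]]. exists r; split; auto. apply A; auto. apply (fo_mono R3); auto.
 - rewrite IHc1, IHc2. split.
  + intros [[p [G1 A]] [q [G2 B]]]. destruct (gen_dir H G1 G2) as [r [R1 [R2 R3]]]. exists r; split; auto.
   split; [apply (fo_mono R2)|apply (fo_mono R3)]; auto.
  + intros [p [G1 [A B]]]; split; eauto.
 - rewrite IHc1, IHc2. split.
  + intros [[p [G1 A]]|[p [G1 A]]]; exists p; split; auto; intros q Q; exists q; (split; [apply (le_refl HP), Q|]); [left|right]; apply (fo_mono Q); auto.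
  + intros [p [G1 A]]. destruct (@gen_below g (fun q => fo c1 q e \/ fo c2 q e) p H G1) as [q [Q1 [[Q2|Q2] Q3]]]; eauto.
   * unfold dfn0; apply d_or; apply dfo0.
   * intros q Q; destruct (A q Q) as [r R]; exists r; tauto.
 - split.
  + intros A. destruct (@gen_dec g (fun p => exists x, fo (fimp c fbot) p (scons x e)) H) as [p [G1 [[x D]|D]]].
   { exact (dfo1 (fimp c fbot) e). }
   * destruct (proj1 (IHc _) (A x)) as [q [G2 B]]. destruct (gen_dir H G1 G2) as [r [R1 [R2 R3]]].
    destruct (D r R2). apply (fo_mono R3); auto.
   * exists p; split; auto. intros x. apply fo_reg; [apply (gen_sub H G1)|]. intros q Q.
    contra N. apply (D q Q). exists x. intros r R K. apply N; eauto.
  + intros [p [G1 A]] x. apply IHc. eauto.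
 - split.
  + intros [x A]. apply IHc in A as [p [G1 A]]. exists p; split; auto. intros q Q; exists q; split; [apply (le_refl HP), Q|].
   exists x. apply (fo_mono Q); auto.
  + intros [p [G1 A]]. destruct (@gen_below g (fun q => exists x, fo c q (scons x e)) p H G1) as [q [Q1 [[x Q2] Q3]]]; auto.
   * apply dfo1.
   * intros q Q; destruct (A q Q) as [r R]; exists r; tauto.
   * exists x. apply IHc; eauto.
Qed.

Fixpoint xfE (c : xc) : fm :=
 match c with
 | xMem i j => fE i j | xBot => fbot | xImp a b => fimp (xfE a) (xfE b) | xAnd a b => fand (xfE a) (xfE b)
 | xOr a b => for_ (xfE a) (xfE b) | xAll a => fall (xfE a) | xEx a => fex (xfE a)
 end.
Lemma forces_fo c : forall p e, forces (@smem S) P L p (xd c e) <-> fo (xfE c) p e.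
Proof.
 induction c; intros p e; simpl; try tauto.
 - split; intros A q Q B; apply IHc2, A; auto; try apply IHc1; auto; apply t_below; auto.
 - rewrite IHc1, IHc2; tauto.
 - split; intros A q Q; apply t_below in Q; destruct (A q Q) as [r [R K]]; exists r; rewrite t_below in *; rewrite IHc1, IHc2 in *; auto.
 - split; intros A x; apply IHc, A.
 - split; intros A q Q; apply t_below in Q; destruct (A q Q) as [r [R [x K]]]; exists r; rewrite t_below in *; split; auto; exists x; apply IHc; auto.
Qed.
Lemma sat_xfE g c : forall e, sat (@smem S) g (gext g) (xfE c) e <-> truth (gext g) (xd c e).
Proof.
 induction c; intros; simpl; try rewrite IHc1, IHc2; try tauto.
 - split; intros K x; apply IHc, K.
 - split; intros [x K]; exists x; eapply IHc, K.
Qed.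
Lemma forces_truth g phi : gen g -> Cod phi -> forall e, truth (gext g) (phi S e) <-> exists p, g p /\ forces (@smem S) P L p (phi S e).
Proof.
 intros H [c C] e. rewrite <- C, <- sat_xfE, fo_truth by auto. split; intros [p A]; exists p; rewrite forces_fo in *; auto.
Qed.

Definition Gen := {g : S -> Prop | gen g}.
Definition gU (i : Gen) : S -> Prop := proj1_sig i.
Definition gE (i : Gen) : S -> S -> Prop := gext (proj1_sig i).

(** Below a condition forcing that x is a counterexample, take in the ground model an element m
    minimal among those which some stronger condition forces to be counterexamples. That condition
    then forces A for all elements of m in a, and by genericity such a condition is met. *)
Lemma gen_IndOk : IndOk gU gE.
Proof.
 intros A [c [f C]] i a x X N.
 set (en := fun y : S => join (fun _ : nat => y) f).
 assert (C' : forall y, A i y <-> exists p, gU i p /\ fo c p (en y)).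
 { intros y. rewrite <- (fo_truth (proj2_sig i)). rewrite (C i (fun _ => y)). reflexivity. }
 assert (CN : forall y, ~ A i y <-> exists p, gU i p /\ fo (fimp c fbot) p (en y)).
 { intros y. rewrite <- (fo_truth (proj2_sig i)). rewrite (C i (fun _ => y)). reflexivity. }
 assert (DF : forall c (t : unit -> (nat -> S) -> S) u, dfts (fun _ _ => False) (fun _ _ _ => False) t -> dfts (fun _ _ => False) (fun _ _ _ => False) u ->
  dfnp (fun i e => fo c (t i e) (en (u i e)))).
 { intros c0 t u T K. eapply d_ext; [|apply (@d_fo _ _ _ c0 (fun n => if Nat.even n then u else fun _ _ => f (Nat.div2 n)) t)]; auto.
  - intros j e. unfold en, join. match goal with |- fo _ _ ?a <-> fo _ _ ?b => replace a with b; [tauto|extensionality n; destruct (Nat.even n); reflexivity] end.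
  - intros n; destruct (Nat.even n); auto. apply ft_const. }
 apply CN in N. destruct N as [p [G1 N]].
 destruct (@gen_below (gU i) (fun q => exists m, m ∊ a /\ fo (fimp c fbot) q (en m) /\ forall z, z ∊ m -> z ∊ a -> fo c q (en z)) p (proj2_sig i) G1) as [q [G2 [[m [M1 [M2 M3]]] _]]].
 - unfold dfn0. apply d_ex, d_and; [dfn|apply d_and]; [apply DF; apply ft_var|].
  apply d_all, d_imp; [dfn|]. apply d_imp; [dfn|]. apply DF; apply ft_var.
 - intros q Q. defset B HB (sep a (fun m => exists r, le r q /\ fo (fimp c fbot) r (en m))).
  destruct (@s_found S B x) as [m [M1 M2]].
  { apply HB; split; auto. exists q; split; [apply (le_refl HP), Q|apply (fo_mono Q); auto]. }
  apply HB in M1 as [M1 [r [R1 R2]]]. exists r; split; auto. exists m; spl.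
  intros z Z1 Z2. apply fo_reg; [apply R1|]. intros s S1. contra N'. apply (M2 z Z1). apply HB; split; auto.
  exists s; split; [apply (le_tr HP S1); auto|]. intros s' S2 K. apply N'; eauto.
 - exists m; split; auto; split; [apply CN; eauto|]. intros z Z1 Z2. apply C'; eauto.
Qed.

Definition Forced (A : Gen -> (nat -> S) -> Prop) p e := forall i : Gen, gU i p -> A i e.
Hypothesis cnt : exists f : nat -> S, forall x, exists n, f n = x.
(** The Rasiowa-Sikorski construction: all sets of the model are listed, and step n enters the n-th
    one if it is dense. *)
Lemma gen_ex p : p ∊ P -> exists i : Gen, gU i p.
Proof.
 intros X. destruct cnt as [f Hf].
 pose (st := fun n q => epsilon (s_inh S) (fun r => le r q /\ (dense (@smem S) P L (f n) -> r ∊ f n))).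
 assert (Hst : forall n q, q ∊ P -> le (st n q) q /\ (dense (@smem S) P L (f n) -> st n q ∊ f n)).
 { intros n q Q. apply epsilon_spec with (P := fun r => le r q /\ (dense (@smem S) P L (f n) -> r ∊ f n)).
  destruct (classic (dense (@smem S) P L (f n))) as [D|D].
  - destruct (proj2 D q Q) as [r [R1 R2]]. exists r. rewrite t_below in R2; auto.
  - exists q. split; [apply (le_refl HP Q)|tauto]. }
 pose (sq := fix sq n := match n with 0 => p | Datatypes.S n => st n (sq n) end).
 assert (SP : forall n, sq n ∊ P) by (induction n; simpl; auto; apply Hst; auto).
 assert (SD : forall n m, n <= m -> le (sq m) (sq n)).
 { intros n m H; induction H; [apply (le_refl HP); auto|]. simpl. apply (le_tr HP (proj1 (Hst m (sq m) (SP m)))); auto. }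
 assert (G : gen (fun q => q ∊ P /\ exists n, le (sq n) q)).
 { split.
  - intros q Q; apply Q.
  - exists p; split; auto. exists 0. apply (le_refl HP X).
  - intros q r [_ [n N]] Q K. split; auto. exists n. apply t_below in K. apply (le_tr HP N K).
  - intros q r [Q [n N]] [R [m M]]. exists (sq (max n m)). split; [split; auto|].
   + exists (max n m). apply (le_refl HP); auto.
   + rewrite !t_below. split; [apply (le_tr HP (SD n (max n m) ltac:(lia)) N)|apply (le_tr HP (SD m (max n m) ltac:(lia)) M)].
  - intros A D. destruct (Hf A) as [n N]. subst A. exists (sq (Datatypes.S n)). split; [split; auto|].
   + exists (Datatypes.S n). apply (le_refl HP); auto.
   + simpl. apply Hst; auto. }
 exists (exist _ _ G). split; auto. exists 0. apply (le_refl HP X).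
Qed.

Lemma Forced_mono A p q e : le q p -> Forced A p e -> Forced A q e.
Proof. intros H K i G. apply K. apply (gen_up (proj2_sig i) G H). Qed.
Lemma Forced_fo (A : Gen -> (nat -> S) -> Prop) c f : (forall i e, A i e <-> sat (@smem S) (gU i) (gE i) c (join e f)) ->
 forall p e, p ∊ P -> (Forced A p e <-> fo c p (join e f)).
Proof.
 intros H p e X. split.
 - intros K. contra N. apply fo_neg in N; auto. destruct N as [q [Q N]].
  destruct (@gen_ex q) as [i G]; [apply Q|]. assert (B := K i (gen_up (proj2_sig i) G Q)). apply H in B.
  apply (fo_truth (proj2_sig i)) in B as [r [R B]]. destruct (gen_dir (proj2_sig i) G R) as [s [S1 [S2 S3]]].
  apply (N s S2). apply (fo_mono S3); auto.
 - intros K i G. apply H. apply (fo_truth (proj2_sig i)). eauto.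
Qed.
Lemma d_Forced (A : Gen -> (nat -> S) -> Prop) : dfns gU gE A -> forall I (U : I -> S -> Prop) E t ts,
 dfts U E t -> (forall n, dfts U E (ts n)) ->
 dfns U E (fun i e => t i e ∊ P /\ Forced A (t i e) (fun n => ts n i e)).
Proof.
 intros [c [f C]] I U E t ts T H. apply d_ext with (A := fun i e => t i e ∊ P /\ fo c (t i e) (join (fun n => ts n i e) f)).
 - intros i e. split; intros [X K]; split; auto; apply (Forced_fo C); auto.
 - apply d_and; [dfn|]. eapply d_ext; [|apply (@d_fo _ _ _ c (fun n => if Nat.even n then ts (Nat.div2 n) else fun _ _ => f (Nat.div2 n)) t)]; auto.
  + intros j e. unfold join. match goal with |- fo _ _ ?a <-> fo _ _ ?b => replace a with b; [tauto|extensionality n; destruct (Nat.even n); reflexivity] end.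
  + intros n; destruct (Nat.even n); auto. apply ft_const.
Qed.
Lemma Forced_truth A i e : dfns gU gE A -> A i e -> exists p, gU i p /\ p ∊ P /\ Forced A p e.
Proof.
 intros [c [f C]] H. apply C in H. apply (fo_truth (proj2_sig i)) in H as [p [G K]].
 exists p; split; auto. assert (X := gen_sub (proj2_sig i) G). split; auto. apply (Forced_fo C); auto.
Qed.
Lemma Forced_below A i e p : dfns gU gE A -> A i e -> gU i p -> exists q, gU i q /\ le q p /\ Forced A q e.
Proof.
 intros D H G. destruct (Forced_truth D H) as [q [Q [X K]]]. destruct (gen_dir (proj2_sig i) G Q) as [r [R1 [R2 R3]]].
 exists r; spl. apply (Forced_mono R3); auto.
Qed.
Lemma forces_Forced phi p : Cod phi -> p ∊ P -> forall e, forces (@smem S) P L p (phi S e) <-> Forced (fun i e => truth (gE i) (phi S e)) p e.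
Proof.
 intros [c C] X e. rewrite <- C, forces_fo.
 assert (K : forall i e, truth (gE i) (phi S e) <-> sat (@smem S) (gU i) (gE i) (ren (xfE c) (fun n => 2 * n)) (join e e)).
 { intros i e'. rewrite sat_ren. replace (fun n => join e' e' (2 * n)) with e' by (extensionality n; rewrite join_e; auto).
  rewrite <- C. symmetry; apply sat_xfE. }
 split.
 - intros F i G. rewrite <- C. apply sat_xfE. apply (fo_truth (proj2_sig i)); eauto.
 - intros F. contra N. apply fo_neg in N; auto. destruct N as [q [Q N]].
  destruct (@gen_ex q) as [i G]; [apply Q|]. assert (B := F i (gen_up (proj2_sig i) G Q)). simpl in B. rewrite <- C in B.
  apply sat_xfE in B. apply (fo_truth (proj2_sig i)) in B as [r [R B]]. destruct (gen_dir (proj2_sig i) G R) as [s [S1 [S2 S3]]].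
  apply (N s S2). apply (fo_mono S3); auto.
Qed.
End Poset.

(** * Names, and the extension as a model *)

Section Names.
Variable S : ZF.
Variables P L : S.
Implicit Types x y z a b p q r s : S.
Notation le := (le P L).
Hypothesis HP : poset P L.
Notation FE := (forces_eq (@smem S) P L).

Definition subc (R : S -> S -> S -> Prop) p s (t : S) := forall rho r q, op rho r ∊ s -> r ∊ P -> le q p -> le q r ->
 exists rho' r' q', op rho' r' ∊ t /\ r' ∊ P /\ le q' q /\ le q' r' /\ R q' rho rho'.
Definition good T W := trans T /\ forall p s t, p ∊ P -> s ∊ T -> t ∊ T ->
 (op p (op s t) ∊ W <-> subc (fun p s t => op p (op s t) ∊ W) p s t /\ subc (fun p s t => op p (op s t) ∊ W) p t s).
Lemma t_mapsW W p s t : tr (∃ u, opair u s t ∧ maps W p u) <-> op p (op s t) ∊ W.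
Proof.
 assert (K : tr (∃ u, opair u s t ∧ maps W p u) <-> exists u, tr (opair u s t) /\ tr (maps W p u)) by reflexivity.
 rewrite K; split; [intros [u [A B]]; apply t_opair in A; apply t_maps in B; subst; auto|].
 intros; exists (op s t); rewrite t_opair, t_maps; auto.
Qed.
Lemma t_subc W p s t : sub_clause (@smem S) P L W p s t <-> subc (fun p s t => op p (op s t) ∊ W) p s t.
Proof.
 unfold sub_clause, subc; split; intros H rho r q A B C D.
 - rewrite <- t_maps in A. rewrite <- t_below in C, D. destruct (H rho r q A B C D) as [rho' [r' [q' [A1 [A2 [A3 [A4 A5]]]]]]].
  exists rho', r', q'. rewrite t_maps in A1. rewrite t_below in A3, A4. rewrite t_mapsW in A5. auto.
 - rewrite t_maps in A. rewrite t_below in C, D. destruct (H rho r q A B C D) as [rho' [r' [q' [A1 [A2 [A3 [A4 A5]]]]]]].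
  exists rho', r', q'. rewrite t_maps. rewrite !t_below. rewrite t_mapsW. auto.
Qed.
Lemma FE_good p s t : FE p s t <-> exists T W, good T W /\ s ∊ T /\ t ∊ T /\ op p (op s t) ∊ W.
Proof.
 unfold forces_eq. split; intros [T [W H]]; exists T, W.
 - rewrite t_mapsW in H. destruct H as [H1 [H2 [H3 [H4 H5]]]]. split; auto. split; [exact H1|].
  intros p' s' t' A B C. rewrite <- t_mapsW, <- !t_subc. apply H4; auto.
 - rewrite t_mapsW. destruct H as [[H1 H4] [H2 [H3 H5]]]. split; [exact H1|split; [auto|split; [auto|split; [|auto]]]].
  intros p' s' t' A B C. rewrite t_mapsW, !t_subc. apply H4; auto.
Qed.
Lemma dom_T T x y s : trans T -> s ∊ T -> op x y ∊ s -> x ∊ T.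
Proof.
 intros H K L'. assert (A := H s K _ L'). assert (B : sg x ∊ T) by (apply (H _ A); apply in_up; auto).
 apply (H _ B), in_sg; auto.
Qed.

Lemma good_unique T W T' W' : good T W -> good T' W' -> forall s, s ∊ T -> s ∊ T' -> forall t, t ∊ T -> t ∊ T' ->
 forall p, p ∊ P -> (op p (op s t) ∊ W <-> op p (op s t) ∊ W') /\ (op p (op t s) ∊ W <-> op p (op t s) ∊ W').
Proof.
 intros [HT HW] [HT' HW'].
 set (Q := fun s => s ∊ T -> s ∊ T' -> forall t, t ∊ T -> t ∊ T' ->
  forall p, p ∊ P -> (op p (op s t) ∊ W <-> op p (op s t) ∊ W') /\ (op p (op t s) ∊ W <-> op p (op t s) ∊ W')).
 (* A name rho with (rho,r) in s lies three membership levels below s, because of the coding of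
    pairs; the induction therefore carries the claim for two further levels. *)
 assert (ALL : forall s, Q s /\ (forall y, y ∊ s -> Q y) /\ (forall y z, y ∊ s -> z ∊ y -> Q z)).
 { apply (@mem_ind S (fun s => Q s /\ (forall y, y ∊ s -> Q y) /\ (forall y z, y ∊ s -> z ∊ y -> Q z))).
  - apply Min_d. dfn.
  - intros s IH.
   assert (Q1 : forall y, y ∊ s -> Q y) by (intros y Y; apply IH; auto).
   assert (Q2 : forall y z, y ∊ s -> z ∊ y -> Q z) by (intros y z Y Z; apply (IH y Y); auto).
   assert (Q3 : forall rho r, op rho r ∊ s -> Q rho).
   { intros rho r A. destruct (IH _ A) as [_ [_ K]]. apply (K (sg rho)); [apply in_up|apply in_sg]; auto. }
   split; [|split]; auto. intros S1 S2 t T1 T2 p Hp.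
   assert (SS : forall q, q ∊ P -> subc (fun p s t => op p (op s t) ∊ W) q s t <-> subc (fun p s t => op p (op s t) ∊ W') q s t).
   { intros q0 _. split; intros H rho r q A B C D; destruct (H rho r q A B C D) as [rho' [r' [q' [A1 [A2 [A3 [A4 A5]]]]]]];
     exists rho', r', q'; repeat split; auto; try apply A3; try apply A4.
    - apply (Q3 rho r A); eauto using dom_T. apply A3.
    - apply (Q3 rho r A); eauto using dom_T. apply A3. }
   assert (SS' : forall q, q ∊ P -> subc (fun p s t => op p (op s t) ∊ W) q t s <-> subc (fun p s t => op p (op s t) ∊ W') q t s).
   { intros q0 _. split; intros H rho r q A B C D; destruct (H rho r q A B C D) as [rho' [r' [q' [A1 [A2 [A3 [A4 A5]]]]]]];
     exists rho', r', q'; repeat split; auto; try apply A3; try apply A4.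
    - apply (Q3 rho' r' A1); eauto using dom_T. apply A3.
    - apply (Q3 rho' r' A1); eauto using dom_T. apply A3. }
   rewrite !HW, !HW', SS, SS' by auto. tauto. }
 intros s; exact (proj1 (ALL s)).
Qed.

Lemma subc_mono (R R' : S -> S -> S -> Prop) p s t : (forall p s t, R p s t -> R' p s t) -> subc R p s t -> subc R' p s t.
Proof.
 intros H K rho r q A B C D. destruct (K rho r q A B C D) as [rho' [r' [q' E]]]. exists rho', r', q'. intuition.
Qed.
(** W is the union of all sets of triples each of which satisfies its clause relative to the set. If
    the clause of a triple holds relative to W, adjoining it gives another such set, so the triple
    was in W already. *)
Lemma good_ex T : trans T -> exists W, good T W.
Proof.
 intros HT. set (X := prod P (prod T T)).
 set (post := fun V => Sub V X /\ forall p s t, op p (op s t) ∊ V -> subc (fun p s t => op p (op s t) ∊ V) p s t /\ subc (fun p s t => op p (op s t) ∊ V) p t s).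
 set (W := Un (sep (Pw X) post)).
 assert (HW : forall u, u ∊ W <-> exists V, post V /\ u ∊ V).
 { intros u; unfold W; rewrite in_Un. split; intros [V K]; exists V.
  - destruct K as [K1 K2]. rewrite in_sep in K1; [tauto|]. dfn.
  - rewrite in_sep; [|dfn]. rewrite in_Pw. unfold post in *. tauto. }
 exists W; split; auto.
 assert (F1 : forall p s t, op p (op s t) ∊ W -> subc (fun p s t => op p (op s t) ∊ W) p s t /\ subc (fun p s t => op p (op s t) ∊ W) p t s).
 { intros p s t [V [[V1 V2] H]]%HW. apply V2 in H as [H1 H2].
  split; [eapply subc_mono; [|exact H1]|eapply subc_mono; [|exact H2]]; intros; apply HW; exists V; split; auto; split; auto. }
 intros p s t Hp Hs Ht. split; [apply F1|]. intros [K1 K2]. apply HW. exists (adj W (op p (op s t))).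
 split; [|apply in_adj; auto]. split.
 - intros u [H| ->]%in_adj.
  + apply HW in H as [V [[V1 _] V2]]; auto.
  + unfold X; rewrite !op_prod; auto.
 - assert (M : forall p s t, op p (op s t) ∊ W -> op p (op s t) ∊ adj W (op p (op s t)) ) by (intros; apply in_adj; auto).
  intros p' s' t' [H|H]%in_adj.
  + apply F1 in H. destruct H; split; eapply subc_mono; try eassumption; intros; apply in_adj; auto.
  + opi.
   split; eapply subc_mono; try eassumption; intros; apply in_adj; auto.
Qed.

Lemma FE_iff p s t : p ∊ P -> (FE p s t <-> subc FE p s t /\ subc FE p t s).
Proof.
 intros Hp. destruct (tc_ex (up s t)) as [T [T1 T2]]. destruct (good_ex T1) as [W HW].
 assert (Hs : s ∊ T) by (apply T2, in_up; auto). assert (Ht : t ∊ T) by (apply T2, in_up; auto).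
 assert (K : forall q x y, q ∊ P -> x ∊ T -> y ∊ T -> (FE q x y <-> op q (op x y) ∊ W)).
 { intros q x y Q X Y. rewrite FE_good. split; [|intros; eauto 8].
  intros [T' [W' [G [A [B C]]]]]. apply (good_unique HW G X A Y B Q); auto. }
 rewrite K by auto. rewrite (proj2 HW p s t) by auto.
 assert (K' : forall x y, x ∊ T -> y ∊ T -> (subc FE p x y <-> subc (fun p s t => op p (op s t) ∊ W) p x y)).
 { intros x y X Y; split; intros H rho r q A B C D; destruct (H rho r q A B C D) as [rho' [r' [q' [A1 [A2 [A3 [A4 A5]]]]]]];
   exists rho', r', q'; repeat split; auto; try apply A3; try apply A4.
  - apply K; eauto using dom_T. apply A3.
  - apply K in A5; eauto using dom_T. apply A3. }
 rewrite !K' by auto. tauto.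
Qed.
Lemma FE_mono p q s t : le q p -> FE p s t -> FE q s t.
Proof.
 intros Q. rewrite !FE_iff by (apply Q || apply (le_in HP Q)). intros [A B].
 split; intros rho r q' C D E F; [apply (A rho r q')|apply (B rho r q')]; auto; apply (le_tr HP E); auto.
Qed.
Lemma d_FE I (U : I -> S -> Prop) E t1 t2 t3 : dfts U E t1 -> dfts U E t2 -> dfts U E t3 ->
 dfns U E (fun i e => FE (t1 i e) (t2 i e) (t3 i e)).
Proof.
 intros. apply (@d_pcod S I U E (fun V mem e => forces_eq mem (e 0) (e 1) (e 2) (e 3) (e 4))
   (fun n => match n with 0 => fun _ _ => P | 1 => fun _ _ => L | 2 => t1 | 3 => t2 | _ => t3 end)).
 - pcod.
 - intros [|[|[|[|n]]]]; auto; apply ft_const.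
Qed.
Hint Resolve d_FE : dfn.
Notation Gen := (Gen P L).
Notation gU := (@gU S P L).
Notation gE := (@gE S P L).

Definition eqg (i : Gen) s t := exists p, gU i p /\ FE p s t.
Lemma d_gU t : dfts gU gE t -> dfns gU gE (fun i e => gU i (t i e)).
Proof. apply d_U. Qed.
Lemma d_gE t u : dfts gU gE t -> dfts gU gE u -> dfns gU gE (fun i e => gE i (t i e) (u i e)).
Proof. apply d_E. Qed.
Lemma d_eqg t u : dfts gU gE t -> dfts gU gE u -> dfns gU gE (fun i e => eqg i (t i e) (u i e)).
Proof. intros; unfold eqg. apply d_ex, d_and; [apply d_gU, ft_var|]. dfn. Qed.

Lemma gU_sub i p : gU i p -> p ∊ P.
Proof. apply (gen_sub (proj2_sig i)). Qed.
Lemma gU_up i p q : gU i q -> le q p -> gU i p.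
Proof. apply (gen_up HP (proj2_sig i)). Qed.
Lemma gU_dir i p q : gU i p -> gU i q -> exists r, gU i r /\ le r p /\ le r q.
Proof. apply (gen_dir (proj2_sig i)). Qed.
Lemma gU_ne (i : Gen) : exists p, gU i p.
Proof. apply (generic_nonempty (proj2_sig i)). Qed.

(** Evaluation of names: genericity turns the density clause of [forces_mem] into an actual pair
    whose condition is in the filter. *)
Lemma gE_iff i s t : gE i s t <-> exists rho r, op rho r ∊ t /\ gU i r /\ eqg i s rho.
Proof.
 split.
 - intros [p [G F]]. destruct (@gen_below _ _ _ HP (gU i) (fun q => exists rho r, op rho r ∊ t /\ le q r /\ FE q s rho) p (proj2_sig i) G) as [q [Q1 [[rho [r [A [B C]]]] _]]].
  + dfn.
  + intros q Q. rewrite <- t_below in Q. destruct (F q Q) as [q' [rho [r [A [B [C [D E]]]]]]]. exists q'.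
   rewrite t_maps in B. rewrite t_below in A, D. split; auto. eauto 8.
  + exists rho, r; split; auto; split; [apply (gU_up Q1 B)|exists q; auto].
 - intros [rho [r [A [B [p0 [G F]]]]]]. destruct (gU_dir B G) as [p [P1 [P2 P3]]]. exists p; split; auto.
  intros q Q. rewrite t_below in Q. exists q, rho, r. rewrite t_maps, !t_below. split; [apply (le_refl HP), Q|].
  split; auto; split; [apply (gU_sub B)|]. split; [apply (le_tr HP Q P2)|]. apply (FE_mono (le_tr HP Q P3) F).
Qed.
Lemma eqg_iff i s t : eqg i s t <-> (forall rho r, op rho r ∊ s -> gU i r -> gE i rho t) /\ (forall rho r, op rho r ∊ t -> gU i r -> gE i rho s).
Proof.
 assert (H1 : forall s t p, gU i p -> subc FE p s t -> forall rho r, op rho r ∊ s -> gU i r -> gE i rho t).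
 { clear s t. intros s t p G F rho r A B. destruct (gU_dir G B) as [q [Q1 [Q2 Q3]]].
  destruct (@gen_below _ _ _ HP (gU i) (fun q => exists rho' r', op rho' r' ∊ t /\ le q r' /\ FE q rho rho') q (proj2_sig i) Q1) as [q' [R1 [[rho' [r' [C [D E]]]] _]]].
  - dfn.
  - intros q' Q'. destruct (F rho r q' A (gU_sub B)) as [rho' [r' [q'' K]]]; [apply (le_tr HP Q' Q2)|apply (le_tr HP Q' Q3)|].
   exists q''; split; [|tauto]. exists rho', r'; tauto.
  - apply gE_iff. exists rho', r'; split; auto; split; [apply (gU_up R1 D)|exists q'; auto]. }
 assert (H2 : forall s t, (forall rho r, op rho r ∊ s -> gU i r -> gE i rho t) -> exists p, gU i p /\ subc FE p s t).
 { clear s t. intros s t H.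
  destruct (@gen_dec _ _ _ HP (gU i) (fun q => exists rho r, op rho r ∊ s /\ le q r /\ forall q', le q' q -> ~ exists rho' r', op rho' r' ∊ t /\ le q' r' /\ FE q' rho rho') (proj2_sig i)) as [p [G D]].
  - dfn.
  - destruct D as [[rho [r [A [B C]]]]|D].
   + assert (K := H rho r A (gU_up G B)). apply gE_iff in K as [rho' [r' [K1 [K2 [p1 [K3 K4]]]]]].
    destruct (gU_dir G K2) as [q [Q1 [Q2 Q3]]]. destruct (gU_dir Q1 K3) as [q' [R1 [R2 R3]]].
    destruct (C q'); [apply (le_tr HP R2 Q2)|]. exists rho', r'; split; auto; split; [apply (le_tr HP R2 Q3)|apply (FE_mono R3 K4)].
   + exists p; split; auto. intros rho r q A B C E. contra N. apply (D q C). exists rho, r; spl.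
    intros q' Q' [rho' [r' [K1 [K2 K3]]]]. apply N. exists rho', r', q'. repeat split; auto; try apply (le_in HP K2); try apply Q'; try apply K2. }
 split.
 - intros [p [G F]]. apply FE_iff in F; [|apply (gU_sub G)]. destruct F as [F1 F2]. split; eapply H1; eauto.
 - intros [A B]. destruct (H2 _ _ A) as [p [G F]]. destruct (H2 _ _ B) as [q [G' F']]. destruct (gU_dir G G') as [r [R1 [R2 R3]]].
  exists r; split; auto. apply FE_iff; [apply (gU_sub R1)|]. split; intros rho r' q' X Y Z; [apply F|apply F']; auto; apply (le_tr HP Z); auto.
Qed.

Lemma name_ind (Q : Gen -> S -> Prop) : dfns gU gE (fun i e => Q i (e 0)) -> forall i,
 (forall s, (forall rho r, op rho r ∊ s -> Q i rho) -> Q i s) -> forall s, Q i s.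
Proof.
 intros D i H.
 assert (ALL : forall s, Q i s /\ (forall y, y ∊ s -> Q i y) /\ (forall y z, y ∊ s -> z ∊ y -> Q i z)).
 { apply (@mem_ind S (fun s => Q i s /\ (forall y, y ∊ s -> Q i y) /\ (forall y z, y ∊ s -> z ∊ y -> Q i z))).
  - apply (@gen_IndOk S P L HP (fun i s => Q i s /\ (forall y, y ∊ s -> Q i y) /\ (forall y z, y ∊ s -> z ∊ y -> Q i z))).
   apply d_and; auto. apply d_and; apply d_all.
   + apply d_imp; [dfn|]. exact D.
   + apply d_all. apply d_imp; [dfn|]. apply d_imp; [dfn|]. exact D.
  - intros s IH.
   assert (Q1 : forall y, y ∊ s -> Q i y) by (intros y Y; apply IH; auto).
   assert (Q2 : forall y z, y ∊ s -> z ∊ y -> Q i z) by (intros y z Y Z; apply (IH y Y); auto).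
   assert (Q3 : forall rho r, op rho r ∊ s -> Q i rho).
   { intros rho r A. destruct (IH _ A) as [_ [_ K]]. apply (K (sg rho)); [apply in_up|apply in_sg]; auto. }
   auto. }
 intros s; apply ALL.
Qed.
Lemma eqg_refl i s : eqg i s s.
Proof.
 revert s. apply (@name_ind (fun i s => eqg i s s)).
 - apply d_eqg; apply ft_var.
 - intros s H. apply eqg_iff. split; intros rho r A B; apply gE_iff; exists rho, r; eauto.
Qed.
Lemma eqg_sym i s t : eqg i s t -> eqg i t s.
Proof. rewrite !eqg_iff; tauto. Qed.
Lemma eqg_trans i s t u : eqg i s t -> eqg i t u -> eqg i s u.
Proof.
 revert s t u. apply (@name_ind (fun i s => forall t u, eqg i s t -> eqg i t u -> eqg i s u)).
 - apply d_all, d_all, d_imp; [apply d_eqg; dfn|]. apply d_imp; apply d_eqg; dfn.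
 - intros s IH t u H K. rewrite eqg_iff in H, K. apply eqg_iff. destruct H as [H1 H2], K as [K1 K2]. split; intros rho r A B.
  + assert (A0 := H1 _ _ A B). apply gE_iff in A0 as [rho' [r' [A1 [A2 A3]]]].
   assert (X := K1 _ _ A1 A2). apply gE_iff in X as [rho'' [r'' [X1 [X2 X3]]]].
   apply gE_iff. exists rho'', r''; spl. apply (IH rho r A _ _ A3 X3).
  + assert (A0 := K2 _ _ A B). apply gE_iff in A0 as [rho' [r' [A1 [A2 A3]]]].
   assert (X := H2 _ _ A1 A2). apply gE_iff in X as [rho'' [r'' [X1 [X2 X3]]]].
   apply gE_iff. exists rho'', r''; spl. apply eqg_sym.
   apply (IH rho'' r'' X1 rho'); apply eqg_sym; auto.
Qed.
Lemma gE_l i s s' t : eqg i s s' -> gE i s t -> gE i s' t.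
Proof.
 rewrite !gE_iff. intros H [rho [r [A [B C]]]]. exists rho, r; spl. apply (eqg_trans (eqg_sym H) C).
Qed.
Lemma gE_r i s t t' : eqg i t t' -> gE i s t -> gE i s t'.
Proof.
 rewrite (gE_iff i s t). intros H [rho [r [A [B C]]]]. apply eqg_iff in H. apply (gE_l (s := rho)); [apply eqg_sym; auto|].
 apply (proj1 H rho r); auto.
Qed.
Lemma gE_name i rho r t : op rho r ∊ t -> gU i r -> gE i rho t.
Proof. intros A B; apply gE_iff; exists rho, r; spl. apply eqg_refl. Qed.
Lemma eqg_ext i s t : (forall z, gE i z s <-> gE i z t) -> eqg i s t.
Proof.
 intros H; apply eqg_iff; split; intros rho r A B; apply H; apply (gE_name A B).
Qed.

Section N.
Variable i : Gen.
Definition nrep s := epsilon (s_inh S) (fun t => eqg i s t).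
Lemma nrep_eq s : eqg i s (nrep s).
Proof. apply epsilon_spec with (P := fun t => eqg i s t). exists s; apply eqg_refl. Qed.
Lemma nrep_congr s t : eqg i s t -> nrep s = nrep t.
Proof.
 intros H; unfold nrep. f_equal. extensionality u. apply propositional_extensionality.
 split; intros K; [apply (eqg_trans (eqg_sym H) K)|apply (eqg_trans H K)].
Qed.
Definition NC := {s : S | nrep s = s}.
Definition Nm (x y : NC) := gE i (proj1_sig x) (proj1_sig y).
Definition val s : NC := exist (fun s => nrep s = s) (nrep s) (eq_sym (nrep_congr (nrep_eq s))).
Lemma NC_eq (x y : NC) : proj1_sig x = proj1_sig y -> x = y.
Proof. destruct x as [x a], y as [y b]; simpl; intros ->; f_equal; apply proof_irrelevance. Qed.
Lemma val_eq s t : val s = val t <-> eqg i s t.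
Proof.
 split.
 - intros H. assert (K : nrep s = nrep t) by (exact (f_equal (@proj1_sig _ _) H)).
  apply (eqg_trans (nrep_eq s)). rewrite K. apply eqg_sym, nrep_eq.
 - intros H; apply NC_eq; simpl; apply nrep_congr; auto.
Qed.
Lemma val_surj (x : NC) : exists s, x = val s.
Proof. exists (proj1_sig x). apply NC_eq; simpl. symmetry; apply (proj2_sig x). Qed.
Lemma val_proj (x : NC) : val (proj1_sig x) = x.
Proof. apply NC_eq; simpl. apply (proj2_sig x). Qed.
Lemma Nm_val s t : Nm (val s) (val t) <-> gE i s t.
Proof.
 unfold Nm; simpl. split; intros H.
 - apply (gE_r (t := nrep t)); [apply eqg_sym, nrep_eq|]. apply (gE_l (s := nrep s)); [apply eqg_sym, nrep_eq|auto].
 - apply (gE_r (t := t)); [apply nrep_eq|]. apply (gE_l (s := s)); [apply nrep_eq|auto].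
Qed.
Lemma Nm_val_iff (x : NC) t : Nm x (val t) <-> exists rho r, op rho r ∊ t /\ gU i r /\ x = val rho.
Proof.
 destruct (val_surj x) as [s ->]. rewrite Nm_val, gE_iff. split; intros [rho [r K]]; exists rho, r; rewrite val_eq in *; auto.
Qed.
Lemma Nm_prod (x : NC) D : Nm x (val (prod D P)) <-> exists rho, rho ∊ D /\ x = val rho.
Proof.
 rewrite Nm_val_iff. destruct (gU_ne i) as [p0 G0]. split.
 - intros [rho [r [A [B ->]]]]. apply op_prod in A. exists rho; tauto.
 - intros [rho [A ->]]. exists rho, p0; split; auto. apply op_prod; split; auto. apply (gU_sub G0).
Qed.

Fixpoint toE (c : fm) : fm :=
 match c with
 | fmem i j => fE i j | fU _ | fE _ _ | fbot => fbot
 | fimp a b => fimp (toE a) (toE b) | fand a b => fand (toE a) (toE b) | for_ a b => for_ (toE a) (toE b)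
 | fall a => fall (toE a) | fex a => fex (toE a)
 end.
Lemma sat_toE c : forall e : nat -> S, sat (@smem S) (gU i) (gE i) (toE c) e <-> sat Nm (fun _ => False) (fun _ _ => False) c (fun n => val (e n)).
Proof.
 assert (K : forall (e : nat -> S) x, (fun n => val (scons x e n)) = scons (val x) (fun n => val (e n))).
 { intros e x; extensionality n; destruct n; reflexivity. }
 induction c; intros e; simpl; try rewrite IHc1, IHc2; try tauto.
 - symmetry; apply Nm_val.
 - split; intros H x.
  + destruct (val_surj x) as [s ->]. rewrite <- K. apply IHc, H.
  + apply IHc. rewrite K. apply H.
 - split.
  + intros [x H]; exists (val x). rewrite <- K. apply IHc, H.
  + intros [x H]. destruct (val_surj x) as [s ->]. exists s; apply IHc; rewrite K; auto.
Qed.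
Lemma N_dfn A : dfn0 Nm A -> exists c f, forall s, A (val s) <-> sat (@smem S) (gU i) (gE i) c (scons s f).
Proof.
 intros [c [f C]].
 exists (ren (toE c) (fun n => match n with 0 => 0 | _ => Datatypes.S n end)), (fun n => proj1_sig (join (fun _ => f 0) f n)).
 intros s. rewrite sat_ren, sat_toE, (C tt (scons (val s) (fun _ => f 0))).
 match goal with |- sat _ _ _ _ ?a <-> sat _ _ _ _ ?b => replace b with a; [tauto|] end.
 extensionality n. destruct n as [|n]; [reflexivity|]. simpl. rewrite val_proj.
 destruct (nat_eo (Datatypes.S n)) as [m [E|E]]; rewrite E.
 - rewrite !join_e. destruct m; [lia|reflexivity].
 - rewrite !join_f; auto.
Qed.

(** The subset is named by the pairs (rho,q) where q lies below a condition attached to rho in s and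
    forces the defining formula at rho. *)
Lemma N_sep A : dfn0 Nm A -> forall a : NC, exists b : NC, forall x : NC, Nm x b <-> Nm x a /\ A x.
Proof.
 intros D a. destruct (val_surj a) as [s ->]. destruct (N_dfn D) as [c [f C]].
 assert (CT : forall t, A (val t) <-> exists p, gU i p /\ fo P L c p (scons t f)).
 { intros t; rewrite C. apply (fo_truth HP (proj2_sig i)). }
 destruct (tc_ex s) as [T [T1 T2]].
 set (b := sep (prod T P) (fun u => exists rho q r, u = op rho q /\ op rho r ∊ s /\ le q r /\ fo P L c q (scons rho f))).
 assert (HB : forall rho q, op rho q ∊ b <-> q ∊ P /\ exists r, op rho r ∊ s /\ le q r /\ fo P L c q (scons rho f)).
 { intros rho q; unfold b. rewrite in_sep.
  - rewrite op_prod. split.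
   + intros [H [rho' [q' [r [E K]]]]]. opi. split; [tauto|]. eauto 8.
   + intros [H [r [K1 [K2 K3]]]]. split; [split; auto|eauto 8].
    assert (X := T2 _ K1). assert (Y : sg rho ∊ T) by (apply (T1 _ X); apply in_up; auto). apply (T1 _ Y), in_sg; auto.
  - unfold dfn0. apply d_ex, d_ex, d_ex. repeat (apply d_and; [dfn|]).
   eapply d_ext; [|apply (@d_fo S P L _ _ _ c (fun n => match n with 0 => fun _ e => e 2 | Datatypes.S n => fun _ _ => f n end) (fun _ e => e 1))].
   + intros j e; unfold etl. match goal with |- fo _ _ _ _ ?a <-> fo _ _ _ _ ?b => replace a with b; [tauto|extensionality n; destruct n; reflexivity] end.
   + apply ft_var.
   + intros [|n]; [apply ft_var|apply ft_const]. }
 exists (val b). intros x. rewrite !Nm_val_iff. split.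
 - intros [rho [q [A1 [A2 ->]]]]. apply HB in A1 as [Q [r [R1 [R2 R3]]]]. split.
  + exists rho, r; split; auto; split; auto. apply (gU_up A2 R2).
  + apply CT; eauto.
 - intros [[rho [r [A1 [A2 ->]]]] B]. apply CT in B as [p [G F]]. destruct (gU_dir A2 G) as [q [Q1 [Q2 Q3]]].
  exists rho, q; split; auto. apply HB. split; [apply (gU_sub Q1)|]. exists r; spl. apply (fo_mono HP Q3); auto.
Qed.
Lemma N_ext : leibniz Nm.
Proof.
 intros x y H. destruct (val_surj x) as [s ->], (val_surj y) as [t ->]. apply val_eq, eqg_ext. intros z. rewrite <- !Nm_val. apply H.
Qed.
End N.

(** * Canonical names of ground-model sets, and the remaining axioms *)

Definition Chk : S -> S := mrecf (fun _ f => prod (ran f) P).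
Lemma Chk_d : dfnp (fun _ e => prod (ran (e 2)) P = e 0).
Proof. dfn. Qed.
Lemma d0_Chk : d0 Chk.
Proof. apply d0_mrecf, Chk_d. Qed.
Lemma Chk_eq x : Chk x = prod (img Chk x) P.
Proof.
 unfold Chk. rewrite mrecf_eq by apply Chk_d. f_equal. fold Chk.
 assert (D := d0_Chk).
 apply sext; intros z; rewrite in_ran, in_img by auto. split.
 - intros [y Y]. rewrite in_img in Y by dfn. destruct Y as [x' [X E]]. opi; eauto.
 - intros [y [Y <-]]. exists y. rewrite in_img by dfn. eauto.
Qed.

Section NChk.
Variable i : Gen.
Definition j x : NC i := val i (Chk x).
Lemma in_j (z : NC i) x : Nm z (j x) <-> exists y, y ∊ x /\ z = j y.
Proof.
 unfold j. rewrite Chk_eq, Nm_prod. split.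
 - intros [rho [R ->]]. rewrite in_img in R by apply d0_Chk. destruct R as [y [Y <-]]; eauto.
 - intros [y [Y ->]]. exists (Chk y); split; auto. rewrite in_img by apply d0_Chk. eauto.
Qed.
Lemma j_inj x y : j x = j y -> x = y.
Proof.
 revert y. refine (@mem_ind S (fun x => forall y, j x = j y -> x = y) _ _ x).
 - apply (@gen_IndOk S P L HP (fun i x => forall y, val i (Chk x) = val i (Chk y) -> x = y)).
  assert (D := d0_Chk). apply d_ext with (A := fun i e => forall y, eqg i (Chk (e 0)) (Chk y) -> e 0 = y).
  + intros; split; intros H y K; apply H; apply val_eq; auto.
  + apply d_all, d_imp; [apply d_eqg; dfn|dfn].
 - clear x. intros x IH y H. apply sext; intros z; split; intros Z.
  + assert (K : Nm (j z) (j y)) by (rewrite <- H; apply in_j; eauto). apply in_j in K as [w [W E]].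
   apply IH in E; subst; auto.
  + assert (K : Nm (j z) (j x)) by (rewrite H; apply in_j; eauto). apply in_j in K as [w [W E]].
   symmetry in E. apply IH in E; auto. subst; auto.
Qed.

Lemma N_pair (x y : NC i) : exists z : NC i, forall w : NC i, Nm w z <-> w = x \/ w = y.
Proof.
 destruct (val_surj x) as [s ->], (val_surj y) as [t ->]. exists (val i (prod (up s t) P)). intros w. rewrite Nm_prod.
 split.
 - intros [rho [R ->]]. apply in_up in R. destruct R; subst; auto.
 - intros [->| ->]; [exists s|exists t]; split; auto; apply in_up; auto.
Qed.
Lemma N_union (a : NC i) : exists u : NC i, forall x : NC i, Nm x u <-> exists y : NC i, Nm y a /\ Nm x y.
Proof.
 destruct (val_surj a) as [s ->]. destruct (tc_ex s) as [T [T1 T2]].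
 assert (DT : forall rho r, op rho r ∊ s -> rho ∊ T).
 { intros rho r K. assert (X := T2 _ K). assert (Y : sg rho ∊ T) by (apply (T1 _ X); apply in_up; auto). apply (T1 _ Y), in_sg; auto. }
 destruct (@N_sep i (fun x : NC i => exists y : NC i, Nm y (val i s) /\ Nm x y)) with (a := val i (prod T P)) as [u H].
 { exists (fex (fand (fmem 0 2) (fmem 1 0))), (fun _ => val i s). intros j0 e. simpl.
  change (join e (fun _ => val i s) 0) with (e 0). change (join e (fun _ => val i s) 1) with (val i s). tauto. }
 exists u. intros x. rewrite H, Nm_prod. split; [tauto|]. intros K; split; auto.
 destruct K as [y [Y X]]. apply Nm_val_iff in Y as [tau [r [A [B ->]]]]. apply Nm_val_iff in X as [rho [r' [A' [B' ->]]]]. exists rho; split; auto. apply (dom_T (x := rho) (y := r') T1 (DT _ _ A) A').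
Qed.
(** With T transitive around s, every subset of the value of s has a name contained in T x P, namely
    the pairs (rho,p) with p forcing rho into it. So the power set of T x P contains enough
    names. *)
Lemma N_power (a : NC i) : exists c : NC i, forall x : NC i, Nm x c <-> forall z : NC i, Nm z x -> Nm z a.
Proof.
 destruct (val_surj a) as [s ->]. destruct (tc_ex s) as [T [T1 T2]].
 assert (DT : forall rho r, op rho r ∊ s -> rho ∊ T).
 { intros rho r K. assert (X := T2 _ K). assert (Y : sg rho ∊ T) by (apply (T1 _ X); apply in_up; auto). apply (T1 _ Y), in_sg; auto. }
 destruct (@N_sep i (fun x : NC i => forall z : NC i, Nm z x -> Nm z (val i s))) with (a := val i (prod (Pw (prod T P)) P)) as [u H].
 { exists (fall (fimp (fmem 0 1) (fmem 0 2))), (fun _ => val i s). intros j0 e. simpl.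
  change (join e (fun _ => val i s) 0) with (e 0). change (join e (fun _ => val i s) 1) with (val i s). tauto. }
 exists u. intros x. rewrite H, Nm_prod. split; [tauto|]. intros K; split; auto.
 destruct (val_surj x) as [t ->].
 assert (DX : dfn0 (@smem S) (fun u => exists rho p, u = op rho p /\ forces_mem (@smem S) P L p rho t)).
 { unfold dfn0. apply d_ex, d_ex, d_and; [dfn|].
  apply (@d_pcod S _ _ _ (fun V mem e => forces_mem mem (e 0) (e 1) (e 2) (e 3) (e 4))
   (fun n => match n with 0 => fun _ _ => P | 1 => fun _ _ => L | 2 => fun _ e => e 0 | 3 => fun _ e => e 1 | _ => fun _ _ => t end)).
  - pcod.
  - intros [|[|[|[|n]]]]; auto; try apply ft_const; apply ft_var. }
 set (x' := sep (prod T P) (fun u => exists rho p, u = op rho p /\ forces_mem (@smem S) P L p rho t)).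
 assert (HX : forall rho p, op rho p ∊ x' <-> rho ∊ T /\ p ∊ P /\ forces_mem (@smem S) P L p rho t).
 { intros rho p; unfold x'. rewrite in_sep.
  - rewrite op_prod. split; [|intros [A [B C]]; split; eauto]. intros [A [rho' [p' [E F]]]]. opi; tauto.
  - auto. }
 exists x'; split; [apply in_Pw; intros v V; unfold x' in V; rewrite in_sep in V; [tauto|auto]|].
 apply N_ext. intros w. split.
 - intros W. assert (W' := K w W). apply Nm_val_iff in W' as [rho [r [A [B ->]]]].
  rewrite Nm_val in W. destruct W as [p [G F]]. apply Nm_val_iff. exists rho, p; split; [|split; [exact G|reflexivity]].
  apply HX. split; [apply (DT _ _ A)|split; [apply (gU_sub G)|exact F]].
 - intros [rho [p [A [B ->]]]]%Nm_val_iff. apply HX in A.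
  apply Nm_val. exists p; split; [exact B|tauto].
Qed.
Lemma N_inf : exists w : NC i, (exists x : NC i, Nm x w /\ forall z : NC i, ~ Nm z x) /\
  forall x : NC i, Nm x w -> exists y : NC i, Nm y w /\ forall z : NC i, Nm z y <-> Nm z x \/ z = x.
Proof.
 exists (j om). split.
 - exists (j em). split; [apply in_j; exists em; split; auto; apply om_0|]. intros z Z. apply in_j in Z as [y [Y _]]. destruct (in_em Y).
 - intros x [n [N ->]]%in_j. exists (j (sc n)). split; [apply in_j; exists (sc n); split; auto; apply om_S; auto|].
  intros z. rewrite !in_j. split.
  + intros [y [Y ->]]. apply in_sc in Y as [Y| ->]; eauto.
  + intros [[y [Y ->]]| ->]; [exists y|exists n]; rewrite in_sc; auto.
Qed.
Lemma N_found (x y : NC i) : Nm y x -> exists m : NC i, Nm m x /\ forall z : NC i, Nm z m -> ~ Nm z x.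
Proof.
 destruct (val_surj x) as [t ->]. intros H. contra N.
 assert (K : forall s, ~ gE i s t).
 { apply (@name_ind (fun i s => ~ gE i s t)).
  - apply d_not, d_gE; [apply ft_var|apply ft_const].
  - intros s IH Hs. apply N. exists (val i s). rewrite Nm_val. split; auto. intros z Z Z'.
   apply Nm_val_iff in Z as [rho [r [A [B ->]]]]. rewrite Nm_val in Z'. apply (IH rho r A Z'). }
 destruct (val_surj y) as [s ->]. apply (K s), Nm_val; auto.
Qed.
Definition NM : SetM := {| scar := NC i; smem := @Nm i; s_ext := @N_ext i; s_pair := N_pair; s_union := N_union;
 s_power := N_power; s_inf := N_inf; s_found := N_found; s_sep := @N_sep i |}.
End NChk.

Section NM.
Variable i : Gen.
Notation N := (NM i).
Definition vl s : N := val i s.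
Definition jj x : N := j i x.
Implicit Types w : N.
Lemma vl_mem s t : vl s ∊ vl t <-> gE i s t.
Proof. apply Nm_val. Qed.
Lemma vl_eq s t : vl s = vl t <-> eqg i s t.
Proof. apply val_eq. Qed.
Lemma vl_surj w : exists s, w = vl s.
Proof. apply val_surj. Qed.
Lemma vl_iff w t : w ∊ vl t <-> exists rho r, op rho r ∊ t /\ gU i r /\ w = vl rho.
Proof. apply Nm_val_iff. Qed.
Lemma vl_prod w D : w ∊ vl (prod D P) <-> exists rho, rho ∊ D /\ w = vl rho.
Proof. apply Nm_prod. Qed.
Lemma in_jj w x : w ∊ jj x <-> exists y, y ∊ x /\ w = jj y.
Proof. apply in_j. Qed.
Lemma jj_inj x y : jj x = jj y -> x = y.
Proof. apply j_inj. Qed.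
Lemma jj_mem x y : jj x ∊ jj y <-> x ∊ y.
Proof. rewrite in_jj. split; [intros [z [Z E]]; apply jj_inj in E; subst; auto|eauto]. Qed.
Lemma jj_Chk x : jj x = vl (Chk x).
Proof. reflexivity. Qed.

Lemma jj_up x y : jj (up x y) = up (jj x) (jj y).
Proof.
 apply sext; intros w. rewrite in_jj, in_up. split.
 - intros [z [Z ->]]. apply in_up in Z. destruct Z; subst; auto.
 - intros [->| ->]; [exists x|exists y]; rewrite in_up; auto.
Qed.
Lemma jj_op x y : jj (op x y) = op (jj x) (jj y).
Proof. unfold op, sg. rewrite !jj_up; auto. Qed.
Lemma jj_em : jj em = em.
Proof. apply sext; intros w; rewrite in_jj. split; [intros [y [Y _]]; destruct (in_em Y)|intros W; destruct (in_em W)]. Qed.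
Lemma jj_adj x y : jj (adj x y) = adj (jj x) (jj y).
Proof.
 apply sext; intros w. rewrite in_jj, in_adj, in_jj. split.
 - intros [z [Z ->]]. apply in_adj in Z. destruct Z; subst; eauto.
 - intros [[z [Z ->]]| ->]; [exists z|exists y]; rewrite in_adj; auto.
Qed.
Lemma jj_sc x : jj (sc x) = sc (jj x).
Proof. apply jj_adj. Qed.
Lemma jj_Ord x : Ord x -> Ord (jj x).
Proof.
 intros O. split; intros w [y [Y ->]]%in_jj.
 - intros v [z [Z ->]]%in_jj. apply jj_mem. apply (Ord_tr O Z Y).
 - intros v V u Hu. apply in_jj in V as [z [Z ->]]. apply in_jj in Hu as [t [Ht ->]].
  apply jj_mem. apply (Ord_tr (Ord_in O Y) Ht Z).
Qed.
Lemma jj_om : jj om = om.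
Proof.
 apply Sub_antisym; intros w W.
 - apply in_jj in W as [n [Hn ->]]. apply in_om. split; [apply jj_Ord, om_ord; auto|].
  assert (K : forall m, m ∊ om -> jj m = em \/ exists k, jj m = sc k).
  { intros m M. destruct (om_case M) as [->|[k [_ ->]]]; [left; apply jj_em|right; exists (jj k); apply jj_sc]. }
  intros m [M| ->]; auto. apply in_jj in M as [m' [M' ->]]. apply K. apply (om_tr Hn M').
 - revert w W. apply om_ind.
  + apply Min_d. dfn.
  + rewrite <- jj_em. apply jj_mem, om_0.
  + intros w _ [n [Hn ->]]%in_jj. rewrite <- jj_sc. apply jj_mem, om_S; auto.
Qed.
Lemma jj_prod x y : jj (prod x y) = prod (jj x) (jj y).
Proof.
 apply sext; intros w. rewrite in_jj, in_prod. split.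
 - intros [z [Z ->]]. apply in_prod in Z as [a [b [A [B ->]]]]. exists (jj a), (jj b). rewrite !jj_mem, jj_op; auto.
 - intros [a [b [A [B ->]]]]. apply in_jj in A; apply in_jj in B. destruct A as [a' [A ->]], B as [b' [B ->]].
  exists (op a' b'). rewrite op_prod, jj_op; auto.
Qed.
Lemma jj_isfun f a b : isfun f a b -> isfun (jj f) (jj a) (jj b).
Proof.
 intros [F1 [F2 F3]]. split; [|split].
 - intros w W. rewrite <- jj_prod. apply in_jj in W as [z [Z ->]]. apply jj_mem; auto.
 - intros w [z [Z ->]]%in_jj. destruct (F2 z Z) as [y Y]. exists (jj y). rewrite <- jj_op. apply jj_mem; auto.
 - intros x y y' X X'. apply in_jj in X; apply in_jj in X'. destruct X as [u [A E]], X' as [u' [A' E']].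
  destruct (proj1 (in_prod _ _ _) (F1 u A)) as [p [q [_ [_ ->]]]]. destruct (proj1 (in_prod _ _ _) (F1 u' A')) as [p' [q' [_ [_ ->]]]].
  rewrite jj_op in E, E'. apply op_inj in E; apply op_inj in E'. destruct E as [-> ->], E' as [E' ->]. apply jj_inj in E'. subst.
  f_equal. eauto.
Qed.
Lemma jj_Inj f a b : Inj f a b -> Inj (jj f) (jj a) (jj b).
Proof.
 intros [F H]. split; [apply jj_isfun; auto|]. intros x x' y X X'.
 assert (A : x ∊ jj a) by (apply (fun_dom (jj_isfun F) X)). assert (A' : x' ∊ jj a) by (apply (fun_dom (jj_isfun F) X')).
 apply in_jj in A; apply in_jj in A'. destruct A as [z [Z ->]], A' as [z' [Z' ->]].
 assert (B : y ∊ jj b) by (apply (fun_cod (jj_isfun F) X)). apply in_jj in B as [w [W ->]].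
 rewrite <- jj_op, jj_mem in X, X'. f_equal. eauto.
Qed.
Lemma jj_emb a b : emb a b -> emb (jj a) (jj b).
Proof. intros [f F]; exists (jj f); apply jj_Inj; auto. Qed.
Lemma jj_ctb a : ctb a -> ctb (jj a).
Proof. unfold ctb. rewrite <- jj_om. apply jj_emb. Qed.

Lemma t_vl phi (e : nat -> S) : Cod phi -> truth (gE i) (phi S e) <-> tr (phi (scar N) (fun n => vl (e n))).
Proof.
 intros [c C]. rewrite <- !C. revert e. clear C phi.
 assert (K : forall (e : nat -> S) x, (fun n => vl (scons x e n)) = scons (vl x) (fun n => vl (e n))).
 { intros e x; extensionality n; destruct n; reflexivity. }
 induction c; intros e; simpl; try rewrite IHc1, IHc2; try tauto.
 - symmetry; apply vl_mem.
 - split; intros H x.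
  + destruct (vl_surj x) as [s ->]. rewrite <- K. apply IHc, H.
  + apply IHc. rewrite K. apply H.
 - split.
  + intros [x H]; exists (vl x). rewrite <- K. apply IHc, H.
  + intros [x H]. destruct (vl_surj x) as [s ->]. exists s; apply IHc; rewrite K; auto.
Qed.

(** A definable list of names becomes a set of the extension, pairing each ground-model index with
    the value of its name. This is how a well-order of names is carried over. *)
Lemma N_enum (h : S -> S) D : d0 h -> exists F : N, forall v, v ∊ F <-> exists a, a ∊ D /\ v = op (jj a) (vl (h a)).
Proof.
 intros Dh. pose (nm := fun a => prod (up (prod (up (Chk a) (Chk a)) P) (prod (up (Chk a) (h a)) P)) P).
 assert (E : forall x y, vl (prod (up x y) P) = up (vl x) (vl y)).
 { intros x y. apply sext; intros w. rewrite vl_prod, in_up. split.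
  - intros [r [R ->]]. apply in_up in R. destruct R; subst; auto.
  - intros [->| ->]; [exists x|exists y]; rewrite in_up; auto. }
 assert (En : forall a, vl (nm a) = op (jj a) (vl (h a))) by (intros a; unfold nm; rewrite !E; reflexivity).
 assert (DC := d0_Chk). assert (Dn : d0 nm) by dfn.
 exists (vl (prod (img nm D) P)). intros v. rewrite vl_prod. split.
 - intros [r [R ->]]. rewrite in_img in R by auto. destruct R as [b [B <-]]. eauto.
 - intros [a [A ->]]. exists (nm a). rewrite in_img by auto. rewrite En. eauto.
Qed.
End NM.

(** One set D of pairs (p,x) describes the part of b cut out by A for all filters simultaneously.
    Such sets replace general names throughout the iteration. *)
Lemma gd_code (A : Gen -> S -> Prop) b : dfns gU gE (fun i e => A i (e 0)) ->
 exists D, Sub D (prod P b) /\ forall i x, x ∊ b -> (A i x <-> exists p, gU i p /\ op p x ∊ D).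
Proof.
 intros [c [f C]]. set (en := fun y : S => join (fun _ : nat => y) f).
 assert (C' : forall i y, A i y <-> exists p, gU i p /\ fo P L c p (en y)).
 { intros i y. rewrite <- (fo_truth HP (proj2_sig i)). rewrite (C i (fun _ => y)). reflexivity. }
 set (D := sep (prod P b) (fun u => exists p x, u = op p x /\ fo P L c p (en x))).
 assert (HD : forall p x, op p x ∊ D <-> p ∊ P /\ x ∊ b /\ fo P L c p (en x)).
 { intros p x. unfold D. rewrite in_sep.
  - rewrite op_prod. split; [|intros [X [Y Z]]; split; [auto|eauto 8]].
   intros [X [p' [x' [E Y]]]]. opi; tauto.
  - unfold dfn0. apply d_ex, d_ex, d_and; [dfn|].
   eapply d_ext; [|apply (@d_fo S P L _ _ _ c (fun n => if Nat.even n then fun _ e => e 0 else fun _ _ => f (Nat.div2 n)) (fun _ e => e 1))].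
   + intros k e. unfold en, join. match goal with |- fo _ _ _ _ ?a <-> fo _ _ _ _ ?b => replace a with b; [tauto|extensionality n; destruct (Nat.even n); reflexivity] end.
   + apply ft_var.
   + intros n; destruct (Nat.even n); [apply ft_var|apply ft_const]. }
 exists D; split.
 - intros u X. unfold D in X. rewrite in_sep in X; [tauto|].
  unfold dfn0. apply d_ex, d_ex, d_and; [dfn|].
   eapply d_ext; [|apply (@d_fo S P L _ _ _ c (fun n => if Nat.even n then fun _ e => e 0 else fun _ _ => f (Nat.div2 n)) (fun _ e => e 1))].
   + intros k e. unfold en, join. match goal with |- fo _ _ _ _ ?a <-> fo _ _ _ _ ?b => replace a with b; [tauto|extensionality n; destruct (Nat.even n); reflexivity] end.
   + apply ft_var.
   + intros n; destruct (Nat.even n); [apply ft_var|apply ft_const].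
 - intros i x X. rewrite C'. split; intros [p [G K]]; exists p; split; auto; [apply HD|apply HD in K; tauto].
  split; [apply (gU_sub G)|auto].
Qed.
Lemma N_real (A : Gen -> S -> Prop) b : dfns gU gE (fun i e => A i (e 0)) ->
 forall i, exists w : NM i, forall v, v ∊ w <-> exists x, v = jj i x /\ x ∊ b /\ A i x.
Proof.
 intros D i. destruct (gd_code b D) as [Dc [H1 H2]]. assert (DC := d0_Chk).
 exists (vl i (img (fun u => op (Chk (pr2 u)) (pr1 u)) Dc)). intros v. rewrite vl_iff. split.
 - intros [rho [r [X [G ->]]]]. rewrite in_img in X by dfn. destruct X as [u [Hu E]].
  assert (Hu' := Hu). apply H1, in_prod in Hu' as [p [x [Hp [Hx ->]]]]. rewrite pr1_op, pr2_op in E.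
  opi. exists x. spl. apply H2; eauto.
 - intros [x [-> [X Y]]]. apply H2 in Y; auto. destruct Y as [p [G Y]]. exists (Chk x), p.
  rewrite in_img by dfn. split; auto. exists (op p x). rewrite pr1_op, pr2_op. auto.
Qed.
End Names.
Arguments gU {S P L}. Arguments gE {S P L}.

(** * Hechler conditions *)

Section Hle.
Variable T : SetM.
Implicit Types n f g k : T.
Lemma hle_i n n' f f' : n ∊ om -> n' ∊ om -> isfun f om om -> isfun f' om om -> Sub n' n -> (forall k, k ∊ n' -> app f k = app f' k) ->
 (forall k, k ∊ om -> Sub (app f' k) (app f k)) -> tr (hechler_le (op n f) (op n' f')).
Proof.
 intros N N' F F' L A B. apply t_hechler_le. exists n, f, n', f'. spl.
 split; [apply (Ord_le (om_ord N') (om_ord N)); auto|]. split.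
 - intros k K y. assert (Ko := om_tr N' K). rewrite (app_iff y F Ko), (app_iff y F' Ko), A by auto. tauto.
 - intros k K y y' Y Y'. apply (app_iff _ F' K) in Y. apply (app_iff _ F K) in Y'. subst.
  apply (Ord_le (om_ord (app_cod F' K)) (om_ord (app_cod F K))); auto.
Qed.
Lemma hle_e n n' f f' : n ∊ om -> n' ∊ om -> isfun f om om -> isfun f' om om -> tr (hechler_le (op n f) (op n' f')) ->
 Sub n' n /\ (forall k, k ∊ n' -> app f k = app f' k) /\ forall k, k ∊ om -> Sub (app f' k) (app f k).
Proof.
 intros N N' F F' [n1 [f1 [n2 [f2 [E1 [E2 [H1 [H2 H3]]]]]]]]%t_hechler_le.
 opi. split; [apply (Ord_le (om_ord N') (om_ord N)); auto|]. split.
 - intros k K. assert (Ko := om_tr N' K). apply (app_iff _ F' Ko). apply H2; auto. apply (app_in F Ko).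
 - intros k K. apply (Ord_le (om_ord (app_cod F' K)) (om_ord (app_cod F K))). exact (H3 k K _ _ (app_in F' K) (app_in F K)).
Qed.
Lemma hle_refl n f : n ∊ om -> isfun f om om -> tr (hechler_le (op n f) (op n f)).
Proof. intros; apply hle_i; auto using Sub_refl. Qed.
(** Pointwise maximum, since the union of two natural numbers is the larger one. *)
Definition mx f g := lam om om (fun k => cup (app f k) (app g k)).
Lemma mx_all f g : isfun f om om -> isfun g om om -> isfun (mx f g) om om /\
 (forall k, k ∊ om -> app (mx f g) k = cup (app f k) (app g k) /\ Sub (app f k) (app (mx f g) k) /\ Sub (app g k) (app (mx f g) k)).
Proof.
 intros F G. assert (D : d0 (fun k => cup (app f k) (app g k))) by dfn.
 assert (C : forall k, k ∊ om -> cup (app f k) (app g k) ∊ om).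
 { intros k K. assert (A := app_cod F K). assert (B := app_cod G K). destruct (Ord_total (om_ord A) (om_ord B)) as [L|L].
  - replace (cup (app f k) (app g k)) with (app g k); auto. apply sext; intros u; rewrite in_cup. split; auto. intros [H|H]; auto.
  - replace (cup (app f k) (app g k)) with (app f k); auto. apply sext; intros u; rewrite in_cup. split; auto. intros [H|H]; auto. }
 split; [exact (lam_fun D C)|]. intros k K. unfold mx. rewrite (app_lam D C K). split; auto. split; intros u U; apply in_cup; auto.
Qed.
Lemma hle_mx n f g : n ∊ om -> isfun f om om -> isfun g om om -> (forall k, k ∊ n -> app f k = app g k) ->
 tr (hechler_le (op n (mx f g)) (op n f)) /\ tr (hechler_le (op n (mx f g)) (op n g)).
Proof.
 intros N F G A. destruct (mx_all F G) as [M1 M2].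
 assert (I : forall x : T, cup x x = x) by (intros; apply sext; intros; rewrite in_cup; tauto).
 split; apply hle_i; auto using Sub_refl; try (intros k K; apply M2; auto); intros k K; destruct (M2 k (om_tr N K)) as [-> _]; rewrite <- A by auto; apply I.
Qed.
(** The function f is left alone below n, where a stem of length n is fixed, and is raised above g
    from n on. *)
Definition mxo n f g := mx f (lam om om (fun k => sep (app g k) (fun _ => ~ k ∊ n))).
Lemma mxo_all n f g : isfun f om om -> isfun g om om -> isfun (mxo n f g) om om /\ (forall k, k ∊ om -> k ∊ n -> app (mxo n f g) k = app f k) /\
 (forall k, k ∊ om -> Sub (app f k) (app (mxo n f g) k)) /\ forall k, k ∊ om -> ~ k ∊ n -> Sub (app g k) (app (mxo n f g) k).
Proof.
 intros F G. assert (E : forall k u, u ∊ sep (app g k) (fun _ => ~ k ∊ n) <-> u ∊ app g k /\ ~ k ∊ n) by (intros; sepd; tauto).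
 assert (D : d0 (fun k => sep (app g k) (fun _ => ~ k ∊ n))).
 { dfn. }
 assert (C : forall k, k ∊ om -> sep (app g k) (fun _ => ~ k ∊ n) ∊ om).
 { intros k K. destruct (classic (k ∊ n)) as [H|H].
  - replace (sep (app g k) (fun _ => ~ k ∊ n)) with (@em T); [apply om_0|]. apply sext; intros u; rewrite E. split; [intros U; destruct (in_em U)|tauto].
  - replace (sep (app g k) (fun _ => ~ k ∊ n)) with (app g k); [apply (app_cod G K)|]. apply sext; intros u; rewrite E. tauto. }
 destruct (mx_all F (lam_fun D C)) as [M1 M2]. split; auto. unfold mxo. split; [|split].
 - intros k K H. destruct (M2 k K) as [-> _]. rewrite (app_lam D C K). apply sext; intros u; rewrite in_cup, E. tauto.
 - intros k K. apply M2; auto.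
 - intros k K H u U. apply M2; auto. rewrite (app_lam D C K). apply E; auto.
Qed.
End Hle.

(** * Fusion of bad stems *)

(* [Dec] relates the stems of conditions to the tasks in [V] which they decide.  A finite partial function [e] is bad if, for
  unboundedly many y, all tasks decided above [e] and some real are related to y, and yet no task is decided above [e] and
  every real. *)
Section Comb.
Variables (T : SetM) (Dec V Sr o : T).
Implicit Types x y z a b c f g h k m n s t u v : T.
Definition tq t := exists n, n ∊ om /\ isfun t n om.
Definition FP (e : T) := Sub e (prod om om) /\ fin e /\ forall c k k', op c k ∊ e -> op c k' ∊ e -> k = k'.
Definition PF := sep (Pw (prod om om)) (fun e : T => FP e).
(** The stems that can be reached below a condition which has the values in e and lies above g
    elsewhere. *)
Definition obey t (e : T) g := Sub e t /\ forall c k, op c k ∊ t -> op c k ∊ e \/ Sub (app g c) k.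
Definition fav e v := forall g, isfun g om om -> exists t, tq t /\ obey t e g /\ op t v ∊ Dec.
Definition Zst e y := exists g, isfun g om om /\ forall t v, tq t -> obey t e g -> v ∊ V -> op t v ∊ Dec -> op y v ∊ Sr.
(** As k grows, the new values below m escape every given g; this is what makes statements about e
    pass to its extensions. *)
Definition exn e m k e' := FP e' /\ Sub e e' /\ forall c v, op c v ∊ e' -> op c v ∊ e \/ (c ∊ m /\ Sub k v).
Definition bd (B : T -> Prop) := exists g, g ∊ o /\ forall x, x ∊ o -> B x -> x ∊ g.
Definition bad e := ~ bd (Zst e) /\ forall v, v ∊ V -> ~ fav e v.
Lemma in_PF e : e ∊ PF <-> FP e.
Proof. unfold PF, FP. sepd. rewrite in_Pw. tauto. Qed.
Lemma obey_tr t e e' g : obey t e' g -> Sub e e' -> (forall c k, op c k ∊ e' -> op c k ∊ e \/ Sub (app g c) k) -> obey t e g.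
Proof. intros [A B] H K. split; [exact (Sub_trans H A)|]. intros c k C. destruct (B c k C); auto. Qed.
Lemma FP_tq t : tq t -> FP t.
Proof.
 intros [n [N F]]. split; [|split].
 - intros u U. apply (proj1 F) in U. apply in_prod in U as [c [k [C [K ->]]]]. apply op_prod; split; auto. apply (om_tr N C).
 - apply (fin_img (F := fun k => op k (app t k)) (a := n)).
  + dfn.
  + apply fin_nat; auto.
  + intros u U. assert (U' := proj1 F u U). apply in_prod in U' as [k [m [K [M ->]]]]. exists k; split; auto.
   f_equal. symmetry. apply (app_iff _ F); auto.
 - apply F.
Qed.
Lemma fav_self t v : tq t -> op t v ∊ Dec -> fav t v.
Proof. intros H D g G. exists t. split; auto. split; auto. split; auto using Sub_refl. Qed.
Lemma fun_bound g m : isfun g om om -> m ∊ om -> exists k, k ∊ om /\ forall c, c ∊ m -> Sub (app g c) k.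
Proof.
 intros G M. apply (@fin_bound T unit _ _ (@IndOk_pure T) (fun _ y n => Sub (app g y) n) tt m).
 - dfn.
 - intros y n n' Y _ _ L. exact (Sub_trans Y L).
 - apply fin_nat; auto.
 - intros y Y. exists (app g y). split; [apply (app_cod G), (om_tr M Y)|apply Sub_refl].
Qed.

Lemma exn_mono e m k k' e' : Sub k' k -> exn e m k e' -> exn e m k' e'.
Proof.
 intros L [E1 [E2 E3]]. spl. intros c w C. destruct (E3 c w C) as [C1|[C1 C2]]; auto. right; split; auto. exact (Sub_trans L C2).
Qed.
Lemma exn_obey e m k e' t g : exn e m k e' -> (forall c, c ∊ m -> Sub (app g c) k) -> obey t e' g -> obey t e g.
Proof.
 intros [_ [E1 E2]] B O. apply (obey_tr O E1). intros c w C. destruct (E2 c w C) as [C1|[C1 C2]]; auto. right. exact (Sub_trans (B c C1) C2).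
Qed.
(** Suppose that for every k some extension by values above k favored v. Each g is bounded on m by
    some k, so a stem obeying that extension and g also obeys e and g, and v would be favored by
    e. *)
Lemma fav_lim e v m : m ∊ om -> ~ fav e v -> exists k, k ∊ om /\ forall e', exn e m k e' -> ~ fav e' v.
Proof.
 intros M NF. contra N. apply NF. intros g G. destruct (fun_bound G M) as [k [K B]]. contra N2.
 apply N. exists k; split; auto. intros e' E' F. destruct (F g G) as [t [T1 [T2 T3]]]. apply N2. exists t; split; auto. split; auto. apply (exn_obey E' B T2).
Qed.
Lemma in_stem t n f c k : isfun t n om -> n ∊ om -> Sub t f -> isfun f om om -> c ∊ n -> (op c k ∊ t <-> op c k ∊ f).
Proof.
 intros Ft N H F C. split; auto. intros K. assert (E := app_in Ft C). assert (E' := H _ E). rewrite (proj2 (proj2 F) _ _ _ K E'). auto.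
Qed.
(** Translation of the order of conditions into the combinatorics of stems: once the function is
    raised above g past its stem e, all later stems obey e and g. The converse [obey_hle] provides a
    common strengthening. *)
Lemma hle_obey n n' e t f f' g : n ∊ om -> n' ∊ om -> isfun e n om -> isfun t n' om -> isfun f om om -> isfun f' om om -> isfun g om om ->
 Sub e f -> Sub t f' -> tr (hechler_le (op n' f') (op n (mxo n f g))) -> obey t e g.
Proof.
 intros N N' Fe Ft F F' G SE ST L. destruct (mxo_all n F G) as [M1 [M2 [M3 M4]]]. apply hle_e in L; auto. destruct L as [L1 [L2 L3]]. split.
 - intros u U. assert (U' := proj1 Fe u U). apply in_prod in U' as [c [k [C [_ ->]]]]. assert (Co := om_tr N C).
  apply (in_stem k Ft N' ST F' (L1 c C)). apply (app_iff _ F' Co). rewrite (L2 c C), (M2 c Co C). apply (app_iff _ F Co); auto.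
 - intros c k K. assert (C := fun_dom Ft K). assert (Co := om_tr N' C). apply ST in K. apply (app_iff _ F' Co) in K. subst k.
  destruct (classic (c ∊ n)) as [CN|CN].
  + left. apply (in_stem _ Fe N SE F CN). apply (app_iff _ F Co). rewrite (L2 c CN), (M2 c Co CN). auto.
  + right. exact (Sub_trans (M4 c Co CN) (L3 c Co)).
Qed.
Lemma obey_hle n n2 e t f f2 : n ∊ om -> n2 ∊ om -> isfun e n om -> isfun t n2 om -> isfun f om om -> isfun f2 om om ->
 Sub e f -> Sub t f2 -> obey t e f -> tr (hechler_le (op n2 (mxo n2 f2 f)) (op n f)) /\
 tr (hechler_le (op n2 (mxo n2 f2 f)) (op n2 f2)).
Proof.
 intros N N2 Fe Ft F F2 SE ST [O1 O2]. destruct (mxo_all n2 F2 F) as [M1 [M2 [M3 M4]]].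
 split; apply hle_i; auto using Sub_refl.
 - intros c C. apply (fun_dom Ft (O1 _ (app_in Fe C))).
 - intros c C. assert (Co := om_tr N C). assert (K := app_in Fe C). assert (C2 := fun_dom Ft (O1 _ K)). rewrite (M2 c Co C2).
  rewrite <- (proj1 (app_iff _ F Co) (SE _ K)). symmetry. apply (app_iff _ F2 Co). auto.
 - intros c Co. destruct (classic (c ∊ n2)) as [C2|C2]; auto. rewrite (M2 c Co C2).
  assert (K := app_in Ft C2). rewrite <- (proj1 (app_iff _ F2 Co) (ST _ K)). destruct (O2 _ _ K) as [K'|K']; auto.
  rewrite (proj1 (app_iff _ F Co) (SE _ K')). apply Sub_refl.
 - intros c C. apply (M2 c (om_tr N2 C) C).
Qed.

Hypothesis o0 : exists g, g ∊ o.
Hypothesis reg : forall R, Sub R (prod PF o) -> (forall e, FP e -> bd (fun y => op e y ∊ R)) -> bd (fun y => exists e, FP e /\ op e y ∊ R).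
Hypothesis H : forall e, FP e -> ~ bd (Zst e) -> (forall v, v ∊ V -> ~ fav e v) -> forall m, m ∊ om ->
 exists k, k ∊ om /\ forall e', exn e m k e' -> forall v, v ∊ V -> ~ fav e' v.

(** A witness h for y in [Zst e] is bounded on m by some k and remains a witness for extensions by
    values above k. If for every k some such extension had a bounded [Zst], then [Zst e] would be
    covered by the bounded ones among the sets [Zst e'], and would be bounded by [reg]. *)
Lemma bad_ext e m : FP e -> bad e -> m ∊ om -> exists k, k ∊ om /\ forall e', exn e m k e' -> bad e'.
Proof.
 intros HE [B1 B2] M. destruct (H HE B1 B2 M) as [k1 [K1 A1]].
 assert (Z : exists k, k ∊ om /\ forall e', exn e m k e' -> ~ bd (Zst e')).
 { contra N. apply B1. destruct o0 as [g0 G0].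
  set (R := sep (prod PF o) (fun u => exists e y, u = op e y /\ Zst e y /\ bd (Zst e))).
  assert (HR : forall e y, op e y ∊ R <-> FP e /\ y ∊ o /\ Zst e y /\ bd (Zst e)).
  { intros e1 y. unfold R, bd. sepd. rewrite op_prod, in_PF. split; [|intros [X [Y Z]]; split; auto; exists e1, y; auto].
   intros [[X Y] [e2 [y2 [E Z]]]]. opi; auto. }
  destruct (@reg R) as [g [G K]].
  - intros u U. unfold R, bd in U. sepd in U. tauto.
  - intros e1 E1. destruct (classic (bd (Zst e1))) as [[g [G K]]|NB].
   + exists g; split; auto. intros x X Y. apply HR in Y. apply K; tauto.
   + exists g0; split; auto. intros x X Y. apply HR in Y. tauto.
  - exists g; split; auto. intros x X [h [Hh Kh]]. apply K; auto. destruct (fun_bound Hh M) as [k [Hk B]].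
   contra N2. apply N. exists k; split; auto. intros e' E' BD. apply N2. exists e'. split; [apply E'|]. apply HR.
   split; [apply E'|]. split; auto. split; auto. exists h; split; auto. intros t v T1 T2. apply Kh; auto. apply (exn_obey E' B T2). }
 destruct Z as [k2 [K2 A2]]. destruct (om_max K1 K2) as [k [K [L1 L2]]]. exists k; split; auto.
 intros e' E'. split; [apply A2, (exn_mono L2 E')|apply A1, (exn_mono L1 E')].
Qed.

Variable e0 : T.
Hypothesis He0 : FP e0.
Hypothesis Be0 : bad e0.
(** The invariant of the fusion: with the values of s as lower bounds for new values below n, e0
    cannot be extended to something that is not bad. *)
Definition Gd s n := forall e', FP e' -> Sub e0 e' -> (forall c k, op c k ∊ e' -> op c k ∊ e0 \/ (c ∊ n /\ Sub (app s c) k)) -> bad e'.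
Lemma app_adj s n k c : n ∊ om -> isfun s n om -> k ∊ om -> isfun (adj s (op n k)) (sc n) om /\
 (c ∊ n -> app (adj s (op n k)) c = app s c) /\ app (adj s (op n k)) n = k.
Proof.
 intros N F K. assert (F' : isfun (adj s (op n k)) (sc n) om).
 { split; [|split].
  - intros u [U| ->]%in_adj.
   + apply (proj1 F) in U. apply in_prod in U as [x [y [X [Y ->]]]]. apply op_prod. split; auto. apply in_sc; auto.
   + apply op_prod. split; auto. apply sc_in.
  - intros x [X| ->]%in_sc.
   + exists (app s x). apply in_adj. left. apply (app_in F X).
   + exists k. apply in_adj; auto.
  - intros x y y' Y Y'. apply in_adj in Y, Y'. destruct Y as [Y|Y], Y' as [Y'|Y'].
   + apply (proj2 (proj2 F) x); auto.
   + apply op_inj in Y'. destruct Y'; subst. destruct (nin (fun_dom F Y)).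
   + opi. destruct (nin (fun_dom F Y')).
   + apply op_inj in Y, Y'. destruct Y, Y'; congruence. }
 split; auto. split.
 - intros C. apply (app_eq F'). apply in_adj. left. apply (app_in F C).
 - apply (app_eq F'). apply in_adj; auto.
Qed.

(* e is enlarged along j until every coordinate left free has values tending to infinity; then [bad_ext] applies. *)
Lemma Gd_step s n : n ∊ om -> isfun s n om -> Gd s n -> exists k, k ∊ om /\ Gd (adj s (op n k)) (sc n).
Proof.
 intros N F G. contra NK.
 (* Counterexamples to the invariant at n+1 that extend e: outside e the new values are at least k
    at n and at the coordinates below j, and respect s below n. *)
 set (X := fun j e k e' => FP e' /\ Sub e e' /\ (forall c w, op c w ∊ e' -> op c w ∊ e \/
  (c ∊ sc n /\ (c ∊ j -> Sub k w) /\ (c = n -> Sub k w) /\ (c ∊ n -> Sub (app s c) w))) /\ ~ bad e').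
 assert (XM : forall j e k k' e', Sub k' k -> X j e k e' -> X j e k' e').
 { intros j e k k' e' L [A [B [C D]]]. split; auto; split; auto; split; auto. intros c w W. destruct (C c w W) as [W1|[W1 [W2 [W3 W4]]]]; auto.
  right; split; auto. split; [|split; auto]; intros Q; [exact (Sub_trans L (W2 Q))|exact (Sub_trans L (W3 Q))]. }
 set (Q := fun j e => FP e /\ Sub e0 e /\ (forall c w, op c w ∊ e -> op c w ∊ e0 \/ (c ∊ j /\ Sub (app s c) w)) /\ forall k, k ∊ om -> exists e', X j e k e').
 assert (QI : forall j, j ∊ om -> Sub j n -> exists e, Q j e).
 { refine (@om_ind T (fun j => Sub j n -> exists e, Q j e) _ _ _).
  - apply Min_d. dfn.
  - intros _. exists e0. split; auto. split; [apply Sub_refl|]. split; auto. intros k K. contra NX. apply NK. exists k; split; auto.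
   intros e' E1 E2 E3. contra NB. apply NX. exists e'. split; auto; split; auto; split; auto. intros c w W.
   destruct (E3 c w W) as [W1|[W1 W2]]; auto. right. split; auto. destruct (app_adj c N F K) as [_ [A1 A2]].
   split; [intros Z; destruct (in_em Z)|]. split; [intros ->; rewrite A2 in W2; auto|intros Z; rewrite A1 in W2; auto].
  - intros j J IH L. assert (JN : j ∊ n) by (apply L, sc_in).
   destruct IH as [e [Q1 [Q2 [Q3 Q4]]]]; [intros z Z; apply L, in_sc; auto|].
   (* Either the counterexamples can have arbitrarily large new values at j, or a fixed value w
      occurs at j for every k, by pigeonhole below k0, and is adjoined to e. *)
   destruct (classic (forall k, k ∊ om -> exists e', X j e k e' /\ forall w, op j w ∊ e' -> op j w ∊ e \/ Sub k w)) as [A|NA].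
   + exists e. spl; split.
    * intros c w W. destruct (Q3 c w W) as [W1|[W1 W2]]; auto. right; split; auto. apply in_sc; auto.
    * intros k K. destruct (A k K) as [e' [[X1 [X2 [X3 X4]]] Y]]. exists e'. split; auto; split; auto; split; auto.
     intros c w W. destruct (X3 c w W) as [W1|[W1 [W2 [W3 W4]]]]; auto.
     destruct (classic (c = j)) as [->|NE]; [destruct (Y w W); auto|]; right; (split; auto; split; [|split; auto]); intros Z; auto.
     apply in_sc in Z as [Z|Z]; auto. contradiction.
   + assert (NA' : exists k0, k0 ∊ om /\ forall e', X j e k0 e' -> exists w, op j w ∊ e' /\ ~ op j w ∊ e /\ w ∊ k0).
    { contra N1. apply NA. intros k K. contra N2. apply N1. exists k; split; auto. intros e' E'.
     contra N3. apply N2. exists e'; split; auto. intros w W. contra N4. apply not_or_and in N4 as [N4 N5].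
     apply N3. exists w. spl. apply (Ord_nle (om_ord K)); auto. destruct E' as [E1 _]. apply (proj1 E1), op_prod in W. apply om_ord; tauto. }
    destruct NA' as [k0 [K0 A]].
    assert (PK : exists w, w ∊ k0 /\ forall k, k ∊ om -> exists e', X j e k e' /\ op j w ∊ e' /\ ~ op j w ∊ e).
    { contra N1.
     destruct (@fin_bound T unit _ _ (@IndOk_pure T) (fun _ w k => forall e', X j e k e' -> op j w ∊ e' -> op j w ∊ e) tt k0) as [k1 [K1 B]].
     - dfn.
     - intros w k k' B _ _ LK e' E'. apply B. apply (XM j e k' k e' LK E').
     - apply fin_nat; auto.
     - intros w W. contra N2. apply N1. exists w; split; auto. intros k K. contra N3. apply N2. exists k; split; auto.
      intros e' E1 E2. contra N4. apply N3. eauto.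
     - destruct (om_max K0 K1) as [k [K [L1 L2]]]. destruct (Q4 k K) as [e' E']. destruct (A e' (XM _ _ _ _ _ L1 E')) as [w [W1 [W2 W3]]].
      apply W2. apply (B w W3 e'); auto. apply (XM _ _ _ _ _ L2 E'). }
    destruct PK as [w [W PK]]. destruct (PK em (@om_0 T)) as [e1 [[X1 [X2 [X3 X4]]] [Y1 Y2]]].
    assert (SE : forall e', X j e em e' -> op j w ∊ e' -> Sub (adj e (op j w)) e').
    { intros e' [_ [E' _]] Z u [U| ->]%in_adj; auto. }
    assert (S1 := SE e1 (conj X1 (conj X2 (conj X3 X4))) Y1).
    exists (adj e (op j w)). split; [|split; [|split]].
    * split; [exact (Sub_trans S1 (proj1 X1))|]. split; [apply fin_adj, Q1|]. intros c k k' C C'. apply (proj2 (proj2 X1) c); apply S1; auto.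
    * intros u U. apply in_adj; auto.
    * intros c k [C|C]%in_adj.
     -- destruct (Q3 c k C) as [W1|[W1 W2]]; auto. right; split; auto. apply in_sc; auto.
     -- opi. right. split; [apply sc_in|]. destruct (X3 j w Y1) as [W1|[_ [_ [_ W4]]]]; [contradiction|auto].
    * intros k K. destruct (PK k K) as [e' [E1 [E2 E3]]]. exists e'. assert (E1' := XM _ _ _ em _ (@om_0_le T k) E1).
     destruct E1 as [Z1 [Z2 [Z3 Z4]]]. split; auto. split; [apply SE; auto|]. split; auto. intros c y Y.
     destruct (Z3 c y Y) as [V1|[V1 [V2 [V3 V4]]]]; [left; apply in_adj; auto|].
     destruct (classic (c = j)) as [->|NE].
     -- left. apply in_adj. right. f_equal. apply (proj2 (proj2 Z1) j); auto.
     -- right. split; auto. split; [|split; auto]. intros [Z|Z]%in_sc; auto. contradiction. }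
 destruct (QI n N (@Sub_refl T n)) as [e [Q1 [Q2 [Q3 Q4]]]]. assert (BE := G e Q1 Q2 Q3).
 (* Now all new values on the coordinates up to n lie above any prescribed k, whereas [bad_ext] says
    that such extensions of the bad e are bad. *)
 destruct (bad_ext Q1 BE (om_S N)) as [k [K A]]. destruct (Q4 k K) as [e' [X1 [X2 [X3 X4]]]]. apply X4, A. spl.
 intros c w W. destruct (X3 c w W) as [W1|[W1 [W2 [W3 _]]]]; auto. right; split; auto. apply in_sc in W1. destruct W1; auto.
Qed.

(* The values of [g] are chosen recursively, as small as possible, so that [Gd] is preserved. *)
Lemma comb : exists g, isfun g om om /\ forall t v, tq t -> obey t e0 g -> v ∊ V -> ~ op t v ∊ Dec.
Proof.
 set (Lk := fun a f k => k ∊ om /\ Gd (adj f (op a k)) (sc a) /\ forall k', k' ∊ k -> ~ Gd (adj f (op a k')) (sc a)).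
 assert (LU : forall a f k k', Lk a f k -> Lk a f k' -> k = k').
 { intros a f k k' [A1 [A2 A3]] [B1 [B2 B3]]. destruct (Ord_tri (om_ord A1) (om_ord B1)) as [C|[C|C]]; auto; [destruct (B3 _ C A2)|destruct (A3 _ C B2)]. }
 destruct (@ord_rec T om om (fun a f k => Lk a f k \/ (~ (exists k, Lk a f k) /\ k = em))) as [g [G1 G2]]; [apply Ord_om|dfn| | |].
 - intros a f k k' [A|[A ->]] [B|[B ->]]; eauto; [destruct B|destruct A]; eauto.
 - intros a f A Hf. destruct (classic (exists k, Lk a f k)) as [[k K]|NK]; [exists k; split; [apply K|auto]|exists em; split; [apply om_0|auto]].
 - assert (RI : forall n, n ∊ om -> isfun (rst g n) n om) by (intros n N; apply (rst_fun G1); intros u U; apply (om_tr N U)).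
  assert (RA : forall n c, n ∊ om -> c ∊ n -> app (rst g n) c = app g c) by (intros n c N C; apply (app_rst G1); auto; intros u U; apply (om_tr N U)).
  assert (GI : forall n, n ∊ om -> Gd (rst g n) n).
  { apply om_ind.
   - apply Min_d. dfn.
   - intros e' E1 E2 E3. replace e' with e0; auto. apply Sub_antisym; auto. intros u U. assert (U' := proj1 E1 u U). apply in_prod in U'.
    destruct U' as [c [k [_ [_ ->]]]]. destruct (E3 c k U) as [K|[K _]]; auto. destruct (in_em K).
   - intros n N IH. destruct (Gd_step N (RI n N) IH) as [k K].
    destruct (@d_least T (fun k => Gd (adj (rst g n) (op n k)) (sc n))) as [k1 [K1 [K2 K3]]]; [dfn|eauto|].
    assert (E : app g n = k1).
    { destruct (G2 n N) as [E|[E _]]; [apply (LU _ _ _ _ E)|destruct E; exists k1]; split; auto. }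
    replace (rst g (sc n)) with (adj (rst g n) (op n k1)); auto.
    apply (@fun_ext T _ _ (sc n) om om (proj1 (app_adj n N (RI n N) K1)) (RI _ (om_S N))). intros c C. rewrite (RA _ c (om_S N) C).
    destruct (app_adj c N (RI n N) K1) as [_ [A1 A2]]. apply in_sc in C as [C| ->]; [rewrite A1, RA; auto|rewrite A2; auto]. }
  exists g. split; auto. intros t v [n [N Ft]] [O1 O2] HV D. assert (TQ : tq t) by (exists n; auto).
  (* The stem t is itself one of the extensions of e0 covered by the invariant, hence bad, whereas a
     stem favors everything it decides. *)
  destruct (GI n N t (FP_tq TQ) O1) as [_ B]; [|apply (B v HV (fav_self TQ D))].
  intros c k C. destruct (O2 c k C) as [K|K]; auto. right. assert (CN := fun_dom Ft C). split; auto. rewrite RA; auto.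
Qed.
End Comb.

(** * The finite support iteration *)

Section Iter.
Variable S : ZF.
Hypothesis cnt : exists f : nat -> S, forall x, exists n, f n = x.
Variables d PP LL QQ : S.
Hypothesis Od : Ord d.
Hypothesis fs : fs_hechler (@smem S) d PP LL QQ.
Implicit Types x y z a b p q r s u v w : S.

Definition Pz x := app PP x.
Definition Lz x := app LL x.
Definition Qz x := app QQ x.
Notation lez x := (le (Pz x) (Lz x)).
Notation Fz x := (forces (@smem S) (Pz x) (Lz x)).

Lemma fon_app f a x y : fon f a -> x ∊ a -> (op x y ∊ f <-> y = app f x).
Proof.
 intros F X. apply (app_iff (a := a) (b := ran f)); auto. apply fon_isfun; split; auto.
 intros x' y' H; apply in_ran; eauto.
Qed.
Lemma fonP : fon PP (sc d).
Proof.
 destruct (fs_P fs) as [d' [A B]]. apply t_succ in A. apply t_fun_on in B. subst; auto.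
Qed.
Lemma fonL : fon LL (sc d).
Proof.
 destruct (fs_L fs) as [d' [A B]]. apply t_succ in A. apply t_fun_on in B. subst; auto.
Qed.
Lemma fonQ : fon QQ d.
Proof. apply t_fun_on. exact (fs_Q fs). Qed.
Lemma mapP x y : x ∊ sc d -> (tr (maps PP x y) <-> y = Pz x).
Proof. intros X; rewrite t_maps. apply (fon_app y fonP X). Qed.
Lemma mapL x y : x ∊ sc d -> (tr (maps LL x y) <-> y = Lz x).
Proof. intros X; rewrite t_maps. apply (fon_app y fonL X). Qed.
Lemma mapQ x y : x ∊ d -> (tr (maps QQ x y) <-> y = Qz x).
Proof. intros X; rewrite t_maps. apply (fon_app y fonQ X). Qed.
Lemma d_in x : x ∊ d -> x ∊ sc d.
Proof. intros; apply in_sc; auto. Qed.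
Lemma scd_sub x : x ∊ sc d -> Sub x d.
Proof. intros [H| ->]%in_sc; [exact (proj1 Od _ H)|apply Sub_refl]. Qed.
Lemma scd_ord x : x ∊ sc d -> Ord x.
Proof. apply Ord_in, Ord_sc, Od. Qed.
Lemma scd_tr x y : x ∊ sc d -> y ∊ x -> y ∊ d.
Proof. intros X Y; exact (scd_sub X Y). Qed.

Definition isname z q := exists t, op q t ∊ Qz z.
Lemma condP x p : x ∊ sc d -> (p ∊ Pz x <-> (fin p /\ exists a, Sub a x /\ fon p a) /\
 forall z q, op z q ∊ p -> rst p z ∊ Pz z /\ isname z q /\ Fz z (rst p z) (q ∈ Qz z)).
Proof.
 intros X. assert (H := fs_cond fs (proj2 (mapP (Pz x) X) eq_refl) p).
 assert (DOM : (exists a, Sub a x /\ fon p a) -> forall z q, op z q ∊ p -> z ∊ d).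
 { intros [a [A B]] z q Q. apply (scd_sub X), A. destruct (proj1 B _ Q) as [z' [q' [Z E]]]. opi; auto. }
 assert (K1 : tr (finite p ∧ ∃ a, sub a x ∧ fun_on p a) <-> fin p /\ exists a, Sub a x /\ fon p a).
 { assert (K : tr (finite p ∧ ∃ a, sub a x ∧ fun_on p a) <-> tr (finite p) /\ exists a, Sub a x /\ tr (fun_on p a)) by reflexivity.
  rewrite K, t_finite. setoid_rewrite t_fun_on. tauto. }
 rewrite H, K1. split; intros [A B]; split; auto.
 - intros z q Q. assert (Zd := DOM (proj2 A) z q Q). rewrite <- t_maps in Q.
  destruct (B z q Q (Pz z) (Lz z) (Qz z) (rst p z)) as [C [E F]].
  + apply mapP; auto. apply d_in; auto.
  + apply mapL; auto. apply d_in; auto.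
  + apply mapQ; auto.
  + apply t_restrict; auto.
  + split; auto; split; auto. destruct E as [t E]. exists t. apply t_maps; auto.
 - intros z q Q Pz' Lz' Qz' p' H1 H2 H3 H4. rewrite t_maps in Q. assert (Zd := DOM (proj2 A) z q Q).
  apply mapP in H1; [|apply d_in; auto]. apply mapL in H2; [|apply d_in; auto]. apply mapQ in H3; auto. apply t_restrict in H4. subst.
  destruct (B z q Q) as [C [[t E] F]]. split; auto; split; auto. exists t. apply t_maps; auto.
Qed.
Lemma condL x p q : x ∊ sc d -> (lez x p q <-> p ∊ Pz x /\ q ∊ Pz x /\ forall z q1, op z q1 ∊ q ->
 exists p1, op z p1 ∊ p /\ Fz z (rst p z) (hechler_le p1 q1)).
Proof.
 intros X. unfold le. rewrite (fs_le fs (proj2 (mapP (Pz x) X) eq_refl) (proj2 (mapL (Lz x) X) eq_refl) (op p q)).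
 assert (DOM : q ∊ Pz x -> forall z q1, op z q1 ∊ q -> z ∊ d).
 { intros H z q1 Q. apply condP in H; auto. destruct H as [[_ [a [A B]]] _]. apply (scd_sub X), A.
  destruct (proj1 B _ Q) as [z' [q' [Z E]]]. opi; auto. }
 split.
 - intros [A [p' [q' [E [B [C D]]]]]]. apply t_opair in E. apply op_inj in E. destruct E; subst p' q'.
  spl. intros z q1 Q. assert (Zd := DOM C z q1 Q). rewrite <- t_maps in Q.
  destruct (D z q1 Q) as [p1 [F G]]. exists p1. rewrite t_maps in F. split; auto.
  apply G; [apply mapP|apply mapL|apply t_restrict]; auto; apply d_in; auto.
 - intros [A [B C]]. split; auto. exists p, q. rewrite t_opair. spl.
  intros z q1 Q. rewrite t_maps in Q. assert (Zd := DOM B z q1 Q). destruct (C z q1 Q) as [p1 [F G]]. exists p1.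
  rewrite t_maps. split; auto. intros Pz' Lz' p' H1 H2 H3. apply mapP in H1; [|apply d_in; auto]. apply mapL in H2; [|apply d_in; auto].
  apply t_restrict in H3. subst; auto.
Qed.
Lemma condQ x p : x ∊ d -> p ∊ Pz x -> Fz x p (∀ y, y ∈ Qz x ⇔ hechler y).
Proof.
 intros X H. apply (fs_name fs (x := x)); auto; [apply mapP|apply mapL|apply mapQ]; auto; apply d_in; auto.
Qed.

Lemma P_dom x p z q : x ∊ sc d -> p ∊ Pz x -> op z q ∊ p -> z ∊ x.
Proof.
 intros X H Q. apply condP in H; auto. destruct H as [[_ [a [A B]]] _]. apply A.
 destruct (proj1 B _ Q) as [z' [q' [Z E]]]. opi; auto.
Qed.
Lemma P_fun x p z q q' : x ∊ sc d -> p ∊ Pz x -> op z q ∊ p -> op z q' ∊ p -> q = q'.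
Proof.
 intros X H Q Q'. apply condP in H; auto. destruct H as [[_ [a [A B]]] _]. eapply (proj2 (proj2 B)); eauto.
Qed.
Lemma P_pair x p u : x ∊ sc d -> p ∊ Pz x -> u ∊ p -> exists z q, u = op z q.
Proof.
 intros X H Q. apply condP in H; auto. destruct H as [[_ [a [A B]]] _]. destruct (proj1 B _ Q) as [z [q [_ E]]]; eauto.
Qed.
Lemma rst_rst p x y : Sub y x -> rst (rst p x) y = rst p y.
Proof.
 intros H; apply sext; intros u; rewrite !in_rst. split; [tauto|]. intros [A [z [q [-> Z]]]]. repeat split; auto; eauto.
Qed.
Lemma fin_rst p x : fin p -> fin (rst p x).
Proof. apply fin_sub. intros u H; apply in_rst in H; tauto. Qed.
Lemma P_rst x z p : x ∊ sc d -> Sub z x -> z ∊ sc d -> p ∊ Pz x -> rst p z ∊ Pz z.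
Proof.
 intros X ZX Z H. assert (H' := H). apply condP in H'; auto. destruct H' as [[A [a [B C]]] D]. apply condP; auto. split; [split|].
 - apply fin_rst; auto.
 - exists (sep a (fun y => y ∊ z)). split; [intros y Y; sepd in Y; tauto|]. split; [|split].
  + intros u [U1 [y [q [-> Y]]]]%in_rst. exists y, q; split; auto. sepd; split; auto.
   destruct (proj1 C _ U1) as [y' [q' [Y' E]]]. opi; auto.
  + intros y Y. sepd in Y. destruct (proj1 (proj2 C) y) as [q Q]; [tauto|]. exists q. apply op_rst; tauto.
  + intros y q q' Q Q'. apply op_rst in Q; apply op_rst in Q'. apply (proj2 (proj2 C) y); tauto.
 - intros y q [Q Y]%op_rst. rewrite rst_rst by exact (proj1 (scd_ord Z) y Y). apply (D y q Q).
Qed.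
Lemma P_up x z p : x ∊ sc d -> Sub z x -> z ∊ sc d -> p ∊ Pz z -> p ∊ Pz x.
Proof.
 intros X ZX Z H. apply condP in H; auto. destruct H as [[A [a [B C]]] D]. apply condP; auto. split; auto. split; auto.
 exists a; split; auto. apply (Sub_trans B ZX).
Qed.
Lemma P_rst_id z p : z ∊ sc d -> p ∊ Pz z -> rst p z = p.
Proof.
 intros Z H. apply sext; intros u; rewrite in_rst. split; [tauto|]. intros Hu; split; auto.
 destruct (P_pair Z H Hu) as [y [q ->]]. exists y, q; split; auto. apply (P_dom Z H Hu).
Qed.
Lemma le_rst x z p q : x ∊ sc d -> Sub z x -> z ∊ sc d -> lez x p q -> lez z (rst p z) (rst q z).
Proof.
 intros X ZX Z H. apply condL in H; auto. destruct H as [A [B C]]. apply condL; auto.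
 split; [apply (P_rst X); auto|split; [apply (P_rst X); auto|]]. intros y q1 [Q Y]%op_rst.
 destruct (C y q1 Q) as [p1 [D E]]. exists p1. rewrite op_rst, rst_rst by exact (proj1 (scd_ord Z) y Y). auto.
Qed.
Lemma le_up x z p q : x ∊ sc d -> Sub z x -> z ∊ sc d -> lez z p q -> lez x p q.
Proof.
 intros X ZX Z H. apply condL in H; auto. destruct H as [A [B C]]. apply condL; auto.
 split; [apply (P_up X ZX Z A)|split; [apply (P_up X ZX Z B)|auto]].
Qed.

Section Names.
Variable z : S.
Hypothesis Hz : z ∊ d.
Hypothesis HP : poset (Pz z) (Lz z).
Lemma name_hech (i : Gen (Pz z) (Lz z)) p q : gU i p -> Fz z p (q ∈ Qz z) ->
 exists n f, n ∊ om /\ isfun f om om /\ vl HP i q = op n f.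
Proof.
 intros G F. assert (X := gU_sub G). apply t_hechler.
 apply (@forces_Forced _ _ _ HP cnt (fun V e => Mem (e 0) (e 1)) p (ltac:(cod)) X (scons q (fun _ => Qz z))) in F.
 assert (F2 := condQ Hz X).
 apply (@forces_Forced _ _ _ HP cnt (fun V e => ∀ h, h ∈ e 0 ⇔ hechler h) p (ltac:(cod)) X (fun _ => Qz z)) in F2.
 assert (K := proj1 (F2 i G q) (F i G)). apply (@t_vl _ _ _ HP i (fun V e => hechler (e 0)) (fun _ => q) (ltac:(cod))) in K. exact K.
Qed.
(** Conditions may only use names occurring in [Qz z]. By genericity every Hechler condition of the
    extension at stage z has such a name. *)
Lemma hech_name (i : Gen (Pz z) (Lz z)) n f : n ∊ om -> isfun f om om -> exists q, isname z q /\ vl HP i q = op n f /\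
 exists p, gU i p /\ Fz z p (q ∈ Qz z).
Proof.
 intros Hn Hf. destruct (vl_surj (op n f)) as [s E].
 destruct (gU_ne i) as [p0 G0]. assert (F2 := condQ Hz (gU_sub G0)).
 apply (@forces_Forced _ _ _ HP cnt (fun V e => ∀ h, h ∈ e 0 ⇔ hechler h) p0 (ltac:(cod)) (gU_sub G0) (fun _ => Qz z)) in F2.
 assert (K : truth (gE i) (hechler s)).
 { apply (@t_vl _ _ _ HP i (fun V e => hechler (e 0)) (fun _ => s) (ltac:(cod))). apply t_hechler. exists n, f; rewrite <- E; auto. }
 apply (proj2 (F2 i G0 s)) in K. apply (gE_iff HP) in K as [q [r [A [B C]]]].
 exists q. split; [exists r; auto|]. split; [rewrite E; symmetry; apply vl_eq; auto|].
 assert (D : gE i q (Qz z)) by (apply (gE_name HP A B)). destruct D as [p [P1 P2]]. exists p; split; auto.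
Qed.
Lemma le_iff p q1 q2 : p ∊ Pz z -> (Fz z p (hechler_le q1 q2) <-> forall i : Gen (Pz z) (Lz z), gU i p ->
 tr (hechler_le (vl HP i q1) (vl HP i q2))).
Proof.
 intros X. rewrite (@forces_Forced _ _ _ HP cnt (fun V e => hechler_le (e 0) (e 1)) p (ltac:(cod)) X (scons q1 (fun _ => q2))).
 split; intros H i G; apply (@t_vl _ _ _ HP i (fun V e => hechler_le (e 0) (e 1)) (scons q1 (fun _ => q2)) (ltac:(cod))), H; auto.
Qed.
Lemma Fmono phi p q : Cod phi -> lez z q p -> forall e, Fz z p (phi S e) -> Fz z q (phi S e).
Proof.
 intros C H e F. apply (forces_Forced HP cnt C); [apply H|]. apply (Forced_mono HP (p := p)); auto.
 apply (forces_Forced HP cnt C); auto. apply (le_in HP H).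
Qed.
Lemma Fmono_name p q n : lez z q p -> Fz z p (n ∈ Qz z) -> Fz z q (n ∈ Qz z).
Proof. intros H. apply (@Fmono (fun V e => Mem (e 0) (e 1)) p q (ltac:(cod)) H (scons n (fun _ => Qz z))). Qed.
Lemma Fmono_le p q n m : lez z q p -> Fz z p (hechler_le n m) -> Fz z q (hechler_le n m).
Proof. intros H. apply (@Fmono (fun V e => hechler_le (e 0) (e 1)) p q (ltac:(cod)) H (scons n (fun _ => m))). Qed.
Lemma Fle_refl p q : p ∊ Pz z -> Fz z p (q ∈ Qz z) -> Fz z p (hechler_le q q).
Proof.
 intros X F. apply le_iff; auto. intros i G. destruct (name_hech G F) as [n [f [A [B E]]]]. rewrite E. apply t_hechler_le.
 exists n, f, n, f. repeat split; auto. intros k K j1 j2 J1 J2. right. apply (proj2 (proj2 B) k); auto.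
Qed.
Lemma Fle_trans p q1 q2 q3 : p ∊ Pz z -> Fz z p (hechler_le q1 q2) -> Fz z p (hechler_le q2 q3) -> Fz z p (q2 ∈ Qz z) -> Fz z p (q1 ∈ Qz z) -> Fz z p (hechler_le q1 q3).
Proof.
 intros X F1 F2 F3 F0. apply le_iff; auto. intros i G. rewrite le_iff in F1, F2 by auto.
 destruct (name_hech G F3) as [n [f [N [F E]]]]. destruct (name_hech G F0) as [n0 [f0 [N0 [F0' E0]]]].
 assert (A := F1 i G). assert (B := F2 i G). apply t_hechler_le in A. apply t_hechler_le in B. apply t_hechler_le.
 destruct A as [m1 [g1 [n1 [f1 [A1 [A2 [A3 [A4 A5]]]]]]]]. destruct B as [m2 [g2 [n2 [f2 [B1 [B2 [B3 [B4 B5]]]]]]]].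
 exists m1, g1, n2, f2. rewrite E in A2, B1. apply op_inj in A2. apply op_inj in B1. destruct A2; destruct B1; subst n1 f1 m2 g2.
 rewrite E0 in A1. opi.
 split; [auto|split; [auto|split; [|split]]].
 - destruct A3 as [A3| ->]; auto. destruct B3 as [B3| ->]; auto. left. apply (Ord_tr (om_ord N0) B3 A3).
 - intros k K j. rewrite <- B4 by auto. apply A4. destruct B3 as [B3| ->]; auto. apply (Ord_tr (om_ord N) K B3).
 - intros k K j1 j2 J1 J2. destruct (B5 k K j1 (app f k) J1 (app_in F K)) as [C| ->].
  + destruct (A5 k K (app f k) j2 (app_in F K) J2) as [D|<-]; auto. left.
   apply (Ord_tr (om_ord (fun_cod F0' J2)) C D).
  + apply (A5 k K _ _ (app_in F K) J2).
Qed.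
End Names.

Lemma P_name x p z q : x ∊ sc d -> p ∊ Pz x -> op z q ∊ p -> rst p z ∊ Pz z /\ isname z q /\ Fz z (rst p z) (q ∈ Qz z).
Proof. intros X H. apply condP in H; auto. apply H. Qed.

(** Induction on the stage: the order at x refers to forcing at smaller z, and the description of
    that forcing by filters requires [Pz z] to be a partial order already. *)
Lemma poset_all x : x ∊ sc d -> poset (Pz x) (Lz x).
Proof.
 revert x. apply (@ord_ind S (fun x => poset (Pz x) (Lz x))).
 - apply Ord_sc, Od.
 - apply Min_d. apply d_ext with (A := fun _ e => (forall p, p ∊ app PP (e 0) -> le (app PP (e 0)) (app LL (e 0)) p p) /\
   (forall p q r, le (app PP (e 0)) (app LL (e 0)) r q -> le (app PP (e 0)) (app LL (e 0)) q p -> le (app PP (e 0)) (app LL (e 0)) r p) /\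
   (forall p q, le (app PP (e 0)) (app LL (e 0)) q p -> p ∊ app PP (e 0))).
  + intros _ e; split; [intros [A [B C]]; split; auto|intros [A B C]; split; auto].
  + dfn.
 - intros x X IH. split.
  + intros p H. apply condL; auto. spl. intros z q Q. exists q; split; auto.
   assert (Z := P_dom X H Q). destruct (P_name X H Q) as [A [B C]]. apply (Fle_refl (scd_tr X Z) (IH z Z)); auto.
  + intros p q r H K. apply condL in H; auto; apply condL in K; auto. destruct H as [H1 [H2 H3]], K as [K1 [K2 K3]].
   apply condL; auto. spl. intros z p1 P1. destruct (K3 z p1 P1) as [q1 [Q1 Q2]].
   destruct (H3 z q1 Q1) as [r1 [R1 R2]]. exists r1; split; auto.
   assert (Z := P_dom X K2 P1). assert (Zd := scd_tr X Z). assert (HZ := IH z Z). assert (ZX : Sub z x) by exact (proj1 (scd_ord X) z Z).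
   assert (LR : lez z (rst r z) (rst q z)).
   { apply (le_rst X); auto; [apply d_in; auto|]. apply condL; auto. }
   apply (Fle_trans Zd HZ (q2 := q1)); auto.
   * apply LR.
   * apply (Fmono_le HZ LR Q2).
   * apply (Fmono_name HZ LR). apply (P_name X K1 Q1).
   * apply (P_name X H1 R1).
  + intros p q H; apply condL in H; tauto.
Qed.

(** * Amalgamation, and restriction of generic filters to a stage *)

Definition glue p r z := cup r (sep p (fun u => ~ u ∊ rst p z)).
Lemma op_glue p r z y q : op y q ∊ glue p r z <-> op y q ∊ r \/ (op y q ∊ p /\ ~ y ∊ z).
Proof.
 unfold glue. rewrite in_cup. sepd. rewrite op_rst. tauto.
Qed.
Lemma glue_rst x p r z y : x ∊ sc d -> p ∊ Pz x -> r ∊ Pz z -> z ∊ sc d -> Sub y z -> rst (glue p r z) y = rst r y.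
Proof.
 intros X H R Z YZ. apply sext; intros u. rewrite !in_rst. split; intros [A [k [q [-> K]]]]; (split; [|eauto]).
 - apply op_glue in A as [A|[_ A]]; auto. destruct A; auto.
 - apply op_glue; auto.
Qed.
Lemma le_rst_self x p z : x ∊ sc d -> z ∊ sc d -> Sub z x -> p ∊ Pz x -> lez x p (rst p z).
Proof.
 intros X Z ZX H. apply condL; auto. split; auto. assert (R := P_rst X ZX Z H). split; [apply (P_up X ZX Z R)|].
 intros y q [Q Y]%op_rst. exists q; split; auto.
 assert (Yd := scd_tr Z Y). apply (Fle_refl Yd (poset_all (d_in Yd))); apply (P_name X H Q).
Qed.

(** Both claims are proved together along the coordinates: a name used by p at k is forced to be a
    condition by p restricted to k, so it must be known that the glued condition, restricted to k,
    is below that. *)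
Lemma glue_all x p r z : x ∊ sc d -> z ∊ sc d -> Sub z x -> p ∊ Pz x -> lez z r (rst p z) ->
 glue p r z ∊ Pz x /\ lez x (glue p r z) p /\ lez x (glue p r z) r /\ rst (glue p r z) z = r.
Proof.
 intros X Z ZX H R. assert (RP : r ∊ Pz z) by apply R.
 assert (ER : rst (glue p r z) z = r) by (rewrite (glue_rst X H RP Z (@Sub_refl _ z)); apply P_rst_id; auto).
 assert (FG : fin (glue p r z)).
 { apply fin_cup; [apply condP in RP; tauto|]. apply fin_sub with (b := p); [intros u U; sepd in U; tauto|]. apply condP in H; tauto. }
 assert (AGR : forall y q1, op y q1 ∊ rst p z -> exists p1, op y p1 ∊ r /\ Fz y (rst r y) (hechler_le p1 q1)).
 { intros y q1 Q. apply condL in R; auto. apply R; auto. }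
 assert (ALL : forall y, y ∊ sc x -> Sub z y -> rst (glue p r z) y ∊ Pz y /\ lez y (rst (glue p r z) y) (rst p y)).
 { apply (@ord_ind S (fun y => Sub z y -> rst (glue p r z) y ∊ Pz y /\ lez y (rst (glue p r z) y) (rst p y))).
  - apply Ord_sc, (scd_ord X).
  - apply Min_d. dfn.
  - intros y Y IH ZY.
   assert (Yd : y ∊ sc d).
   { apply in_sc in Y as [Y| ->]; auto. apply d_in, (scd_tr X Y). }
   assert (YX : Sub y x) by (apply in_sc in Y as [Y| ->]; [exact (proj1 (scd_ord X) y Y)|apply Sub_refl]).
   assert (STEP : forall k q, op k q ∊ p -> ~ k ∊ z -> k ∊ y -> rst (glue p r z) k ∊ Pz k /\ lez k (rst (glue p r z) k) (rst p k)).
   { intros k q Q NK KY. apply IH; auto. assert (OK : Ord k) by (apply (Ord_in (scd_ord Yd) KY)).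
    destruct (Ord_total (scd_ord Z) OK) as [T|T]; auto. apply (Ord_le OK (scd_ord Z)) in T as [T|T]; [tauto|subst; apply Sub_refl]. }
   assert (PY : rst (glue p r z) y ∊ Pz y).
   { apply condP; auto. split; [split; [apply fin_rst; auto|]|].
    - exists (sep y (fun k => exists q, op k q ∊ glue p r z)). split; [intros k K; sepd in K; tauto|]. split; [|split].
     + intros u [U [k [q [-> K]]]]%in_rst. exists k, q; split; auto. sepd; eauto.
     + intros k K. sepd in K. destruct K as [K [q Q]]. exists q. apply op_rst; auto.
     + intros k q q' Q Q'. apply op_rst in Q; apply op_rst in Q'. destruct Q as [Q _], Q' as [Q' _].
      apply op_glue in Q; apply op_glue in Q'. destruct Q as [Q|[Q NQ]], Q' as [Q'|[Q' NQ']].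
      * apply (P_fun Z RP Q Q').
      * destruct NQ'. apply (P_dom Z RP Q).
      * destruct NQ. apply (P_dom Z RP Q').
      * apply (P_fun X H Q Q').
    - intros k q [Q KY]%op_rst. rewrite rst_rst by exact (proj1 (scd_ord Yd) k KY).
     apply op_glue in Q as [Q|[Q NQ]].
     + assert (KZ := P_dom Z RP Q). rewrite (glue_rst X H RP Z (proj1 (scd_ord Z) k KZ)). apply (P_name Z RP Q).
     + destruct (STEP k q Q NQ KY) as [A B]. destruct (P_name X H Q) as [C [D E]]. spl.
      apply (Fmono_name (poset_all (d_in (scd_tr Yd KY))) B E). }
   split; auto. apply condL; auto. split; auto. split; [apply (P_rst X); auto|].
   intros k q1 [Q KY]%op_rst. assert (Ksub : Sub k y) by exact (proj1 (scd_ord Yd) k KY). rewrite rst_rst by auto.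
   destruct (classic (k ∊ z)) as [KZ|NK].
   + destruct (AGR k q1) as [p1 [A B]]; [apply op_rst; auto|]. exists p1. rewrite op_rst, op_glue. split; auto.
    rewrite (glue_rst X H RP Z (proj1 (scd_ord Z) k KZ)); auto.
   + destruct (STEP k q1 Q NK KY) as [A B]. exists q1. rewrite op_rst, op_glue. split; auto.
    assert (Kd := scd_tr Yd KY). apply (Fle_refl Kd (poset_all (d_in Kd))); auto.
    apply (Fmono_name (poset_all (d_in Kd)) B). apply (P_name X H Q). }
 destruct (ALL x (sc_in x) ZX) as [A B].
 assert (GX : rst (glue p r z) x = glue p r z).
 { apply sext; intros u. rewrite in_rst. split; [tauto|]. intros U; split; auto. unfold glue in U. apply in_cup in U as [U|U].
  - destruct (P_pair Z RP U) as [y [q ->]]. exists y, q; split; auto. apply ZX, (P_dom Z RP U).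
  - sepd in U. destruct U as [U _]. destruct (P_pair X H U) as [y [q ->]]. exists y, q; split; auto. apply (P_dom X H U). }
 rewrite GX in A, B. rewrite (P_rst_id X H) in B. split; auto; split; auto; split; auto.
 rewrite <- ER at 2. apply le_rst_self; auto.
Qed.

Lemma scd_d : d ∊ sc d.
Proof. apply sc_in. Qed.
Lemma scd_ssub x y : x ∊ sc d -> y ∊ sc x -> y ∊ sc d /\ Sub y x.
Proof.
 intros X [Y| ->]%in_sc.
 - split; [apply d_in, (scd_tr X Y)|exact (proj1 (scd_ord X) y Y)].
 - split; auto; apply Sub_refl.
Qed.
Lemma sc_scd z : z ∊ d -> sc z ∊ sc d.
Proof.
 intros Z. apply in_sc. assert (O := Ord_in Od Z). apply (Ord_le (Ord_sc O) Od). apply (Ord_sc_le O Od); auto.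
Qed.
Lemma le_xd x p q : x ∊ sc d -> lez x p q -> lez d p q.
Proof. intros X H. apply (le_up scd_d (scd_sub X) X H). Qed.
Lemma P_d x p : x ∊ sc d -> p ∊ Pz x -> p ∊ Pz d.
Proof. intros X H. apply (P_up scd_d (scd_sub X) X H). Qed.
Definition HPd : poset (Pz d) (Lz d) := poset_all scd_d.
Notation GD := (Gen (Pz d) (Lz d)).

Lemma rst_G (i : GD) p z : z ∊ sc d -> gU i p -> gU i (rst p z).
Proof.
 intros Z H. apply (gU_up HPd H). apply le_rst_self; auto; [apply scd_d|apply scd_sub; auto|apply (gU_sub H)].
Qed.
(** A dense set of the smaller stage gives a dense set of conditions of the last stage whose
    restriction lies in it, because an extension of the restriction can be glued back. *)
Lemma res_gen z (i : GD) : z ∊ sc d -> generic (@smem S) (Pz z) (Lz z) (fun p => gU i p /\ p ∊ Pz z).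
Proof.
 intros Z. assert (ZD := scd_sub Z). split.
 - tauto.
 - destruct (gU_ne i) as [p G]. exists (rst p z). split; [apply rst_G; auto|]. apply (P_rst scd_d); auto. apply (gU_sub G).
 - intros p q [G Q] Hp L. split; auto. apply (gU_up HPd G). apply (le_xd Z). apply t_below; auto.
 - intros p q [G Hp] [G' Hq]. destruct (gU_dir G G') as [r [R1 [R2 R3]]]. exists (rst r z).
  split; [split; [apply rst_G; auto|apply (P_rst scd_d); auto; apply (gU_sub R1)]|].
  rewrite !t_below. rewrite <- (P_rst_id Z Hp), <- (P_rst_id Z Hq). split; apply (le_rst scd_d); auto.
 - intros A [A1 A2]. destruct (@gen_dense S (Pz d) (Lz d) (gU i) (fun p => rst p z ∊ A) (proj2_sig i)) as [p [G B]].
  + dfn.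
  + intros p Hp. destruct (A2 (rst p z)) as [r [R1 R2]]; [apply (P_rst scd_d); auto|]. apply t_below in R2.
   destruct (glue_all scd_d Z ZD Hp R2) as [C1 [C2 [C3 C4]]]. exists (glue p r z). rewrite C4; auto.
  + exists (rst p z). split; auto. split; [apply rst_G; auto|]. apply (P_rst scd_d); auto. apply (gU_sub G).
Qed.
Definition Rs z (H : z ∊ sc d) (i : GD) : Gen (Pz z) (Lz z) := exist _ _ (res_gen i H).
Lemma gUd_ex p : p ∊ Pz d -> exists i : GD, gU i p.
Proof. apply (gen_ex HPd cnt). Qed.

(** Only the restriction of q is in the filter. It has a common extension with s there; gluing this
    under q gives a condition that need not be in the filter, but whose restriction is. *)
Lemma amal x z (i : GD) q s : x ∊ sc d -> z ∊ sc x -> q ∊ Pz x -> gU i (rst q z) -> gU i s -> s ∊ Pz z ->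
 exists r, r ∊ Pz x /\ lez x r q /\ lez x r s /\ gU i (rst r z).
Proof.
 intros X Z Q G Gs Hs. destruct (scd_ssub X Z) as [Zd ZX]. assert (Q' := P_rst X ZX Zd Q).
 destruct (@gU_dir _ _ _ (Rs Zd i) (rst q z) s) as [r [R1 [R2 R3]]]; [split; auto|split; auto|].
 destruct (glue_all X Zd ZX Q R2) as [C1 [C2 [C3 C4]]]. exists (glue q r z). spl. split.
 - apply (le_tr (poset_all X) C3). apply (le_up X ZX Zd R3).
 - rewrite C4. apply R1.
Qed.

(** Sets D of pairs (p,x) serve as names for sets of ground-model objects; their evaluation involves
    no recursion on names. *)
Definition Ad P L (i : Gen P L) D x := exists p, gU i p /\ op p x ∊ D.
Definition lvl z D := forall p x, op p x ∊ D -> p ∊ Pz z.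
(** If membership failed, some s in the filter at stage z would be incompatible with all conditions
    putting x into D. But [amal] gives a common extension of q and s, and a filter through it
    contradicts the hypothesis on q. *)
Lemma abs_pos z (i : GD) D q x : z ∊ sc d -> lvl z D -> q ∊ Pz d -> gU i (rst q z) -> (forall i' : GD, gU i' q -> Ad i' D x) -> Ad i D x.
Proof.
 intros Z LD Q G H. assert (HZ := poset_all Z).
 destruct (@gen_dense S (Pz z) (Lz z) (gU (Rs Z i)) (fun s => (exists p, op p x ∊ D /\ le (Pz z) (Lz z) s p) \/
  forall p, op p x ∊ D -> forall t, le (Pz z) (Lz z) t s -> ~ le (Pz z) (Lz z) t p) (proj2_sig (Rs Z i))) as [s [Gs K]].
 - dfn.
 - intros s Hs. destruct (classic (exists p t, op p x ∊ D /\ le (Pz z) (Lz z) t s /\ le (Pz z) (Lz z) t p)) as [[p [t [A [B C]]]]|N].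
  + exists t. split; auto. left; eauto.
  + exists s. split; [|apply (le_refl HZ Hs)]. right. intros p A t B C. apply N; eauto.
 - destruct Gs as [Gs Hs]. destruct K as [[p [A B]]|K].
  + exists p; split; auto. apply (gU_up HPd Gs). apply (le_xd Z B).
  + exfalso. destruct (amal scd_d Z Q G Gs Hs) as [r [R1 [R2 [R3 _]]]].
   destruct (gUd_ex R1) as [i' I]. destruct (H i' (gU_up HPd I R2)) as [p [Gp Dp]].
   destruct (@gU_dir _ _ _ (Rs Z i') p s) as [t [T1 [T2 T3]]].
   * split; auto. apply (LD _ _ Dp).
   * split; auto. apply (gU_up HPd I R3).
   * apply (K p Dp t T3 T2).
Qed.

(** * Adjoining one coordinate *)

Section Ext.
Variable z : S.
Hypothesis Hz : z ∊ d.
Let Zs : z ∊ sc d := d_in Hz.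
Let HPz : poset (Pz z) (Lz z) := poset_all Zs.
Lemma adj_rst r q y : r ∊ Pz z -> Sub y z -> rst (adj r (op z q)) y = rst r y.
Proof.
 intros R Y. apply sext; intros u. rewrite !in_rst, in_adj. split; [|intros [A B]; tauto].
 intros [[A| ->] [k [q' [E K]]]]; [split; eauto|]. opi. destruct (nin (Y _ K)).
Qed.
Lemma adj_P x r q : x ∊ sc d -> z ∊ x -> r ∊ Pz z -> isname z q -> Fz z r (q ∈ Qz z) -> adj r (op z q) ∊ Pz x.
Proof.
 intros X ZX R N F. assert (R' := R). apply condP in R'; auto. destruct R' as [[A [a [B C]]] D]. apply condP; auto.
 assert (NZ : forall q', ~ op z q' ∊ r) by (intros q' H; apply (P_dom Zs R) in H; apply (nin H)).
 split; [split; [apply fin_adj; auto|]|].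
 - exists (adj a z). split; [intros y [Y| ->]%in_adj; auto; apply (Ord_tr (scd_ord X) (B _ Y) ZX)|].
  split; [|split].
  + intros u [U| ->]%in_adj.
   * destruct (proj1 C u U) as [y [q' [Y ->]]]. exists y, q'. rewrite in_adj; auto.
   * exists z, q. rewrite in_adj; auto.
  + intros y [Y| ->]%in_adj.
   * destruct (proj1 (proj2 C) y Y) as [q' Q]. exists q'. apply in_adj; auto.
   * exists q. apply in_adj; auto.
  + intros y q1 q2 Q1 Q2. apply in_adj in Q1, Q2. destruct Q1 as [Q1|Q1], Q2 as [Q2|Q2].
   * apply (P_fun Zs R Q1 Q2).
   * opi. destruct (NZ _ Q1).
   * opi. destruct (NZ _ Q2).
   * opi; congruence.
 - intros y q' [Q|Q]%in_adj.
  + rewrite adj_rst; auto. apply (proj1 (scd_ord Zs)), (P_dom Zs R Q).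
  + apply op_inj in Q. destruct Q; subst y q'. rewrite adj_rst, P_rst_id; auto. apply Sub_refl.
Qed.
Lemma adj_le r q p : p ∊ Pz (sc z) -> r ∊ Pz z -> isname z q -> Fz z r (q ∈ Qz z) -> lez z r (rst p z) ->
 (forall q', op z q' ∊ p -> Fz z r (hechler_le q q')) -> lez (sc z) (adj r (op z q)) p.
Proof.
 intros Hp R N F L H. assert (X := sc_scd Hz). apply condL; auto. split; [apply adj_P; auto; apply sc_in|]. split; auto.
 intros y q1 Q. assert (Y := P_dom X Hp Q). apply in_sc in Y as [Y| ->].
 - apply condL in L; auto. destruct L as [_ [_ L]]. destruct (L y q1) as [p1 [A B]]; [apply op_rst; auto|].
  exists p1. rewrite in_adj. split; auto. rewrite adj_rst; auto. exact (proj1 (scd_ord Zs) y Y).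
 - exists q. rewrite in_adj. split; auto. rewrite adj_rst, P_rst_id; auto. apply Sub_refl.
Qed.
(** The pair (n,f) lives in the extension at stage z and has a name s there. A condition of the
    filter forces s below the values of p and of q at z; put under s, it yields a common
    extension. *)
Lemma ext2 (j : Gen (Pz z) (Lz z)) p q n f : p ∊ Pz (sc z) -> q ∊ Pz (sc z) -> gU j (rst p z) -> gU j (rst q z) ->
 n ∊ om -> isfun f om om ->
 (forall q', op z q' ∊ p \/ op z q' ∊ q -> tr (hechler_le (op n f) (vl HPz j q'))) ->
 exists r s, r ∊ Pz (sc z) /\ lez (sc z) r p /\ lez (sc z) r q /\ gU j (rst r z) /\ op z s ∊ r /\ vl HPz j s = op n f.
Proof.
 intros Hp Hq Gp Gq Hn Hf H. assert (X := sc_scd Hz).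
 destruct (hech_name Hz Hn Hf) as [s [N [V [p1 [G1 F1]]]]].
 assert (K : forall p, p ∊ Pz (sc z) -> (forall q', op z q' ∊ p -> tr (hechler_le (op n f) (vl HPz j q'))) ->
  exists p2, gU j p2 /\ forall q', op z q' ∊ p -> Fz z p2 (hechler_le s q')).
 { intros p0 P0 H0. destruct (classic (exists q', op z q' ∊ p0)) as [[q' Q]|NQ].
  - assert (T := H0 q' Q). rewrite <- V in T.
   apply (@t_vl _ _ _ HPz j (fun V e => hechler_le (e 0) (e 1)) (scons s (fun _ => q')) (ltac:(cod))) in T.
   apply (@forces_truth _ _ _ HPz (gU j) (fun V e => hechler_le (e 0) (e 1)) (proj2_sig j) (ltac:(cod)) (scons s (fun _ => q'))) in T.
   destruct T as [p2 [G2 T]]. exists p2; split; auto. intros q2 Q2. rewrite (P_fun X P0 Q2 Q). exact T.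
  - exists p1; split; auto. intros q' Q; destruct NQ; eauto. }
 destruct (K p Hp) as [p2 [G2 F2]]; auto. destruct (K q Hq) as [p3 [G3 F3]]; auto.
 destruct (gU_dir G1 G2) as [a [A1 [A2 A3]]]. destruct (gU_dir A1 G3) as [b [B1 [B2 B3]]].
 destruct (gU_dir B1 Gp) as [c [C1 [C2 C3]]]. destruct (gU_dir C1 Gq) as [r [R1 [R2 R3]]].
 assert (T := fun x y w => @le_tr _ _ _ HPz x y w).
 assert (RB : lez z r b) by eauto. assert (RA : lez z r a) by eauto. assert (R : r ∊ Pz z) by apply R2.
 assert (F : Fz z r (s ∈ Qz z)) by (apply (Fmono_name HPz (p := p1)); eauto).
 exists (adj r (op z s)), s. split; [apply adj_P; auto; apply sc_in|].
 split; [apply adj_le; eauto; intros q' Q; apply (Fmono_le HPz (p := p2)); eauto|].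
 split; [apply adj_le; eauto; intros q' Q; apply (Fmono_le HPz (p := p3)); eauto|].
 split; [rewrite adj_rst, P_rst_id; auto; apply Sub_refl|]. split; auto. apply in_adj; auto.
Qed.
End Ext.

(** * Deciding stems *)

Definition stf {V} (q n t : V) : form V := ∃ f om', omega om' ∧ opair q n f ∧ func f om' om' ∧ sub t f.
Lemma cod_stf : Cod (fun V e => stf (e 0) (e 1) (e 2)).
Proof. unfold stf; cod. Qed.
Lemma t_stf (T : SetM) (q0 n t : T) : tr (stf q0 n t) <-> exists f, isfun f om om /\ q0 = op n f /\ Sub t f.
Proof.
 assert (K : tr (stf q0 n t) <-> exists f w : T, tr (omega w) /\ tr (opair q0 n f) /\
  tr (func f w w) /\ tr (sub t f)) by reflexivity.
 rewrite K. split.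
 - intros [f [w0 [W [O [F H]]]]]. rewrite t_omega in W. subst w0. rewrite t_opair in O. rewrite t_func in F. rewrite t_sub in H. eauto.
 - intros [f [F [O H]]]. exists f, om. rewrite t_omega, t_opair, t_func, t_sub. auto.
Qed.
(** The canonical names are those of the last stage, so that a single definable function of n and t
    serves for all z; by [vl_Chkd] they have the intended values. *)
Definition st z r q n t := Fz z r (stf q (Chk (Pz d) n) (Chk (Pz d) t)).
Definition SQ n t := n ∊ @om S /\ isfun t n om.
Lemma d_st I (U : I -> S -> Prop) E t1 t2 t3 t4 t5 : dfts U E t1 -> dfts U E t2 -> dfts U E t3 ->
 dfts U E t4 -> dfts U E t5 -> dfns U E (fun i e => st (t1 i e) (t2 i e) (t3 i e) (t4 i e) (t5 i e)).
Proof.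
 intros. unfold st, Pz, Lz. assert (DC := d0_Chk (S := S) (Pz d)).
 apply (@d_pcod S I U E (fun V mem e => forces mem (e 0) (e 1) (e 2) (stf (e 3) (e 4) (e 5)))
   (fun n => match n with 0 => fun i e => app PP (t1 i e) | 1 => fun i e => app LL (t1 i e) | 2 => t2 | 3 => t3
   | 4 => fun i e => Chk (Pz d) (t4 i e) | _ => fun i e => Chk (Pz d) (t5 i e) end)).
 - unfold stf; pcod.
 - intros [|[|[|[|[|k]]]]]; dfn.
Qed.
Hint Resolve d_st : dfn.

Section Stem.
Variable z : S.
Hypothesis Hz : z ∊ d.
Let Zs : z ∊ sc d := d_in Hz.
Let HPz : poset (Pz z) (Lz z) := poset_all Zs.
Notation NZ j := (NM HPz j).
(** The pairs in such a name whose condition is not in the filter at stage z contribute nothing, and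
    conditions of stage z, which also belong to the last stage, put every element in. *)
Lemma vl_Chkd (j : Gen (Pz z) (Lz z)) x : vl HPz j (Chk (Pz d) x) = jj HPz j x.
Proof.
 assert (D := d0_Chk (S := S) (Pz d)). assert (D' := d0_Chk (S := S) (Pz z)).
 refine (@mem_ind S (fun x => vl HPz j (Chk (Pz d) x) = jj HPz j x) _ _ x).
 - apply (@gen_IndOk S _ _ HPz (fun j x => vl HPz j (Chk (Pz d) x) = jj HPz j x)).
  apply d_ext with (A := fun i e => eqg i (Chk (Pz d) (e 0)) (Chk (Pz z) (e 0))); [intros; symmetry; apply vl_eq|apply d_eqg; dfn].
 - clear x. intros x IH. apply sext; intros w. rewrite in_jj, Chk_eq, vl_iff. split.
  + intros [rho [r [Q [_ ->]]]]. apply op_prod in Q as [Q _]. rewrite in_img in Q by auto. destruct Q as [y [Y <-]]. eauto.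
  + intros [y [Y ->]]. destruct (gU_ne j) as [r R]. exists (Chk (Pz d) y), r. rewrite op_prod, in_img, IH by auto.
   split; [|auto]. split; [eauto|]. apply (P_d Zs (gU_sub R)).
Qed.
Lemma st_truth (j : Gen (Pz z) (Lz z)) q n t : truth (gE j) (stf q (Chk (Pz d) n) (Chk (Pz d) t)) <->
 exists f, isfun (S := NZ j) f om om /\ vl HPz j q = op (jj HPz j n) f /\ Sub (jj HPz j t) f.
Proof.
 rewrite (@t_vl _ _ _ HPz j (fun V e => stf (e 0) (e 1) (e 2)) (scons q (scons (Chk (Pz d) n) (fun _ => Chk (Pz d) t))) cod_stf).
 change (fun V e => stf (e 0) (e 1) (e 2)) with (fun V (e : nat -> V) => stf (e 0) (e 1) (e 2)).
 match goal with |- truth _ ?f <-> _ => change f with (stf (vl HPz j q) (vl HPz j (Chk (Pz d) n)) (vl HPz j (Chk (Pz d) t))) end.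
 rewrite t_stf, !vl_Chkd. reflexivity.
Qed.
Lemma st_iff r q n t : r ∊ Pz z -> (st z r q n t <-> forall j : Gen (Pz z) (Lz z), gU j r ->
 exists f, isfun (S := NZ j) f om om /\ vl HPz j q = op (jj HPz j n) f /\ Sub (jj HPz j t) f).
Proof.
 intros R. unfold st.
 rewrite (@forces_Forced _ _ _ HPz cnt (fun V e => stf (e 0) (e 1) (e 2)) r cod_stf R (scons q (scons (Chk (Pz d) n) (fun _ => Chk (Pz d) t)))).
 split; intros H j G; apply st_truth, H; auto.
Qed.
Lemma st_mono r r' q n t : lez z r' r -> st z r q n t -> st z r' q n t.
Proof.
 intros L H. apply st_iff; [apply L|]. intros j G. apply (proj1 (st_iff q n t (le_in HPz L)) H).
 apply (gU_up HPz G L).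
Qed.
Lemma jj_isfun_inv (j : Gen (Pz z) (Lz z)) f a b : isfun (S := NZ j) (jj HPz j f) (jj HPz j a) (jj HPz j b) -> isfun f a b.
Proof.
 intros [A [B C]]. split; [|split].
 - intros u U. apply (jj_mem HPz j), A in U. rewrite <- jj_prod, jj_mem in U. auto.
 - intros x X. destruct (B (jj HPz j x)) as [y Y]; [apply jj_mem; auto|]. assert (Y' := A _ Y). rewrite <- jj_prod, in_jj in Y'.
  destruct Y' as [u [_ E]]. rewrite E, jj_mem in Y.
  assert (U := proj2 (jj_mem HPz j u f) Y). apply A in U. rewrite <- jj_prod, jj_mem in U. apply in_prod in U as [x' [y' [_ [_ ->]]]]. rewrite jj_op in E. apply op_inj in E as [E _]. apply jj_inj in E. subst. eauto.
 - intros x y y' Y Y'. apply (jj_inj (HP := HPz) (i := j)). apply (C (jj HPz j x)); rewrite <- jj_op; apply jj_mem; auto.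
Qed.
(** No new finite sequences of natural numbers appear: this is an induction on the length, adjoining
    one pair of ground-model numbers at a time. *)
Lemma real_rst (j : Gen (Pz z) (Lz z)) f n : isfun (S := NZ j) f om om -> n ∊ om -> exists t, SQ n t /\ rst f (jj HPz j n) = jj HPz j t.
Proof.
 intros F N. assert (FN : forall m, m ∊ @om (NZ j) -> rst f m ∊ jj HPz j (Pw (prod om om))).
 { apply om_ind.
  - apply Min_d. dfn.
  - replace (rst f em) with (@em (NZ j)); [rewrite <- (jj_em HPz j); apply jj_mem, in_Pw; intros u U; destruct (in_em U)|].
   apply sext; intros u. rewrite in_rst. split; [intros U; destruct (in_em U)|intros [_ [k [v [_ K]]]]; destruct (in_em K)].
  - intros m Hm [a [A E]]%in_jj.
   assert (HA := app_cod F Hm). rewrite <- (jj_om HPz j) in Hm, HA. apply in_jj in Hm, HA. destruct Hm as [m' [Hm' ->]], HA as [k [Hk K]].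
   replace (rst f (sc (jj HPz j m'))) with (jj HPz j (adj a (op m' k))).
   + apply jj_mem, in_Pw. intros u U. apply in_Pw in A. apply in_adj in U as [U| ->]; auto. apply op_prod; auto.
   + rewrite jj_adj, jj_op, <- E, <- K. apply sext; intros u. rewrite in_adj, !in_rst. split.
    * intros [[U [k' [v [-> Q]]]]| ->]; [split; auto; exists k', v; split; auto; apply in_sc; auto|].
     split; [apply (app_in F); rewrite <- (jj_om HPz j); apply jj_mem; auto|]. do 2 eexists; split; [reflexivity|]. apply sc_in.
    * intros [U [k' [v [-> Q]]]]. apply in_sc in Q as [Q| ->]; [left; split; eauto|right].
     f_equal. apply (app_iff v F); auto. apply (fun_dom F U). }
 assert (N' : jj HPz j n ∊ @om (NZ j)) by (rewrite <- (jj_om HPz j); apply jj_mem; auto).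
 assert (K := FN _ N'). apply in_jj in K as [t [_ E]]. exists t. split; auto. split; auto.
 apply (@jj_isfun_inv j). rewrite <- E, jj_om. apply (rst_fun F). intros u U. apply (om_tr N' U).
Qed.
Lemma st_ex (j : Gen (Pz z) (Lz z)) r q n' f : gU j r -> isfun (S := NZ j) f om om -> n' ∊ om -> vl HPz j q = op n' f ->
 exists n t r', n' = jj HPz j n /\ SQ n t /\ rst f n' = jj HPz j t /\ gU j r' /\ lez z r' r /\ st z r' q n t.
Proof.
 intros G F N V. rewrite <- (jj_om HPz j) in N. apply in_jj in N as [n [N ->]].
 destruct (real_rst F N) as [t [T E]]. exists n, t.
 assert (K : truth (gE j) (stf q (Chk (Pz d) n) (Chk (Pz d) t))).
 { apply st_truth. exists f; spl. rewrite <- E. intros u U; apply in_rst in U; tauto. }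
 apply (@forces_truth _ _ _ HPz (gU j) (fun V e => stf (e 0) (e 1) (e 2)) (proj2_sig j) cod_stf (scons q (scons (Chk (Pz d) n) (fun _ => Chk (Pz d) t)))) in K.
 destruct K as [r1 [G1 K]]. destruct (gU_dir G G1) as [r' [R1 [R2 R3]]]. exists r'. spl.
 apply (st_mono R3 K).
Qed.
Lemma st_val (j : Gen (Pz z) (Lz z)) r q n t : gU j r -> st z r q n t ->
 exists f, isfun (S := NZ j) f om om /\ vl HPz j q = op (jj HPz j n) f /\ Sub (jj HPz j t) f.
Proof. intros G H. apply (proj1 (st_iff q n t (gU_sub G)) H j G). Qed.
Lemma SQ_agree (j : Gen (Pz z) (Lz z)) n t f k : SQ n t -> isfun (S := NZ j) f om om -> Sub (jj HPz j t) f -> k ∊ n -> app f (jj HPz j k) = jj HPz j (app t k).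
Proof. intros [N T] F K Hk. apply (app_eq F), K. rewrite <- jj_op. apply jj_mem, (app_in T Hk). Qed.
End Stem.

Definition dm p := sep (Un (Un p)) (fun z => exists q, op z q ∊ p).
Lemma in_dm p z : z ∊ dm p <-> exists q, op z q ∊ p.
Proof.
 unfold dm. sepd. split; [tauto|]. intros [q Q]; split; eauto. apply in_Un. exists (sg z). split; [|apply in_sg; auto].
 apply in_Un. exists (op z q). split; auto. apply in_up; auto.
Qed.
Lemma fin_dm x p : x ∊ sc d -> p ∊ Pz x -> fin (dm p).
Proof.
 intros X H. assert (F : fin p) by (apply condP in H; tauto). apply (fin_img (F := @pr1 S) (a := p)); auto.
 - dfn.
 - intros y [q Q]%in_dm. exists (op y q). rewrite pr1_op; auto.
Qed.
Lemma fin_max a : fin a -> (forall y, y ∊ a -> Ord y) -> a = em \/ exists m, m ∊ a /\ forall y, y ∊ a -> Sub y m.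
Proof.
 revert a. refine (@fin_ind S (fun a => (forall y, y ∊ a -> Ord y) -> a = em \/ exists m, m ∊ a /\ forall y, y ∊ a -> Sub y m) _ _ _).
 - dfn.
 - auto.
 - intros a y _ IH _ O. right. destruct IH as [->|[m [M1 M2]]].
  + intros; apply O, in_adj; auto.
  + exists y. rewrite in_adj; split; auto. intros k [K| ->]%in_adj; [destruct (in_em K)|apply Sub_refl].
  + assert (Om : Ord m) by (apply O, in_adj; auto). assert (Oy : Ord y) by (apply O, in_adj; auto).
   destruct (Ord_total Om Oy) as [L|L].
   * exists y. rewrite in_adj; split; auto. intros k [K| ->]%in_adj; [|apply Sub_refl]. exact (Sub_trans (M2 k K) L).
   * exists m. rewrite in_adj; split; auto. intros k [K| ->]%in_adj; auto.
Qed.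
Lemma P_low x y p : x ∊ sc d -> y ∊ sc d -> p ∊ Pz x -> (forall k q, op k q ∊ p -> k ∊ y) -> p ∊ Pz y.
Proof.
 intros X Y H K. apply condP in H; auto. destruct H as [[A [a [B C]]] D]. apply condP; auto. split; auto. split; auto.
 exists a; split; auto. intros k Hk. destruct (proj1 (proj2 C) k Hk) as [q Q]. apply (K k q Q).
Qed.
Lemma P_em x p : x ∊ sc d -> p ∊ Pz x -> dm p = em -> p = em.
Proof.
 intros X H E. apply sext; intros u. split; [|intros K; destruct (in_em K)]. intros U. destruct (P_pair X H U) as [z [q ->]].
 destruct (@in_em S z). rewrite <- E. apply in_dm; eauto.
Qed.

(* The conditions all of whose stems are decided, by pairs (length, stem) of the ground model. *)
Definition dst p := forall z q, op z q ∊ p -> exists n t, SQ n t /\ st z (rst p z) q n t.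
(** The support is finite, so it has a largest coordinate z. The stem there is decided by
    strengthening the part below z, to which the induction hypothesis is then applied, and the
    result is glued back. *)
Lemma dst_dense x : x ∊ sc d -> forall p, p ∊ Pz x -> exists q, lez x q p /\ dst q.
Proof.
 revert x. refine (@ord_ind S (fun x => forall p, p ∊ Pz x -> exists q, lez x q p /\ dst q) _ _ _ _).
 - apply Ord_sc, Od.
 - apply Min_d. dfn.
 - intros x X IH p H. destruct (fin_max (fin_dm X H)) as [E|[z [Z M]]].
  + intros y [q Q]%in_dm. apply (Ord_in (scd_ord X) (P_dom X H Q)).
  + exists p. split; [apply (le_refl (poset_all X) H)|]. intros z q Q. rewrite (P_em X H E) in Q. destruct (in_em Q).
  + apply in_dm in Z as [q Q]. assert (ZX := P_dom X H Q). assert (Zd := scd_tr X ZX). assert (Zs := d_in Zd).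
   destruct (P_name X H Q) as [R [N F]]. destruct (gen_ex (poset_all Zs) cnt R) as [j G].
   assert (Zx : Sub z x) by exact (proj1 (scd_ord X) z ZX).
   destruct (name_hech Zd (poset_all (d_in Zd)) G F) as [n' [f [N' [F' V]]]].
   destruct (st_ex (Hz := Zd) G F' N' V) as [n [t [r1 [_ [T [_ [_ [L1 ST]]]]]]]].
   assert (R1 : r1 ∊ Pz z) by apply L1. destruct (IH z ZX r1 R1) as [r2 [L2 D2]].
   assert (L3 : lez z r2 (rst p z)) by apply (le_tr (poset_all Zs) L2 L1).
   destruct (glue_all X Zs Zx H L3) as [G1 [G2 [G3 G4]]]. exists (glue p r2 z). split; auto.
   intros y q' Q'. apply op_glue in Q' as [Q'|[Q' NZ]].
   * assert (R2 : r2 ∊ Pz z) by apply L2. assert (Y := P_dom Zs R2 Q'). rewrite (glue_rst X H R2 Zs (proj1 (scd_ord Zs) y Y)). apply (D2 y q' Q').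
   * assert (Y : y = z).
    { assert (K : Sub y z) by (apply M, in_dm; eauto). apply (Ord_le (Ord_in (scd_ord X) (P_dom X H Q')) (scd_ord Zs)) in K. tauto. }
    subst y. rewrite (P_fun X H Q' Q), G4. exists n, t; split; auto. apply (st_mono Zd L2 ST).
Qed.
Lemma st_uniq z r q n t n' t' : z ∊ d -> r ∊ Pz z -> SQ n t -> SQ n' t' -> st z r q n t -> st z r q n' t' -> n = n' /\ t = t'.
Proof.
 intros Z R T T' H H'. destruct (gen_ex (poset_all (d_in Z)) cnt R) as [j G].
 destruct (st_val Z G H) as [f [F [V K]]]. destruct (st_val Z G H') as [f' [F' [V' K']]].
 rewrite V in V'. apply op_inj in V' as [E <-]. apply jj_inj in E. subst n'. split; auto.
 apply (fun_ext (proj2 T) (proj2 T')). intros k Hk. apply (@jj_inj _ _ _ (poset_all (d_in Z)) j).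
 rewrite <- (SQ_agree (Hz := Z) T F K Hk), <- (SQ_agree (Hz := Z) T' F K' Hk). reflexivity.
Qed.

(** Let z be the largest coordinate in the two supports. The parts below z have a common extension
    by induction; in an extension through it the two values at z have the same stem, so the maximum
    of their functions gives a Hechler condition below both. *)
Lemma same_stems_compat x : x ∊ sc d -> forall p p', p ∊ Pz x -> p' ∊ Pz x ->
 (forall z q q', op z q ∊ p -> op z q' ∊ p' -> exists n t, SQ n t /\ st z (rst p z) q n t /\ st z (rst p' z) q' n t) ->
 exists r, lez x r p /\ lez x r p'.
Proof.
 revert x. refine (@ord_ind S (fun x => forall p p', p ∊ Pz x -> p' ∊ Pz x ->
 (forall z q q', op z q ∊ p -> op z q' ∊ p' -> exists n t, SQ n t /\ st z (rst p z) q n t /\ st z (rst p' z) q' n t) ->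
 exists r, lez x r p /\ lez x r p') _ _ _ _).
 - apply Ord_sc, Od.
 - apply Min_d. dfn.
 - intros x X IH p p' H H' K.
  assert (HD : forall z, z ∊ cup (dm p) (dm p') <-> exists q, op z q ∊ p \/ op z q ∊ p').
  { intros z. rewrite in_cup, !in_dm. split; [intros [[q Q]|[q Q]]; eauto|intros [q [Q|Q]]; eauto]. }
  assert (HX : forall z q, op z q ∊ p \/ op z q ∊ p' -> z ∊ x) by (intros z q [Q|Q]; [apply (P_dom X H Q)|apply (P_dom X H' Q)]).
  destruct (fin_max (fin_cup (fin_dm X H) (fin_dm X H'))) as [E|[z [Z M]]].
  + intros y [q Q]%HD. apply (Ord_in (scd_ord X) (HX y q Q)).
  + assert (NE : forall z, ~ z ∊ cup (dm p) (dm p')) by (intros z; rewrite E; apply in_em).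
   assert (E1 : p = em).
   { apply (P_em X H). apply sext; intros z; split; intros Z; [|destruct (in_em Z)]. destruct (NE z). apply in_cup; auto. }
   assert (E2 : p' = em).
   { apply (P_em X H'). apply sext; intros z; split; intros Z; [|destruct (in_em Z)]. destruct (NE z). apply in_cup; auto. }
   subst p p'. exists em. split; apply (le_refl (poset_all X) H).
  + assert (ZX : z ∊ x) by (apply HD in Z as [q Q]; eauto).
   assert (Zd := scd_tr X ZX). assert (Zs := d_in Zd). assert (Zx : Sub z x) by exact (proj1 (scd_ord X) z ZX).
   assert (SX : Sub (sc z) x) by (apply (Ord_sc_le (scd_ord Zs) (scd_ord X)); auto). assert (SZ := sc_scd Zd).
   assert (LOW : forall y q, op y q ∊ p \/ op y q ∊ p' -> y ∊ sc z).
   { intros y q Q. assert (Y : Sub y z) by (apply M, HD; eauto).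
    apply (Ord_le (Ord_in (scd_ord X) (HX y q Q)) (scd_ord Zs)) in Y. apply in_sc; auto. }
   assert (Hp : p ∊ Pz (sc z)) by (apply (P_low X SZ H); eauto). assert (Hp' : p' ∊ Pz (sc z)) by (apply (P_low X SZ H'); eauto).
   destruct (IH z ZX (rst p z) (rst p' z)) as [r0 [L1 L2]].
   { apply (P_rst X); auto. } { apply (P_rst X); auto. }
   { intros y q q' Q Q'. apply op_rst in Q, Q'. destruct Q as [Q Y], Q' as [Q' _]. rewrite !rst_rst by exact (proj1 (scd_ord Zs) y Y). apply K; auto. }
   destruct (gen_ex (poset_all (d_in Zd)) cnt (le_in1 L1)) as [j G].
   assert (G1 := gU_up (poset_all (d_in Zd)) G L1). assert (G2 := gU_up (poset_all (d_in Zd)) G L2).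
   assert (VAL : forall p0 q, p0 ∊ Pz x -> gU j (rst p0 z) -> op z q ∊ p0 -> exists n f, n ∊ om /\ isfun f om om /\ vl (poset_all (d_in Zd)) j q = op n f).
   { intros p0 q P0 G0 Q. destruct (P_name X P0 Q) as [_ [_ F]]. apply (name_hech Zd (poset_all (d_in Zd)) G0 F). }
   assert (NF : exists n f, n ∊ om /\ isfun f om om /\ forall q', op z q' ∊ p \/ op z q' ∊ p' ->
    truth (@smem (NM (poset_all (d_in Zd)) j)) (hechler_le (op n f) (vl (poset_all (d_in Zd)) j q'))).
   { destruct (classic (exists q, op z q ∊ p)) as [[q Q]|N1].
    - destruct (VAL p q H G1 Q) as [n [f [N [F V]]]].
     destruct (classic (exists q', op z q' ∊ p')) as [[q' Q']|N2].
     + destruct (VAL p' q' H' G2 Q') as [n2 [f' [N' [F' V']]]]. destruct (K z q q' Q Q') as [m [t [T [T1 T2]]]].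
      destruct (st_val Zd G1 T1) as [f1 [F1 [V1 K1]]]. destruct (st_val Zd G2 T2) as [f2 [F2 [V2 K2]]].
      rewrite V in V1. rewrite V' in V2. apply op_inj in V1, V2. destruct V1 as [E1 <-], V2 as [E2 <-]. subst n n2.
      assert (AG : forall k, k ∊ jj (poset_all (d_in Zd)) j m -> app f k = app f' k).
      { intros k [k' [Hk ->]]%in_jj. rewrite (SQ_agree (Hz := Zd) T F1 K1 Hk), (SQ_agree (Hz := Zd) T F2 K2 Hk). auto. }
      destruct (hle_mx N F F' AG) as [A B]. destruct (mx_all F F') as [MX _].
      exists (jj (poset_all (d_in Zd)) j m), (mx f f'). spl.
      intros q1 [Q1|Q1]; [rewrite (P_fun X H Q1 Q), V; auto|rewrite (P_fun X H' Q1 Q'), V'; auto].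
     + exists n, f. spl. intros q1 [Q1|Q1]; [|destruct N2; eauto]. rewrite (P_fun X H Q1 Q), V. apply hle_refl; auto.
    - apply HD in Z as [q' [Q'|Q']]; [destruct N1; eauto|]. destruct (VAL p' q' H' G2 Q') as [n [f [N [F V]]]].
     exists n, f. spl. intros q1 [Q1|Q1]; [destruct N1; eauto|]. rewrite (P_fun X H' Q1 Q'), V. apply hle_refl; auto. }
   destruct NF as [n [f [N [F HH]]]]. destruct (ext2 Hp Hp' G1 G2 N F HH) as [r [s [R1 [R2 [R3 _]]]]].
   exists r. split; apply (le_up X SX SZ); auto.
Qed.

(** * The countable chain condition and its consequences *)

Definition FS X := sep (Pw X) (fun a => fin a).
Lemma in_FS X a : a ∊ FS X <-> Sub a X /\ fin a.
Proof. unfold FS. sepd. rewrite in_Pw. tauto. Qed.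
(** Under an enumeration of X, every finite subset is contained in an initial segment, and a finite
    set has finitely many subsets. *)
Lemma ctb_FS X : ctb X -> ctb (FS X).
Proof.
 intros [f F]. set (A := fun m => Pw (sep X (fun x => app f x ∊ m))).
 assert (HA : forall m a, a ∊ A m <-> Sub a X /\ forall x, x ∊ a -> app f x ∊ m).
 { intros m a. unfold A. rewrite in_Pw. split.
  - intros H; split; intros x Hx; apply H in Hx; sepd in Hx; tauto.
  - intros [H1 H2] x Hx. sepd; auto. }
 assert (DA : d0 A) by dfn.
 apply (ctb_cover (F := A) (a := om)); [auto|apply ctb_om| |].
 { intros m M. apply fin_ctb, fin_Pw. exists m. split; auto. apply (emb_lam (F := fun x => app f x)).
  - dfn.
  - intros x Hx. sepd in Hx. tauto.
  - intros x x' Hx Hx'. sepd in Hx. sepd in Hx'. apply (Inj_app F); tauto. }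
 intros a [Ha Fa]%in_FS.
 destruct (@fin_bound S unit _ _ (@IndOk_pure S) (fun _ x m => app f x ∊ m) tt a) as [m [M K]]; auto.
 - dfn.
 - intros y Y. exists (sc (app f y)). split; [apply om_S, (app_cod (proj1 F)); auto|apply sc_in].
 - exists m. split; auto. apply HA; auto.
Qed.
Definition SQs := sep (Pw (prod om om)) (fun t : S => exists n, SQ n t).
Lemma in_SQs t : t ∊ SQs <-> exists n, SQ n t.
Proof.
 unfold SQs. sepd. rewrite in_Pw. split; [tauto|]. intros [n [N T]]; split; [|exists n; split; auto]. intros u U.
 apply (proj1 T) in U. apply in_prod in U as [k [m [K [M ->]]]]. apply op_prod. split; auto. apply (om_tr N K).
Qed.
Lemma fin_SQ n t : SQ n t -> fin t.
Proof.
 intros [N T]. apply (fin_img (F := fun k => op k (app t k)) (a := n)).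
 - dfn.
 - apply fin_nat; auto.
 - intros u U. assert (U' := proj1 T u U). apply in_prod in U' as [k [m [K [M ->]]]]. exists k; split; auto.
  f_equal. symmetry. apply (app_iff _ T); auto.
Qed.
Lemma ctb_SQs : ctb SQs.
Proof.
 refine (ctb_sub _ (ctb_FS (@ctb_prod S))). intros t [n T]%in_SQs. apply in_FS.
 split; [|apply (fin_SQ T)]. apply in_Pw. assert (X : t ∊ SQs) by (apply in_SQs; eauto). unfold SQs in X. sepd in X. tauto.
Qed.
Lemma SQ_dom n n' t : SQ n t -> SQ n' t -> n = n'.
Proof.
 intros [N T] [N' T']. apply sext; intros k; split; intros K.
 - apply (fun_dom T' (app_in T K)).
 - apply (fun_dom T (app_in T' K)).
Qed.

Definition stm q o' := forall z t, op z t ∊ o' -> exists q' n, op z q' ∊ q /\ SQ n t /\ st z (rst q z) q' n t.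

(* Close a countable set C of coordinates under a choice, for every finite piece of stems over C, of a condition extending it;
  then two conditions that agree on C agree on all the common coordinates. *)
Lemma ccc x A : x ∊ sc d -> Sub A (Pz x) -> exists A', Sub A' A /\ ctb A' /\ forall a, a ∊ A -> exists a' r, a' ∊ A' /\ lez x r a /\ lez x r a'.
Proof.
 intros X HA. defset B HB (sep (Pz x) (fun q => dst q /\ exists a, a ∊ A /\ lez x q a)).
 destruct (@choose S (fun o' q => stm q o') B) as [ph [Dph Hph]]; [dfn|].
 set (F := fun C => cup C (sep x (fun z => exists o', o' ∊ FS (prod C SQs) /\ ph o' ∊ B /\ z ∊ dm (ph o')))).
 assert (HF : forall C z, z ∊ F C <-> z ∊ C \/ z ∊ x /\ exists o', o' ∊ FS (prod C SQs) /\ ph o' ∊ B /\ z ∊ dm (ph o')).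
 { intros C z. unfold F. rewrite in_cup. sepd. tauto. }
 assert (DF : d0 F) by dfn.
 assert (CF : forall C, ctb C -> ctb (F C)).
 { intros C HC. apply ctb_cup; auto. apply (ctb_cover (F := fun o' => dm (ph o')) (a := sep (FS (prod C SQs)) (fun o' => ph o' ∊ B))); [dfn| | |].
  - refine (ctb_sub _ (ctb_FS (ctb_prod2 HC ctb_SQs))). intros v V. sepd in V; tauto.
  - intros v V. sepd in V. apply fin_ctb, (fin_dm X), HB; tauto.
  - intros z Z. sepd in Z. destruct Z as [_ [o' [O1 [O2 O3]]]]. exists o'. split; auto. sepd; auto. }
 destruct (@om_rec S F (Pw x) em DF) as [h [H1 [H2 H3]]].
 { intros C HC. apply in_Pw. apply in_Pw in HC. intros z [Z|Z]%HF; [auto|tauto]. }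
 { apply in_Pw. intros z Z; destruct (in_em Z). }
 assert (CH : forall n, n ∊ om -> ctb (app h n)).
 { apply om_ind.
  - apply Min_d; dfn.
  - rewrite H2. apply fin_ctb, fin_em.
  - intros n N IH. rewrite H3 by auto. apply CF; auto. }
 assert (MON : forall m, m ∊ om -> forall n, n ∊ om -> Sub n m -> Sub (app h n) (app h m)).
 { refine (@om_ind S (fun m => forall n, n ∊ om -> Sub n m -> Sub (app h n) (app h m)) _ _ _).
  - apply Min_d; dfn.
  - intros n N L. replace n with (@em S); [apply Sub_refl|]. apply sext; intros z; split; intros Z; [destruct (in_em Z)|auto].
  - intros m M IH n N L. apply (Ord_le (om_ord N) (Ord_sc (om_ord M))) in L as [L|L].
   + apply (om_lt_S N M) in L. intros z Z. rewrite H3 by auto. apply HF. left. apply (IH n N L z Z).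
   + subst. apply Sub_refl. }
 set (C := sep x (fun z => exists n, n ∊ om /\ z ∊ app h n)).
 assert (HC : forall z, z ∊ C <-> exists n, n ∊ om /\ z ∊ app h n).
 { intros z. unfold C. sepd. split; [tauto|]. intros [n [N Z]]; split; eauto. assert (K := app_cod H1 N). apply in_Pw in K. auto. }
 assert (CC : ctb C) by (apply (ctb_cover (F := fun n => app h n) (a := om)); [dfn|apply ctb_om|auto|intros z Z; apply HC; auto]).
 assert (CLO : forall o', o' ∊ FS (prod C SQs) -> ph o' ∊ B -> Sub (dm (ph o')) C).
 { intros o' O PB. apply in_FS in O as [O1 O2].
  destruct (@fin_bound S unit _ _ (@IndOk_pure S) (fun _ y n => y ∊ prod (app h n) SQs) tt o') as [n [N K]]; auto.
  - dfn.
  - intros y n m Y N M L. apply in_prod in Y as [k [t [K [T ->]]]]. apply op_prod. split; auto. apply (MON m M n N L k K).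
  - intros y Y. apply O1, in_prod in Y as [k [t [K [T ->]]]]. apply HC in K as [n [N K]]. exists n. rewrite op_prod; auto.
  - intros z Z. apply HC. exists (sc n). split; [apply om_S; auto|]. rewrite H3 by auto. apply HF. right.
   split; [|exists o'; split; auto; apply in_FS; auto]. apply in_dm in Z as [q Q]. apply HB in PB. apply (P_dom X (proj1 PB) Q). }
 destruct (@choose S (fun q a => lez x q a) A) as [g [Dg Hg']]; [dfn|].
 assert (Hg : forall q, q ∊ B -> g q ∊ A /\ lez x q (g q)) by (intros q [_ [_ [a [Q3 Q4]]]]%HB; eauto).
 set (FC := sep (FS (prod C SQs)) (fun o' => ph o' ∊ B)).
 assert (HFC : forall o', o' ∊ FC <-> o' ∊ FS (prod C SQs) /\ ph o' ∊ B) by (intros; unfold FC; sepd; tauto).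
 assert (Dgp : d0 (fun o' => g (ph o'))) by dfn.
 exists (img (fun o' => g (ph o')) FC). split; [|split].
 - intros a Ha. rewrite in_img in Ha by auto. destruct Ha as [o' [O <-]]. apply Hg, HFC; auto.
 - apply (ctb_img (F := fun o' => g (ph o')) (a := FC)); auto.
  + refine (ctb_sub _ (ctb_FS (ctb_prod2 CC ctb_SQs))). intros v V. apply HFC in V; tauto.
  + intros y Y. rewrite in_img in Y by auto. auto.
 - intros a Ha. destruct (dst_dense X (HA a Ha)) as [q [Q1 Q2]].
  assert (QB : q ∊ B) by (apply HB; split; [apply Q1|eauto]).
  assert (QP : q ∊ Pz x) by apply Q1.
  (* The trace of q on C. The condition chosen for this trace has its support inside C, so every
     coordinate it shares with q carries a stem recorded in the trace. *)
  defset o' HO (sep (prod C SQs) (fun u => exists z t q' n, u = op z t /\ op z q' ∊ q /\ SQ n t /\ st z (rst q z) q' n t)).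
  assert (HO' : forall z t, op z t ∊ o' <-> z ∊ C /\ exists q' n, op z q' ∊ q /\ SQ n t /\ st z (rst q z) q' n t).
  { intros z t. rewrite HO, op_prod. split.
   - intros [[Z T] [z1 [t1 [q' [n [E K]]]]]]. opi. eauto.
   - intros [Z [q' [n [K1 [K2 K3]]]]]. split; [split; auto; apply in_SQs; eauto|]. exists z, t, q', n; auto. }
  assert (SM : stm q o') by (intros z t Z; apply HO' in Z; tauto).
  assert (FO : fin o').
  { destruct (fin_dm X QP) as [n [N K]]. exists n; split; auto. refine (emb_trans _ K).
   apply (emb_lam (F := @pr1 S)).
   - dfn.
   - intros u [_ [z [t [q' [n' [-> [U _]]]]]]]%HO. rewrite pr1_op. apply in_dm; eauto.
   - intros u u' U U' E. apply HO in U, U'. destruct U as [_ [z [t [q1 [n1 [-> [A1 [A2 A3]]]]]]]], U' as [_ [z' [t' [q2 [n2 [-> [B1 [B2 B3]]]]]]]].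
    rewrite !pr1_op in E. subst z'. rewrite (P_fun X QP B1 A1) in B3.
    assert (Zd : z ∊ d) by apply (scd_tr X (P_dom X QP A1)). destruct (P_name X QP A1) as [R _].
    destruct (st_uniq Zd R A2 B2 A3 B3) as [_ ->]. auto. }
  destruct (Hph o' q QB SM) as [P1 P2].
  assert (OF : o' ∊ FS (prod C SQs)) by (apply in_FS; split; auto; intros u U; apply HO in U; tauto).
  assert (PC := CLO o' OF P1).
  assert (P1' : ph o' ∊ Pz x) by (apply HB in P1; tauto).
  destruct (same_stems_compat X QP P1') as [r [R1 R2]].
  { intros z q1 q2 A1 A2. destruct (Q2 z q1 A1) as [n [t [T1 T2]]]. assert (ZC : z ∊ C) by (apply PC, in_dm; eauto).
   assert (ZT : op z t ∊ o') by (apply HO'; split; eauto). destruct (P2 z t ZT) as [q3 [n3 [B1 [B2 B3]]]].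
   rewrite (P_fun X P1' A2 B1). rewrite (SQ_dom B2 T1) in B3. exists n, t; auto. }
  destruct (Hg _ P1) as [G1 G2]. exists (g (ph o')), r. split; [rewrite in_img by auto; exists o'; split; auto; apply HFC; auto|].
  split; [apply (le_tr (poset_all X) R1 Q1)|apply (le_tr (poset_all X) R2 G2)].
Qed.

Section Predense.
Variables P L : S.
Hypothesis HP : poset P L.
Lemma gen_meets (i : Gen P L) p0 K : gU i p0 -> (forall q, le P L q p0 -> exists a r, a ∊ K /\ le P L r q /\ le P L r a) -> exists a, a ∊ K /\ gU i a.
Proof.
 intros G H. destruct (@gen_below S P L HP (gU i) (fun r => exists a, a ∊ K /\ le P L r a) p0 (proj2_sig i) G) as [r [R1 [[a [R2 R3]] _]]].
 - dfn.
 - intros q Q. destruct (H q Q) as [a [r [A1 [A2 A3]]]]. exists r; split; eauto.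
 - exists a; split; auto. apply (gU_up HP R1 R3).
Qed.
End Predense.
Notation gUd := (@gU S (Pz d) (Lz d)).
Notation gEd := (@gE S (Pz d) (Lz d)).

Definition Fo (A : GD -> S -> Prop) p x := p ∊ Pz d /\ forall i : GD, gU i p -> A i x.
Lemma d_Fo A : dfns gUd gEd (fun i e => A i (e 0)) -> forall I (U : I -> S -> Prop) E (t u : I -> (nat -> S) -> S), dfts U E t -> dfts U E u ->
 dfns U E (fun i e => Fo A (t i e) (u i e)).
Proof.
 intros D I U E t u T T'. exact (@d_Forced S (Pz d) (Lz d) HPd cnt (fun i e => A i (e 0)) D I U E t (fun _ => u) T (fun _ => T')).
Qed.
Lemma Fo_truth A i x : dfns gUd gEd (fun i e => A i (e 0)) -> A i x -> exists p, gU i p /\ p ∊ Pz d /\ Fo A p x.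
Proof.
 intros D H. destruct (@Forced_truth S (Pz d) (Lz d) HPd cnt (fun i e => A i (e 0)) i (fun _ => x) D H) as [p [P1 [P2 P3]]]. exists p. repeat split; auto.
Qed.
Lemma d_gU' P L (t1 : Gen P L -> (nat -> S) -> S) : dfts (@gU S P L) (@gE S P L) t1 -> dfns (@gU S P L) (@gE S P L) (fun i e => gU i (t1 i e)).
Proof. intros; apply d_gU; auto. Qed.
Hint Resolve d_gU' d_Fo : dfn.

(** Conditions forcing different values are incompatible, so each possible value is the one forced
    by a member of the countable set given by [ccc]. This bounds the number of values of a name for
    a single ground-model object. *)
Lemma fun_ctb (A : GD -> S -> Prop) b : dfns gUd gEd (fun i e => A i (e 0)) -> (forall i x y, A i x -> A i y -> x = y) ->
 ctb (sep b (fun x => exists p, p ∊ Pz d /\ Fo A p x)).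
Proof.
 intros D H. defset C HC (sep b (fun x => exists p, p ∊ Pz d /\ Fo A p x)).
 defset Q HQ (sep (Pz d) (fun p => exists x, x ∊ b /\ Fo A p x)).
 destruct (@ccc d Q scd_d) as [Q' [Q1 [Q2 Q3]]]; [intros p Hp; apply HQ in Hp; tauto|].
 destruct (@choose S (fun q x => Fo A q x) b) as [F [DF HF]]; [dfn|]. apply (ctb_img (F := F) (a := Q')); auto.
 intros x [X [p [Hp K]]]%HC. assert (P' : p ∊ Q) by (apply HQ; eauto).
 destruct (Q3 p P') as [q [r [R1 [R2 R3]]]]. exists q; split; auto. assert (Q4 := Q1 q R1). apply HQ in Q4 as [Q4 [y [Y1 Y2]]].
 apply HF in Y2 as [_ Y2]; auto. destruct (gUd_ex (le_in1 R2)) as [i G]. apply (H i); [apply (proj2 Y2), (gU_up HPd G R3)|apply (proj2 K), (gU_up HPd G R2)].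
Qed.

(** Nice names: among the conditions below one that puts x into D there is a countable predense set,
    by the chain condition, and the filter meets it exactly when x is in the set named by D. *)
Lemma refine_name z D b : z ∊ sc d -> lvl z D -> exists K : S -> S, d0 K /\ forall x, x ∊ b -> ctb (K x) /\ Sub (K x) (Pz z) /\
 forall i : GD, Ad i D x <-> exists a, a ∊ K x /\ gU i a.
Proof.
 intros Z LD. assert (HZ := poset_all Z).
 set (A := fun x => sep (Pz z) (fun p => exists p', op p' x ∊ D /\ lez z p p')).
 assert (HA : forall x p, p ∊ A x <-> p ∊ Pz z /\ exists p', op p' x ∊ D /\ lez z p p') by (intros; unfold A; sepd; tauto).
 set (R := fun x k => ctb k /\ (forall a, a ∊ k -> exists p', op p' x ∊ D /\ lez z a p') /\
  forall p p', p ∊ Pz z -> op p' x ∊ D -> lez z p p' -> exists a r, a ∊ k /\ lez z r p /\ lez z r a).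
 destruct (@choose S R (Pw (Pz z))) as [K [DK HK]]; [dfn|]. exists K. split; auto. intros x _.
 destruct (@ccc z (A x) Z) as [k [K1 [K2 K3]]]; [intros p H; apply HA in H; tauto|].
 destruct (HK x k) as [J1 [J2 [J3 J4]]].
 { apply in_Pw. intros a Ha; apply K1, HA in Ha; tauto. }
 { split; auto. split; [intros a Ha; apply K1, HA in Ha; tauto|]. intros p p' Hp Hp' L. apply K3, HA; eauto. }
 split; auto. split; [apply in_Pw, J1|]. intros i. split.
 - intros [p' [G Hp]]. destruct (@gen_meets (Pz z) (Lz z) HZ (Rs Z i) p' (K x)) as [a [A1 A2]].
  + split; auto. apply (LD _ _ Hp).
  + intros q Q. apply (J4 q p'); auto. apply Q.
  + exists a; split; auto. apply A2.
 - intros [a [A1 A2]]. destruct (J3 a A1) as [p' [P1 P2]]. exists p'; split; auto. apply (gU_up HPd A2). apply (le_xd Z P2).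
Qed.

Variable o : S.
Hypothesis Ho : isom1 o.
Hypothesis Hd : ~ emb d o /\ forall b, b ∊ d -> emb b o.
Definition bdd (B : S -> Prop) := exists g, g ∊ o /\ forall x, x ∊ o -> B x -> x ∊ g.
Lemma bdd_sub (A B : S -> Prop) : (forall x, x ∊ o -> A x -> B x) -> bdd B -> bdd A.
Proof. intros H [g [G K]]. exists g; split; auto. Qed.
(** The least bound of the set attached to x exists by [gen_IndOk] and has only countably many
    possible values by [fun_ctb]. So all possible values, for all x in X, have a common bound
    already in the ground model. *)
Lemma bdd_ctb_union (R : GD -> S -> S -> Prop) X i : dfns gUd gEd (fun i e => R i (e 0) (e 1)) -> ctb X -> (forall x, x ∊ X -> bdd (R i x)) ->
 bdd (fun y => exists x, x ∊ X /\ R i x y).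
Proof.
 intros D CX H. assert (Oo : Ord o) by apply Ho.
 set (LB := fun (i : GD) u => exists x g, u = op x g /\ g ∊ o /\ (forall y, y ∊ o -> R i x y -> y ∊ g) /\ forall g', g' ∊ g -> ~ forall y, y ∊ o -> R i x y -> y ∊ g').
 assert (DL : dfns gUd gEd (fun i e => LB i (e 0))) by dfn.
 set (T := fun x => sep o (fun g => exists q, q ∊ Pz d /\ Fo LB q (op x g))).
 assert (HT : forall x g, g ∊ T x <-> g ∊ o /\ exists q, q ∊ Pz d /\ Fo LB q (op x g)) by (intros; unfold T; sepd; tauto).
 assert (DT : d0 T) by dfn.
 assert (CT : forall x, ctb (T x)).
 { intros x. set (A := fun (i : GD) g => LB i (op x g)). assert (DA : dfns gUd gEd (fun i e => A i (e 0))) by dfn.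
  refine (ctb_sub _ (fun_ctb o DA _)).
  - intros g G. apply HT in G. sepd. auto.
  - intros j g g' [x1 [g1 [E1 [G1 [A1 B1]]]]] [x2 [g2 [E2 [G2 [A2 B2]]]]]. opi.
   destruct (Ord_tri (Ord_in Oo G1) (Ord_in Oo G2)) as [K|[K|K]]; auto; [destruct (B2 _ K)|destruct (B1 _ K)]; auto. }
 destruct (@om1_ctb_bdd S o Ho (sep o (fun g => exists x, x ∊ X /\ g ∊ T x))) as [g [G K]].
 - intros g G. sepd in G. tauto.
 - apply (ctb_cover (F := T) (a := X)); auto. intros g G. sepd in G. apply G.
 - exists g; split; auto. intros y Y [x [X1 X2]]. destruct (H x X1) as [g0 [G0 K0]].
  destruct (@gen_IndOk S (Pz d) (Lz d) HPd (fun i g => ~ forall y, y ∊ o -> R i x y -> y ∊ g)) with (i := i) (a := o) (x := g0) as [g1 [G1 [G2 G3]]]; auto.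
  + dfn.
  + apply NNPP in G2. assert (L : LB i (op x g1)).
   { exists x, g1. spl. intros g' G'. apply G3; auto. apply (proj1 Oo _ G1 _ G'). }
   destruct (Fo_truth DL L) as [q [Q1 [Q2 Q3]]]. assert (G4 : g1 ∊ g).
   { apply K. sepd. split; auto. exists x. rewrite HT. eauto. }
   apply (Ord_tr (Ord_in Oo G) (G2 y Y X2) G4).
Qed.

Definition supp k := sep d (fun z => exists p, p ∊ k /\ z ∊ dm p).
Lemma in_supp x k z : x ∊ sc d -> Sub k (Pz x) -> (z ∊ supp k <-> exists p q, p ∊ k /\ op z q ∊ p).
Proof.
 intros X K. unfold supp. sepd. setoid_rewrite in_dm. split; [intros [_ [p [A [q B]]]]; eauto|].
 intros [p [q [A B]]]. split; [|eauto]. apply (scd_tr X (P_dom X (K p A) B)).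
Qed.
Lemma ctb_supp x k : x ∊ sc d -> ctb k -> Sub k (Pz x) -> ctb (supp k).
Proof.
 intros X C K. apply (ctb_cover (F := dm) (a := k)); [dfn|auto| |].
 - intros p Hp. apply fin_ctb, (fin_dm X (K p Hp)).
 - intros z Z. unfold supp in Z. sepd in Z. apply Z.
Qed.
(** Nice names for omega1 many memberships involve at most omega1 many coordinates, and by
    regularity of omega2 these lie below some z in d. *)
Lemma capture D b : lvl d D -> emb b o -> exists z D', z ∊ d /\ lvl z D' /\ forall (i : GD) x, x ∊ b -> (Ad i D x <-> Ad i D' x).
Proof.
 intros LD Eb. destruct (refine_name b scd_d LD) as [K [DK HK]].
 destruct (@om2_bdd S o Ho d (conj Od Hd) (sep d (fun z => exists x, x ∊ b /\ z ∊ supp (K x))) (fun z => z)) as [g [G HG]].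
 - dfn.
 - refine (emb_trans (emb_cover (F := fun x => supp (K x)) (a := b) _ Eb _ _) (om1_om_emb Ho)); [dfn| |intros z Z; sepd in Z; apply Z].
  intros x X. destruct (HK x X) as [K1 [K2 _]]. apply (ctb_supp scd_d K1 K2).
 - intros z Z. sepd in Z. tauto.
 - assert (SUP : forall x p z q, x ∊ b -> p ∊ K x -> op z q ∊ p -> z ∊ g).
  { intros x p z q X A B. destruct (HK x X) as [_ [K2 _]]. apply HG. sepd. split; [apply (P_dom scd_d (K2 p A) B)|]. exists x. rewrite (in_supp z scd_d K2). eauto. }
  exists g, (sep (prod (Pz g) b) (fun u => exists p x, u = op p x /\ p ∊ K x)).
  assert (HD : forall p x, op p x ∊ sep (prod (Pz g) b) (fun u => exists p x, u = op p x /\ p ∊ K x) <-> p ∊ Pz g /\ x ∊ b /\ p ∊ K x).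
  { intros p x. sepd. rewrite op_prod. split; [|intros [A [B C]]; split; auto; exists p, x; auto].
   intros [A [p' [x' [E C]]]]. opi; tauto. }
  split; auto. split; [intros p x A; apply HD in A; tauto|]. intros i x X. destruct (HK x X) as [K1 [K2 K3]]. rewrite K3. unfold Ad.
  setoid_rewrite HD. split; [|intros [a A]; exists a; tauto]. intros [a [A1 A2]]. exists a. split; auto. split; auto.
  apply (P_low scd_d (d_in G) (K2 a A1)). intros k q Q. apply (SUP x a k q); auto.
Qed.

Lemma lvl_up z x D : x ∊ sc d -> z ∊ sc x -> lvl z D -> lvl x D.
Proof. intros X Z L p y H. destruct (scd_ssub X Z) as [Z1 Z2]. apply (P_up X Z2 Z1 (L _ _ H)). Qed.
Lemma Ad_Rs z (Z : z ∊ sc d) (i : GD) D x : lvl z D -> (Ad (Rs Z i) D x <-> Ad i D x).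
Proof.
 intros L. unfold Ad. split; intros [p [G H]]; exists p; (split; [|auto]); [apply G|split; auto; apply (L _ _ H)].
Qed.
Definition stc z p t := exists q n, op z q ∊ p /\ SQ n t /\ st z (rst p z) q n t.

Section GJ.
Variables P L : S.
Hypothesis HP : poset P L.
Variable j : Gen P L.
Notation T := (NM HP j).
Notation J := (jj HP j).
(** Together with [ofG] this exchanges subsets of ground-model sets, as elements of the extension,
    with names of the simple form D. *)
Lemma toG b (w : T) : exists D, (forall p x, op p x ∊ D -> p ∊ P) /\ forall x, x ∊ b -> (J x ∊ w <-> Ad j D x).
Proof.
 destruct (vl_surj w) as [s ->]. assert (DC := d0_Chk (S := S) P).
 destruct (@gd_code S P L HP (fun j x => gE j (Chk P x) s) b) as [D [D1 D2]]; [apply d_gE; [dfn|apply ft_const]|].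
 exists D; split; [intros p x K; apply D1, op_prod in K; tauto|]. intros x X. rewrite jj_Chk, vl_mem, D2 by auto. reflexivity.
Qed.
Lemma ofG b D : exists w : T, forall v : T, v ∊ w <-> exists x, v = J x /\ x ∊ b /\ Ad j D x.
Proof. apply (@N_real S P L HP (fun j x => Ad j D x) b). dfn. Qed.
Lemma gJ_om n : n ∊ om -> J n ∊ om.
Proof. intros N. rewrite <- (jj_om HP j). apply jj_mem; auto. Qed.
Lemma gJ_om_inv (w : T) : w ∊ om -> exists n, n ∊ om /\ w = J n.
Proof. intros N. rewrite <- (jj_om HP j) in N. apply in_jj in N. auto. Qed.
Lemma gJ_fin x : fin x -> fin (J x).
Proof. intros [n [N H]]. exists (J n). split; [apply gJ_om; auto|apply jj_emb; auto]. Qed.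
(** By adjoining one element at a time: forcing adds no finite subset of a ground-model set. *)
Lemma gfin_J b (w : T) : fin w -> Sub w (J b) -> exists x, w = J x /\ x ∊ FS b.
Proof.
 intros F. assert (K : Sub w (J b) -> w ∊ J (FS b)).
 { revert w F. refine (@fin_ind T (fun w : T => Sub w (J b) -> w ∊ J (FS b)) _ _ _).
  - dfn.
  - intros _. rewrite <- (jj_em HP j). apply jj_mem, in_FS. split; [intros u U; destruct (in_em U)|apply fin_em].
  - intros w y _ IH _ H. destruct (proj1 (in_jj (HP := HP) (i := j) _ _) (IH (fun (u : T) U => H u (proj2 (in_adj _ _ _) (or_introl U))))) as [x [X ->]].
   assert (Y : y ∊ J b) by (apply H, in_adj; auto). apply in_jj in Y as [y' [Y ->]]. rewrite <- jj_adj. apply jj_mem, in_FS.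
   apply in_FS in X. split; [|apply fin_adj; tauto]. intros u [U| ->]%in_adj; auto. apply X; auto. }
 intros H. apply K in H. apply in_jj in H as [x [X E]]. exists x. auto.
Qed.
Lemma gbd_J B : bd (J o) B <-> bdd (fun y => B (J y)).
Proof.
 split.
 - intros [g [G K]]. apply in_jj in G as [g' [G ->]]. exists g'; split; auto. intros x X BX. apply (jj_mem HP j), K; auto. apply jj_mem; auto.
 - intros [g [G K]]. exists (J g). split; [apply jj_mem; auto|]. intros x X BX. apply in_jj in X as [x' [X ->]]. apply jj_mem; auto.
Qed.
End GJ.

(** * The Hechler real added at a stage *)

Section Real.
Variable z : S.
Hypothesis Hz : z ∊ d.
Let Zs : z ∊ sc d := d_in Hz.
Let HPz : poset (Pz z) (Lz z) := poset_all Zs.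
Let Xz : sc z ∊ sc d := sc_scd Hz.
Let ZX : Sub z (sc z).
Proof. intros u U; apply in_sc; auto. Qed.
Lemma pval (j : Gen (Pz z) (Lz z)) p q : p ∊ Pz (sc z) -> gU j (rst p z) -> op z q ∊ p ->
 exists n f, n ∊ om /\ isfun f om om /\ vl HPz j q = op n f.
Proof. intros Hp G Q. destruct (P_name Xz Hp Q) as [_ [_ F]]. apply (name_hech Hz HPz G F). Qed.
Lemma hv (j : Gen (Pz z) (Lz z)) p : p ∊ Pz (sc z) -> gU j (rst p z) ->
 exists n f, n ∊ om /\ isfun f om om /\ forall q, op z q ∊ p -> vl HPz j q = op n f.
Proof.
 intros Hp G. destruct (classic (exists q, op z q ∊ p)) as [[q Q]|N].
 - destruct (pval Hp G Q) as [n [f [A [B C]]]]. exists n, f. spl. intros q' Q'. rewrite (P_fun Xz Hp Q' Q). auto.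
 - assert (D : d0 (fun _ : NM HPz j => em)) by dfn.
  exists em, (lam om om (fun _ => em)). split; [apply om_0|]. split; [apply lam_fun; auto; intros; apply om_0|]. intros q Q; destruct N; eauto.
Qed.
(** The common extension of [ext2] is strengthened below z until the stem of its value at z, the
    restriction of f to n, is decided. *)
Lemma extend_real (j : Gen (Pz z) (Lz z)) p q n f : p ∊ Pz (sc z) -> q ∊ Pz (sc z) -> gU j (rst p z) -> gU j (rst q z) ->
 n ∊ om -> isfun f om om ->
 (forall q', op z q' ∊ p \/ op z q' ∊ q -> tr (hechler_le (op n f) (vl HPz j q'))) ->
 exists r s m t, lez (sc z) r p /\ lez (sc z) r q /\ gU j (rst r z) /\ op z s ∊ r /\ vl HPz j s = op n f /\
  n = jj HPz j m /\ SQ m t /\ rst f n = jj HPz j t /\ st z (rst r z) s m t.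
Proof.
 intros Hp Hq Gp Gq N F H. destruct (ext2 Hp Hq Gp Gq N F H) as [r [s [R1 [R2 [R3 [R4 [R5 R6]]]]]]].
 destruct (st_ex (Hz := Hz) R4 F N R6) as [m [t [r' [E [T [K [G [L ST]]]]]]]].
 destruct (glue_all Xz Zs ZX R1 L) as [G1 [G2 [G3 G4]]]. exists (glue r r' z), s, m, t.
 assert (TR := fun x y w => @le_tr _ _ _ (poset_all Xz) x y w). rewrite G4.
 split; [apply (TR _ _ _ G2 R2)|]. split; [apply (TR _ _ _ G2 R3)|]. split; auto. split; [apply op_glue; right; split; auto; apply nin|].
 auto.
Qed.
Lemma lower (j : Gen (Pz z) (Lz z)) r r' : r ∊ Pz (sc z) -> gU j (rst r z) -> gU j r' -> r' ∊ Pz z -> exists q, lez (sc z) q r /\ gU j (rst q z) /\ lez z (rst q z) r' /\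
 forall s, op z s ∊ r -> op z s ∊ q.
Proof.
 intros R G G' R'. destruct (gU_dir G G') as [w [W1 [W2 W3]]]. destruct (glue_all Xz Zs ZX R W2) as [G1 [G2 [G3 G4]]].
 exists (glue r w z). rewrite G4. spl. intros s H. apply op_glue. right; split; auto; apply nin.
Qed.
Lemma val_le (j : Gen (Pz z) (Lz z)) p q p1 : lez (sc z) q p -> gU j (rst q z) -> op z p1 ∊ p -> exists q1, op z q1 ∊ q /\
 tr (hechler_le (vl HPz j q1) (vl HPz j p1)).
Proof.
 intros L G P1. apply condL in L; auto. destruct L as [A [B C]]. destruct (C z p1 P1) as [q1 [Q1 Q2]]. exists q1; split; auto.
 apply (proj1 (le_iff HPz q1 p1 (gU_sub G)) Q2 j G).
Qed.
Lemma dens (i : GD) (Q : S -> Prop) p0 : dfn0 (@smem S) Q -> gU i p0 -> p0 ∊ Pz (sc z) ->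
 (forall p, lez (sc z) p p0 -> exists q, lez (sc z) q p /\ Q q) -> exists q, gU i q /\ lez (sc z) q p0 /\ Q q.
Proof.
 intros D G Hp H. destruct (@gen_below S (Pz (sc z)) (Lz (sc z)) (poset_all Xz) (gU (Rs Xz i)) Q p0 (proj2_sig (Rs Xz i))) as [q [Q1 [Q2 Q3]]]; auto.
 - split; auto.
 - intros q Q1. destruct (H q Q1) as [r [R1 R2]]. eauto.
 - exists q; split; [apply Q1|auto].
Qed.

(** A name for the graph of the Hechler real added at z: the union of the decided stems in the
    filter. *)
Definition DF := sep (prod (Pz (sc z)) (prod om om)) (fun u => exists p x t, u = op p x /\ stc z p t /\ x ∊ t).
Lemma in_DF p x : op p x ∊ DF <-> p ∊ Pz (sc z) /\ exists t, stc z p t /\ x ∊ t.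
Proof.
 unfold DF. sepd. rewrite op_prod. split.
 - intros [[A B] [p' [x' [t [E C]]]]]. opi. eauto.
 - intros [A [t [B C]]]. split; [split; auto|exists p, x, t; auto]. destruct B as [q [n [_ [[N T] _]]]]. apply (proj1 T) in C. apply in_prod in C as [c [k [C [K ->]]]]. apply op_prod; split; auto. apply (om_tr N C).
Qed.
Lemma lvl_DF : lvl (sc z) DF.
Proof. intros p x H. apply in_DF in H; tauto. Qed.
Definition Fa (i : GD) c k := Ad i DF (op c k).
Lemma Fa_in (i : GD) p t c k : gU i p -> p ∊ Pz (sc z) -> stc z p t -> op c k ∊ t -> Fa i c k.
Proof. intros G Hp T K. exists p; split; auto. apply in_DF. eauto. Qed.
Lemma Fa_om i c k : Fa i c k -> c ∊ om /\ k ∊ om.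
Proof.
 intros [p [G H]]. apply in_DF in H as [_ [t [[q [n [_ [[N T] _]]]] K]]].
 split; [apply (om_tr N (fun_dom T K))|apply (fun_cod T K)].
Qed.
Lemma stc_val (j : Gen (Pz z) (Lz z)) p t : gU j (rst p z) -> stc z p t -> exists q n f, op z q ∊ p /\ SQ n t /\
 isfun (S := NM HPz j) f om om /\ vl HPz j q = op (jj HPz j n) f /\ Sub (jj HPz j t) f.
Proof.
 intros G [q [n [Q [T ST]]]]. destruct (st_val Hz G ST) as [f [A [B C]]]. exists q, n, f; auto.
Qed.
(** The value of r at z need not have a decided stem, but it is below the value of p there and
    therefore still extends the stem decided by p. *)
Lemma Fa_le (j : Gen (Pz z) (Lz z)) p r t : p ∊ Pz (sc z) -> lez (sc z) r p -> gU j (rst r z) -> stc z p t -> exists s n f, op z s ∊ r /\ n ∊ om /\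
 isfun (S := NM HPz j) f om om /\ vl HPz j s = op n f /\ Sub (jj HPz j t) f /\ (forall n0, SQ n0 t -> Sub (jj HPz j n0) n).
Proof.
 intros Hp L G T. assert (Gp : gU j (rst p z)) by (apply (gU_up HPz G); apply (le_rst Xz ZX Zs L)).
 destruct (stc_val Gp T) as [q [n [f [Q [Tn [F [V K]]]]]]]. destruct (val_le L G Q) as [s [S1 S2]].
 destruct (pval (le_in1 L) G S1) as [n' [f' [N' [F' V']]]]. rewrite V, V' in S2.
 assert (Nj : jj HPz j n ∊ @om (NM HPz j)) by (rewrite <- (jj_om HPz j); apply jj_mem; apply Tn).
 apply hle_e in S2; auto. destruct S2 as [H1 [H2 H3]]. exists s, n', f'. spl. split.
 - intros u U. assert (U' := K u U). apply in_jj in U as [v [Hv ->]]. assert (Hv' := proj1 (proj2 Tn) v Hv). apply in_prod in Hv'.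
  destruct Hv' as [c [k [C [_ ->]]]]. rewrite jj_op in *. assert (C' : jj HPz j c ∊ jj HPz j n) by (apply jj_mem; auto).
  apply (app_iff _ F' (om_tr Nj C')). rewrite (H2 _ C'). apply (app_iff _ F (om_tr Nj C')); auto.
 - intros n0 N0. rewrite (SQ_dom N0 Tn). auto.
Qed.
Lemma Fa_fun i c k k' : Fa i c k -> Fa i c k' -> k = k'.
Proof.
 intros [p [G H]] [p' [G' H']]. apply in_DF in H, H'. destruct H as [Hp [t [T K]]], H' as [Hp' [t' [T' K']]].
 destruct (@gU_dir _ _ _ (Rs Xz i) p p') as [r [[R1 R0] [R2 R3]]]; [split; auto|split; auto|].
 assert (GR : gU (Rs Zs i) (rst r z)) by (split; [apply rst_G; auto|apply (P_rst Xz); auto]).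
 destruct (Fa_le Hp R2 GR T) as [s [n [f [S1 [N [F [V [A _]]]]]]]]. destruct (Fa_le Hp' R3 GR T') as [s' [n' [f' [S1' [N' [F' [V' [A' _]]]]]]]].
 rewrite (P_fun Xz R0 S1' S1), V in V'. apply op_inj in V' as [_ <-]. apply (@jj_inj _ _ _ HPz (Rs Zs i)).
 apply (proj2 (proj2 F) (jj HPz (Rs Zs i) c)); rewrite <- jj_op; [apply A|apply A']; apply jj_mem; auto.
Qed.
Lemma extend_stem (j : Gen (Pz z) (Lz z)) p : p ∊ Pz (sc z) -> gU j (rst p z) -> exists r t s n f, lez (sc z) r p /\ gU j (rst r z) /\ stc z r t /\
 op z s ∊ r /\ n ∊ om /\ isfun f om om /\ vl HPz j s = op n f /\ rst f n = jj HPz j t.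
Proof.
 intros Hp G. destruct (hv Hp G) as [n [f [N [F V]]]]. destruct (@extend_real j p p n f) as [r [s [m [t [A1 [_ [A3 [A4 [A5 [A6 [A7 [A8 A9]]]]]]]]]]]]; auto.
 - intros q [Q|Q]; rewrite (V q Q); apply hle_refl; auto.
 - exists r, t, s, n, f. spl; split; [exists s, m; auto|]. auto.
Qed.
Lemma Fa_tot (i : GD) c : c ∊ om -> exists k, Fa i c k.
Proof.
 intros C. destruct (gU_ne (Rs Xz i)) as [p0 [G0 H0]].
 destruct (@dens i (fun p => exists t k, stc z p t /\ op c k ∊ t) p0) as [q [Q1 [Q2 [t [k [T K]]]]]]; auto.
 - dfn.
 - intros p L. assert (Hp := le_in1 L). destruct (gen_ex HPz cnt (P_rst Xz ZX Zs Hp)) as [j G].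
  destruct (hv Hp G) as [n [f [N [F V]]]].
  set (c' := jj HPz j c). assert (C' : c' ∊ @om (NM HPz j)) by (unfold c'; rewrite <- (jj_om HPz j); apply jj_mem; auto).
  destruct (om_max N (om_S C')) as [n' [N' [L1 L2]]].
  destruct (@extend_real j p p n' f) as [r [s [m [t [A1 [_ [A3 [A4 [A5 [A6 [A7 [A8 A9]]]]]]]]]]]]; auto.
  + intros q [Q|Q]; rewrite (V q Q); apply hle_i; auto using Sub_refl.
  + exists r; split; auto. assert (K : op c' (app f c') ∊ jj HPz j t).
   { rewrite <- A8. apply op_rst. split; [apply (app_in F C')|apply L2, sc_in]. }
   apply in_jj in K as [u [U E]]. assert (U' := proj1 (proj2 A7) u U). apply in_prod in U' as [a [k [_ [_ ->]]]].
   rewrite jj_op in E. apply op_inj in E as [E _]. unfold c' in E. apply jj_inj in E. subst a.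
   exists t, k. split; auto. exists s, m; auto.
 - exists k. apply (Fa_in Q1 (le_in1 Q2) T K).
Qed.

Variable i : GD.
Notation T := (NM HPz (Rs Zs i)).
Notation J := (jj HPz (Rs Zs i)).
Lemma toD b (w : T) : exists D, lvl z D /\ forall x, x ∊ b -> (J x ∊ w <-> Ad i D x).
Proof.
 destruct (toG b w) as [D [L H]]. exists D; split; auto. intros x X. rewrite (H x X). apply (Ad_Rs Zs i x L).
Qed.
Lemma ofD b D : lvl z D -> exists w : T, forall v : T, v ∊ w <-> exists x, v = J x /\ x ∊ b /\ Ad i D x.
Proof.
 intros L. destruct (ofG HPz (Rs Zs i) b D) as [w W]. exists w. intros v. rewrite W. setoid_rewrite Ad_Rs; auto. reflexivity.
Qed.
Lemma J_om n : n ∊ om -> J n ∊ om.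
Proof. apply gJ_om. Qed.
Lemma J_om_inv (w : T) : w ∊ om -> exists n, n ∊ om /\ w = J n.
Proof. apply gJ_om_inv. Qed.
Lemma J_fin x : fin x -> fin (J x).
Proof. apply gJ_fin. Qed.
Lemma fin_J b (w : T) : fin w -> Sub w (J b) -> exists x, w = J x /\ x ∊ FS b.
Proof. apply gfin_J. Qed.
Lemma bd_J B : bd (J o) B <-> bdd (fun y => B (J y)).
Proof. apply gbd_J. Qed.
End Real.

Lemma lvl_truth x (X : x ∊ sc d) (i : GD) (A : Gen (Pz x) (Lz x) -> Prop) p0 : dfns gU gE (fun j (_ : nat -> S) => A j) -> A (Rs X i) ->
 gU i p0 -> p0 ∊ Pz x -> exists p, gU i p /\ lez x p p0 /\ forall i' : GD, gU i' p -> A (Rs X i').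
Proof.
 intros D HA G Hp. destruct (@Forced_below S (Pz x) (Lz x) (poset_all X) cnt (fun j _ => A j) (Rs X i) (fun _ => p0) p0 D HA) as [q [Q1 [Q2 Q3]]]; [split; auto|].
 exists q. split; [apply Q1|]. split; auto. intros i' G'. apply Q3. split; auto. apply Q2.
Qed.

(** The real is the one added just after a stage z capturing D. Given y and a condition with stem of
    length n, the fiber over (y,n) contains some k at least as large as the value of its function at
    n, and k may be appended to the stem; so this happens densely. *)
Lemma lemC D : lvl d D -> exists z, z ∊ d /\ forall i : GD,
 (forall y n m, y ∊ o -> n ∊ om -> m ∊ om -> exists k, k ∊ om /\ Sub m k /\ Ad i D (op (op y n) k)) ->
 forall y, y ∊ o -> exists n k, Fa z i n k /\ Ad i D (op (op y n) k).
Proof.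
 intros LD. destruct (@capture D (prod (prod o om) om) LD) as [z [D' [Z [LD' HD]]]].
 { exact (emb_trans (emb_prod (om1_om_emb Ho) (emb_sub (@Sub_refl _ om))) (om1_om_emb Ho)). }
 exists z; split; auto. intros i H.
 assert (HD' : forall (i : GD) y n k, y ∊ o -> n ∊ om -> k ∊ om -> (Ad i D (op (op y n) k) <-> Ad i D' (op (op y n) k))) by (intros; apply HD; rewrite !op_prod; auto).
 assert (Zs := d_in Z). assert (Xz := sc_scd Z). assert (ZX : Sub z (sc z)) by (intros u U; apply in_sc; auto).
 set (A := fun j : Gen (Pz z) (Lz z) => forall y n m, y ∊ o -> n ∊ om -> m ∊ om -> exists k, k ∊ om /\ Sub m k /\ Ad j D' (op (op y n) k)).
 assert (HA : forall i : GD, (forall y n m, y ∊ o -> n ∊ om -> m ∊ om -> exists k, k ∊ om /\ Sub m k /\ Ad i D (op (op y n) k)) -> A (Rs (d_in Z) i)).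
 { intros i' H' y n m Y N M. destruct (H' y n m Y N M) as [k [K1 [K2 K3]]]. exists k. spl. apply Ad_Rs; auto. apply HD'; auto. }
 assert (DA : dfns gU gE (fun (j : Gen (Pz z) (Lz z)) (_ : nat -> S) => A j)) by dfn.
 destruct (gU_ne (Rs (d_in Z) i)) as [p0 [G0 H0]].
 destruct (@Forced_below S (Pz z) (Lz z) (poset_all (d_in Z)) cnt (fun j _ => A j) (Rs (d_in Z) i) (fun _ => p0) p0 DA (HA i H)) as [r0 [[R0 R0'] [_ R1]]]; [split; auto|].
 intros y Y.
 destruct (@dens z Z i (fun q => exists t n k s, stc z q t /\ op n k ∊ t /\ op s (op (op y n) k) ∊ D' /\ lez z (rst q z) s) r0) as [q [Q1 [Q2 [t [n [k [s [T [K1 [K2 K3]]]]]]]]]]; auto.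
 - dfn.
 - apply (P_up Xz ZX Zs R0').
 - intros p L. assert (Hp := le_in1 L). assert (Lz' := le_rst Xz ZX Zs L). rewrite (P_rst_id Zs R0') in Lz'.
  destruct (gen_ex (poset_all (d_in Z)) cnt (P_rst Xz ZX Zs Hp)) as [j G]. assert (Gr := gU_up (poset_all (d_in Z)) G Lz').
  assert (AJ := R1 j Gr). destruct (hv Z Hp G) as [n' [f [N' [F V]]]].
  assert (JO := @gJ_om_inv _ _ (poset_all (d_in Z)) j). assert (OJ := @gJ_om _ _ (poset_all (d_in Z)) j).
  destruct (JO n' N') as [n [N ->]]. destruct (JO _ (app_cod F N')) as [m [M E]]. destruct (AJ y n m Y N M) as [k [K1 [K2 [s [Gs K3]]]]].
  (* The position n is the first one past the stem, so its value may be raised to k. *)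
  set (g := lam om om (fun c => ifeq c (jj (poset_all (d_in Z)) j n) (jj (poset_all (d_in Z)) j k) (app f c))).
  assert (DG : d0 (fun c => ifeq c (jj (poset_all (d_in Z)) j n) (jj (poset_all (d_in Z)) j k) (app f c))) by dfn.
  assert (CG : forall c, c ∊ om -> ifeq c (jj (poset_all (d_in Z)) j n) (jj (poset_all (d_in Z)) j k) (app f c) ∊ om).
  { intros c C. destruct (classic (c = jj (poset_all (d_in Z)) j n)) as [->|NE]; [rewrite ifeq_l; auto|rewrite ifeq_r by auto; apply (app_cod F C)]. }
  assert (Fg : isfun g om om) by exact (lam_fun DG CG). assert (Ag : forall c, c ∊ om -> app g c = ifeq c (jj (poset_all (d_in Z)) j n) (jj (poset_all (d_in Z)) j k) (app f c)) by (intros c C; exact (app_lam DG CG C)).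
  destruct (@extend_real z Z j p p (sc (jj (poset_all (d_in Z)) j n)) g) as [r [s1 [n1 [t [A1 [_ [A3 [A4 [A5 [A6 [A7 [A8 A9]]]]]]]]]]]]; auto.
  + apply om_S; auto.
  + intros q Q. replace (vl (poset_all (d_in Z)) j q) with (op (jj (poset_all (d_in Z)) j n) f) by (symmetry; destruct Q; apply V; auto).
   apply hle_i; auto; [apply om_S; auto|intros u U; apply in_sc; auto| |].
   * intros c C. rewrite Ag by apply (om_tr N' C). apply ifeq_r. intros ->. apply (nin C).
   * intros c C. rewrite Ag by auto. destruct (classic (c = jj (poset_all (d_in Z)) j n)) as [->|NE].
    -- rewrite ifeq_l, E. intros u [u' [U ->]]%in_jj. apply jj_mem; auto.
    -- rewrite ifeq_r by auto. apply Sub_refl.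
  + destruct (lower Z (le_in1 A1) A3 Gs (LD' _ _ K3)) as [q [B1 [B2 [B3 B4]]]]. exists q. split; [apply (le_tr (poset_all Xz) B1 A1)|].
   exists t, n, k, s. split; [|split; [|split]]; auto.
   * exists s1, n1. spl. apply (st_mono Z (le_rst Xz ZX Zs B1) A9).
   * apply (jj_mem (poset_all (d_in Z)) j). rewrite <- A8, jj_op. apply op_rst. split; [|apply sc_in].
    apply (app_iff _ Fg); auto. rewrite Ag by auto. rewrite ifeq_l. auto.
 - exists n, k. split; [apply (Fa_in Q1 (le_in1 Q2) T K1)|]. assert (NK : n ∊ om /\ k ∊ om) by (apply (Fa_om (Fa_in Q1 (le_in1 Q2) T K1))).
  apply HD'; try tauto. exists s; split; auto. apply (gU_up HPd (rst_G Zs Q1)). apply (le_xd Zs K3).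
Qed.

(** In a task (n,(k,w)) the set w is here any finite set of pairs, which keeps the set of tasks
    independent of the filter; that w is a subset of n x k is imposed by [Fit]. *)
Definition UU : S := prod om (FS (prod om om)).
Definition VV : S := prod om UU.
Lemma ctb_VV : ctb VV.
Proof. exact (ctb_prod2 (@ctb_om S) (ctb_prod2 (@ctb_om S) (ctb_FS (@ctb_prod S)))). Qed.
(** * Unbounded families stay unbounded on infinite sets of tasks *)

(* [DS] names the relation S between ordinals below omega1 and tasks (n, (k, w)); [D] names an infinite set A of tasks
  (n, (f n, w)), with f the Hechler real added at [al].  [Star i x] says that, if A belongs to stage [x], then only boundedly
  many ordinals are related by S to almost all elements of A.  It is proved by induction on [x]. *)
Section Star.
Variables al DS : S.
Hypothesis Hal : al ∊ d.
Hypothesis LS : lvl al DS.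
Definition Inf P L (i : Gen P L) D := forall m, m ∊ om -> exists n u, n ∊ om /\ u ∊ UU /\ Sub m n /\ Ad i D (op n u).
Definition Fit P L (i : Gen P L) D := forall n u, n ∊ om -> u ∊ UU -> Ad i D (op n u) -> exists k w, u = op k w /\ Ad i (DF al) (op n k) /\ Sub w (prod n k).
Definition Alm P L (i : Gen P L) D m y := forall n u, n ∊ om -> u ∊ UU -> Sub m n -> Ad i D (op n u) -> Ad i DS (op y (op n u)).
Definition Star (i : GD) x := forall D, lvl x D -> Inf i D -> Fit i D -> bdd (fun y => exists m, m ∊ om /\ Alm i D m y).
Lemma lvl_S x : x ∊ sc d -> al ∊ sc x -> lvl x DS.
Proof. intros X A. apply (lvl_up X A LS). Qed.
Lemma lvl_F x : x ∊ sc d -> al ∊ x -> lvl x (DF al).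
Proof.
 intros X A. apply (lvl_up X (z := sc al)); [|apply lvl_DF]. apply in_sc. apply (Ord_le (Ord_sc (Ord_in (scd_ord X) A)) (scd_ord X)).
 apply (Ord_sc_le (Ord_in (scd_ord X) A) (scd_ord X)); auto.
Qed.
Lemma Inf_Rs x (X : x ∊ sc d) (i : GD) D : lvl x D -> (Inf (Rs X i) D <-> Inf i D).
Proof. intros L. unfold Inf. setoid_rewrite (Ad_Rs X i _ L). reflexivity. Qed.
Lemma Fit_Rs x (X : x ∊ sc d) (i : GD) D : lvl x D -> al ∊ x -> (Fit (Rs X i) D <-> Fit i D).
Proof. intros L A. unfold Fit. setoid_rewrite (Ad_Rs X i _ L). setoid_rewrite (Ad_Rs X i _ (lvl_F X A)). reflexivity. Qed.
Lemma Alm_Rs x (X : x ∊ sc d) (i : GD) D m y : lvl x D -> al ∊ sc x -> (Alm (Rs X i) D m y <-> Alm i D m y).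
Proof. intros L A. unfold Alm. setoid_rewrite (Ad_Rs X i _ L). setoid_rewrite (Ad_Rs X i _ (lvl_S X A)). reflexivity. Qed.

Lemma good_cond x (X : x ∊ sc d) (i : GD) D : al ∊ x -> lvl x D -> Inf i D -> Fit i D -> exists r0, gU i r0 /\ r0 ∊ Pz x /\
 forall i' : GD, gU i' r0 -> Inf i' D /\ Fit i' D.
Proof.
 intros A L I F. destruct (gU_ne (Rs X i)) as [p0 [G0 H0]].
 destruct (@lvl_truth x X i (fun j => Inf j D /\ Fit j D) p0) as [r0 [R1 [R2 R3]]]; auto.
 - dfn.
 - rewrite Inf_Rs, Fit_Rs; auto.
 - exists r0. split; auto. split; [apply R2|]. intros i' G. destruct (R3 i' G) as [K1 K2]. rewrite Inf_Rs in K1 by auto. rewrite Fit_Rs in K2 by auto. auto.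
Qed.
(** Only the restriction of q to z is in the filter. But the Hechler real added at [al] is known at
    stage z, so by [abs_pos] what q forces about its value is true. *)
Lemma Fit_abs z (i : GD) D q n u : z ∊ sc d -> al ∊ z -> q ∊ Pz d -> gU i (rst q z) -> (forall i' : GD, gU i' q -> Fit i' D /\ Ad i' D (op n u)) ->
 n ∊ om -> u ∊ UU -> exists k w, u = op k w /\ Fa al i n k /\ Sub w (prod n k).
Proof.
 intros Z A Q G H N U. destruct (gUd_ex Q) as [i0 G0]. destruct (H i0 G0) as [F0 A0]. destruct (F0 n u N U A0) as [k [w [E [_ W]]]].
 exists k, w. split; auto. split; auto. unfold Fa. apply (abs_pos Z (lvl_F Z A) Q G). intros i' G'.
 destruct (H i' G') as [F' A']. destruct (F' n u N U A') as [k' [w' [E' [K' _]]]]. rewrite E in E'. apply op_inj in E'. destruct E'; subst. auto.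
Qed.

(** The conditions deciding the memberships in D have countably many coordinates. If these are
    bounded below x, then D belongs to an earlier stage. Otherwise they are cofinal in x, and for
    every y under consideration the property is forced by a condition belonging to the stage of one
    of them; it then suffices to bound the y treated by a fixed stage w. *)
Lemma star_lim x (i : GD) : x ∊ sc d -> al ∊ x -> (forall z, z ∊ x -> sc z ∊ x) -> (forall z, z ∊ x -> al ∊ z -> Star i z) -> Star i x.
Proof.
 intros X AX LIM IH D LD I F. assert (Ox := scd_ord X).
 assert (MAX : forall z, z ∊ x -> exists z1, z1 ∊ x /\ al ∊ z1 /\ Sub z z1).
 { intros z Z. destruct (Ord_total (Ord_in Ox Z) (Ord_in Ox (LIM _ AX))) as [L|L].
  - exists (sc al). split; auto. split; auto. apply sc_in.
  - exists z. split; auto. split; [apply L, sc_in|apply Sub_refl]. }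
 apply (@bdd_ctb_union (fun i m y => Alm i D m y) om i); [dfn|apply ctb_om|]. intros N HN.
 destruct (refine_name VV X LD) as [K [DK HK]].
 set (Wd := sep d (fun z => exists v, v ∊ VV /\ z ∊ supp (K v))).
 assert (HW : forall z, z ∊ Wd <-> exists v p q, v ∊ VV /\ p ∊ K v /\ op z q ∊ p).
 { intros z. unfold Wd. sepd. split.
  - intros [_ [v [V Z]]]. apply (in_supp z X (proj1 (proj2 (HK v V)))) in Z as [p [q [A B]]]. eauto 6.
  - intros [v [p [q [V [A B]]]]]. assert (H : z ∊ supp (K v)) by (apply (in_supp z X (proj1 (proj2 (HK v V)))); eauto). split; [|eauto]. unfold supp in H. sepd in H. apply H. }
 assert (CW : ctb Wd).
 { apply (ctb_cover (F := fun v => supp (K v)) (a := VV)); [dfn|apply ctb_VV| |intros z Z; unfold Wd in Z; sepd in Z; apply Z].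
  intros v V. destruct (HK v V) as [K1 [K2 _]]. apply (ctb_supp X K1 K2). }
 assert (WX : forall w, w ∊ Wd -> w ∊ x).
 { intros w [v [p [q [V [A B]]]]]%HW. apply (P_dom X (proj1 (proj2 (HK v V)) p A) B). }
 assert (IV : forall n u, op n u ∊ VV <-> n ∊ om /\ u ∊ UU) by (intros; apply op_prod).
 destruct (classic (exists z, z ∊ x /\ Sub Wd z)) as [[z [Z WZ]]|NB].
 - destruct (MAX z Z) as [z1 [Z1 [A1 L1]]]. assert (Z1d := d_in (scd_tr X Z1)).
  set (D' := sep (prod (Pz z1) VV) (fun u => exists p v, u = op p v /\ p ∊ K v)).
  assert (HD' : forall p v, op p v ∊ D' <-> p ∊ Pz z1 /\ v ∊ VV /\ p ∊ K v).
  { intros p v. unfold D'. sepd. rewrite op_prod. split; [|intros [B1 [B2 B3]]; split; auto; exists p, v; auto].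
   intros [B1 [p' [v' [E B2]]]]. opi; tauto. }
  assert (EQ : forall v, v ∊ VV -> (Ad i D' v <-> Ad i D v)).
  { intros v V. destruct (HK v V) as [K1 [K2 K3]]. rewrite K3. unfold Ad. setoid_rewrite HD'. split; [intros [p B]; exists p; tauto|].
   intros [p [B1 B2]]. exists p. split; auto. split; auto. apply (P_low X Z1d (K2 p B1)). intros k q Q. apply L1, WZ, HW. eauto 6. }
  refine (bdd_sub _ (IH z1 Z1 A1 D' _ _ _)).
  + intros y Y H. exists N; split; auto. intros n u Hn U L B. apply H; auto. apply EQ; auto. apply IV; auto.
  + intros p v B. apply HD' in B; tauto.
  + intros m M. destruct (I m M) as [n [u [B1 [B2 [B3 B4]]]]]. exists n, u. rewrite EQ; auto. apply IV; auto.
  + intros n u Hn U B. apply F; auto. apply EQ; auto. apply IV; auto.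
 - destruct (good_cond X AX LD I F) as [r0 [G0 [R0 H0]]].
  set (R := fun (i : GD) w y => exists p, gU i p /\ p ∊ Pz w /\ p ∊ Pz x /\ Forced (fun (j : Gen (Pz x) (Lz x)) e => Alm j D N (e 0)) p (fun _ => y)).
  assert (DR : dfns gUd gEd (fun i e => R i (e 0) (e 1))).
  { unfold R, Pz. apply d_ex, d_and; [dfn|]. apply d_and; [dfn|].
   apply (@d_Forced S (Pz x) (Lz x) (poset_all X) cnt (fun j e => Alm j D N (e 0))) with (ts := fun n i e => e 2); [dfn|apply ft_var|intros; apply ft_var]. }
  assert (NE : forall z, z ∊ x -> exists w, w ∊ Wd /\ Sub z w).
  { intros z Z. contra NW. apply NB. exists z; split; auto. intros w Hw. contra N2. apply NW. exists w; split; auto.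
   assert (Ow := Ord_in Ox (WX w Hw)). assert (Oz := Ord_in Ox Z). destruct (Ord_total Oz Ow) as [L|L]; auto.
   apply (Ord_le Ow Oz) in L as [L| ->]; [contradiction|apply Sub_refl]. }
  refine (bdd_sub _ (@bdd_ctb_union R Wd i DR CW _)).
  + intros y Y H. apply (Alm_Rs X i N y LD (proj2 (in_sc _ _) (or_introl AX))) in H.
   destruct (@lvl_truth x X i (fun j => True) r0) as [_ _]; auto; [dfn|].
   destruct (@Forced_below S (Pz x) (Lz x) (poset_all X) cnt (fun j e => Alm j D N (e 0)) (Rs X i) (fun _ => y) r0) as [p [[G1 P1] [_ P2]]]; auto; [dfn|split; auto|].
   destruct (fin_max (fin_dm X P1)) as [E|[z [Z M]]].
   * intros z [q Q]%in_dm. apply (Ord_in Ox (P_dom X P1 Q)).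
   * destruct (NE al AX) as [w [Hw _]]. exists w. split; auto. exists p. split; auto. split; auto.
    apply (P_low X (d_in (scd_tr X (WX w Hw))) P1). intros k q Q. rewrite (P_em X P1 E) in Q. destruct (in_em Q).
   * assert (ZX : z ∊ x) by (apply in_dm in Z as [q Q]; apply (P_dom X P1 Q)).
    destruct (NE (sc z) (LIM z ZX)) as [w [Hw L]]. exists w. split; auto. exists p. split; auto. split; auto.
    apply (P_low X (d_in (scd_tr X (WX w Hw))) P1). intros k q Q. apply L.
    assert (KM : Sub k z) by (apply M, in_dm; eauto). apply in_sc. apply (Ord_le (Ord_in Ox (P_dom X P1 Q)) (Ord_in Ox ZX)); auto.
  + intros w Hw. destruct (MAX w (WX w Hw)) as [z1 [Z1 [A1 L1]]]. assert (Z1d := d_in (scd_tr X Z1)). assert (Zx1 : z1 ∊ sc x) by (apply in_sc; auto).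
   assert (SZ1 : Sub z1 x) by exact (proj1 Ox z1 Z1).
   (* The tasks beyond N which the filter at stage z1 leaves possible. If a condition of stage w in
      the filter forces the property of y, then y is related to all these tasks, because it can be
      amalgamated with the conditions that force them into D. *)
   set (D' := sep (prod (Pz z1) VV) (fun v0 => exists s n u q p, v0 = op s (op n u) /\ Sub N n /\ lez x q r0 /\ op p (op n u) ∊ D /\ lez x q p /\ s = rst q z1)).
   assert (HD' : forall s n u, op s (op n u) ∊ D' <-> s ∊ Pz z1 /\ op n u ∊ VV /\ Sub N n /\ exists q p, lez x q r0 /\ op p (op n u) ∊ D /\ lez x q p /\ s = rst q z1).
   { intros s n u. unfold D'. sepd. rewrite op_prod. split.
    - intros [B1 [s' [n' [u' [q [p [E B2]]]]]]]. opi. split; [tauto|split; [tauto|split; [tauto|exists q, p; tauto]]].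
    - intros [B1 [B2 [B3 [q [p B4]]]]]. split; auto. exists s, n, u, q, p. tauto. }
   assert (AD : forall n u, n ∊ om -> u ∊ UU -> (Ad i D' (op n u) <-> Sub N n /\ exists q p, lez x q r0 /\ op p (op n u) ∊ D /\ lez x q p /\ gU i (rst q z1))).
   { intros n u Hn Hu. split.
    - intros [s [G B]]. apply HD' in B as [_ [_ [B [q [p [B1 [B2 [B3 ->]]]]]]]]. split; auto. exists q, p. auto.
    - intros [B [q [p [B1 [B2 [B3 B4]]]]]]. exists (rst q z1). split; auto. apply HD'. split; [apply (P_rst X SZ1 Z1d); apply B1|]. rewrite IV. spl. exists q, p; auto. }
   refine (bdd_sub _ (IH z1 Z1 A1 D' _ _ _)).
   * intros y Y [p [G1 [P1 [P2 P3]]]]. exists N; split; auto. intros n u Hn Hu L B. apply AD in B; auto. destruct B as [_ [q [p' [B1 [B2 [B3 B4]]]]]].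
    assert (Pw1 : p ∊ Pz z1) by (apply (P_up Z1d L1 (d_in (scd_tr X (WX w Hw))) P1)).
    destruct (amal X Zx1 (le_in1 B1) B4 G1 Pw1) as [r [R1 [R2 [R3 R4]]]].
    apply (abs_pos Z1d (lvl_S Z1d (proj2 (in_sc _ _) (or_introl A1))) (P_d X R1) R4). intros i' G'.
    assert (K1 := P3 (Rs X i') (conj (gU_up HPd G' (le_xd X R3)) P2)). apply (Alm_Rs X i' N y LD (proj2 (in_sc _ _) (or_introl AX))) in K1.
    apply K1; auto. exists p'. split; auto. apply (gU_up HPd (gU_up HPd G' (le_xd X R2)) (le_xd X B3)).
   * intros s v B. unfold D' in B. sepd in B.  destruct B as [B _]. apply op_prod in B; tauto.
   * intros m M. destruct (om_max M HN) as [m' [M' [ML NL]]]. destruct (I m' M') as [n [u [B1 [B2 [B3 [p [B4 B5]]]]]]].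
    exists n, u. spl. split; [exact (Sub_trans ML B3)|]. apply AD; auto. split; [exact (Sub_trans NL B3)|].
    destruct (@gU_dir _ _ _ (Rs X i) p r0) as [q [[Q1 Q2] [Q3 Q4]]]; [split; auto; apply (LD _ _ B5)|split; auto|]. exists q, p. spl. apply rst_G; auto.
   * intros n u Hn Hu B. apply AD in B; auto. destruct B as [_ [q [p [B1 [B2 [B3 B4]]]]]].
    apply (@Fit_abs z1 i D q n u Z1d A1 (P_d X (le_in1 B1)) B4); auto. intros i' G'.
    split; [apply H0, (gU_up HPd G' (le_xd X B1))|]. exists p. split; auto. apply (gU_up HPd G' (le_xd X B3)).
Qed.

Lemma o_ne : exists g, g ∊ o.
Proof. exists em. apply (om1_om Ho), om_0. Qed.
Lemma bdd_no (B : S -> Prop) : (forall x, x ∊ o -> ~ B x) -> bdd B.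
Proof. intros H. destruct o_ne as [g G]. exists g; split; auto. intros x X K. destruct (H x X K). Qed.
Definition VN N := sep VV (fun v => exists n u, v = op n u /\ Sub N n).
Lemma in_VN N n u : op n u ∊ VN N <-> n ∊ om /\ u ∊ UU /\ Sub N n.
Proof.
 unfold VN. sepd. unfold VV. rewrite op_prod. split.
 - intros [[A B] [n' [u' [E C]]]]. opi; auto.
 - intros [A [B C]]. split; [auto|eauto].
Qed.
Lemma VN_pair N v : v ∊ VN N -> exists n u, v = op n u /\ n ∊ om /\ u ∊ UU /\ Sub N n.
Proof. intros H. assert (H' := H). unfold VN in H'. sepd in H'. destruct H' as [_ [n [u [-> L]]]]. apply in_VN in H. eauto. Qed.

(** * Successor stages: reduction to the combinatorics of stems *)

Section Suc.
Variables ze D r0 : S.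
Hypothesis Hz : ze ∊ d.
Variable i : GD.
Let Zs : ze ∊ sc d := d_in Hz.
Let HPz : poset (Pz ze) (Lz ze) := poset_all Zs.
Let Xz : sc ze ∊ sc d := sc_scd Hz.
Let ZX : Sub ze (sc ze) := fun u U => proj2 (in_sc ze u) (or_introl U).
Hypothesis HA : al ∊ sc ze.
Hypothesis LD : lvl (sc ze) D.
Hypothesis G0 : gU i r0.
Hypothesis R0 : r0 ∊ Pz (sc ze).
Hypothesis H0 : forall i' : GD, gU i' r0 -> Inf i' D /\ Fit i' D.
Notation T := (NM HPz (Rs Zs i)).
Notation J := (jj HPz (Rs Zs i)).
Definition Wit t v q p := lez (sc ze) q r0 /\ op p v ∊ D /\ lez (sc ze) q p /\ stc ze q t.
(** The relation [Dec] of the fusion, as a name of stage [ze]: a stem decides a task if some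
    condition below r0 has this stem, forces the task into D, and has its lower part in the
    filter. *)
Definition DecD := sep (prod (Pz ze) (prod SQs VV)) (fun x => exists s t v q p, x = op s (op t v) /\ Wit t v q p /\ s = rst q ze).
Lemma lvl_Dec : lvl ze DecD.
Proof. intros s x H. unfold DecD, Wit in H. sepd in H. destruct H as [H _]. apply op_prod in H; tauto. Qed.
Lemma Ad_Dec t v : t ∊ SQs -> v ∊ VV -> (Ad i DecD (op t v) <-> exists q p, Wit t v q p /\ gU i (rst q ze)).
Proof.
 intros Ht Hv. unfold DecD. split.
 - intros [s [G H]]. unfold Wit in H. sepd in H. destruct H as [_ [s' [t' [v' [q [p [E [H ->]]]]]]]].
  opi. exists q, p. split; auto.
 - intros [q [p [H G]]]. exists (rst q ze). split; auto. unfold Wit in *. sepd. rewrite !op_prod. split; [split; auto; apply (P_rst Xz ZX Zs); apply H|].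
  exists (rst q ze), t, v, q, p. auto.
Qed.
Variables dec sr : T.
Hypothesis Hdec : forall w : T, w ∊ dec <-> exists x, w = J x /\ x ∊ prod SQs VV /\ Ad i DecD x.
Hypothesis Hsr : forall w : T, w ∊ sr <-> exists x, w = J x /\ x ∊ prod o VV /\ Ad i DS x.
Notation fav' := (@fav T dec).
Notation Zs' N := (@Zst T dec (J (VN N)) sr).
Lemma dec_iff t v : op (J t) (J v) ∊ dec <-> t ∊ SQs /\ v ∊ VV /\ exists q p, Wit t v q p /\ gU i (rst q ze).
Proof.
 rewrite Hdec, <- jj_op. split.
 - intros [x [E [X A]]]. apply jj_inj in E. subst x. apply op_prod in X. destruct X. spl. apply Ad_Dec; auto.
 - intros [A [B C]]. exists (op t v). rewrite op_prod. spl. apply Ad_Dec; auto.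
Qed.
Lemma sr_iff y v : op (J y) (J v) ∊ sr <-> y ∊ o /\ v ∊ VV /\ Ad i DS (op y v).
Proof.
 rewrite Hsr, <- jj_op. split.
 - intros [x [E [X A]]]. apply jj_inj in E. subst x. apply op_prod in X. tauto.
 - intros [A [B C]]. exists (op y v). rewrite op_prod. auto.
Qed.
Lemma tq_J (t' : T) : tq t' -> exists t n, t' = J t /\ SQ n t.
Proof.
 intros H. destruct (FP_tq H) as [A [B _]]. rewrite <- (jj_om HPz (Rs Zs i)), <- jj_prod in A.
 destruct (fin_J (Hz := Hz) B A) as [t [-> _]]. destruct H as [n' [N' F]]. destruct (J_om_inv (Hz := Hz) N') as [n [N ->]].
 exists t, n. spl. apply (jj_isfun_inv (Hz := Hz) (j := Rs Zs i)). rewrite jj_om. exact F.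
Qed.
Lemma SQ_J n t : SQ n t -> J n ∊ om /\ isfun (J t) (J n) om.
Proof. intros [N F]. split; [apply (J_om Hz i N)|]. rewrite <- (jj_om HPz (Rs Zs i)). apply jj_isfun; auto. Qed.
Lemma J_tq n t : SQ n t -> tq (J t).
Proof. intros H. exists (J n). apply (SQ_J H). Qed.
Lemma FP_J (e' : T) : FP e' -> exists e, e' = J e /\ e ∊ FS (prod om om).
Proof.
 intros [A [B C]]. rewrite <- (jj_om HPz (Rs Zs i)), <- jj_prod in A. exact (fin_J (Hz := Hz) B A).
Qed.
(** The hypothesis [reg] of the fusion in the extension at stage [ze]: finite partial functions are
    ground-model objects, there are countably many of them, and [bdd_ctb_union] applies. *)
Lemma regT (R : T) : Sub R (prod (@PF T) (J o)) -> (forall e, FP e -> @bd T (J o) (fun y : T => op e y ∊ R)) -> @bd T (J o) (fun y : T => exists e, FP e /\ op e y ∊ R).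
Proof.
 intros SR H. destruct (toD (Hz := Hz) (prod (FS (prod om om)) o) R) as [DR [L1 L2]].
 assert (L2' : forall e y, e ∊ FS (prod om om) -> y ∊ o -> (op (J e) (J y) ∊ R <-> Ad i DR (op e y))).
 { intros e y E Y. rewrite <- jj_op. apply L2, op_prod; auto. }
 apply bd_J. refine (bdd_sub _ (@bdd_ctb_union (fun i e y => Ad i DR (op e y)) (FS (prod om om)) i _ _ _)).
 - intros y Y [e' [E R']]. destruct (FP_J E) as [e [-> Ee]]. exists e. split; auto. apply L2'; auto.
 - dfn.
 - apply ctb_FS, ctb_prod.
 - intros e E. destruct (classic (FP (J e))) as [F|F].
  + refine (bdd_sub _ (proj1 (bd_J (Hz := Hz) (i := i) _) (H _ F))). intros y Y K. apply L2'; auto.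
  + apply bdd_no. intros y Y K. apply L2' in K; auto. apply SR, op_prod in K as [K _]. apply in_PF in K. auto.
Qed.

Lemma toT b (w : T) : exists D', lvl ze D' /\ forall x, x ∊ b -> (J x ∊ w <-> Ad i D' x).
Proof. exact (toD (Hz := Hz) b w). Qed.
(** Raise the value of p at [ze] above g past the stem e. The result still forces D to be infinite,
    so some extension of it, with lower part in the filter, puts a task beyond N' into D and has a
    decided stem. That stem obeys e and g, and decides the task. *)
Lemma FA p e N' (g : T) : gU i p -> lez (sc ze) p r0 -> stc ze p e -> N' ∊ om -> isfun g om om ->
 (forall t v : T, tq t -> obey t (J e) g -> v ∊ J (VN N') -> ~ op t v ∊ dec) -> False.
Proof.
 intros G L ST HN Fg NO. assert (TR := fun x y w => @le_tr _ _ _ (poset_all Xz) x y w). assert (Hp := le_in1 L).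
 assert (Gp : gU (Rs Zs i) (rst p ze)) by (split; [apply rst_G; auto|apply (P_rst Xz ZX Zs Hp)]).
 destruct (stc_val Hz Gp ST) as [q [n [f [Q [SE [F [V KE]]]]]]]. destruct (SQ_J SE) as [Nn Fe].
 destruct (mxo_all (J n) F Fg) as [M1 [M2 [M3 M4]]].
 destruct (@extend_real ze Hz (Rs Zs i) p p (J n) (mxo (J n) f g)) as [p' [s [m [t0 [A1 [_ [A3 [A4 [A5 _]]]]]]]]]; auto.
 { intros q' [Q'|Q']; rewrite (P_fun Xz Hp Q' Q), V; apply hle_i; auto using Sub_refl; intros c C; apply M2; auto; apply (om_tr Nn C). }
 destruct (@gen_below S (Pz ze) (Lz ze) HPz (gU (Rs Zs i)) (fun s0 => exists q1 t n1 u p3, s0 = rst q1 ze /\ lez (sc ze) q1 p' /\ op p3 (op n1 u) ∊ D /\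
  lez (sc ze) q1 p3 /\ n1 ∊ om /\ u ∊ UU /\ Sub N' n1 /\ stc ze q1 t) (rst p' ze) (proj2_sig (Rs Zs i)) A3) as [s0 [S1 [[q1 [t [n1 [u [p3 [-> [B1 [B2 [B3 [B4 [B5 [B6 B7]]]]]]]]]]]] _]]].
 - dfn.
 - intros s0 Ls. destruct (glue_all Xz Zs ZX (le_in1 A1) Ls) as [C1 [C2 [C3 C4]]]. set (p2 := glue p' s0 ze) in *.
  destruct (gUd_ex (P_d Xz C1)) as [i' G'].
  assert (Gr : gU i' r0) by (apply (gU_up HPd G'), (le_xd Xz), (TR _ _ _ C2), (TR _ _ _ A1), L).
  destruct (proj1 (H0 Gr) N' HN) as [n1 [u [N1 [Hu [L1 [p3 [G3 Hp3]]]]]]].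
  destruct (@gU_dir _ _ _ (Rs Xz i') p2 p3) as [q0 [[Q1 Q2] [Q3 Q4]]]; [split; auto|split; auto; apply (LD Hp3)|].
  destruct (@extend_stem ze Hz (Rs Zs i') q0 Q2) as [r [t [s1 [n2 [f2 [E1 [E2 [E3 _]]]]]]]]; [split; [apply rst_G; auto|apply (P_rst Xz ZX Zs Q2)]|].
  exists (rst r ze). assert (Lr := TR _ _ _ E1 Q3). split.
  + exists r, t, n1, u, p3. split; auto. split; [apply (TR _ _ _ Lr C2)|]. split; auto. split; [apply (TR _ _ _ E1 Q4)|]. auto.
  + rewrite <- C4. apply (le_rst Xz ZX Zs Lr).
 - assert (HQ := le_in1 B1). destruct (stc_val Hz S1 B7) as [q2 [n' [f' [Q2 [ST' [F' [V' KT]]]]]]]. destruct (SQ_J ST') as [Nn' Ft].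
  destruct (val_le Hz B1 S1 A4) as [q3 [Q3 HL]]. rewrite (P_fun Xz HQ Q3 Q2), V', A5 in HL.
  apply (NO (J t) (J (op n1 u))).
  + apply (J_tq ST').
  + apply (hle_obey Nn Nn' Fe Ft F F' Fg KE KT HL).
  + apply jj_mem, in_VN; auto.
  + apply dec_iff. split; [apply in_SQs; eauto|]. split; [apply op_prod; auto|]. exists q1, p3. split; [|apply S1].
   split; [apply (TR _ _ _ B1), (TR _ _ _ A1), L|]. auto.
Qed.

(** The property of y is forced by some p in the filter with a decided stem e, and the function of p
    at [ze] is the witness g. A condition whose stem obeys e and g is compatible with p, so a task
    it forces into D must be related to y. *)
Lemma stem_of_Alm N y : N ∊ om -> y ∊ o -> Alm i D N y -> exists e p, gU i p /\ lez (sc ze) p r0 /\ stc ze p e /\ Zs' N (J e) (J y).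
Proof.
 intros HN Y AL. assert (TR := fun x y w => @le_tr _ _ _ (poset_all Xz) x y w). assert (HA' : al ∊ sc (sc ze)) by (apply in_sc; auto).
 apply (Alm_Rs Xz i N y LD HA') in AL.
 destruct (@lvl_truth (sc ze) Xz i (fun j => Alm j D N y) r0) as [p1 [P1 [P2 P3]]]; auto; [dfn|].
 destruct (@dens ze Hz i (fun q => exists e, stc ze q e) p1) as [p [Gp [L [e SE]]]]; auto; [dfn|apply P2| |].
 { intros p L. destruct (gen_ex HPz cnt (P_rst Xz ZX Zs (le_in1 L))) as [j G].
  destruct (extend_stem Hz (le_in1 L) G) as [r [t [s [n [f [E1 [E2 [E3 _]]]]]]]]. exists r. split; [exact E1|eauto]. }
 exists e, p. split; auto. split; [apply (TR _ _ _ L P2)|]. split; auto. assert (Hp := le_in1 L).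
 assert (GR : gU (Rs Zs i) (rst p ze)) by (split; [apply rst_G; auto|apply (P_rst Xz ZX Zs Hp)]).
 destruct (stc_val Hz GR SE) as [q [n [f [Q [SQe [F [V KE]]]]]]]. destruct (SQ_J SQe) as [Nn Fe].
 exists f. split; auto. intros t' v' TQ OB HV HD. destruct (tq_J TQ) as [t [n2 [-> ST]]]. destruct (SQ_J ST) as [Nn2 Ft].
 apply in_jj in HV as [v [HV ->]]. destruct (VN_pair HV) as [n1 [u [-> [N1 [U1 L1]]]]].
 apply dec_iff in HD as [_ [VV1 [q1 [p3 [[W1 [W2 [W3 W4]]] Gq]]]]]. assert (HQ := le_in1 W1).
 assert (GQ : gU (Rs Zs i) (rst q1 ze)) by (split; auto; apply (P_rst Xz ZX Zs HQ)).
 destruct (stc_val Hz GQ W4) as [q2 [n2' [f2 [Q2 [ST' [F2 [V2 KT]]]]]]]. rewrite (SQ_dom ST' ST) in V2.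
 destruct (obey_hle Nn Nn2 Fe Ft F F2 KE KT OB) as [HL1 HL2]. destruct (mxo_all (J n2) F2 F) as [M1 _].
 destruct (@extend_real ze Hz (Rs Zs i) p q1 (J n2) (mxo (J n2) f2 f)) as [r [s [m [t0 [A1 [A2 [A3 _]]]]]]]; auto.
 { intros q' [Q'|Q']; [rewrite (P_fun Xz Hp Q' Q), V|rewrite (P_fun Xz HQ Q' Q2), V2]; auto. }
 apply sr_iff. spl. destruct A3 as [A3 _].
 apply (abs_pos Zs (lvl_S Zs HA) (P_d Xz (le_in1 A1)) A3). intros i' G'.
 assert (K1 := P3 i' (gU_up HPd G' (le_xd Xz (TR _ _ _ A1 L)))). apply (Alm_Rs Xz i' N y LD HA') in K1.
 apply K1; auto. exists p3. split; auto. apply (gU_up HPd G' (le_xd Xz (TR _ _ _ A2 W3))).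
Qed.

(** By [stem_of_Alm] and the countability of stems, an unbounded set of y yields one stem e with
    [Zst] unbounded. The hypothesis supplies what the fusion requires beyond some N', and the g
    obtained from [comb] contradicts [FA]. *)
Lemma suc_common N : N ∊ om -> (forall e p, gU i p -> lez (sc ze) p r0 -> stc ze p e -> ~ bdd (fun y => Zs' N (J e) (J y)) ->
 exists N', N' ∊ om /\ Sub N N' /\ (forall v : T, v ∊ J (VN N') -> ~ fav' (J e) v) /\
 forall e : T, FP e -> ~ @bd T (J o) (Zs' N' e) -> (forall v : T, v ∊ J (VN N') -> ~ fav' e v) -> forall m : T, m ∊ om ->
 exists k, k ∊ om /\ forall e', exn e m k e' -> forall v : T, v ∊ J (VN N') -> ~ fav' e' v) -> bdd (Alm i D N).
Proof.
 intros HN H. contra NB.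
 assert (E : exists e p, gU i p /\ lez (sc ze) p r0 /\ stc ze p e /\ ~ bdd (fun y => Zs' N (J e) (J y))).
 { contra NE. apply NB.
  destruct (toT (prod SQs o) (sep (prod (@PF T) (J o)) (fun u : T => exists e y : T, u = op e y /\ Zs' N e y))) as [DZ [Z1 Z2]].
  assert (Z3 : forall n e y, SQ n e -> y ∊ o -> (Zs' N (J e) (J y) <-> Ad i DZ (op e y))).
  { intros n e y SE Y. rewrite <- Z2 by (apply op_prod; split; auto; apply in_SQs; eauto). rewrite in_sep by dfn. rewrite jj_op, op_prod.
   split; [|intros [_ [e1 [y1 [E1 K]]]]; opi; auto].
   intros K. split; [split; [apply in_PF, FP_tq, (J_tq SE)|apply jj_mem; auto]|eauto]. }
  refine (bdd_sub _ (@bdd_ctb_union (fun i e y => (exists p, gU i p /\ lez (sc ze) p r0 /\ stc ze p e) /\ Ad i DZ (op e y)) SQs i _ ctb_SQs _)).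
  - intros y Y AL. destruct (stem_of_Alm HN Y AL) as [e [p [P1 [P2 [P3 P4]]]]]. destruct P3 as [q [n [P5 [P6 P7]]]]. exists e. split; [apply in_SQs; eauto|].
   split; [exists p; spl; exists q, n; auto|]. apply (Z3 n); auto.
  - dfn.
  - intros e [n SE]%in_SQs. destruct (classic (exists p, gU i p /\ lez (sc ze) p r0 /\ stc ze p e)) as [[p P]|NP].
   + assert (B : bdd (fun y => Zs' N (J e) (J y))) by (contra NB2; apply NE; exists e, p; tauto).
    refine (bdd_sub _ B). intros y Y [_ K]. apply (Z3 n); auto.
   + apply bdd_no. intros y Y [K _]. auto. }
 destruct E as [e [p [P1 [P2 [P3 P4]]]]]. destruct (H e p P1 P2 P3 P4) as [N' [HN' [LN [NF HH]]]].
 assert (TE : FP (J e)) by (destruct P3 as [q [n [_ [SE _]]]]; apply FP_tq, (J_tq SE)).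
 destruct (@comb T dec (J (VN N')) sr (J o)) with (e0 := J e) as [g [G1 G2]]; auto.
 - destruct o_ne as [g G]. exists (J g). apply jj_mem; auto.
 - apply regT.
 - split; auto. intros B. apply P4. refine (bdd_sub _ (proj1 (bd_J (Hz := Hz) (i := i) _) B)). intros y Y [g [G K]]. exists g; split; auto.
  intros t v T1 T2 HV. apply K; auto. apply in_jj in HV as [v1 [HV ->]]. apply jj_mem.
  destruct (VN_pair HV) as [n1 [u [-> [N1 [U1 L1]]]]]. apply in_VN. spl. exact (Sub_trans LN L1).
 - apply (FA P1 P2 P3 HN' G1). intros t v T1 T2 T3. apply G2; auto.
Qed.

Lemma cst_fun (k : T) : k ∊ om -> exists g, isfun g om om /\ forall c, c ∊ om -> app g c = k.
Proof.
 intros K. assert (Dk : d0 (fun _ : T => k)) by dfn. exists (lam om om (fun _ => k)).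
 split; [apply lam_fun; auto|]. intros c C. rewrite (app_lam Dk (fun _ _ => K) C). auto.
Qed.
Lemma fav_wit (e' g : T) v : fav' e' (J v) -> isfun g om om -> exists t q p, obey (J t) e' g /\ Wit t v q p /\ gU i (rst q ze) /\ t ∊ SQs /\ v ∊ VV.
Proof.
 intros H G. destruct (H g G) as [t' [TQ [OB HD]]]. destruct (tq_J TQ) as [t [n [-> ST]]]. apply dec_iff in HD as [A [B [q [p [C E]]]]]. exists t, q, p. auto.
Qed.
Lemma Wit_abs t n u q p : n ∊ om -> u ∊ UU -> Wit t (op n u) q p -> forall i' : GD, gU i' q -> Fit i' D /\ Ad i' D (op n u).
Proof.
 intros Hn Hu [W1 [W2 [W3 _]]] i' G'. split; [apply H0, (gU_up HPd G' (le_xd Xz W1))|]. exists p; split; auto. apply (gU_up HPd G' (le_xd Xz W3)).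
Qed.
(** The star property at [ze] brought into usable form: the infinite set of tasks may be given by
    any predicate definable in the extension at that stage. *)
Lemma starT (Q : T -> Prop) : Star i ze -> dfn0 (@smem T) Q -> (forall m, m ∊ om -> exists n u, n ∊ om /\ u ∊ UU /\ Sub m n /\ Q (J (op n u))) ->
 (forall n u, n ∊ om -> u ∊ UU -> Q (J (op n u)) -> exists k w, u = op k w /\ Fa al i n k /\ Sub w (prod n k)) ->
 bdd (fun y => exists m, m ∊ om /\ forall n u, n ∊ om -> u ∊ UU -> Sub m n -> Q (J (op n u)) -> Ad i DS (op y (op n u))).
Proof.
 intros SZ DQ HI HF. destruct (toT VV (sep (J VV) Q)) as [D2 [L2 E2]].
 assert (E : forall n u, n ∊ om -> u ∊ UU -> (Q (J (op n u)) <-> Ad i D2 (op n u))).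
 { intros n u N U. assert (V : op n u ∊ VV) by (apply op_prod; auto). rewrite <- E2 by auto. rewrite in_sep by auto. rewrite jj_mem. tauto. }
 refine (bdd_sub _ (SZ D2 L2 _ _)).
 - intros y Y [m [M H]]. exists m; split; auto. intros n u N U L A. apply H; auto. apply E; auto.
 - intros m M. destruct (HI m M) as [n [u [A1 [A2 [A3 A4]]]]]. exists n, u. rewrite <- E; auto.
 - intros n u N U A. apply HF; auto. apply E; auto.
Qed.
Lemma VN_J N (v : T) : v ∊ J (VN N) -> exists n u, v = J (op n u) /\ n ∊ om /\ u ∊ UU /\ Sub N n.
Proof. intros [v1 [H ->]]%in_jj. destruct (VN_pair H) as [n [u [-> K]]]. eauto. Qed.
(* Successor stages above [al]: the star property of the stage [ze] is applied to the set of favored tasks. *)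
Section Later.
Hypothesis AL : al ∊ ze.
Hypothesis SZ : Star i ze.
Lemma fav_fit (e' : T) n u : n ∊ om -> u ∊ UU -> fav' e' (J (op n u)) -> exists k w, u = op k w /\ Fa al i n k /\ Sub w (prod n k).
Proof.
 intros N U H. destruct (cst_fun (@om_0 T)) as [g [G _]]. destruct (fav_wit H G) as [t [q [p [_ [W [Gq _]]]]]].
 apply (@Fit_abs ze i D q n u Zs AL (P_d Xz (le_in1 (proj1 W))) Gq); auto. exact (Wit_abs N U W).
Qed.
(** Otherwise for every k some task is favored by an extension of e with new values above k. For a
    given n there are finitely many candidates (n,(f(n),w)), and each drops out for large k by
    [fav_lim]; so the first coordinates tend to infinity. Taking those of least n for each k gives
    an infinite set, to almost all of which every y in [Zst e] is related, against the star
    property. *)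
Lemma favor_later N' : N' ∊ om -> forall e : T, FP e -> ~ @bd T (J o) (Zs' N' e) -> (forall v : T, v ∊ J (VN N') -> ~ fav' e v) -> forall m : T, m ∊ om ->
 exists k, k ∊ om /\ forall e', exn e m k e' -> forall v : T, v ∊ J (VN N') -> ~ fav' e' v.
Proof.
 intros HN e FPe NB NF m M. contra NK.
 set (X := fun k v : T => v ∊ J (VN N') /\ exists e', exn e m k e' /\ fav' e' v).
 assert (NK' : forall k : T, k ∊ om -> exists v : T, X k v).
 { intros k K. contra N1. apply NK. exists k; split; auto. intros e' E' v V FV. apply N1. exists v; split; eauto. }
 assert (XM : forall k k' v : T, Sub k' k -> X k v -> X k' v).
 { intros k k' v L [V [e' [E' FV]]]. split; auto. exists e'; split; auto. apply (exn_mono L E'). }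
 assert (XF : forall v : T, exists k : T, k ∊ om /\ ~ X k v).
 { intros v. destruct (classic (v ∊ J (VN N'))) as [V|V]; [|exists em; split; [apply om_0|intros [V' _]; auto]].
  destruct (fav_lim M (NF v V)) as [k [K A]]. exists k; split; auto. intros [_ [e' [E' FV]]]. apply (A e' E' FV). }
 assert (XV : forall k v : T, X k v -> exists n u, v = J (op n u) /\ n ∊ om /\ u ∊ UU /\ exists k w, u = op k w /\ Fa al i n k /\ Sub w (prod n k)).
 { intros k v [V [e' [E' FV]]]. destruct (VN_J V) as [n [u [-> [N1 [U1 _]]]]]. exists n, u. spl. apply (fav_fit N1 U1 FV). }
 (* Minimality of n ensures that k is large when n is: a task occurring for K0 occurs for all
    smaller k as well and bounds the n selected for them. *)
 set (Q := fun v : T => exists n u k : T, v = op n u /\ k ∊ om /\ X k v /\ forall n' u' : T, X k (op n' u') -> Sub n n').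
 assert (B : bdd (fun y => exists m, m ∊ om /\ forall n u, n ∊ om -> u ∊ UU -> Sub m n -> Q (J (op n u)) -> Ad i DS (op y (op n u)))).
 { apply starT; auto.
  - dfn.
  - intros m0 M0.
   assert (BK : exists k : T, k ∊ om /\ forall n : T, n ∊ J m0 -> forall u : T, ~ X k (op n u)).
   { apply (@fin_bound T unit _ _ (@IndOk_pure T) (fun _ n k => forall u : T, ~ X k (op n u)) tt (J m0)).
    - dfn.
    - intros n k k' H _ _ L u H'. apply (H u). apply (XM k'); auto.
    - apply (J_fin Hz i), fin_nat; auto.
    - intros n' Hn'. apply in_jj in Hn' as [n [Hn ->]]. assert (No := om_tr M0 Hn). destruct (Fa_tot Hal i No) as [k1 K1].
     set (fs1 := img (fun w => op n (op k1 w)) (Pw (prod n k1))). assert (Df : d0 (fun w : S => op n (op k1 w))) by dfn.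
     destruct (@fin_bound T unit _ _ (@IndOk_pure T) (fun _ (v k : T) => ~ X k v) tt (J fs1)) as [k [K A]].
     + dfn.
     + intros v k k' H _ _ L H'. apply H. apply (XM k'); auto.
     + apply (J_fin Hz i). apply (fin_img (F := fun w => op n (op k1 w)) (a := Pw (prod n k1))); auto.
      * apply fin_Pw, fin_prod; apply fin_nat; auto. apply (Fa_om K1).
      * intros y Y. unfold fs1 in Y. rewrite in_img in Y by auto. auto.
     + intros v _. apply XF.
     + exists k; split; auto. intros u H. destruct (XV _ _ H) as [n2 [u2 [E [N2 [U2 [k2 [w [-> [F2 W]]]]]]]]]. apply (A (op (J n) u)); auto.
      rewrite E. apply jj_mem. unfold fs1. rewrite in_img by auto. rewrite jj_op in E. apply op_inj in E as [E _]. apply jj_inj in E. subst n2.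
      rewrite (Fa_fun Hal F2 K1) in *. exists w. split; auto. apply in_Pw; auto. }
   destruct BK as [k [K A]]. destruct (NK' k K) as [v V]. destruct (XV _ _ V) as [n1 [u1 [-> [N1 [U1 _]]]]]. rewrite jj_op in V.
   destruct (@d_least T (fun n : T => exists u : T, X k (op n u))) as [n [Hn [[u Hu] LS']]].
   + dfn.
   + exists (J n1). split; [apply (J_om Hz i N1)|eauto].
   + destruct (XV _ _ Hu) as [n2 [u2 [E [N2 [U2 _]]]]]. exists n2, u2. spl. rewrite jj_op in E. opi. split.
    * destruct (Ord_total (om_ord M0) (om_ord N2)) as [L|L]; auto. apply (Ord_le (om_ord N2) (om_ord M0)) in L.
     destruct L as [L| ->]; [|apply Sub_refl]. exfalso. apply (A (J n2) (proj2 (jj_mem HPz (Rs Zs i) n2 m0) L) _ Hu).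
    * exists (J n2), (J u2), k. rewrite jj_op. spl. intros n' u' H'.
     contra NS. assert (N'o : n' ∊ om).
     { destruct (XV _ _ H') as [n3 [u3 [E3 [N3 _]]]]. rewrite jj_op in E3. opi. apply (J_om Hz i N3). }
     apply (Ord_nle (om_ord Hn) (om_ord N'o)) in NS. apply (LS' n' NS). eauto.
  - intros n u N1 U1 [n' [u' [k [_ [_ [H _]]]]]]. destruct H as [_ [e' [_ FV]]]. apply (fav_fit N1 U1 FV). }
 apply NB. apply bd_J. refine (bdd_sub _ B). intros y Y [g [G HG]]. destruct (fun_bound G M) as [K0 [HK0 BK0]].
 destruct (NK' K0 HK0) as [v0 V0]. destruct (XV _ _ V0) as [n0 [u0 [E0 [N0 [U0 _]]]]]. exists (sc n0). split; [apply om_S; auto|].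
 intros n u N1 U1 L [n' [u' [k [E [K [H LE]]]]]]. rewrite jj_op in E. apply op_inj in E as [<- <-].
 assert (KK : Sub K0 k).
 { contra NS. apply (Ord_nle (om_ord HK0) (om_ord K)) in NS. assert (SK : Sub k K0) by exact (proj1 (om_ord HK0) _ NS).
  assert (V1 := XM _ _ _ SK V0). rewrite E0, jj_op in V1. apply LE in V1. apply (@nin _ (J n0)), V1, jj_mem. apply L, sc_in. }
 destruct H as [HV [e' [E' FV]]]. destruct (FV g G) as [t [T1 [T2 T3]]].
 assert (R := HG t (J (op n u)) T1 (exn_obey E' (fun c C => Sub_trans (BK0 c C) KK) T2) HV T3). apply sr_iff in R. tauto.
Qed.
(** If the stem e favors tasks with arbitrarily large n, these form an infinite set at stage [ze],
    and the star property bounds [Zst] for e. If not, N is increased until none is left. *)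
Lemma bdd_later N : N ∊ om -> bdd (Alm i D N).
Proof.
 intros HN. apply suc_common; auto. intros e p G L ST NB.
 destruct (classic (forall m, m ∊ om -> exists n u, n ∊ om /\ u ∊ UU /\ Sub m n /\ fav' (J e) (J (op n u)))) as [I|NI].
 - exfalso. apply NB. refine (bdd_sub _ (@starT (fun v : T => fav' (J e) v) SZ _ I _)).
  + intros y Y [g [Gg HG]]. exists N. split; auto. intros n u N1 U1 LN FV. destruct (FV g Gg) as [t [T1 [T2 T3]]].
   assert (R := HG t (J (op n u)) T1 T2 (proj2 (jj_mem HPz (Rs Zs i) _ _) (proj2 (in_VN N n u) (conj N1 (conj U1 LN)))) T3). apply sr_iff in R. tauto.
  + dfn.
  + intros n u N1 U1 FV. apply (fav_fit N1 U1 FV).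
 - assert (NM' : exists m, m ∊ om /\ forall n u, n ∊ om -> u ∊ UU -> Sub m n -> ~ fav' (J e) (J (op n u))).
  { contra N1. apply NI. intros m M. contra N2. apply N1. exists m; split; auto. intros n u A B C FV. apply N2. exists n, u. auto. }
  destruct NM' as [m [M A]]. destruct (om_max HN M) as [N' [HN' [L1 L2]]]. exists N'. spl. split.
  + intros v V. destruct (VN_J V) as [n [u [-> [N1 [U1 LN]]]]]. apply A; auto. exact (Sub_trans L2 LN).
  + apply favor_later; auto.
Qed.
End Later.

(* The stage [al] itself: here the property of S on finite subfamilies makes large values of f escape. *)
Section Same.
Hypothesis AE : al = ze.
Hypothesis HD : forall DB, lvl ze DB -> ~ bdd (fun y => Ad i DB y) -> forall n, n ∊ om -> exists B0 k0, fin B0 /\ (forall y, y ∊ B0 -> y ∊ o /\ Ad i DB y) /\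
 k0 ∊ om /\ forall k, k ∊ om -> Sub k0 k -> forall w, Sub w (prod n k) -> exists y, y ∊ B0 /\ ~ Ad i DS (op y (op n (op k w))).
Lemma Wit_Fa t n u q p : n ∊ om -> u ∊ UU -> Wit t (op n u) q p -> exists k w, u = op k w /\ k ∊ om /\ Sub w (prod n k) /\ forall i' : GD, gU i' q -> Fa ze i' n k.
Proof.
 intros N U W. assert (A := Wit_abs N U W). destruct (gUd_ex (P_d Xz (le_in1 (proj1 W)))) as [i1 G1].
 destruct (A i1 G1) as [F1 A1]. destruct (F1 n u N U A1) as [k [w [E [F2 W2]]]]. rewrite AE in F2. exists k, w. split; auto. split; [apply (Fa_om F2)|]. split; auto.
 intros i' G'. destruct (A i' G') as [F' A']. destruct (F' n u N U A') as [k' [w' [E' [K' _]]]]. rewrite E in E'. apply op_inj in E'. destruct E'; subst k' w'.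
 rewrite AE in K'. exact K'.
Qed.
(** A condition forcing the task (n,(k,w)) into D forces the Hechler real to take the value k at n.
    Let g be constantly k+1. The stem obtained has the value k at n from e', since a value outside
    e' would exceed k, and since a stem not reaching n could be prolonged by a value above k. *)
Lemma favored_Fa (e' : T) n u : FP e' -> n ∊ om -> u ∊ UU -> fav' e' (J (op n u)) -> exists k w, u = op k w /\ k ∊ om /\ op (J n) (J k) ∊ e' /\ Sub w (prod n k).
Proof.
 intros FE N U FV. destruct (cst_fun (@om_0 T)) as [g0 [Gg0 _]]. destruct (fav_wit FV Gg0) as [t0 [q0 [p0 [_ [W0 _]]]]].
 destruct (Wit_Fa N U W0) as [k [w [E [K [WS _]]]]]. exists k, w. spl.
 destruct (cst_fun (J_om Hz i (om_S K))) as [g [Gg Ag]]. destruct (fav_wit FV Gg) as [t [q [p [OB [W [Gq [Ht _]]]]]]].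
 destruct (Wit_Fa N U W) as [k' [w' [E' [_ [_ HF]]]]]. rewrite E in E'. apply op_inj in E' as [<- _].
 assert (HQ := le_in1 (proj1 W)). assert (GQ : gU (Rs Zs i) (rst q ze)) by (split; auto; apply (P_rst Xz ZX Zs HQ)).
 destruct W as [W1 [W2 [W3 W4]]].
 destruct (stc_val Hz GQ W4) as [q2 [n2 [f2 [Q2 [ST [F2 [V2 KT]]]]]]]. destruct (SQ_J ST) as [Nn2 Ft].
 assert (NJ := J_om Hz i N).
 destruct (classic (n ∊ n2)) as [C|C].
 - assert (A := app_in (proj2 ST) C). destruct (gUd_ex (P_d Xz HQ)) as [i' G']. assert (F1 := Fa_in G' HQ W4 A).
  rewrite (Fa_fun Hz F1 (HF i' G')) in A. apply (jj_mem HPz (Rs Zs i)) in A. rewrite jj_op in A. destruct (proj2 OB _ _ A) as [B|B]; auto.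
  exfalso. rewrite Ag in B by auto. apply (@nin _ (J k)), B, jj_mem, sc_in.
 - exfalso. destruct (mxo_all (J n2) F2 Gg) as [M1 [M2 [M3 M4]]].
  assert (NS : Sub n2 n) by (destruct (Ord_total (om_ord (proj1 ST)) (om_ord N)) as [L|L]; auto; apply (Ord_le (om_ord N) (om_ord (proj1 ST))) in L as [L| ->]; [contradiction|apply Sub_refl]).
  assert (JS : J (sc n) ∊ om) by apply (J_om Hz i (om_S N)).
  destruct (@extend_real ze Hz (Rs Zs i) q q (J (sc n)) (mxo (J n2) f2 g)) as [r [s [m [t1 [A1 [A2 [A3 [A4 [A5 [A6 [A7 [A8 A9]]]]]]]]]]]]; auto.
  + intros q' [Q'|Q']; rewrite (P_fun Xz HQ Q' Q2), V2; apply hle_i; auto; try (intros c Hc; apply M2; auto; apply (om_tr Nn2 Hc));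
    intros c [c' [Hc ->]]%in_jj; apply jj_mem, in_sc; left; apply NS; auto.
  + change (rst (mxo (J n2) f2 g) (J (sc n)) = J t1) in A8. apply jj_inj in A6. subst m. assert (NC : ~ J n ∊ J n2) by (rewrite jj_mem; auto).
   destruct (J_om_inv (Hz := Hz) (app_cod M1 NJ)) as [k2 [K2' E2]]. change (app (mxo (J n2) f2 g) (J n) = J k2) in E2.
   assert (IN : op n k2 ∊ t1).
   { apply (jj_mem HPz (Rs Zs i)). rewrite jj_op. assert (X : op (J n) (J k2) ∊ rst (mxo (J n2) f2 g) (J (sc n))).
    - apply op_rst. rewrite <- E2. split; [apply (app_in M1 NJ)|apply jj_mem, sc_in].
    - rewrite A8 in X. exact X. }
   assert (HR := le_in1 A1). destruct (gUd_ex (P_d Xz HR)) as [i' G'].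
   assert (F1 := Fa_in G' HR (ex_intro _ s (ex_intro _ (sc n) (conj A4 (conj A7 A9)))) IN).
   assert (EK := Fa_fun Hz F1 (HF i' (gU_up HPd G' (le_xd Xz A1)))). subst k2.
   assert (L := M4 (J n) NJ NC). rewrite Ag, E2 in L by auto. apply (@nin _ (J k)), L, jj_mem, sc_in.
Qed.
(** The point (n,k) of a favored task lies in the extension e'. If it comes from e, then w ranges
    over finitely many sets and [fav_lim] disposes of all these tasks. If it is new, then n is below
    m and k is large; the finite set B0 given by [HD] for [Zst e] contains a y unrelated to the
    task, although the witnesses for B0 are all obeyed once k is large. *)
Lemma favor_same N' : N' ∊ om -> forall e : T, FP e -> ~ @bd T (J o) (Zs' N' e) -> (forall v : T, v ∊ J (VN N') -> ~ fav' e v) -> forall m : T, m ∊ om ->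
 exists k, k ∊ om /\ forall e', exn e m k e' -> forall v : T, v ∊ J (VN N') -> ~ fav' e' v.
Proof.
 intros HN e FPe NB NF m M.
 assert (S1 : exists k, k ∊ om /\ forall x : T, x ∊ e -> forall n k' w : T, x = op n k' -> op n (op k' w) ∊ J (VN N') -> Sub w (prod n k') ->
  forall e', exn e m k e' -> ~ fav' e' (op n (op k' w))).
 { apply (@fin_bound T unit _ _ (@IndOk_pure T) (fun _ (x k : T) => forall n k' w : T, x = op n k' -> op n (op k' w) ∊ J (VN N') -> Sub w (prod n k') ->
   forall e', exn e m k e' -> ~ fav' e' (op n (op k' w))) tt e).
  - dfn.
  - intros x k1 k2 H _ _ L n k' w E V W e' E'. apply (H n k' w E V W e'). apply (exn_mono L E').
  - apply FPe.
  - intros x Hx. assert (X := proj1 FPe x Hx). apply in_prod in X as [n [k' [Hn [Hk' ->]]]].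
   destruct (@fin_bound T unit _ _ (@IndOk_pure T) (fun _ (w k : T) => op n (op k' w) ∊ J (VN N') -> forall e', exn e m k e' -> ~ fav' e' (op n (op k' w))) tt (Pw (prod n k'))) as [k [K A]].
   + dfn.
   + intros w k1 k2 H _ _ L V e' E'. apply (H V e'). apply (exn_mono L E').
   + apply fin_Pw, fin_prod; apply fin_nat; auto.
   + intros w _. destruct (classic (op n (op k' w) ∊ J (VN N'))) as [V|V].
    * destruct (fav_lim M (NF _ V)) as [k [K A]]. exists k. split; auto.
    * exists em. split; [apply om_0|]. intros V'; contradiction.
   + exists k; split; auto. intros n0 k0 w E V W. opi. apply A; auto. apply in_Pw; auto. }
 assert (S2 : exists k, k ∊ om /\ forall n : T, n ∊ m -> forall k' w : T, op n (op k' w) ∊ J (VN N') -> Sub w (prod n k') -> Sub k k' ->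
  forall e', exn e m k e' -> ~ fav' e' (op n (op k' w))).
 { destruct (J_om_inv (Hz := Hz) M) as [m' [M' EM]].
  apply (@fin_bound T unit _ _ (@IndOk_pure T) (fun _ n k => forall k' w : T, op n (op k' w) ∊ J (VN N') -> Sub w (prod n k') -> Sub k k' ->
   forall e', exn e m k e' -> ~ fav' e' (op n (op k' w))) tt m).
  - dfn.
  - intros x k1 k2 H _ _ L k' w V W LK e' E'. apply (H k' w V W (Sub_trans L LK) e'). apply (exn_mono L E').
  - apply fin_nat; auto.
  - intros n' Hn'. rewrite EM in Hn'. apply in_jj in Hn' as [n [Hn ->]]. assert (No := om_tr M' Hn).
   destruct (toT o (sep (J o) (Zs' N' e))) as [DB [LB EB]].
   assert (EB' : forall y, y ∊ o -> (Zs' N' e (J y) <-> Ad i DB y)).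
   { intros y Y. rewrite <- (EB y Y), in_sep by dfn. rewrite jj_mem. tauto. }
   destruct (HD LB) with (n := n) as [B0 [k0 [FB [HB [K0 HB2]]]]]; auto.
   { intros B. apply NB, bd_J. refine (bdd_sub _ B). intros y Y Z. apply EB'; auto. }
   destruct (@fin_bound T unit _ _ (@IndOk_pure T) (fun _ (y k : T) => exists g, isfun g om om /\ (forall c, c ∊ m -> Sub (app g c) k) /\
    forall t v : T, tq t -> obey t e g -> v ∊ J (VN N') -> op t v ∊ dec -> op y v ∊ sr) tt (J B0)) as [k1 [K1 A]].
   + dfn.
   + intros y k1 k2 [g [G1 [G2 G3]]] _ _ L. exists g. split; auto. split; auto. intros c C. exact (Sub_trans (G2 c C) L).
   + apply (J_fin Hz i FB).
   + intros y' Y'. apply in_jj in Y' as [y [Y ->]]. destruct (HB y Y) as [Yo AY]. apply EB' in AY; auto. destruct AY as [g [G HG]].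
    destruct (fun_bound G M) as [k [K BK]]. exists k. split; auto. exists g; auto.
   + destruct (om_max K1 (J_om Hz i K0)) as [k [K [L1 L2]]]. exists k; split; auto. intros k' w' V W LK e' E' FV.
    destruct (VN_J V) as [n2 [u2 [E [N2 [U2 LN]]]]]. rewrite jj_op in E. apply op_inj in E as [E1 E2]. apply jj_inj in E1. subst n2.
    apply in_prod in U2 as [kk [w [Hkk [Hw ->]]]]. rewrite jj_op in E2. opi.
    assert (LK0 : Sub k0 kk). { intros c C. apply (jj_mem HPz (Rs Zs i)), LK, L2, jj_mem; auto. }
    assert (LW : Sub w (prod n kk)). { intros c C. apply (jj_mem HPz (Rs Zs i)). rewrite jj_prod. apply W, jj_mem; auto. }
    destruct (HB2 kk Hkk LK0 w LW) as [y [Y NA]]. destruct (A (J y) (proj2 (jj_mem HPz (Rs Zs i) _ _) Y)) as [g [G1 [G2 G3]]].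
    destruct (FV g G1) as [t [T1 [T2 T3]]]. assert (R := G3 t _ T1 (exn_obey E' (fun c C => Sub_trans (G2 c C) L1) T2) V T3).
    change (op (J y) (op (J n) (op (J kk) (J w))) ∊ sr) in R. rewrite <- (jj_op HPz (Rs Zs i) kk w), <- (jj_op HPz (Rs Zs i) n (op kk w)) in R. apply sr_iff in R. tauto. }
 destruct S1 as [k1 [K1 A1]], S2 as [k2 [K2 A2]]. destruct (om_max K1 K2) as [k [K [L1 L2]]]. exists k; split; auto. intros e' E' v V FV.
 destruct (VN_J V) as [n [u [-> [N1 [U1 LN]]]]]. destruct (favored_Fa (proj1 E') N1 U1 FV) as [kk [w [-> [HK [IN W]]]]]. rewrite !jj_op in FV, V.
 assert (LW : Sub (J w) (prod (J n) (J kk))). { rewrite <- jj_prod. intros c [c' [C ->]]%in_jj. apply jj_mem; auto. }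
 destruct (proj2 (proj2 E') _ _ IN) as [B|[B1 B2]].
 - apply (A1 _ B _ _ _ eq_refl V LW e' (exn_mono L1 E') FV).
 - apply (A2 _ B1 _ _ V LW (Sub_trans L2 B2) e' (exn_mono L2 E') FV).
Qed.
(** By [favored_Fa] a stem favors only tasks whose first coordinate is within its length, so it is
    enough to take N' beyond that length. *)
Lemma bdd_same N : N ∊ om -> bdd (Alm i D N).
Proof.
 intros HN. apply suc_common; auto. intros e p G L ST NB. destruct ST as [q [n [_ [SE _]]]].
 destruct (om_max HN (proj1 SE)) as [N' [HN' [L1 L2]]]. exists N'. spl. split; [|apply favor_same; auto].
 intros v V FV. destruct (VN_J V) as [n1 [u [-> [N1 [U1 LN]]]]]. destruct (favored_Fa (FP_tq (J_tq SE)) N1 U1 FV) as [k [w [_ [_ [IN _]]]]].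
 rewrite <- jj_op, jj_mem in IN. apply (@nin _ n1), LN, L2, (fun_dom (proj2 SE) IN).
Qed.
End Same.
End Suc.

Theorem star_all (i : GD) : (forall DB, lvl al DB -> ~ bdd (fun y => Ad i DB y) -> forall n, n ∊ om -> exists B0 k0, fin B0 /\ (forall y, y ∊ B0 -> y ∊ o /\ Ad i DB y) /\
 k0 ∊ om /\ forall k, k ∊ om -> Sub k0 k -> forall w, Sub w (prod n k) -> exists y, y ∊ B0 /\ ~ Ad i DS (op y (op n (op k w)))) ->
 forall x, x ∊ sc d -> al ∊ x -> Star i x.
Proof.
 intros HD. refine (@ord_ind S (fun x => al ∊ x -> Star i x) (sc d) (Ord_sc Od) _ _).
 - apply (@gen_IndOk S (Pz d) (Lz d) HPd (fun i x => al ∊ x -> Star i x)). dfn.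
 - intros x X IH AX. assert (Ox := scd_ord X). destruct (classic (forall z, z ∊ x -> sc z ∊ x)) as [LIM|NL].
  + apply star_lim; auto.
  + assert (SX : exists z, z ∊ x /\ x = sc z).
   { contra N. apply NL. intros z Z. assert (Oz := Ord_in Ox Z). assert (K := proj1 (Ord_sc_le Oz Ox) Z).
    apply (Ord_le (Ord_sc Oz) Ox) in K as [K|K]; auto. destruct N; eauto. }
   destruct SX as [z [Z ->]]. assert (Hz := scd_tr X Z). intros D LD I F. destruct (good_cond X AX LD I F) as [r0 [G0 [R0 H0]]].
   apply (@bdd_ctb_union (fun i m y => Alm i D m y) om i); [dfn|apply ctb_om|]. intros N HN.
   assert (LDec : lvl z (DecD z D r0)) by (eapply lvl_Dec; eauto).
   destruct (@ofD z Hz i (prod SQs VV) _ LDec) as [dec Hdec].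
   destruct (@ofD z Hz i (prod o VV) _ (lvl_S (d_in Hz) AX)) as [sr Hsr].
   assert (AX' := AX). apply in_sc in AX' as [AZ|AZ].
   * apply (@bdd_later z D r0 Hz i AX LD G0 R0 H0 dec sr Hdec Hsr AZ); auto.
   * assert (HD' := HD). rewrite AZ in HD'. apply (@bdd_same z D r0 Hz i AX LD G0 R0 H0 dec sr Hdec Hsr AZ HD'); auto.
Qed.
End Star.

(** * The combinatorial principles in the final extension *)

Section Main.
Variable i : GD.
Notation N := (NM HPd i).
Notation J := (jj HPd i).
Notation w1 := (J o).
(** Injecting omega1 into omega would write it as a countable union of sets with at most one
    element, against [bdd_ctb_union]. *)
Lemma N_isom1 : isom1 w1.
Proof.
 split; [apply jj_Ord, Ho|]. split.
 - intros [f F]. destruct (toG (prod o om) f) as [D [L H]].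
  assert (B : bdd (fun y => exists n, n ∊ om /\ (y ∊ o /\ Ad i D (op y n)))).
  { apply (@bdd_ctb_union (fun i n y => y ∊ o /\ Ad i D (op y n)) om i); [dfn|apply ctb_om|].
   intros n Hn. destruct (classic (exists y, y ∊ o /\ Ad i D (op y n))) as [[y [Y A]]|NE].
   - exists (sc y). split; [apply (om1_S Ho Y)|]. intros y' Y' [_ A']. apply in_sc. right.
    apply H in A; [|apply op_prod; auto]. apply H in A'; [|apply op_prod; auto]. rewrite jj_op in A, A'.
    apply (@jj_inj _ _ _ HPd i), (proj2 F _ _ _ A' A).
   - apply bdd_no. intros y Y A. eauto. }
  destruct B as [g [G K]]. apply (@nin _ g). apply K; auto.
  assert (A := app_in (proj1 F) (proj2 (jj_mem HPd i g o) G)). assert (C := app_cod (proj1 F) (proj2 (jj_mem HPd i g o) G)).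
  apply gJ_om_inv in C as [n [Hn E]]. rewrite E in A. exists n. spl. apply H; [apply op_prod; auto|]. rewrite jj_op. auto.
 - intros b [b' [B ->]]%in_jj. apply jj_ctb, Ho; auto.
Qed.
Lemma in_w1 (y : N) : y ∊ w1 -> exists y', y' ∊ o /\ y = J y'.
Proof. intros Y. apply in_jj in Y. auto. Qed.
Lemma hreal z : z ∊ d -> exists h : N, isfun h om om /\ forall c k, Fa z i c k <-> (c ∊ om /\ k ∊ om /\ app h (J c) = J k).
Proof.
 intros Z. destruct (ofG HPd i (prod om om) (DF z)) as [h Hh]. assert (Hh' : forall c k, op (J c) (J k) ∊ h <-> Fa z i c k).
 { intros c k. rewrite Hh, <- jj_op. split.
  - intros [x [E [_ A]]]. apply jj_inj in E. subst x. exact A.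
  - intros A. exists (op c k). split; auto. split; auto. apply op_prod. apply (Fa_om A). }
 assert (F : isfun h om om).
 { split; [|split].
  - intros u [x [-> [X _]]]%Hh. rewrite <- (jj_om HPd i), <- jj_prod. apply jj_mem; auto.
  - intros c [c' [C ->]]%gJ_om_inv. destruct (Fa_tot Z i C) as [k K]. exists (J k). apply Hh'; auto.
  - intros c k k' K K'. assert (U := proj1 (Hh _) K). assert (U' := proj1 (Hh _) K'). destruct U as [x [E [X A]]], U' as [x' [E' [X' A']]].
   apply in_prod in X, X'. destruct X as [a [b [_ [_ ->]]]], X' as [a' [b' [_ [_ ->]]]]. rewrite jj_op in E, E'. apply op_inj in E, E'. destruct E as [-> ->], E' as [E' ->].
   apply jj_inj in E'. subst a'. f_equal. apply (Fa_fun Z A A'). }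
 exists h. split; auto. intros c k. rewrite <- Hh'. split.
 - intros K. assert (C := proj1 (Hh' c k) K). split; [apply (Fa_om C)|]. split; [apply (Fa_om C)|]. apply (app_eq F K).
 - intros [C [K E]]. rewrite <- E. apply (app_in F), gJ_om; auto.
Qed.
(** The principle behind strong measure zero: one real meets omega1 many relations with infinite
    fibers. *)
Lemma N_C (R : N) : (forall y n m : N, y ∊ w1 -> n ∊ om -> m ∊ om -> exists k, k ∊ om /\ Sub m k /\ op (op y n) k ∊ R) ->
 exists h, isfun h om om /\ forall y : N, y ∊ w1 -> exists n, n ∊ om /\ op (op y n) (app h n) ∊ R.
Proof.
 intros H. destruct (toG (prod (prod o om) om) R) as [D [L HD]].
 assert (HD' : forall y n k, y ∊ o -> n ∊ om -> k ∊ om -> (op (op (J y) (J n)) (J k) ∊ R <-> Ad i D (op (op y n) k))).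
 { intros y n k Y Hn K. rewrite <- !jj_op. apply HD. rewrite !op_prod; auto. }
 destruct (lemC L) as [z [Z HZ]]. destruct (hreal Z) as [h [F Hh]]. exists h. split; auto. intros y [y' [Y ->]]%in_w1.
 destruct (HZ i) with (y := y') as [n [k [A B]]]; auto.
 - clear y' Y. intros y n m Y Hn M. destruct (H (J y) (J n) (J m)) as [k [K1 [K2 K3]]]; [apply jj_mem; auto|apply gJ_om; auto|apply gJ_om; auto|].
  apply gJ_om_inv in K1 as [k' [K1 ->]]. exists k'. split; auto. split; [intros c C; apply (jj_mem HPd i), K2, jj_mem; auto|]. apply HD'; auto.
 - apply Hh in A as [A1 [A2 A3]]. exists (J n). split; [apply gJ_om; auto|]. rewrite A3. apply HD'; auto.
Qed.
Lemma FS_sub n k w : n ∊ om -> k ∊ om -> Sub w (prod n k) -> op k w ∊ UU.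
Proof.
 intros Hn K W. apply op_prod. split; auto. apply in_FS. split.
 - intros u U. apply W, in_prod in U as [a [b [A [B ->]]]]. apply op_prod. split; [apply (om_tr Hn A)|apply (om_tr K B)].
 - apply (fin_sub W), fin_prod; apply fin_nat; auto.
Qed.
(** The principle behind the result on gamma-sets: h is the Hechler real added after Sr has been
    captured, and A is treated by the star property of the last stage. *)
Lemma N_D (Sr : N) : (forall B : N, Sub B w1 -> ~ (exists g, g ∊ w1 /\ forall y : N, y ∊ B -> y ∊ g) -> forall n : N, n ∊ om -> exists B0 k0 : N, fin B0 /\ Sub B0 B /\ k0 ∊ om /\
  forall k : N, k ∊ om -> Sub k0 k -> forall w : N, Sub w (prod n k) -> exists y : N, y ∊ B0 /\ ~ op y (op n (op k w)) ∊ Sr) ->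
 exists h, isfun h om om /\ forall A : N, (forall m : N, m ∊ om -> exists n w : N, n ∊ om /\ Sub m n /\ Sub w (prod n (app h n)) /\ op n (op (app h n) w) ∊ A) ->
  exists g, g ∊ w1 /\ forall y : N, y ∊ w1 -> (exists m : N, m ∊ om /\ forall n w : N, n ∊ om -> Sub m n -> Sub w (prod n (app h n)) -> op n (op (app h n) w) ∊ A ->
   op y (op n (op (app h n) w)) ∊ Sr) -> y ∊ g.
Proof.
 intros H. destruct (toG (prod o VV) Sr) as [DS0 [L0 E0]].
 destruct (@capture DS0 (prod o VV) L0) as [z [DS [Z [LS E1]]]].
 { exact (emb_trans (emb_prod (emb_sub (@Sub_refl _ o)) ctb_VV) (om1_om_emb Ho)). }
 assert (ES : forall y n u, y ∊ o -> n ∊ om -> u ∊ UU -> (op (J y) (J (op n u)) ∊ Sr <-> Ad i DS (op y (op n u)))).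
 { intros y n u Y Hn U. assert (X : op y (op n u) ∊ prod o VV) by (unfold VV; rewrite !op_prod; auto). rewrite <- E1, <- E0, !jj_op by auto. reflexivity. }
 destruct (hreal Z) as [h [F Hh]]. exists h. split; auto. intros A HA.
 defset A1 HA1 (sep A (fun v : N => exists n w : N, n ∊ om /\ Sub w (prod n (app h n)) /\ v = op n (op (app h n) w))).
 destruct (toG VV A1) as [D [LD ED]].
 assert (ED' : forall n u, n ∊ om -> u ∊ UU -> (J (op n u) ∊ A1 <-> Ad i D (op n u))) by (intros; apply ED, op_prod; auto).
 assert (HJ : forall n' w' : N, n' ∊ om -> Sub w' (prod n' (app h n')) -> exists (n k w : S), n' = J n /\ app h n' = J k /\ w' = J w /\ n ∊ om /\ k ∊ om /\ Fa z i n k /\ Sub w (prod n k)).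
 { intros n' w' N' W. assert (K' := app_cod F N'). apply gJ_om_inv in N', K'. destruct N' as [n [Hn ->]], K' as [k [Hk EK]]. rewrite EK in W.
  rewrite <- jj_prod in W. destruct (@gfin_J _ _ HPd i (prod n k) w') as [w [-> Hw]]; auto.
  - apply (fin_sub W), gJ_fin, fin_prod; apply fin_nat; auto.
  - apply in_FS in Hw. exists n, k, w. spl. split; [apply Hh; auto|apply Hw]. }
 assert (ST : Star z DS i d).
 { apply (star_all Z LS); auto; [|apply scd_d]. intros DB LB NB n Hn. destruct (ofG HPd i o DB) as [B HB].
  assert (HB' : forall y, J y ∊ B <-> y ∊ o /\ Ad i DB y).
  { intros y. rewrite HB. split; [intros [x [E X]]; apply jj_inj in E; subst; auto|intros X; exists y; auto]. }
  destruct (H B) with (n := J n) as [B0' [k0' [FB [SB [K0 HK]]]]].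
  - intros y [x [-> [X _]]]%HB. apply jj_mem; auto.
  - intros [g [G K]]. apply NB. apply in_w1 in G as [g' [G ->]]. exists g'. split; auto. intros x X AX. apply (jj_mem HPd i), K, HB'; auto.
  - apply gJ_om; auto.
  - assert (SBo : Sub B0' (J o)) by (intros y Y; apply SB, HB in Y as [x [-> [X _]]]; apply jj_mem; auto).
   destruct (gfin_J FB SBo) as [B0 [-> HB0]]. apply in_FS in HB0. apply gJ_om_inv in K0 as [k0 [K0 ->]].
   exists B0, k0. split; [apply HB0|]. split; [intros y Y; apply HB', SB, jj_mem; auto|]. split; auto. intros k Hk Lk w W.
   destruct (HK (J k)) with (w := J w) as [y' [Y NS]].
   + apply gJ_om; auto.
   + intros c [c' [C ->]]%in_jj. apply jj_mem; auto.
   + intros c [c' [C ->]]%in_jj. rewrite <- jj_prod. apply jj_mem; auto.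
   + apply in_jj in Y as [y [Y ->]]. exists y. split; auto. intros AS. apply NS. rewrite <- !jj_op.
    assert (Yo : y ∊ o) by (apply HB0; auto). rewrite jj_op. apply ES; auto. apply (FS_sub Hn Hk W). }
 destruct (ST D) as [g [G K]]; auto.
 - intros m M. destruct (HA (J m)) as [n' [w' [B1 [B2 [B3 B4]]]]]; [apply gJ_om; auto|]. destruct (HJ n' w' B1 B3) as [n [k [w [-> [E2 [-> [Hn [Hk [FA' W]]]]]]]]].
  exists n, (op k w). assert (U := FS_sub Hn Hk W). spl. split; [intros c C; apply (jj_mem HPd i), B2, jj_mem; auto|].
  apply ED'; auto. rewrite !jj_op, <- E2. apply HA1. split; auto. exists (J n), (J w). auto.
 - intros n u Hn U B. apply ED' in B; auto. apply HA1 in B as [_ [n' [w' [B1 [B2 B3]]]]]. destruct (HJ n' w' B1 B2) as [n0 [k [w [E1' [E2 [-> [_ [Hk [FA' W]]]]]]]]].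
  rewrite E2, E1', <- !jj_op in B3. apply jj_inj in B3. opi. exists k, w. auto.
 - exists (J g). split; [apply jj_mem; auto|]. intros y' Y' [m' [M' HM]]. apply in_w1 in Y' as [y [Y ->]]. apply gJ_om_inv in M' as [m [M ->]].
  apply jj_mem, K; auto. exists m. split; auto. intros n u Hn U L B. apply ED' in B; auto. apply HA1 in B as [B0 [n' [w' [B1 [B2 B3]]]]].
  apply ES; auto. rewrite B3. rewrite B3 in B0. apply HM; auto. destruct (HJ n' w' B1 B2) as [n0 [k [w [E1' [E2 [E3 _]]]]]].
  rewrite E2, E1', E3, <- !jj_op in B3. apply jj_inj in B3. apply op_inj in B3 as [-> _]. rewrite E1'.
  intros c [c' [C ->]]%in_jj. apply jj_mem; auto.
Qed.

(** A ground-model well-order of the names occurring in a name of X enumerates X by an ordinal,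
    perhaps with repetitions. As long as the range so far is countable, the element outside it of
    least index is taken next. *)
Lemma N_AC (X : N) : ~ ctb X -> emb w1 X.
Proof.
 intros NC. destruct (vl_surj X) as [s ->]. set (X := vl HPd i s) in *.
 destruct (well_order (dm s)) as [al [h [Oal [Dh Hh]]]]. destruct (N_enum HPd i al Dh) as [g HG].
 assert (GX : forall x : N, x ∊ X -> exists b : N, b ∊ J al /\ op b x ∊ g).
 { intros x [rho [q [A [_ ->]]]]%vl_iff. destruct (Hh rho) as [z [Z <-]]; [apply in_dm; eauto|].
  exists (J z). split; [apply jj_mem; auto|apply HG; eauto]. }
 set (Q := fun B b x : N => op b x ∊ g /\ x ∊ X /\ ~ x ∊ B).
 destruct (@ord_inj N w1 X (fun B x : N => exists b : N, b ∊ J al /\ Q B b x /\ forall b' : N, b' ∊ b -> ~ exists x' : N, Q B b' x')) as [F [I _]]; [apply N_isom1|dfn| | |exists F; exact I].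
 - intros B x x' [b [Hb [K M]]] [b' [Hb' [K' M']]]. assert (Oj := jj_Ord HPd i Oal).
  destruct (Ord_tri (Ord_in Oj Hb) (Ord_in Oj Hb')) as [T|[T|T]]; [destruct (M' _ T); eauto| |destruct (M _ T); eauto].
  subst b'. destruct K as [K _], K' as [K' _]. apply HG in K as [a [_ E]], K' as [a' [_ E']]. apply op_inj in E as [-> ->], E' as [E ->].
  apply jj_inj in E. congruence.
 - intros a f A Hf. assert (NE : exists x : N, x ∊ X /\ ~ x ∊ ran f).
  { contra NE. apply NC. apply (@ctb_img N a X (fun x : N => app f x)); [dfn|apply N_isom1; auto|].
   intros y Y. assert (R : y ∊ ran f) by (contra R; eauto). apply in_ran in R as [x R]. exists x. split; [apply (fun_dom Hf R)|apply (app_eq Hf R)]. }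
  destruct NE as [x [X1 X2]]. destruct (GX x X1) as [b [Hb K]].
  destruct (@d_least_ord N (fun b : N => exists x : N, Q (ran f) b x) (J al)) as [m [M1 [[y Y] M2]]]; [apply jj_Ord, Oal|dfn|exists b; split; [auto|exists x; split; auto]|].
  exists y. split; [apply Y|]. split; [apply Y|]. eauto.
Qed.

End Main.
End Iter.

(** The least related ordinal is the value, so a relation without common values is enough and no
    function has to be chosen. *)
Lemma emb_rel (S : SetM) (a b : S) (R : S -> S -> Prop) : dfnp (fun _ e => R (e 0) (e 1)) -> Ord b ->
 (forall x, x ∊ a -> exists y, y ∊ b /\ R x y) -> (forall x x' y, x ∊ a -> x' ∊ a -> y ∊ b -> R x y -> R x' y -> x = x') -> emb a b.
Proof.
 intros D O H1 H2.
 assert (D' : forall t u, dftp t -> dftp u ->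
  dfnp (fun i e => R (t i e) (u i e))) by (intros; apply (d_sub2 (P := fun _ u v => R u v) D); auto).
 set (f := sep (prod a b) (fun u => exists x y, u = op x y /\ R x y /\ forall y', y' ∊ y -> ~ R x y')).
 assert (Hf : forall x y, op x y ∊ f <-> (x ∊ a /\ y ∊ b) /\ R x y /\ forall y', y' ∊ y -> ~ R x y').
 { intros x y. unfold f. sepd. rewrite op_prod. split; [intros [K [x' [y' [E L]]]]; opi; auto|intros [K L]; split; auto; eauto 8]. }
 exists f. split; [split; [|split]|].
 - intros u U. unfold f in U. sepd in U. tauto.
 - intros x X. destruct (@d_least_ord S (fun y => R x y) b O) as [y [Y [K L]]]; auto.
  + dfn.
  + exists y. apply Hf. auto.
 - intros x y y' K K'. apply Hf in K, K'. destruct K as [[X Y] [K1 K2]], K' as [[_ Y'] [K1' K2']].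
  destruct (Ord_tri (Ord_in O Y) (Ord_in O Y')) as [Q|[Q|Q]]; auto; exfalso; [apply (K2' y)|apply (K2 y')]; auto.
 - intros x x' y K K'. apply Hf in K, K'. apply (H2 x x' y); tauto.
Qed.
(** * Real lines and metric spaces *)

Section Line.
Variable S : SetM.
Notation T := (truth (@smem S)).
Lemma t_op2 (f a b : S) : T (op2 f a b) -> forall x y, x ∊ a -> y ∊ a -> app f (op x y) ∊ b /\ forall v, op (op x y) v ∊ f <-> v = app f (op x y).
Proof.
 intros H x y X Y. destruct (H x X y Y) as [v [V [H1 H2]]]. apply t_maps2 in H1.
 assert (U : forall v', op (op x y) v' ∊ f -> v' = v) by (intros v' K; apply t_eqv, H2, t_maps2, K).
 assert (E : app f (op x y) = v).
 { apply sext. intros t. rewrite in_app. split; [intros [v' [K L]]; apply U in K; subst; auto|intros; eauto 8]. }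
 rewrite E. split; auto. intros v'. split; [apply U|intros ->; auto].
Qed.
Variables c a m z l : S.
Notation R := (Line c a m z l).
Hypothesis HR : T (real_line R).
Notation "x ⊕ y" := (app a (op x y)) (at level 50, left associativity).
Notation "x ⊗ y" := (app m (op x y)) (at level 40, left associativity).
Notation "x ≺ y" := (op x y ∊ l) (at level 70).
Lemma l_pl x y : x ∊ c -> y ∊ c -> x ⊕ y ∊ c.
Proof. intros X Y. destruct HR as [[[H _] _] _]. exact (proj1 (t_op2 H X Y)). Qed.
Lemma pl_iff x y v : x ∊ c -> y ∊ c -> (op (op x y) v ∊ a <-> v = x ⊕ y).
Proof. intros X Y. destruct HR as [[[H _] _] _]. exact (proj2 (t_op2 H X Y) v). Qed.
Lemma l_ml x y : x ∊ c -> y ∊ c -> x ⊗ y ∊ c.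
Proof. intros X Y. destruct HR as [[_ [_ [_ [_ [[H _] _]]]]] _]. exact (proj1 (t_op2 H X Y)). Qed.
Lemma ml_iff x y v : x ∊ c -> y ∊ c -> (op (op x y) v ∊ m <-> v = x ⊗ y).
Proof. intros X Y. destruct HR as [[_ [_ [_ [_ [[H _] _]]]]] _]. exact (proj2 (t_op2 H X Y) v). Qed.
Lemma pl_C x y : x ∊ c -> y ∊ c -> x ⊕ y = y ⊕ x.
Proof. intros X Y. destruct HR as [[[_ [H _]] _] _]. apply pl_iff; auto. apply t_maps2, H; auto. apply t_maps2, pl_iff; auto. Qed.
Lemma pl_A x y w : x ∊ c -> y ∊ c -> w ∊ c -> x ⊕ (y ⊕ w) = x ⊕ y ⊕ w.
Proof.
 intros X Y W. destruct HR as [[[_ [_ H]] _] _]. symmetry. apply pl_iff; auto; [apply l_pl; auto|]. apply t_maps2. refine (H x X y Y w W (x ⊕ y) (y ⊕ w) _ _).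
 repeat split; apply t_maps2, pl_iff; auto; apply l_pl; auto.
Qed.
Lemma z_in : z ∊ c.
Proof. destruct HR as [[_ [H _]] _]. exact H. Qed.
Hint Resolve l_pl l_ml z_in : core.
Lemma pl_z x : x ∊ c -> x ⊕ z = x.
Proof. intros X. destruct HR as [[_ [_ [H _]]] _]. symmetry. apply pl_iff; auto. apply t_maps2, H, X. Qed.
Lemma pl_inv x : x ∊ c -> exists y, y ∊ c /\ x ⊕ y = z.
Proof. intros X. destruct HR as [[_ [_ [_ [H _]]]] _]. destruct (H x X) as [y [Y K]]. exists y. split; auto. symmetry. apply pl_iff; auto. apply t_maps2, K. Qed.
Lemma one_ex : exists e, e ∊ c /\ e <> z /\ (forall x, x ∊ c -> x ⊗ e = x) /\ forall x, x ∊ c -> x <> z -> exists y, y ∊ c /\ x ⊗ y = e.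
Proof.
 destruct HR as [[_ [_ [_ [_ [_ [H _]]]]]] _]. destruct H as [e [E [N [H1 H2]]]]. exists e. split; auto.
 split; [intros K; apply N, t_eqv, K|]. split.
 - intros x X. symmetry. apply ml_iff; auto. apply t_maps2, H1, X.
 - intros x X NX. destruct (H2 x X) as [y [Y K]]; [intros Q; apply NX, t_eqv, Q|]. exists y. split; auto. symmetry. apply ml_iff; auto. apply t_maps2, K.
Qed.
Lemma ml_D x y w : x ∊ c -> y ∊ c -> w ∊ c -> x ⊗ y ⊕ x ⊗ w = x ⊗ (y ⊕ w).
Proof.
 intros X Y W. destruct HR as [[_ [_ [_ [_ [_ [_ [H _]]]]]]] _]. symmetry. apply pl_iff; auto. apply t_maps2.
 refine (H x X y Y w W (y ⊕ w) _ _ _ _). repeat split; apply t_maps2; [apply pl_iff|apply ml_iff|apply ml_iff|apply ml_iff]; auto.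
Qed.
Lemma lt_irr x : x ∊ c -> ~ x ≺ x.
Proof. intros X K. destruct HR as [[_ [_ [_ [_ [_ [_ [_ [H _]]]]]]]] _]. apply (H x X), t_maps, K. Qed.
Lemma lt_tr x y w : x ∊ c -> y ∊ c -> w ∊ c -> x ≺ y -> y ≺ w -> x ≺ w.
Proof. intros X Y W K L. destruct HR as [[_ [_ [_ [_ [_ [_ [_ [_ [H _]]]]]]]]] _]. apply t_maps, (H x X y Y w W). split; apply t_maps; auto. Qed.
Lemma lt_tot x y : x ∊ c -> y ∊ c -> x ≺ y \/ x = y \/ y ≺ x.
Proof.
 intros X Y. destruct HR as [[_ [_ [_ [_ [_ [_ [_ [_ [_ [H _]]]]]]]]]] _]. destruct (H x X y Y) as [K|[K|K]]; [left; apply t_maps, K|right; left; apply t_eqv, K|right; right; apply t_maps, K].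
Qed.
Lemma lt_pl x y w : x ∊ c -> y ∊ c -> w ∊ c -> x ≺ y -> x ⊕ w ≺ y ⊕ w.
Proof.
 intros X Y W K. destruct HR as [[_ [_ [_ [_ [_ [_ [_ [_ [_ [_ [H _]]]]]]]]]]] _]. apply t_maps, (H x X y Y w W). repeat split; [apply t_maps, K|apply t_maps2, pl_iff; auto|apply t_maps2, pl_iff; auto].
Qed.
Lemma sup_ex (A : S) : Sub A c -> A <> em -> (exists b, b ∊ c /\ forall x, x ∊ A -> ~ b ≺ x) ->
 exists b, b ∊ c /\ (forall x, x ∊ A -> ~ b ≺ x) /\ forall b', b' ∊ c -> (forall x, x ∊ A -> ~ b' ≺ x) -> ~ b' ≺ b.
Proof.
 intros HA NE [b [B1 B2]]. destruct HR as [_ H]. destruct (H A) as [s [[S1' S2'] S3']].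
 - split; [apply t_sub, HA|]. split; [intros K; apply t_empty in K; auto|]. exists b. split; auto. intros x X K. apply t_maps in K. apply (B2 x); auto.
 - exists s. split; auto. split.
  + intros x X K. apply (S2' x X), t_maps, K.
  + intros b' Q1 Q2 K. apply (S3' b'); [|apply t_maps, K]. split; auto. intros x X L. apply t_maps in L. apply (Q2 x); auto.
Qed.
Lemma lt_pl' x y w : x ∊ c -> y ∊ c -> w ∊ c -> x ≺ y -> w ⊕ x ≺ w ⊕ y.
Proof. intros X Y W K. rewrite (pl_C W X), (pl_C W Y). apply lt_pl; auto. Qed.
Lemma lt_can x y w : x ∊ c -> y ∊ c -> w ∊ c -> x ⊕ w ≺ y ⊕ w -> x ≺ y.
Proof.
 intros X Y W K. destruct (lt_tot X Y) as [L|[->|L]]; auto; exfalso; [eapply lt_irr, K; auto|]. apply (lt_irr (l_pl X W)).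
 apply (@lt_tr _ (y ⊕ w)); auto. apply lt_pl; auto.
Qed.
Lemma lt_can' x y w : x ∊ c -> y ∊ c -> w ∊ c -> w ⊕ x ≺ w ⊕ y -> x ≺ y.
Proof. intros X Y W. rewrite (pl_C W X), (pl_C W Y). apply lt_can; auto. Qed.
Lemma lt_pl2 x y u v : x ∊ c -> y ∊ c -> u ∊ c -> v ∊ c -> x ≺ y -> u ≺ v -> x ⊕ u ≺ y ⊕ v.
Proof. intros X Y U V K L. apply (@lt_tr _ (y ⊕ u)); auto; [apply lt_pl|apply lt_pl']; auto. Qed.
Lemma lt_nlt x y : x ∊ c -> y ∊ c -> x ≺ y -> ~ y ≺ x.
Proof. intros X Y K L. apply (lt_irr X). apply (@lt_tr _ y); auto. Qed.
Lemma le_lt x y w : x ∊ c -> y ∊ c -> w ∊ c -> ~ y ≺ x -> y ≺ w -> x ≺ w.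
Proof. intros X Y W K L. destruct (lt_tot X Y) as [Q|[->|Q]]; auto; [apply (@lt_tr _ y); auto|tauto]. Qed.
Lemma lt_le x y w : x ∊ c -> y ∊ c -> w ∊ c -> x ≺ y -> ~ w ≺ y -> x ≺ w.
Proof. intros X Y W K L. destruct (lt_tot Y W) as [Q|[<-|Q]]; auto; [apply (@lt_tr _ y); auto|tauto]. Qed.
Lemma sub_ex x y : x ∊ c -> y ∊ c -> exists e, e ∊ c /\ x ⊕ e = y.
Proof.
 intros X Y. destruct (pl_inv X) as [x' [X' E]]. exists (x' ⊕ y). split; auto. rewrite pl_A, E, pl_C, pl_z by auto. auto.
Qed.
Lemma sub_lt x y : x ∊ c -> y ∊ c -> x ≺ y -> exists e, e ∊ c /\ x ⊕ e = y /\ z ≺ e.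
Proof.
 intros X Y K. destruct (sub_ex X Y) as [e [E1 E2]]. exists e. spl. apply (@lt_can' _ _ x); auto. rewrite E2, pl_z; auto.
Qed.
Lemma lt_plus x e : x ∊ c -> e ∊ c -> z ≺ e -> x ≺ x ⊕ e.
Proof. intros X E K. rewrite <- (pl_z X) at 1. apply lt_pl'; auto. Qed.
Lemma half_ex : exists h, h ∊ c /\ (forall x, x ∊ c -> x ⊗ h ⊕ x ⊗ h = x) /\ forall x, x ∊ c -> z ≺ x -> z ≺ x ⊗ h.
Proof.
 destruct one_ex as [e [E [NE [H1 H2]]]]. destruct (H2 (e ⊕ e)) as [h [Hh K]]; auto.
 (* Here 1 + 1 is nonzero because it has the same sign as 1. *)
 - intros Q. destruct (lt_tot E z_in) as [L|[L|L]]; auto; apply (lt_irr z_in).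
  + assert (K := lt_pl2 E z_in E z_in L L). rewrite Q, pl_z in K; auto.
  + assert (K := lt_pl2 z_in E z_in E L L). rewrite Q, pl_z in K; auto.
 - assert (HH : h ⊕ h = h ⊗ (e ⊕ e)) by (rewrite <- ml_D, H1; auto).
  exists h. split; auto. assert (Q : forall x, x ∊ c -> x ⊗ h ⊕ x ⊗ h = x).
  { intros x X. rewrite ml_D by auto. replace (h ⊕ h) with e; auto. rewrite HH. destruct HR as [[_ [_ [_ [_ [[_ [H _]] _]]]]] _].
   apply ml_iff; auto. apply t_maps2, (H (e ⊕ e)); auto. apply t_maps2, ml_iff; auto. }
  split; auto. intros x X L. destruct (lt_tot z_in (l_ml X Hh)) as [P|[P|P]]; auto; exfalso; apply (lt_irr z_in).
  + assert (K1 := Q x X). rewrite <- P, pl_z in K1 by auto. subst x. auto.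
  + assert (K1 := lt_pl2 (l_ml X Hh) z_in (l_ml X Hh) z_in P P). rewrite Q, pl_z in K1 by auto. apply (@lt_tr _ x); auto.
Qed.
Lemma r_ex : exists r, isfun r om c /\ (forall n, n ∊ om -> z ≺ app r n) /\ forall n, n ∊ om -> app r (sc n) ⊕ app r (sc n) = app r n.
Proof.
 destruct half_ex as [h [Hh [H1 H2]]]. destruct one_ex as [e [E [NE _]]].
 assert (P : exists r0, r0 ∊ c /\ z ≺ r0).
 { destruct (lt_tot E z_in) as [L|[L|L]]; [|tauto|eauto]. destruct (sub_lt E z_in L) as [r0 [Q1 [_ Q2]]]. eauto. }
 destruct P as [r0 [R0 P0]]. set (Y := sep c (fun x => z ≺ x)). assert (HY : forall x, x ∊ Y <-> x ∊ c /\ z ≺ x) by (intros; unfold Y; sepd; tauto).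
 destruct (@om_rec S (fun x => x ⊗ h) Y r0) as [r [F [Z0 Z1]]].
 - dfn.
 - intros y K. apply HY in K. apply HY. destruct K. auto.
 - apply HY; auto.
 - assert (K : forall n, n ∊ om -> app r n ∊ Y) by (intros n N; apply (app_cod F N)).
  exists r. split; [|split].
  + apply fon_isfun in F. apply fon_isfun. split; [apply F|]. intros x y K'. apply F in K'. apply HY in K'. tauto.
  + intros n N. apply K, HY in N. tauto.
  + intros n N. rewrite Z1 by auto. apply H1. apply K, HY in N. tauto.
Qed.
Variable r : S.
Hypothesis Hr : isfun r om c /\ (forall n, n ∊ om -> z ≺ app r n) /\ forall n, n ∊ om -> app r (sc n) ⊕ app r (sc n) = app r n.
Notation rr := (app r).
Lemma r_in n : n ∊ om -> rr n ∊ c.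
Proof. intros N. apply (app_cod (proj1 Hr) N). Qed.
Lemma r_pos n : n ∊ om -> z ≺ rr n.
Proof. apply Hr. Qed.
Lemma r_S n : n ∊ om -> rr (sc n) ⊕ rr (sc n) = rr n.
Proof. apply Hr. Qed.
Hint Resolve r_in r_pos om_S om_0 : core.
Lemma r_lt n : n ∊ om -> rr (sc n) ≺ rr n.
Proof. intros N. rewrite <- (r_S N). apply lt_plus; auto. Qed.
Lemma r_dec n k : n ∊ om -> k ∊ om -> Sub n k -> ~ rr n ≺ rr k.
Proof.
 intros N K. revert k K. refine (@om_ind S (fun k => Sub n k -> ~ rr n ≺ rr k) _ _ _).
 - apply Min_d. dfn.
 - intros L. assert (n = em) as -> by (apply Sub_antisym; auto; apply om_0_le). apply lt_irr; auto.
 - intros k K IH L. destruct (classic (n = sc k)) as [->|NE]; [apply lt_irr; auto|].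
  assert (L' : Sub n k).
  { apply om_lt_S; auto. destruct (proj1 (Ord_le (om_ord N) (om_ord (om_S K))) L); auto. tauto. }
  intros Q. apply (IH L'). apply (@lt_tr _ (rr (sc k))); auto. apply r_lt; auto.
Qed.
(** The Archimedean property: the elements below all r n would have a supremum s, and s + s would
    again be one of them. *)
Lemma r_small e : e ∊ c -> z ≺ e -> exists n, n ∊ om /\ rr n ≺ e.
Proof.
 intros E P. apply NNPP. intros NE.
 defset A HA (sep c (fun x => forall n, n ∊ om -> ~ rr n ≺ x)).
 assert (EA : e ∊ A) by (apply HA; split; auto; intros n N K; apply NE; eauto).
 destruct (@sup_ex A) as [s [B1 [B2 B3]]].
 - intros x X. apply HA in X. tauto.
 - intros K. rewrite K in EA. destruct (in_em EA).
 - exists (rr em). split; auto. intros x X. apply HA in X. apply X; auto.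
 - assert (SA : forall n, n ∊ om -> ~ rr n ≺ s).
  { intros n N. apply B3; auto. intros x X. apply HA in X. apply X; auto. }
  assert (PS : z ≺ s) by (apply (@lt_le _ e); auto).
  apply (B2 (s ⊕ s)); [|apply lt_plus; auto]. apply HA. split; auto. intros n N K. rewrite <- (r_S N) in K.
  destruct (lt_tot B1 (r_in (om_S N))) as [L|[L|L]].
  + assert (Q := lt_pl2 B1 (r_in (om_S N)) B1 (r_in (om_S N)) L L). apply (lt_irr (l_pl B1 B1)). apply (@lt_tr _ (rr (sc n) ⊕ rr (sc n))); auto.
  + rewrite <- L in K. apply (lt_irr (l_pl B1 B1)); auto.
  + apply (SA (sc n)); auto.
Qed.
(** Here g n k is k times r n. The recursion on k produces functions of n, and definability in both
    arguments is recorded because g enters later separations. *)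
Lemma mul_ex : exists g : S -> S -> S, (forall n, n ∊ om -> g n em = z) /\ (forall n k, n ∊ om -> k ∊ om -> g n k ∊ c /\ g n (sc k) = g n k ⊕ rr n) /\
 forall I U E t (u : I -> (nat -> S) -> S), dfts U E t -> dfts U E u -> dfts U E (fun i e => g (t i e) (u i e)).
Proof.
 set (Y := sep (Pw (prod om c)) (fun f => isfun f om c)). assert (HY : forall f, f ∊ Y <-> isfun f om c).
 { intros f. unfold Y. sepd. rewrite in_Pw. split; [tauto|]. intros F. split; auto. apply F. }
 assert (DL : forall f, d0 (fun n => app f n ⊕ app r n)) by (intros; dfn).
 destruct (@om_rec S (fun f => lam om c (fun n => app f n ⊕ app r n)) Y (lam om c (fun _ => z))) as [G [F [Z0 Z1]]].
 - assert (HL : forall f u, u ∊ lam om c (fun n => app f n ⊕ app r n) <-> u ∊ prod om c /\ exists n, u = op n (app f n ⊕ app r n)) by (intros; unfold lam; sepd; tauto).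
  apply ft_spec with (Q := fun _ (e : nat -> S) (y : S) => forall u : S, u ∊ y <-> u ∊ prod om c /\ exists n : S, u = op n (app (e 0) n ⊕ app r n)); [|dfn].
  intros ? e y. split; [intros <-; apply HL|intros K; apply sext; intros; rewrite HL, K; tauto].
 - intros f K. apply HY in K. apply HY. apply lam_fun; auto. intros n N. apply l_pl; auto. apply (app_cod K N).
 - apply HY. apply lam_fun; auto. dfn.
 - assert (K : forall k, k ∊ om -> isfun (app G k) om c) by (intros k N; apply HY, (app_cod F N)).
  exists (fun n k => app (app G k) n). split; [|split].
  + intros n N. rewrite Z0. apply app_lam; auto. dfn.
  + intros n k N N'. split; [apply (app_cod (K k N') N)|]. rewrite Z1 by auto. refine (@app_lam S om c (fun n0 => app (app G k) n0 ⊕ rr n0) n _ _ N); auto. intros n' M. apply l_pl; auto. apply (app_cod (K k N') M).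
  + intros; dfn.
Qed.
(** The elements k r(n) - j r(n) are used, with subtraction written as an equation. Given x < y,
    choose n with r(n) below y - x and j with x + j r(n) positive, then the least k with k r(n)
    above x + j r(n). *)
Lemma dense_ex : exists Q : S, Sub Q c /\ ctb Q /\ forall x y, x ∊ c -> y ∊ c -> x ≺ y -> exists q, q ∊ Q /\ x ≺ q /\ q ≺ y.
Proof.
 destruct mul_ex as [g [G0 [GS GD]]].
 assert (Gc : forall n k, n ∊ om -> k ∊ om -> g n k ∊ c) by (intros; apply GS; auto).
 assert (AR : forall n x, n ∊ om -> x ∊ c -> exists k, k ∊ om /\ x ≺ g n k).
 { intros n x N X. apply NNPP. intros NE. set (A := sep c (fun v => exists k, k ∊ om /\ v = g n k)).
  assert (HA : forall v, v ∊ A <-> exists k, k ∊ om /\ v = g n k).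
  { intros v. unfold A. rewrite in_sep by dfn. split; [tauto|]. intros [k [K ->]]. split; eauto. }
  destruct (@sup_ex A) as [s [B1 [B2 B3]]].
  - intros v [k [K ->]]%HA. auto.
  - intros K. assert (Z : z ∊ A) by (apply HA; exists em; rewrite G0; auto). rewrite K in Z. destruct (in_em Z).
  - exists x. split; auto. intros v V K. apply HA in V as [k [K' ->]]. eauto.
  - destruct (sub_ex (r_in N) B1) as [t [T1 T2]]. rewrite pl_C in T2 by auto. apply (B3 t); auto; [|rewrite <- T2; apply lt_plus; auto].
   intros v V K. apply HA in V as [k [K' ->]]. apply (B2 (g n (sc k))); [apply HA; exists (sc k); auto|].
   destruct (GS n k N K') as [_ ->]. rewrite <- T2. apply lt_pl; auto. }
 defset Q HQ (sep c (fun v => exists n k j, n ∊ om /\ k ∊ om /\ j ∊ om /\ v ⊕ g n j = g n k)).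
 exists Q. split; [intros v V; apply HQ in V; tauto|]. split.
 - destruct (emb_trans (emb_prod (@ctb_prod S) (emb_sub (@Sub_refl S om))) (@ctb_prod S)) as [f F].
  apply (@emb_rel S Q om (fun v i => exists n k j, (n ∊ om /\ k ∊ om /\ j ∊ om /\ v ⊕ g n j = g n k) /\ op (op (op n k) j) i ∊ f)).
  + dfn.
  + apply Ord_om.
  + intros v [V [n [k [j [N [K [J E]]]]]]]%HQ. exists (app f (op (op n k) j)).
   assert (W : op (op n k) j ∊ prod (prod om om) om) by (rewrite !op_prod; auto).
   split; [apply (app_cod (proj1 F) W)|]. exists n, k, j. split; auto. apply (app_in (proj1 F) W).
  + intros v v' i V V' I [n [k [j [[N [K [J E]]] H1]]]] [n' [k' [j' [[N' [K' [J' E']]] H1']]]].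
   assert (W := proj2 F _ _ _ H1 H1'). apply op_inj in W as [W <-]. apply op_inj in W as [<- <-].
   apply HQ in V, V'. destruct V as [V _], V' as [V' _]. rewrite <- E in E'. assert (Gn := Gc n j N J).
   destruct (lt_tot V V') as [L|[L|L]]; auto; exfalso; apply (lt_pl (w := g n j)) in L; auto; rewrite E' in L; apply lt_irr in L; auto.
 - intros x y X Y L. destruct (sub_lt X Y L) as [e [E1 [E2 E3]]]. destruct (r_small E1 E3) as [n [N Rn]].
  destruct (pl_inv X) as [x' [X' EX]]. destruct (AR n x' N X') as [j [J HJ]].
  assert (P : z ≺ x ⊕ g n j) by (rewrite <- EX; apply lt_pl'; auto).
  destruct (@d_least S (fun k => x ⊕ g n j ≺ g n k)) as [k [K [K1 K2]]].
  + dfn.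
  + apply AR; auto.
  + destruct (om_case K) as [->|[k' [K' ->]]].
   * exfalso. rewrite G0 in K1 by auto. apply (lt_irr z_in). apply (@lt_tr _ (x ⊕ g n j)); auto.
   * destruct (GS n k' N K') as [_ ES]. assert (GK := Gc n k' N K'). assert (GJ := Gc n j N J). assert (NK := K2 k' (sc_in k')).
    destruct (sub_ex GJ (Gc n (sc k') N K)) as [q [Q1 Q2]]. rewrite pl_C in Q2 by auto. exists q. split; [apply HQ; split; eauto 10|]. split.
    -- apply (@lt_can x q (g n j)); auto. rewrite Q2; auto.
    -- apply (@lt_can q y (g n j)); auto. rewrite Q2, ES.
      apply (@le_lt _ (x ⊕ g n j ⊕ rr n)); auto.
      ++ intros C. apply NK, (@lt_can _ _ (rr n)); auto.
      ++ rewrite <- E2. rewrite <- !pl_A by auto. apply lt_pl'; auto. rewrite (pl_C E1) by auto. apply lt_pl'; auto.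
Qed.
End Line.

Lemma isom1_unique (S : SetM) (k o : S) : isom1 k -> isom1 o -> k = o.
Proof.
 intros [K1 [K2 K3]] [O1 [O2 O3]]. destruct (Ord_tri K1 O1) as [Q|[Q|Q]]; auto; exfalso; [apply K2, O3|apply O2, K3]; auto.
Qed.

(** * Strong measure zero *)

Section Smz.
Variable S : SetM.
Notation T := (truth (@smem S)).
Variable o : S.
Hypothesis Ho : isom1 o.
Hypothesis HC : forall R : S, (forall y n m : S, y ∊ o -> n ∊ om -> m ∊ om -> exists k, k ∊ om /\ Sub m k /\ op (op y n) k ∊ R) ->
 exists h, isfun h om om /\ forall y : S, y ∊ o -> exists n, n ∊ om /\ op (op y n) (app h n) ∊ R.
Lemma N_smz : T omega1_sets_smz.
Proof.
 change (forall c a m z l : S, T (real_line (Line c a m z l)) -> forall X : S, (T (sub X c) /\ exists k, T (omega1 k) /\ T (equipotent X k)) -> T (strong_measure_zero (Line c a m z l) X)).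
 intros c a m z l HR X [SX [k [K [f [Hf SU]]]]]. apply t_omega1 in K. assert (k = o) as -> by (apply isom1_unique; auto). clear K.
 apply t_sub in SX. apply t_inj in Hf. split; [apply t_sub, SX|]. intros w eps [W [EP PO]]. apply t_omega in W. subst w. apply t_func in EP.
 assert (EPc : forall n, n ∊ om -> app eps n ∊ c) by (intros n N; apply (app_cod EP N)).
 assert (EP0 : forall n, n ∊ om -> op z (app eps n) ∊ l).
 { intros n N. destruct (PO n (app eps n)) as [_ P]; [apply t_maps, (app_in EP N)|]. apply t_maps in P. exact P. }
 destruct (r_ex HR) as [r Hr]. destruct (dense_ex HR Hr) as [Q [Qc [CQ DQ]]].
 (* A code also carries a natural number j, so each interval with endpoints in Q has infinitely many
    codes. *)
 destruct (emb_trans (emb_prod (emb_trans (emb_prod CQ CQ) (@ctb_prod S)) (emb_sub (@Sub_refl S om))) (@ctb_prod S)) as [g G].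
 set (V := fun n q q' : S => q ∊ Q /\ q' ∊ Q /\ op q q' ∊ l /\ op q' (app a (op q (app eps n))) ∊ l).
 set (CD := fun q q' k : S => exists j, j ∊ om /\ op (op (op q q') j) k ∊ g).
 assert (CU : forall q q' p p' k, CD q q' k -> CD p p' k -> q = p /\ q' = p').
 { intros q q' p p' k [j [_ A]] [j' [_ B]]. assert (E := proj2 G _ _ _ A B). opi. auto. }
 set (RR := sep (prod (prod o om) om) (fun u => exists t y n k q q', u = op (op y n) k /\ t ∊ X /\ op t y ∊ f /\ V n q q' /\ CD q q' k /\ op q t ∊ l /\ op t q' ∊ l)).
 assert (HRR : forall y n k, op (op y n) k ∊ RR <-> (y ∊ o /\ n ∊ om) /\ k ∊ om /\ exists t q q', t ∊ X /\ op t y ∊ f /\ V n q q' /\ CD q q' k /\ op q t ∊ l /\ op t q' ∊ l).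
 { intros y n k. unfold RR. rewrite in_sep by dfn. rewrite !op_prod. split.
  - intros [[A B] [t [y' [n' [k' [q [q' [E H]]]]]]]]. opi. eauto 10.
  - intros [A [B [t [q [q' H]]]]]. split; auto. exists t, y, n, k, q, q'. auto. }
 destruct (HC (R := RR)) as [h [Fh Hh]].
 { intros y n p Y N P. destruct (SU y Y) as [t [TX TY]]. apply t_maps in TY. assert (Tc := SX t TX).
  (* Take u to be t minus half of eps(n); then endpoints in Q can be found around t at distance less
     than eps(n). *)
  assert (E1 : exists u, u ∊ c /\ op u t ∊ l /\ op t (app a (op u (app eps n))) ∊ l).
  { destruct (half_ex HR) as [h [Hc [H1 H2]]]. set (e := app m (op (app eps n) h)).
   assert (Ec : e ∊ c) by (apply (l_ml HR); auto). assert (Ep : op z e ∊ l) by (apply H2; auto).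
   destruct (sub_ex HR Ec Tc) as [u [U1 U2]]. rewrite (pl_C HR) in U2 by auto. exists u. split; auto. split; [rewrite <- U2; apply (lt_plus HR); auto|].
   rewrite <- (H1 (app eps n)) by auto. fold e. rewrite (pl_A HR) by auto. rewrite U2. apply (lt_plus HR); auto. }
  destruct E1 as [u [U1 [U2 U3]]]. destruct (DQ u t) as [q [Q1 [Q2 Q3]]]; auto. assert (Qc' := Qc q Q1).
  assert (Sc : app a (op q (app eps n)) ∊ c) by (apply (l_pl HR); auto).
  assert (L : op t (app a (op q (app eps n))) ∊ l).
  { apply (lt_tr HR (y := app a (op u (app eps n)))); auto; [apply (l_pl HR); auto|]. apply (lt_pl HR); auto. }
  destruct (DQ t _ Tc Sc L) as [q' [Q1' [Q2' Q3']]]. assert (Qc'' := Qc q' Q1').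
  (* If no code of this interval were at least p, then mapping j to the code would embed omega into
     p. *)
  apply NNPP. intros NE. apply (@om_nfin S). exists p. split; auto.
  apply (@emb_rel S om p (fun j k => op (op (op q q') j) k ∊ g)); [dfn|apply om_ord; auto| |].
  - intros j J. assert (WJ : op (op q q') j ∊ prod (prod Q Q) om) by (rewrite !op_prod; auto).
   exists (app g (op (op q q') j)). split; [|apply (app_in (proj1 G) WJ)]. apply NNPP. intros NP. apply NE. assert (KO := app_cod (proj1 G) WJ).
   exists (app g (op (op q q') j)). split; auto. split.
   + destruct (Ord_total (om_ord P) (om_ord KO)) as [B|B]; auto. apply Ord_le in B; [|apply om_ord; auto|apply om_ord; auto]. destruct B as [B| ->]; [tauto|apply Sub_refl].
   + apply HRR. spl. exists t, q, q'. spl. split; [|split; [exists j; split; auto; apply (app_in (proj1 G) WJ)|auto]].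
    split; auto. split; auto. split; auto. apply (lt_tr HR (y := t)); auto.
  - intros j j' k' _ _ _ A B. assert (E := proj2 G _ _ _ A B). apply op_inj in E. apply E. }
 destruct (half_ex HR) as [hh [Hc [H1 H2]]].
 assert (hc : forall n, n ∊ om -> app m (op (app eps n) hh) ∊ c) by (intros; apply (l_ml HR); auto).
 assert (Zc := z_in HR).
 (* When h(n) is not the code of an admissible interval, the interval from 0 to half of eps(n) is
    used as a default. *)
 set (W1 := fun n x y => (exists q q', V n q q' /\ CD q q' (app h n) /\ x = q /\ y = q') \/ (~ (exists q q', V n q q' /\ CD q q' (app h n)) /\ x = z /\ y = app m (op (app eps n) hh))).
 set (A := sep (prod om c) (fun u => exists n x y, u = op n x /\ W1 n x y)).
 set (B := sep (prod om c) (fun u => exists n x y, u = op n y /\ W1 n x y)).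
 assert (HA : forall n x, op n x ∊ A <-> (n ∊ om /\ x ∊ c) /\ exists y, W1 n x y).
 { intros n x. unfold A. rewrite in_sep by dfn. rewrite op_prod. split; [intros [Q1 [n' [x' [y [E H]]]]]; opi; eauto|].
  intros [Q1 [y H]]. split; auto. exists n, x, y. auto. }
 assert (HB : forall n y, op n y ∊ B <-> (n ∊ om /\ y ∊ c) /\ exists x, W1 n x y).
 { intros n y. unfold B. rewrite in_sep by dfn. rewrite op_prod. split; [intros [Q1 [n' [x [y' [E H]]]]]; opi; eauto|].
  intros [Q1 [x H]]. split; auto. exists n, x, y. auto. }
 assert (WU : forall n x y x' y', W1 n x y -> W1 n x' y' -> x = x' /\ y = y').
 { intros n x y x' y' [[q [q' [V1 [C1 [-> ->]]]]]|[N1 [-> ->]]] [[p [p' [V2 [C2 [-> ->]]]]]|[N2 [-> ->]]]; auto; [apply (CU _ _ _ _ _ C1 C2)|destruct N2; eauto|destruct N1; eauto]. }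
 assert (WE : forall n, n ∊ om -> exists x y, W1 n x y /\ x ∊ c /\ y ∊ c).
 { intros n N. destruct (classic (exists q q', V n q q' /\ CD q q' (app h n))) as [[q [q' [V1 V2]]]|NE].
  - exists q, q'. split; [left; eauto 10|]. split; apply Qc, V1.
  - exists z, (app m (op (app eps n) hh)). split; [right; auto|]. auto. }
 assert (FA : isfun A om c).
 { split; [|split]; [intros u U; unfold A in U; rewrite in_sep in U by dfn; tauto| |].
  - intros n N. destruct (WE n N) as [x [y [H [Hx Hy]]]]. exists x. apply HA. eauto.
  - intros n x x' K K'. apply HA in K, K'. destruct K as [_ [y K]], K' as [_ [y' K']]. apply (WU _ _ _ _ _ K K'). }
 assert (FB : isfun B om c).
 { split; [|split]; [intros u U; unfold B in U; rewrite in_sep in U by dfn; tauto| |].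
  - intros n N. destruct (WE n N) as [x [y [H [Hx Hy]]]]. exists y. apply HB. eauto.
  - intros n x x' K K'. apply HB in K, K'. destruct K as [_ [y K]], K' as [_ [y' K']]. apply (WU _ _ _ _ _ K K'). }
 exists A, B. split; [apply t_func, FA|]. split; [apply t_func, FB|]. split.
 - intros n x y e s [K1 [K2 [K3 K4]]]. apply t_maps in K1, K2, K3. apply t_maps2 in K4. apply HA in K1. apply HB in K2. destruct K1 as [[N Hx] [y' K1]], K2 as [[_ Hy] [x' K2]].
  destruct (WU _ _ _ _ _ K1 K2) as [<- ->]. clear K2. apply (app_eq EP) in K3. subst e. apply (pl_iff HR) in K4; auto. subst s.
  destruct K1 as [[q [q' [V1 [_ [-> ->]]]]]|[_ [-> ->]]]; [split; apply t_maps, V1|]. split; apply t_maps; [apply H2; auto|].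
  rewrite (pl_C HR), (pl_z HR) by auto. rewrite <- (H1 (app eps n)) at 2 by auto. apply (lt_plus HR); auto.
 - intros t TX. assert (Y := app_cod (proj1 Hf) TX). assert (TY := app_in (proj1 Hf) TX). destruct (Hh _ Y) as [n [N K]]. apply HRR in K as [_ [_ [t' [q [q' [TX' [TY' [V1 [C1 [L1 L2]]]]]]]]]].
  assert (t' = t) as -> by (apply (proj2 Hf _ _ _ TY' TY)). assert (WQ : W1 n q q') by (left; exists q, q'; auto).
  exists n, q, q'. split; [apply t_maps, HA|]; [split; [split; auto; apply Qc, V1|eauto]|]. split; [apply t_maps, HB|]; [split; [split; auto; apply Qc, V1|eauto]|]. split; apply t_maps; auto.
Qed.
End Smz.

Lemma om_bdd_fin (S : SetM) (k : S) (R : S -> S -> Prop) : dfnp (fun _ e => R (e 0) (e 1)) ->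
 (forall y n m, R y n -> n ∊ om -> m ∊ om -> Sub n m -> R y m) -> fin k -> (forall y, y ∊ k -> exists n, n ∊ om /\ R y n) -> exists N, N ∊ om /\ forall y, y ∊ k -> R y N.
Proof. intros D M. exact (@fin_bound S _ _ _ (@IndOk_pure S) (fun _ => R) tt k D M). Qed.

Section Om1Limit.
Variable S : SetM.
Variable o : S.
Hypothesis Ho : isom1 o.
Lemma om_sub_om1 : Sub om o.
Proof.
 intros n N. destruct Ho as [O [U _]]. destruct (Ord_tri (@Ord_om S) O) as [Q|[Q|Q]].
 - apply (proj1 O _ Q), N.
 - subst; auto.
 - destruct U. apply emb_sub. intros x X. apply (om_tr Q X).
Qed.
Lemma om1_succ y : y ∊ o -> sc y ∊ o.
Proof.
 intros Y. assert (O := proj1 Ho). destruct (Ord_tri (Ord_sc (Ord_in O Y)) O) as [Q|[Q|Q]]; auto; exfalso.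
 - apply (proj1 (proj2 Ho)). rewrite <- Q. destruct (proj2 (proj2 Ho) y Y) as [f F].
  apply (@emb_lam S (sc y) om (fun z => ifeq z y em (sc (app f z)))).
  + dfn.
  + intros z Z. destruct (classic (z = y)) as [->|NE]; [rewrite ifeq_l; apply om_0|rewrite ifeq_r by auto].
   apply om_S. apply in_sc in Z as [Z|Z]; [apply (app_cod (proj1 F) Z)|tauto].
  + intros x x' Hx Hx'. apply in_sc in Hx, Hx'. assert (NEM : forall t : S, sc t <> em) by (intros t E; apply (@in_em S t); rewrite <- E; apply sc_in).
   destruct (classic (x = y)) as [->|NE], (classic (x' = y)) as [->|NE']; auto.
   * rewrite ifeq_l, ifeq_r by auto. intros E. destruct (NEM (app f x')); auto.
   * rewrite ifeq_l, ifeq_r by auto. intros E. destruct (NEM (app f x)); auto.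
   * rewrite !ifeq_r by auto. intros E. apply sc_inj in E. apply (Inj_app F); auto; tauto.
 - apply in_sc in Q as [Q| ->]; [apply (nin2 Q Y)|apply (nin Y)].
Qed.
Lemma fin_bdd_om1 B : fin B -> Sub B o -> exists g, g ∊ o /\ forall y, y ∊ B -> y ∊ g.
Proof.
 revert B. apply (@fin_ind S (fun B => Sub B o -> exists g, g ∊ o /\ forall y, y ∊ B -> y ∊ g)).
 - dfn.
 - intros _. exists em. split; [apply om_sub_om1, om_0|]. intros y Y. destruct (in_em Y).
 - intros B y FB IH _ SB. destruct IH as [g [G K]]; [intros x X; apply SB, in_adj; auto|].
  assert (Y : y ∊ o) by (apply SB, in_adj; auto). assert (O := proj1 Ho).
  assert (M : exists h, h ∊ o /\ Sub g h /\ Sub (sc y) h).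
  { assert (Y' := om1_succ Y). destruct (Ord_total (Ord_in O G) (Ord_in O Y')) as [L|L]; [exists (sc y)|exists g]; auto using Sub_refl. }
  destruct M as [h [H1 [H2 H3]]]. exists h. split; auto. intros x [X| ->]%in_adj; auto. apply H3, sc_in.
Qed.
Lemma unbdd_fin B n : Sub B o -> ~ (exists g, g ∊ o /\ forall y, y ∊ B -> y ∊ g) -> n ∊ om -> exists B0, fin B0 /\ Sub B0 B /\ emb n B0.
Proof.
 intros SB NB. revert n. refine (@om_ind S (fun n => exists B0, fin B0 /\ Sub B0 B /\ emb n B0) _ _ _).
 - apply Min_d. dfn.
 - exists em. split; [apply fin_em|]. split; [intros x X; destruct (in_em X)|apply emb_sub, Sub_refl].
 - intros n N [B0 [F0 [S0 [f F]]]].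
  assert (E : exists y, y ∊ B /\ ~ y ∊ B0).
  { apply NNPP. intros NE. apply NB. destruct (fin_bdd_om1 F0) as [g [G K]]; [intros x X; auto|]. exists g. split; auto. intros y Y. apply K. apply NNPP. intros Q. apply NE. eauto. }
  destruct E as [y [Y NY]]. exists (adj B0 y). split; [apply fin_adj; auto|]. split; [intros x [X| ->]%in_adj; auto|].
  assert (KF : forall x, x ∊ n -> app f x ∊ B0) by (intros x X; apply (app_cod (proj1 F) X)).
  apply (@emb_lam S (sc n) (adj B0 y) (fun z => ifeq z n y (app f z))).
  + dfn.
  + intros z Z. apply in_adj. destruct (classic (z = n)) as [->|NE]; [rewrite ifeq_l; auto|rewrite ifeq_r by auto]. left. apply KF. apply in_sc in Z. destruct Z; tauto.
  + intros x x' Hx Hx'. apply in_sc in Hx, Hx'.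
   destruct (classic (x = n)) as [->|NE], (classic (x' = n)) as [->|NE']; auto.
   * rewrite ifeq_l, ifeq_r by auto. intros E. destruct NY. rewrite E. apply KF. tauto.
   * rewrite ifeq_l, ifeq_r by auto. intros E. destruct NY. rewrite <- E. apply KF. tauto.
   * rewrite !ifeq_r by auto. intros E. apply (Inj_app F); auto; tauto.
Qed.
End Om1Limit.

(** * Gamma-sets *)

Section Gamma.
Variable S : SetM.
Notation T := (truth (@smem S)).
Variable o : S.
Hypothesis Ho : isom1 o.
Variables c a m z l : S.
Notation R := (Line c a m z l).
Hypothesis HR : T (real_line R).
Variable r : S.
Hypothesis Hr : isfun r om c /\ (forall n, n ∊ om -> op z (app r n) ∊ l) /\ forall n, n ∊ om -> app a (op (app r (sc n)) (app r (sc n))) = app r n.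
Notation "x ⊕ y" := (app a (op x y)) (at level 50, left associativity).
Notation "x ≺ y" := (op x y ∊ l) (at level 70).
Variables X d : S.
Hypothesis HM : T (metric R X d).
Definition ds x y := app d (op x y).
Lemma ds_in x y : x ∊ X -> y ∊ X -> ds x y ∊ c.
Proof. intros A B. destruct HM as [H _]. exact (proj1 (t_op2 H A B)). Qed.
Lemma ds_iff x y v : x ∊ X -> y ∊ X -> (op (op x y) v ∊ d <-> v = ds x y).
Proof. intros A B. destruct HM as [H _]. exact (proj2 (t_op2 H A B) v). Qed.
Lemma ds_z x y : x ∊ X -> y ∊ X -> (ds x y = z <-> x = y).
Proof.
 intros A B. destruct HM as [_ [H _]]. destruct (H x A y B) as [H1 H2]. split.
 - intros E. apply t_eqv, H1, t_maps2, ds_iff; auto.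
 - intros ->. symmetry. apply ds_iff; auto. apply t_maps2, H2, t_eqv. auto.
Qed.
Lemma ds_C x y : x ∊ X -> y ∊ X -> ds x y = ds y x.
Proof. intros A B. destruct HM as [_ [_ [H _]]]. apply ds_iff; auto. apply t_maps2, (H x A y B), t_maps2, ds_iff; auto. Qed.
Lemma ds_tri x y w : x ∊ X -> y ∊ X -> w ∊ X -> ~ (ds x y ⊕ ds y w) ≺ ds x w.
Proof.
 intros A B C K. destruct HM as [_ [_ [_ H]]]. assert (I1 := ds_in A B). assert (I2 := ds_in B C). refine (H x A y B w C (ds x y) (ds y w) (ds x w) (ds x y ⊕ ds y w) _ _).
 - repeat split; apply t_maps2; [apply ds_iff|apply ds_iff|apply ds_iff|apply (pl_iff HR)]; auto.
 - apply t_maps, K.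
Qed.
Let rin n (N : n ∊ om) : app r n ∊ c := r_in Hr N.
Let rpos n (N : n ∊ om) : z ≺ app r n := r_pos Hr N.
Let plin x y (A : x ∊ c) (B : y ∊ c) : x ⊕ y ∊ c := l_pl HR A B.
Let zin : z ∊ c := z_in HR.
Hint Resolve ds_in rin rpos plin zin om_S om_0 : core.
Lemma ds_pos x y : x ∊ X -> y ∊ X -> x <> y -> z ≺ ds x y.
Proof.
 intros A B N. assert (I := ds_in A B). destruct (lt_tot HR I zin) as [L|[L|L]]; auto; exfalso; [|apply N, ds_z; auto].
 assert (K := lt_pl2 HR I zin I zin L L). rewrite (pl_z HR) in K by auto. apply (@ds_tri x y x); auto. rewrite (@ds_C y x) by auto.
 assert (ds x x = z) as -> by (apply ds_z; auto). auto.
Qed.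
Variables D phi : S.
Hypothesis HD : Sub D X /\ forall x e, x ∊ X -> e ∊ c -> z ≺ e -> exists y, y ∊ D /\ ds x y ≺ e.
Hypothesis Hphi : Inj phi (prod D om) om.
(** The sets W(j,1) and, with [WF], W(j,0). If j codes (q,n), these are the ball of radius 2 r(n)
    about q and the set of points farther than r(n) from q; they overlap, hence cover X. If j codes
    nothing, both conditions hold vacuously. *)
Definition WT j y := forall q n, q ∊ D -> n ∊ om -> op (op q n) j ∊ phi -> ds y q ≺ app r n ⊕ app r n.
Definition WF j y := forall q n, q ∊ D -> n ∊ om -> op (op q n) j ∊ phi -> app r n ≺ ds y q.
Definition WB w i j y := (op i j ∊ w /\ WT j y) \/ (~ op i j ∊ w /\ WF j y).
Definition Wp n k w y := exists i, i ∊ n /\ forall j, j ∊ k -> WB w i j y.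
Lemma WTF j y : y ∊ X -> WT j y \/ WF j y.
Proof.
 intros Y. destruct (classic (WT j y)) as [K|K]; [auto|right]. intros q n Q N P. apply NNPP. intros NL. apply K. intros q' n' Q' N' P'.
 assert (E := proj2 Hphi _ _ _ P P'). apply op_inj in E as [<- <-]. assert (QX : q ∊ X) by (apply HD; auto). assert (I := ds_in Y QX).
 apply (le_lt HR I (rin N)); auto. apply (lt_plus HR); auto.
Qed.
(** Let q in D be very near x. Then x is not far from q and y is not near it, so x and y cannot be
    on the same side for the code j of this ball, whatever w prescribes. *)
Lemma Wsep x y : x ∊ X -> y ∊ X -> x <> y -> exists j, j ∊ om /\ forall w i, WB w i j x -> WB w i j y -> False.
Proof.
 (* Two halvings leave room for the triangle inequality: 2 r(n) is half of r(n0), which is less than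
    the distance of x and y. *)
 intros A B N. destruct (r_small HR Hr (ds_in A B) (ds_pos A B N)) as [n0 [N0 L]]. set (n := sc (sc n0)). assert (Nn : n ∊ om) by (unfold n; auto).
 assert (E2 : app r n ⊕ app r n = app r (sc n0)) by (apply Hr; auto).
 destruct HD as [DX DD]. destruct (DD x (app r n)) as [q [Q LQ]]; auto. assert (QX := DX _ Q).
 assert (W : op q n ∊ prod D om) by (apply op_prod; auto).
 assert (J := app_cod (proj1 Hphi) W). assert (P := app_in (proj1 Hphi) W). exists (app phi (op q n)). split; auto.
 assert (I1 := ds_in A QX). assert (I2 := ds_in B QX). assert (I3 := ds_in A B).
 assert (NF : ~ WF (app phi (op q n)) x) by (intros H; apply (lt_nlt HR I1 (rin Nn) LQ), (H q n); auto).
 assert (NT : ~ WT (app phi (op q n)) y).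
 { intros H. specialize (H q n Q Nn P). rewrite E2 in H. apply (@ds_tri x q y); auto. rewrite (ds_C QX B).
  assert (L2 : ds x q ≺ app r (sc n0)) by (apply (lt_tr HR (y := app r n)); auto; apply (r_lt HR Hr); auto).
  apply (lt_tr HR (y := app r n0)); auto. rewrite <- (r_S Hr N0). apply (lt_pl2 HR); auto. }
 intros w i [[K1 K2]|[K1 K2]] [[K3 K4]|[K3 K4]]; tauto.
Qed.
(** At most one pair (q,n) is coded by j, so a single strict inequality on distances has to be
    preserved near x. *)
Lemma Wopen w i j x : x ∊ X -> WB w i j x -> exists n, n ∊ om /\ forall y, y ∊ X -> ds x y ≺ app r n -> WB w i j y.
Proof.
 intros A H. destruct HD as [DX DD].
 assert (G : forall (P : S -> Prop), (forall q n, q ∊ D -> n ∊ om -> op (op q n) j ∊ phi -> exists e, e ∊ c /\ z ≺ e /\ forall y, y ∊ X -> ds x y ≺ e -> P y) ->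
  ((forall q n, q ∊ D -> n ∊ om -> ~ op (op q n) j ∊ phi) -> forall y, P y) -> exists n, n ∊ om /\ forall y, y ∊ X -> ds x y ≺ app r n -> P y).
 { intros P H1 H2. destruct (classic (exists q n, q ∊ D /\ n ∊ om /\ op (op q n) j ∊ phi)) as [[q [n [Q [N K]]]]|NE].
  - destruct (H1 q n Q N K) as [e [E [EP HE]]]. destruct (r_small HR Hr E EP) as [k [K1 K2]]. exists k. split; auto. intros y Y L. apply HE; auto.
   apply (lt_tr HR (y := app r k)); auto.
  - exists em. split; auto. intros y _ _. apply H2. intros q n Q N K. apply NE. eauto. }
 apply (G (fun y => WB w i j y)); clear G.
 - intros q n Q N P. assert (QX := DX _ Q). assert (I := ds_in A QX).
  assert (U : forall q' n', op (op q' n') j ∊ phi -> q' = q /\ n' = n) by (intros q' n' P'; apply op_inj, (proj2 Hphi _ _ _ P' P)).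
  destruct H as [[K1 K2]|[K1 K2]].
  + destruct (sub_lt HR I (plin (rin N) (rin N)) (K2 q n Q N P)) as [e [E1 [E2 E3]]]. exists e. spl. intros y Y L.
   left. split; auto. intros q' n' _ _ P'. apply U in P' as [-> ->]. rewrite <- E2. assert (I2 := ds_in Y QX). assert (I3 := ds_in Y A).
   apply (le_lt HR I2 (plin I3 I)); auto; [apply ds_tri; auto|]. rewrite (ds_C Y A), (pl_C HR) by auto. apply (lt_pl' HR); auto.
  + destruct (sub_lt HR (rin N) I (K2 q n Q N P)) as [e [E1 [E2 E3]]]. exists e. spl. intros y Y L.
   right. split; auto. intros q' n' _ _ P'. apply U in P' as [-> ->]. assert (I2 := ds_in Y QX).
   apply (lt_can HR (w := e)); auto. rewrite E2. apply (le_lt HR I (plin (ds_in A Y) I2)); auto; [apply ds_tri; auto|].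
   rewrite (pl_C HR) by auto. apply (lt_pl' HR); auto.
 - intros NE y. destruct H as [[K _]|[K _]]; [left|right]; split; auto; intros q n Q N P; destruct (NE q n); auto.
Qed.
Lemma Wp_open n k w x : k ∊ om -> x ∊ X -> Wp n k w x -> exists q, q ∊ om /\ forall y, y ∊ X -> ds x y ≺ app r q -> Wp n k w y.
Proof.
 intros K A [i [I H]]. destruct (@om_bdd_fin S k (fun j q => forall y, y ∊ X -> ds x y ≺ app r q -> WB w i j y)) as [q [Q HQ]].
 - dfn.
 - intros j q q' H1 Q Q' L y Y M. apply H1; auto. apply (lt_le HR (y := app r q')); auto. apply (r_dec HR Hr); auto.
 - apply fin_nat; auto.
 - intros j J. apply Wopen; auto.
 - exists q. split; auto. intros y Y L. exists i. split; auto.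
Qed.
End Gamma.

Section GammaMain.
Variable S : SetM.
Notation T := (truth (@smem S)).
Variable o : S.
Hypothesis Ho : isom1 o.
Hypothesis HAC : forall X : S, ~ ctb X -> emb o X.
Hypothesis HDD : forall Sr : S, (forall B : S, Sub B o -> ~ (exists g, g ∊ o /\ forall y : S, y ∊ B -> y ∊ g) -> forall n : S, n ∊ om -> exists B0 k0 : S, fin B0 /\ Sub B0 B /\ k0 ∊ om /\
  forall k : S, k ∊ om -> Sub k0 k -> forall w : S, Sub w (prod n k) -> exists y : S, y ∊ B0 /\ ~ op y (op n (op k w)) ∊ Sr) ->
 exists h, isfun h om om /\ forall A : S, (forall m : S, m ∊ om -> exists n w : S, n ∊ om /\ Sub m n /\ Sub w (prod n (app h n)) /\ op n (op (app h n) w) ∊ A) ->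
  exists g, g ∊ o /\ forall y : S, y ∊ o -> (exists m : S, m ∊ om /\ forall n w : S, n ∊ om -> Sub m n -> Sub w (prod n (app h n)) -> op n (op (app h n) w) ∊ A ->
   op y (op n (op (app h n) w)) ∊ Sr) -> y ∊ g.
Variables c a m z l : S.
Notation R := (Line c a m z l).
Hypothesis HR : T (real_line R).
Variables X d : S.
Hypothesis HG : T (gamma_set R X d).
Notation dist := (ds d).
Lemma gamma_ctb : ctb X.
Proof.
 apply NNPP. intros NC. destruct HG as [HM [[D [DX [CD DD]]] HC]]. apply t_sub in DX. apply t_countable in CD. destruct (r_ex HR) as [r Hr].
 destruct (HAC NC) as [F HF]. destruct (emb_trans (emb_prod CD (emb_sub (@Sub_refl S om))) (@ctb_prod S)) as [phi Hphi].
 assert (HD : Sub D X /\ forall x e, x ∊ X -> e ∊ c -> op z e ∊ l -> exists y, y ∊ D /\ op (dist x y) e ∊ l).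
 { split; auto. intros x e Hx E P. destruct (DD x Hx e) as [y [Y [v [V1 V2]]]].
  - split; auto. apply t_maps, P.
  - exists y. split; auto. apply t_maps2 in V1. apply t_maps in V2. apply (ds_iff HM v Hx (DX _ Y)) in V1. subst v. auto. }
 assert (XF : forall y, y ∊ o -> app F y ∊ X) by (intros y Y; apply (app_cod (proj1 HF) Y)).
 assert (FI : forall y y', y ∊ o -> y' ∊ o -> app F y = app F y' -> y = y') by (intros; apply (Inj_app HF); auto).
 assert (OO := om_sub_om1 Ho). assert (rin := r_in Hr). assert (rpos := r_pos Hr). assert (din := ds_in HM). clear NC CD DD.
 set (WP := fun n k w y => Wp a l r d D phi n k w y).
 assert (WPd : forall I (U : I -> S -> Prop) E t1 t2 t3 t4, dfts U E t1 -> dfts U E t2 -> dfts U E t3 -> dfts U E t4 ->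
  dfns U E (fun i e => WP (t1 i e) (t2 i e) (t3 i e) (t4 i e))).
 { intros. dfn. }
 assert (Wsep' : forall x y, x ∊ X -> y ∊ X -> x <> y -> exists j, j ∊ om /\ forall w i, WB a l r d D phi w i j x -> WB a l r d D phi w i j y -> False) by (intros; apply (Wsep HR Hr HM HD Hphi); auto).
 set (Sr := sep (prod o (prod om (prod om (Pw (prod om om))))) (fun u => exists y n k w, u = op y (op n (op k w)) /\ WP n k w (app F y))).
 assert (HSr : forall y n k w, y ∊ o -> n ∊ om -> k ∊ om -> Sub w (prod n k) -> (op y (op n (op k w)) ∊ Sr <-> WP n k w (app F y))).
 { intros y n k w Y N K W. unfold Sr. sepd. rewrite !op_prod, in_Pw. split.
  - intros [_ [y' [n' [k' [w' [E H]]]]]]. opi. auto.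
  - intros H. split; [|eauto 8]. spl. intros u U. apply W, in_prod in U as [i [j [I [J ->]]]].
   apply op_prod. split; [apply (om_tr N I)|apply (om_tr K J)]. }
 destruct (HDD (Sr := Sr)) as [f [Ff Hf]].
 (* Choose n+1 elements of B and k0 so large that their points are pairwise separated by some j <
    k0. If all of them lay in the set W(n,k,w), two would share the same i < n and agree at every j
    < k. *)
 { intros B SB NB n N. destruct (unbdd_fin Ho SB NB (om_S N)) as [B0 [FB [SB0 EB]]].
  assert (P : exists k0, k0 ∊ om /\ forall u, u ∊ prod B0 B0 -> forall y y', u = op y y' -> y <> y' -> exists j, j ∊ k0 /\ forall w i, WB a l r d D phi w i j (app F y) -> WB a l r d D phi w i j (app F y') -> False).
  { apply om_bdd_fin.
   - dfn.
   - intros u n' m' H _ _ L y y' E NE. destruct (H y y' E NE) as [j [J K]]. exists j. auto.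
   - apply fin_prod; auto.
   - intros u [y [y' [Y [Y' ->]]]]%in_prod. destruct (classic (y = y')) as [->|NE].
    + exists em. split; [apply om_0|]. intros y0 y1 E NE. opi; tauto.
    + assert (NEF : app F y <> app F y') by (intros Q; apply NE, FI; auto). destruct (Wsep' (app F y) (app F y')) as [j [J K]]; auto. exists (sc j). split; [apply om_S; auto|]. intros y0 y1 E _. opi.
     exists j. split; [apply sc_in|auto]. }
  destruct P as [k0 [K0 HK]]. exists B0, k0. spl. intros k K L w W. apply NNPP. intros NE. apply (php N). apply (emb_trans EB).
  apply (@emb_rel S B0 n (fun y i => forall j, j ∊ k -> WB a l r d D phi w i j (app F y))).
  - dfn.
  - apply om_ord; auto.
  - intros y Y. assert (Q : WP n k w (app F y)).
   { apply (HSr y n k w); auto. apply NNPP. intros Q. apply NE. eauto. }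
   exact Q.
  - intros y y' i Y Y' I H H'. apply NNPP. intros Q. destruct (HK (op y y')) with (y := y) (y' := y') as [j [J Z]]; auto; [apply op_prod; auto|]. apply (Z w i); auto. }
 assert (fin' : forall n, n ∊ om -> app f n ∊ om) by (intros n N; apply (app_cod Ff N)).
 (* The members of the cover: W(n,f(n),w) without the point of index i, where i is at most n. *)
 set (Rep := fun U n w i => n ∊ om /\ Sub w (prod n (app f n)) /\ i ∊ sc n /\ forall y, y ∊ U <-> y ∊ X /\ WP n (app f n) w y /\ y <> app F i).
 assert (Repd : forall I (U : I -> S -> Prop) E t1 t2 t3 t4, dfts U E t1 -> dfts U E t2 -> dfts U E t3 -> dfts U E t4 ->
  dfns U E (fun i e => Rep (t1 i e) (t2 i e) (t3 i e) (t4 i e))).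
 { intros. dfn. }
 set (C := sep (Pw X) (fun U => exists n w i, Rep U n w i)).
 assert (HCi : forall U, U ∊ C <-> exists n w i, Rep U n w i).
 { intros U. unfold C. sepd. rewrite in_Pw. split; [tauto|]. intros [n [w [i H]]]. split; eauto. intros y Y. apply H in Y. tauto. }
 assert (RepE : forall n w i, n ∊ om -> Sub w (prod n (app f n)) -> i ∊ sc n -> exists U, Rep U n w i).
 { intros n w i N W I. exists (sep X (fun y => WP n (app f n) w y /\ y <> app F i)). spl. intros y. sepd. tauto. }
 assert (RepU : forall U U' n w i, Rep U n w i -> Rep U' n w i -> U = U') by (intros U U' n w i [_ [_ [_ H]]] [_ [_ [_ H']]]; apply sext; intros y; rewrite H, H'; tauto).
 (* Number the points of the finite set by i < n and let w record, for the i-th point and j < f(n),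
    whether it belongs to the first set of the j-th pair. Of the n+1 points that may be deleted, one
    is not in the finite set. *)
 assert (OM : forall Fn, Sub Fn X -> fin Fn -> exists U, U ∊ C /\ Sub Fn U).
 { intros Fn SF [n [N [g G]]]. set (w := sep (prod n (app f n)) (fun u => exists i j y, u = op i j /\ y ∊ Fn /\ op y i ∊ g /\ WT a l r d D phi j y)).
  assert (Hw : forall i j, op i j ∊ w <-> (i ∊ n /\ j ∊ app f n) /\ exists y, y ∊ Fn /\ op y i ∊ g /\ WT a l r d D phi j y).
  { intros i j. unfold w. rewrite in_sep by (dfn). rewrite op_prod. split; [intros [H [i' [j' [y [E K]]]]]; opi; eauto|].
   intros [H [y K]]. split; auto. exists i, j, y. auto. }
  assert (I : exists i, i ∊ sc n /\ ~ app F i ∊ Fn).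
  { apply NNPP. intros NE. apply (php N). refine (emb_trans _ (emb_Inj G)). apply (@emb_lam S (sc n) Fn (fun i => app F i)); [dfn| |].
   - intros i I. apply NNPP. intros Q. apply NE. eauto.
   - intros i i' I I'. assert (Sub (sc n) o) by (intros t Tt; apply OO, (om_tr (om_S N) Tt)). apply FI; auto. }
  destruct I as [i [I NI]]. destruct (RepE n w i) as [U HU]; auto; [intros u Hu; unfold w in Hu; rewrite in_sep in Hu by (dfn); tauto|].
  exists U. split; [apply HCi; eauto|]. intros y Y. apply HU. split; auto. split; [|intros ->; auto]. exists (app g y). split; [apply (app_cod (proj1 G) Y)|].
  intros j J. assert (A := app_in (proj1 G) Y). assert (An := app_cod (proj1 G) Y). destruct (classic (WT a l r d D phi j y)) as [K|K].
  - left. split; auto. apply Hw. split; [split; auto|eauto 8].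
  - right. split; [|destruct (WTF HR Hr HM HD Hphi j (SF _ Y)); tauto]. intros [_ [y' [Y' [A' K']]]]%Hw.
   assert (y' = y) by (apply (proj2 G _ _ _ A' A)). subst. auto. }
 destruct (HC C) as [C' [SC [[GC1 GC2] [GC3 GC4]]]].
 { split; [split|split].
  - intros U [n [w [i H]]]%HCi. destruct (H) as [N [W [I HU]]]. split; [apply t_sub; intros y Y; apply HU in Y; tauto|].
   assert (Io : i ∊ o) by (apply OO, (om_tr (om_S N) I)).
   intros x [Hx [WX NX]]%HU. destruct (Wp_open HR Hr HM HD Hphi (fin' n N) Hx WX) as [q [Q HQ]].
   destruct (r_small HR Hr (din _ _ Hx (XF i Io)) (ds_pos HR HM Hx (XF i Io) NX)) as [q' [Q' LQ]]. destruct (om_max Q Q') as [q2 [Q2 [L1 L2]]].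
   exists (app r q2). split; [split; auto; apply t_maps; auto|]. intros y Y [v [V1 V2]]. apply t_maps2, (ds_iff HM v Hx Y) in V1. apply t_maps in V2. subst v.
   assert (I1 := din _ _ Hx Y). apply HU. split; auto. split.
   + apply HQ; auto. apply (lt_le HR (y := app r q2)); auto. apply (r_dec HR Hr); auto.
   + intros ->. assert (L3 : op (dist x (app F i)) (app r q') ∊ l) by (apply (lt_le HR (y := app r q2)); auto; apply (r_dec HR Hr); auto).
    apply (lt_nlt HR I1 (rin q' Q') L3 LQ).
  - intros x Hx. destruct (OM (sg x)) as [U [HU SU]].
   + intros y Y. apply in_sg in Y. subst; auto.
   + apply (fin_sub (b := adj em x)); [intros y Y; apply in_sg in Y; apply in_adj; auto|apply fin_adj, fin_em].
   + exists U. split; auto. apply SU, in_sg; auto.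
  - intros [n [w [i [N [_ [I HX]]]]]]%HCi. destruct (proj1 (HX (app F i))) as [_ [_ Q]]; auto. apply XF, OO, (om_tr (om_S N) I).
  - intros Fn [SF FF]. apply t_sub in SF. apply t_finite in FF. destruct (OM Fn SF FF) as [U [HU SU]]. exists U. split; auto. }
 apply t_sub in SC. assert (GC3' : ~ fin C') by (intros Q; apply GC3, t_finite, Q). clear GC1 GC2 GC3.
 (* A set may have several representations. Requiring n to be least makes n a function of the set,
    so finitely many exceptional sets involve boundedly many n. *)
 set (LR := fun U n w => (exists i, Rep U n w i) /\ forall n' w' i', n' ∊ n -> ~ Rep U n' w' i').
 assert (LRd : forall I (U : I -> S -> Prop) E t1 t2 t3, dfts U E t1 -> dfts U E t2 -> dfts U E t3 ->
  dfns U E (fun i e => LR (t1 i e) (t2 i e) (t3 i e))).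
 { intros. dfn. }
 assert (LRE : forall U, U ∊ C -> exists n w, LR U n w).
 { intros U HU. apply HCi in HU. destruct (@d_least S (fun n => exists w i, Rep U n w i)) as [n [N [[w [i K]] K']]].
  - dfn.
  - destruct HU as [n [w [i H]]]. exists n. split; [apply H|eauto].
  - exists n, w. split; eauto. intros n' w' i' N' H. apply (K' n' N'). eauto. }
 assert (LRU : forall U n w n' w', LR U n w -> LR U n' w' -> n = n').
 { intros U n w n' w' [[i H] K] [[i' H'] K']. destruct (Ord_tri (om_ord (proj1 H)) (om_ord (proj1 H'))) as [Q|[Q|Q]]; auto; exfalso; [apply (K' _ _ _ Q H)|apply (K _ _ _ Q H')]. }
 set (A := sep (prod om (prod om (Pw (prod om om)))) (fun v => exists n w U, v = op n (op (app f n) w) /\ U ∊ C' /\ LR U n w)).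
 assert (HA : forall n w, n ∊ om -> Sub w (prod n (app f n)) -> (op n (op (app f n) w) ∊ A <-> exists U, U ∊ C' /\ LR U n w)).
 { intros n w N W. unfold A. sepd. rewrite !op_prod, in_Pw. split.
  - intros [_ [n' [w' [U [E H]]]]]. opi. eauto.
  - intros [U H]. split; [|eauto 8]. spl. intros u Hu. apply W, in_prod in Hu as [i [j [I [J ->]]]].
   apply op_prod. split; [apply (om_tr N I)|apply (om_tr (fin' n N) J)]. }
 destruct (Hf A) as [g [G HG']].
 { intros p P. apply NNPP. intros NE. apply GC3'.
  (* For each n there are finitely many w and i, hence finitely many represented sets; an infinite
     subcover therefore contains sets with arbitrarily large n. *)
  assert (FIN : forall n, n ∊ om -> exists Z, fin Z /\ forall U, U ∊ C' -> (exists n' w i, n' ∊ n /\ Rep U n' w i) -> U ∊ Z).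
  { refine (@om_ind S (fun n => exists Z, fin Z /\ forall U, U ∊ C' -> (exists n' w i, n' ∊ n /\ Rep U n' w i) -> U ∊ Z) _ _ _).
   - apply Min_d. dfn.
   - exists em. split; [apply fin_em|]. intros U _ [n' [w [i [N' _]]]]. destruct (in_em N').
   - intros n N [Z [FZ HZ]]. set (Z' := sep C' (fun U => exists w i, Rep U n w i)).
    exists (cup Z Z'). split.
    + apply fin_cup; auto. assert (FP : fin (prod (Pw (prod n (app f n))) (sc n))) by (apply fin_prod; [apply fin_Pw, fin_prod; apply fin_nat; auto|apply fin_nat, om_S; auto]).
     set (FF := fun u : S => sep X (fun y => exists w i, u = op w i /\ WP n (app f n) w y /\ y <> app F i)).
     assert (HFF : forall u y, y ∊ FF u <-> y ∊ X /\ exists w i, u = op w i /\ WP n (app f n) w y /\ y <> app F i) by (intros; unfold FF; sepd; tauto).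
     apply (@fin_img S _ Z' FF) in FP; auto.
     * apply ft_spec with (Q := fun _ (e : nat -> S) (v : S) => forall y : S, y ∊ v <-> y ∊ X /\ exists w i : S, e 0 = op w i /\ WP n (app f n) w y /\ y <> app F i); [|dfn].
      intros ? e v. split; [intros <-; apply HFF|intros K; apply sext; intros; rewrite HFF, K; tauto].
     * intros U HU. unfold Z' in HU. sepd in HU. destruct HU as [_ [w [i [_ [W [I HU]]]]]]. exists (op w i). split; [apply op_prod; rewrite in_Pw; auto|].
      apply sext. intros y. rewrite HFF, HU. split.
      -- intros [Y [w' [i' [E K]]]]. opi. auto.
      -- intros [Y K]. split; auto. exists w, i. auto.
    + intros U HU [n' [w [i [N' K]]]]. apply in_cup. apply in_sc in N' as [N'| ->]; [left; apply HZ; auto; eauto 8|right]. unfold Z'. sepd. eauto. }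
  destruct (FIN p P) as [Z [FZ HZ]]. apply (fin_sub (b := Z)); auto. intros U HU. destruct (LRE U (SC _ HU)) as [n [w K]]. destruct (K) as [[i K1] _].
  apply HZ; auto. exists n, w, i. split; auto. apply NNPP. intros NP. apply NE. exists n, w. assert (N := proj1 K1). assert (W := proj1 (proj2 K1)).
  split; auto. split; [|split; auto; apply HA; eauto]. destruct (Ord_total (om_ord P) (om_ord N)) as [B|B]; auto. apply Ord_le in B; [|apply om_ord; auto|apply om_ord; auto].
  destruct B as [B| ->]; [tauto|apply Sub_refl]. }
 (* The point of index g is in all but finitely many members of the subcover, so g is among the
    ordinals that g is supposed to bound. *)
 apply (@nin S g). apply HG'; auto. assert (Xg := XF g G). destruct (GC4 _ Xg) as [Ex [FEx HEx]]. apply t_finite in FEx.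
 destruct (@om_bdd_fin S Ex (fun U p => forall n w, LR U n w -> n ∊ p)) as [p [P HP]].
 { dfn. }
 { intros U n k H _ _ L n' w' K. apply L, (H n' w'), K. }
 { exact FEx. }
 { intros U _. destruct (classic (exists n w, LR U n w)) as [[n [w K]]|NE].
  - exists (sc n). assert (N : n ∊ om) by (destruct K as [[i K] _]; apply K). split; [apply om_S; auto|]. intros n' w' K'. rewrite (LRU _ _ _ _ _ K K'). apply sc_in.
  - exists em. split; [apply om_0|]. intros n w K. destruct NE; eauto. }
 exists p. split; auto. intros n w N L W HAn. apply HSr; auto. apply HA in HAn; auto. destruct HAn as [U [HU K]].
 destruct (HEx U HU) as [Q|Q].
 - exfalso. apply (@nin S n). apply L. apply (HP U Q n w K).
 - destruct K as [[i [_ [_ [_ K]]]] _]. apply K in Q. tauto.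
Qed.
End GammaMain.
Lemma N_gamma (S : SetM) (o : S) : isom1 o -> (forall X : S, ~ ctb X -> emb o X) ->
 (forall Sr : S, (forall B : S, Sub B o -> ~ (exists g, g ∊ o /\ forall y : S, y ∊ B -> y ∊ g) -> forall n : S, n ∊ om -> exists B0 k0 : S, fin B0 /\ Sub B0 B /\ k0 ∊ om /\
  forall k : S, k ∊ om -> Sub k0 k -> forall w : S, Sub w (prod n k) -> exists y : S, y ∊ B0 /\ ~ op y (op n (op k w)) ∊ Sr) ->
 exists h, isfun h om om /\ forall A : S, (forall m : S, m ∊ om -> exists n w : S, n ∊ om /\ Sub m n /\ Sub w (prod n (app h n)) /\ op n (op (app h n) w) ∊ A) ->
  exists g, g ∊ o /\ forall y : S, y ∊ o -> (exists m : S, m ∊ om /\ forall n w : S, n ∊ om -> Sub m n -> Sub w (prod n (app h n)) -> op n (op (app h n) w) ∊ A ->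
   op y (op n (op (app h n) w)) ∊ Sr) -> y ∊ g) -> truth (@smem S) gamma_sets_countable.
Proof.
 intros Ho AC DD.
 change (forall c a m z l : S, tr (real_line (Line c a m z l)) -> forall X d : S, tr (gamma_set (Line c a m z l) X d) -> tr (countable X)).
 intros c a m z l HR X d HG. apply t_countable. exact (gamma_ctb Ho AC DD HR HG).
Qed.

(** * From countable models to arbitrary ones *)

(** The schemas of [ZFC] are stated for [code], so the other connectives are translated classically;
    the predicates [fU] and [fE], interpreted as empty here, become falsity. *)
Fixpoint fm_code (c : fm) : code :=
 match c with
 | fmem i j => CMem i j | fU _ | fE _ _ | fbot => CBot | fimp a b => CImp (fm_code a) (fm_code b)
 | fand a b => CImp (CImp (fm_code a) (CImp (fm_code b) CBot)) CBot
 | for_ a b => CImp (CImp (fm_code a) CBot) (fm_code b)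
 | fall a => CAll (fm_code a) | fex a => CImp (CAll (CImp (fm_code a) CBot)) CBot
 end.
Lemma sat_fm_code V (mem : V -> V -> Prop) c : forall e, sat mem (fun _ => False) (fun _ _ => False) c e <-> truth mem (decode (fm_code c) e).
Proof.
 induction c; intros e; simpl; try tauto.
 - rewrite IHc1, IHc2. tauto.
 - rewrite IHc1, IHc2. tauto.
 - rewrite IHc1, IHc2. tauto.
 - setoid_rewrite IHc. tauto.
 - setoid_rewrite IHc. split; [intros [x H] K; apply (K x H)|]. intros H. apply NNPP. intros N. apply H. intros x K. apply N. eauto.
Qed.

Section FromZFC.
Variables (V : Type) (mem : V -> V -> Prop).
Hypothesis Z : ZFC mem.
Hypothesis L : leibniz mem.
Lemma eqv_eq x y : (mem ⊨ x ≐ y) <-> x = y.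
Proof. split; [apply L|intros ->; simpl; tauto]. Qed.
Lemma dfn_code A : dfn0 mem A -> exists c f, forall x, A x <-> (mem ⊨ decode c (scons x f)).
Proof.
 intros [c [f C]]. exists (fm_code (ren c (fun n => if Nat.even n then 0 else S (Nat.div2 n)))), f. intros x.
 rewrite <- sat_fm_code, sat_ren. rewrite (C tt (fun _ => x)). match goal with |- sat _ _ _ _ ?a <-> sat _ _ _ _ ?b => replace a with b; [tauto|] end.
 extensionality n. unfold join. destruct (Nat.even n); reflexivity.
Qed.
Definition SetM_of : SetM.
Proof.
 refine {| scar := V; smem := mem; s_ext := L |}.
 - intros x y. destruct (pairing Z x y) as [z H]. exists z. intros w. rewrite <- !eqv_eq. apply H.
 - intros a. destruct (union Z a) as [u H]. exists u. intros x. apply H.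
 - intros a. destruct (powerset Z a) as [u H]. exists u. intros x. apply H.
 - destruct (infinity Z) as [w [[x [H1 H2]] H3]]. exists w. split; [exists x; auto|]. intros y Y. destruct (H3 y Y) as [y' [H4 H5]]. exists y'. split; auto.
  intros v. rewrite <- eqv_eq. apply H5.
 - intros x y H. destruct (foundation Z (x := x)) as [m [H1 H2]]; [intros K; apply (K y H)|]. exists m. split; auto.
 - intros A D a. destruct (dfn_code D) as [c [f H]]. destruct (separation Z c f a) as [b K]. exists b. intros x. rewrite H. apply K.
Defined.
Definition ZF_of : ZF.
Proof.
 refine {| zs := SetM_of |}.
 - intros R [c [f C]] a H.
  pose (c' := fm_code (ren c (fun n => if Nat.even n then (match Nat.div2 n with 0 => 0 | _ => 1 end) else S (S (Nat.div2 n))))).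
  assert (C' : forall x y, R x y <-> (mem ⊨ decode c' (scons x (scons y f)))).
  { intros x y. unfold c'. rewrite <- sat_fm_code, sat_ren. rewrite (C tt (fun n => match n with 0 => x | _ => y end)).
   match goal with |- sat _ _ _ _ ?a <-> sat _ _ _ _ ?b => replace a with b; [tauto|] end.
   extensionality n. unfold join. destruct (Nat.even n); [destruct (Nat.div2 n)|]; reflexivity. }
  assert (FN : forall x, mem x a -> forall y y', (mem ⊨ decode c' (scons x (scons y f))) /\ (mem ⊨ decode c' (scons x (scons y' f))) -> mem ⊨ y ≐ y').
  { intros x X y y' [A B]. apply eqv_eq. apply (H x X); apply C'; auto. }
  destruct (@replacement V mem Z c' f a FN) as [b K].
  exists b. intros y. split.
  + intros Y. apply K in Y as [x [X Y]]. exists x. split; auto. apply C', Y.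
  + intros [x [X Y]]. apply K. exists x. split; auto. apply C', Y.
 - intros a H1 H2. assert (H1' : forall x, mem x a -> ~ (mem ⊨ empty x)).
  { intros x X E. apply (H1 x X). apply (t_empty (S := SetM_of)), E. }
  assert (H2' : forall x, mem x a -> forall y, mem y a -> (mem ⊨ ∃[z ∈ x] z ∈ y) -> mem ⊨ x ≐ y).
  { intros x X y Y E. apply eqv_eq. apply H2; auto. }
  destruct (@Defs.choice V mem Z a (conj H1' H2')) as [c H]. exists c. intros x X. destruct (H x X) as [v [K1 K2]]. exists v. split; auto. intros v' A B. apply eqv_eq, K2. split; auto.
Defined.
End FromZFC.

Lemma countable_forced (S : ZF) : (exists f : nat -> S, forall x, exists n, f n = x) -> forall d P L Q : S,
 tr (omega2 d) -> fs_hechler (@smem S) d P L Q -> poset (Pz P d) (Lz L d) /\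
 forall p, p ∊ Pz P d -> forces (@smem S) (Pz P d) (Lz L d) p (gamma_sets_countable ∧ omega1_sets_smz).
Proof.
 intros cnt d P L Q H2 fs. apply t_omega2 in H2 as [Od [o [Ho Hd]]]. split; [apply (HPd cnt Od fs)|].
 intros p Hp. apply (forces_Forced (HPd cnt Od fs) cnt cod_conclusion Hp (fun _ => p)). intros i _.
 apply (t_vl (HPd cnt Od fs) i (fun _ => p) cod_conclusion). assert (O1 := N_isom1 cnt Od fs Ho Hd i). split.
 - apply (N_gamma O1); [intros X; apply (N_AC Ho Hd)|intros Sr; apply (N_D Ho Hd)].
 - apply (N_smz O1). intros R. apply (N_C Ho Hd).
Qed.

Lemma pcod_congr V (mem : V -> V -> Prop) A : ZFC mem -> PCod A -> forall e e' : nat -> V, (forall n, mem ⊨ e n ≐ e' n) -> (A V mem e <-> A V mem e').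
Proof. intros Z [c C] e e' H. rewrite <- !C. apply truth_congr; auto. Qed.

(** That the last stage is a partial order is proved by filters, hence over countable models only.
    In this first-order form it can be transferred together with the forcing statement, for the
    truth lemma over the given model. *)
Definition PO V (mem : V -> V -> Prop) (P L : V) := (forall p, mem p P -> below mem P L p p) /\
 (forall p q r, below mem P L r q -> below mem P L q p -> below mem P L r p) /\ (forall p q, below mem P L q p -> mem p P).
Lemma pcod_PO i j : PCod (fun V mem e => PO mem (e i) (e j)).
Proof. unfold PO. pcod. Qed.
Lemma PO_poset (S : ZF) (P L : S) : PO (@smem S) P L <-> poset P L.
Proof.
 unfold PO. split.
 - intros [A [B C]]. split.
  + intros p H. apply t_below, A, H.
  + intros p q r K H. apply t_below. apply (B p q r); apply t_below; auto.
  + intros p q H. apply (C p q), t_below, H.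
 - intros [A B C]. split; [|split].
  + intros p H. apply t_below, A, H.
  + intros p q r K H. apply t_below. apply (B p q r); apply t_below; auto.
  + intros p q H. apply (C p q), t_below, H.
Qed.

Definition frc V (mem : V -> V -> Prop) (P L : V) := PO mem P L /\ forall p, mem p P -> forces mem P L p (gamma_sets_countable ∧ omega1_sets_smz).
Lemma pcod_frc i j : PCod (fun V mem e => frc mem (e i) (e j)).
Proof.
 unfold frc. apply pcod_and; [apply pcod_PO|]. apply pcod_all. cbv beta delta [etl]. apply pcod_imp; [pcod|].
 apply (@pcod_forces (S i) (S j) 0 (fun V _ => gamma_sets_countable ∧ omega1_sets_smz)), cod_conclusion.
Qed.

Definition iteration V (mem : V -> V -> Prop) (e : nat -> V) := (mem ⊨ omega2 (e 0)) /\ fs_hechler mem (e 0) (e 1) (e 2) (e 3) /\ (mem ⊨ maps (e 1) (e 0) (e 4)) /\ (mem ⊨ maps (e 2) (e 0) (e 5)).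
Lemma pcod_iteration : PCod iteration.
Proof. unfold iteration. apply pcod_and; [pcod|]. apply pcod_and; [apply pcod_fs|]. pcod. Qed.

(** The parameters are put into a countable elementary submodel; the hypothesis on the iteration is
    transferred down, and the forced conclusion back up. *)
Lemma iteration_frc V (mem : V -> V -> Prop) (Z : ZFC mem) (L : leibniz mem) e : iteration mem e -> frc mem (e 4) (e 5).
Proof.
 intros H. destruct (downward_LS L e) as [V0 [mem0 [h [E [L0 [cnt HP]]]]]].
 assert (Z0 : ZFC mem0) by (destruct (HP 0) as [x _]; exact (elem_ZFC (inhabits x) E Z)).
 set (e0 := fun n => proj1_sig (constructive_indefinite_description _ (HP n))).
 assert (E0 : (fun n => h (e0 n)) = e) by (extensionality n; apply (proj2_sig (constructive_indefinite_description _ (HP n)))).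
 rewrite <- E0 in H. apply (elem_pcod E pcod_iteration) in H. replace e with (fun n => h (e0 n)). apply (elem_pcod E (pcod_frc 4 5) e0).
 destruct H as [H1 [H2 [H3 H4]]]. set (S0 := ZF_of Z0 L0).
 destruct (@countable_forced S0 cnt (e0 0) (e0 1) (e0 2) (e0 3) H1 H2) as [PS FS].
 assert (EP : e0 4 = Pz (S := S0) (e0 1) (e0 0)) by (apply (mapP (S := S0) H2 (x := e0 0)); [apply sc_in|apply H3]).
 assert (EL : e0 5 = Lz (S := S0) (e0 2) (e0 0)) by (apply (mapL (S := S0) H2 (x := e0 0)); [apply sc_in|apply H4]).
 rewrite EP, EL. split; [apply (PO_poset (S := S0)), PS|exact FS].
Qed.

Theorem theorem1 (M : Type) (mem : M -> M -> Prop)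
  (hZFC : ZFC mem) (hCH : mem ⊨ CH)
  (delta P L Q : M) (hdelta : mem ⊨ omega2 delta)
  (hit : fs_hechler mem delta P L Q)
  (Pd Ld : M) (hPd : mem ⊨ maps P delta Pd) (hLd : mem ⊨ maps L delta Ld)
  (G : M -> Prop) (hG : generic mem Pd Ld G) :
 ext mem Pd Ld G ⊨ gamma_sets_countable ∧ omega1_sets_smz.
Proof.
 (* Forcing was developed for models in which coextensional sets are equal, so the order, the filter
    and the extension are carried over to the quotient. *)
 destruct (quotient hZFC) as [M1 [mem1 [s [pi [H1 [H2 [L1 E1]]]]]]].
 assert (Z1 : ZFC mem1) by exact (elem_ZFC (inhabits (pi delta)) E1 hZFC).
 assert (TR : forall A, PCod A -> forall e : nat -> M, A M1 mem1 (fun n => pi (e n)) <-> A M mem e).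
 { intros A C e. rewrite (elem_pcod E1 C). apply (pcod_congr hZFC C). auto. }
 set (e := fun n => match n with 0 => delta | 1 => P | 2 => L | 3 => Q | 4 => Pd | _ => Ld end).
 assert (F1 : frc mem1 (pi Pd) (pi Ld)).
 { apply (iteration_frc Z1 L1 (e := fun n => pi (e n))), (TR _ pcod_iteration).
  exact (conj hdelta (conj hit (conj hPd hLd))). }
 assert (F : frc mem Pd Ld) by (apply (TR _ (pcod_frc 4 5) e), F1).
 destruct F1 as [PO1 FO1]. destruct F as [[R1 [R2 R3]] _]. set (S1 := ZF_of Z1 L1).
 (* The filter respects coextensionality: p is below itself, hence below any q coextensional with
    it, and filters are closed upwards. *)
 assert (Gc : forall p q, (mem ⊨ p ≐ q) -> G p -> G q).
 { intros p q K Gp. assert (Pp := generic_sub hG Gp).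
  assert (B : below mem Pd Ld p q).
  { apply (pcod_congr hZFC (pcod_below 0 1 2 3) (e := fun n => match n with 0 => Pd | 1 => Ld | 2 => p | _ => p end) (e' := fun n => match n with 0 => Pd | 1 => Ld | 2 => p | _ => q end)); [|apply R1, Pp].
   intros [|[|[|n]]]; try exact K; simpl; tauto. }
  apply (generic_up hG Gp); auto. apply (R3 q p B). }
 assert (T3 : forall A, PCod A -> forall x y v w, A M1 mem1 (fun n => match n with 0 => pi Pd | 1 => pi Ld | 2 => x | 3 => y | 4 => v | _ => w end) <-> A M mem (fun n => match n with 0 => Pd | 1 => Ld | 2 => s x | 3 => s y | 4 => s v | _ => s w end)).
 { intros A C x y v w. rewrite (elem_pcod E1 C). apply (pcod_congr hZFC C). intros [|[|[|[|[|n]]]]]; auto; simpl; tauto. }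
 assert (B3 : forall q p, below mem1 (pi Pd) (pi Ld) q p <-> below mem Pd Ld (s q) (s p)) by (intros q p; exact (T3 _ (pcod_below 0 1 2 3) q p p p)).
 set (G1 := fun p => G (s p)).
 assert (Gpi : forall p, G p -> G1 (pi p)) by (intros p Gp; apply (Gc p); auto; intros v; destruct (H2 p v); split; auto).
 assert (HG1 : generic mem1 (pi Pd) (pi Ld) G1).
 { split.
  - intros p Gp. apply (T3 _ (pcod_mem 2 0) p p p p). apply (generic_sub hG Gp).
  - destruct (generic_nonempty hG) as [p Gp]. exists (pi p). auto.
  - intros p q Gq Pp B. apply (generic_up hG Gq); [apply (T3 _ (pcod_mem 2 0) p p p p), Pp|apply B3, B].
  - intros p q Gp Gq. destruct (generic_dir hG Gp Gq) as [r [Gr [B1 B2]]]. exists (pi r). split; [auto|].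
   assert (BB : forall q, below mem Pd Ld r (s q) -> below mem1 (pi Pd) (pi Ld) (pi r) q).
   { intros q' B. rewrite <- (H1 q'). exact (proj2 (TR _ (pcod_below 0 1 2 3) (fun n => match n with 0 => Pd | 1 => Ld | 2 => r | _ => s q' end)) B). }
   split; apply BB; auto.
  - intros A D. destruct (generic_dense hG (A := s A)) as [p [Gp K]].
   + apply (TR _ pcod_dense (fun n => match n with 0 => Pd | 1 => Ld | _ => s A end)). rewrite H1. exact D.
   + exists (pi p). split; auto. rewrite <- (H1 A). exact (proj2 (TR _ (pcod_mem 0 1) (fun n => match n with 0 => p | _ => s A end)) K). }
 assert (EX : forall x y, ext mem1 (pi Pd) (pi Ld) G1 (pi x) (pi y) <-> ext mem Pd Ld G x y).
 { assert (K : forall p x y, forces_mem mem1 (pi Pd) (pi Ld) (pi p) (pi x) (pi y) <-> forces_mem mem Pd Ld p x y) by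
   (intros p x y; exact (TR _ (pcod_forces_mem 0 1 2 3 4) (fun n => match n with 0 => Pd | 1 => Ld | 2 => p | 3 => x | _ => y end))).
  intros x y. split.
  - intros [p [Gp H]]. exists (s p). split; auto. apply K. rewrite H1. exact H.
  - intros [p [Gp H]]. exists (pi p). split; auto. apply K, H. }
 assert (TE : forall c e, truth (ext mem1 (pi Pd) (pi Ld) G1) (xd c (fun n => pi (e n))) <-> truth (ext mem Pd Ld G) (xd c e)).
 { assert (SC : forall x e, (fun n => pi (scons x e n)) = scons (pi x) (fun n => pi (e n))) by (intros; extensionality n; destruct n; reflexivity).
  intros c. induction c; intros e'; simpl; try (rewrite IHc1, IHc2); try tauto.
  - apply EX.
  - split; intros K x.
   + apply IHc. rewrite SC. apply K.
   + rewrite <- (H1 x), <- SC. apply IHc, K.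
  - split; intros [x K].
   + exists (s x). apply IHc. rewrite SC, H1. exact K.
   + exists (pi x). rewrite <- SC. apply IHc, K. }
 destruct cod_conclusion as [c C]. rewrite <- (C M (fun _ => delta)). apply TE. rewrite C.
 (* The quotient may be uncountable, but the truth lemma concerns one given generic filter and does
    not depend on the size of the model. *)
 apply (forces_truth (S := S1) (P := pi Pd) (L := pi Ld) (proj1 (PO_poset (S := S1) (pi Pd) (pi Ld)) PO1) HG1 cod_conclusion (fun _ => pi delta)).
 destruct (generic_nonempty HG1) as [p Gp]. exists p. split; auto. apply FO1, (generic_sub HG1 Gp).
Qed.
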